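(* Let $f\in E^1(\mathbb{T}^n)$ be a local diffeomorphism that is partially hyperbolic with expanding extremal direction, with complementary splitting $\mathbb{E}^c_x+\mathcal{C}^u_x$, satisfying the following properties: (1) $\{w\in f^{-k}(x):k\in\mathbb{N}\}$ is dense in $\mathbb{T}^n$ for every $x\in\mathbb{T}^n$. (2) There exist $\delta_0>0$, $\lambda_0>1$ and $k_0\in\mathbb{N}$ such that for every $x\in\mathbb{T}^n$, if $\gamma$ is a disc (through $x$) tangent to the unstable cones $\mathcal{C}^u$ with internal diameter larger than $\delta_0$, then there exists a point $y\in\gamma$ such that $m\{Df^i|_{\mathbb{E}^c(f^k(y))}\}>\lambda_0^i$ for all $i>0$ and all $k>k_0$. Then for every $g$ sufficiently close to $f$ in $E^1(\mathbb{T}^n)$, the set $\{w\in g^{-k}(x):k\in\mathbb{N}\}$ is dense in $\mathbb{T}^n$ for every $x\in\mathbb{T}^n$.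
   Context: $E^1(\mathbb{T}^n)$ is the space of $C^1$ maps $\mathbb{T}^n\to\mathbb{T}^n$ with the $C^1$ topology. For a linear isomorphism $L$ of normed spaces, $m\{L\}=\|L^{-1}\|^{-1}$. Inverse branches: if $V$ is open and $f|_V$ is a diffeomorphism onto its image, the inverse branch of $f$ on $f(V)$ is the map $\varphi:f(V)\to V$ with $f\circ\varphi(x)=x$. Unstable cone family: a continuous cone field $\mathcal{C}^u=\{\mathcal{C}^u_x\}$ is called unstable if it is forward invariant: $Df(x')\,\mathcal{C}^u_{x'}\subset\mathcal{C}^u_{f(x')}$. (The unstable direction need not be unique: for each inverse path $\{x_k\}_{k\ge0}$, $x_0=x$, $f(x_{k+1})=x_k$, there is an unstable direction in $\mathcal{C}^u_x$.) Complementary splitting: $\mathbb{E}^c_x+\mathcal{C}^u_x$, where $\mathbb{E}^c$ is the central subbundle ($Df$-invariant), is complementary if the unstable cone $\mathcal{C}^u_x$ contains an invariant subspace whose dimension equals the dimension of the manifold minus the dimension of $\mathbb{E}^c$. Both parts of the splitting are non-trivial. $f$ is partially hyperbolic with expanding extremal direction if for every $x$ there exists a complementary splitting $\mathbb{E}^c_x+\mathcal{C}^u_x$, with $\{\mathcal{C}^u_x\}_x$ a family of unstable cones, and there exists $0<\lambda<1$ such that for every inverse branch $\varphi$ of $f$: (i) $\|D\varphi(x)v\|<\lambda$ for all unit vectors $v\in\mathcal{C}^u_x$; (ii) $\|Df(x')|_{\mathbb{E}^c(x')}\|\,\|D\varphi(x)v\|<\lambda$ for all unit vectors $v\in\mathcal{C}^u_x$,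 where $\varphi(x)=x'$, $f(x')=x$. A disc $\gamma$ tangent to the unstable cones is an embedded disc of dimension $n-\dim\mathbb{E}^c$ with $T_y\gamma\subset\mathcal{C}^u_y$ for every $y\in\gamma$; its internal diameter is its diameter for the intrinsic (induced Riemannian) distance on $\gamma$. *)

(* Defs.v *)
From HB Require Import structures.
From mathcomp Require Import all_boot all_order all_algebra.
From mathcomp Require Import all_classical all_reals all_analysis.
Import Order.TTheory GRing.Theory Num.Theory.
Import numFieldNormedType.Exports.

Set Implicit Arguments.
Unset Strict Implicit.
Unset Printing Implicit Defensive.

Local Open Scope classical_set_scope.
Local Open Scope ring_scope.
Local Open Scope quotient_scope.

(* Conventions: tangent vectors are row vectors, and a derivative is a matrix
   acting on the right (as with the library's jacobian), so that composition of
   derivatives is the matrix product in reading order. *)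

(* The library norm on 'rV is the sup norm; lengths of tangent vectors are
   measured by the flat Riemannian metric. *)
Definition enorm {R : realType} {n : nat} (v : 'rV[R]_n) : R :=
  Num.sqrt (\sum_i v 0 i ^+ 2).

Section Torus.
Context {R : realType} {n : nat}.

Definition int_lattice : {pred 'rV[R]_n} := fun v => v \is a mxOver Num.int.

Fact int_lattice_zmod_closed : zmod_closed int_lattice.
Proof.
split=> [|u v /mxOverP uZ /mxOverP vZ]; first by apply/mxOverP => i j; rewrite mxE.
by apply/mxOverP => i j; rewrite !mxE rpredB.
Qed.

HB.instance Definition _ :=
  GRing.isZmodClosed.Build 'rV[R]_n int_lattice int_lattice_zmod_closed.

Definition torus : Type := Quotient.quot (int_lattice : zmodClosed 'rV[R]_n).

HB.instance Definition _ := GRing.Zmodule.on torus.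
HB.instance Definition _ := EqQuotient.on torus.

Definition torus_open (U : set torus) : Prop := open (\pi_torus @^-1` U).

Fact torus_openT : torus_open setT.
Proof. by rewrite /torus_open preimage_setT; exact: openT. Qed.

Fact torus_openI (U V : set torus) :
  torus_open U -> torus_open V -> torus_open (U `&` V).
Proof. exact: openI. Qed.

Fact torus_open_bigU (I : Type) (F : I -> set torus) :
  (forall i, torus_open (F i)) -> torus_open (\bigcup_i F i).
Proof. by move=> oF; apply: bigcup_open => i _; exact: oF. Qed.

HB.instance Definition _ :=
  isOpenTopological.Build torus torus_openT torus_openI torus_open_bigU.

Definition tproj (v : 'rV[R]_n) : torus := \pi v.

(* The representative of a point with all coordinates in [-1/2, 1/2[; it is a
   chart near 0, inverse to tproj, and has minimal norm among representatives *)
Definition tlog (x : torus) : 'rV[R]_n :=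
  map_mx (fun r : R => r - (Num.floor (r + 2^-1))%:~R) (repr x).

Definition tdist (x y : torus) : R := enorm (tlog (x - y)).

(* f read in the charts obtained by translating tlog to x and to f x; tangent
   spaces of the torus are thereby identified with R^n *)
Definition local_expr (f : torus -> torus) (x : torus) (v : 'rV[R]_n) :
  'rV[R]_n := tlog (f (x + tproj v) - f x).

Definition tderiv (f : torus -> torus) (x : torus) : 'M[R]_n :=
  'J (local_expr f x) 0.

Definition C1_on (V : set torus) (f : torus -> torus) : Prop :=
  forall x, V x ->
    differentiable (local_expr f x) 0 /\ {for x, continuous (tderiv f)}.

Definition C1_map (f : torus -> torus) : Prop := C1_on setT f.

Definition C1_close (e : R) (f g : torus -> torus) : Prop :=
  forall x, tdist (f x) (g x) < e /\ `|tderiv f x - tderiv g x| < e.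

(* phi is totalized: its values outside f @` V are irrelevant *)
Definition inverse_branch (f : torus -> torus) (V : set torus)
    (phi : torus -> torus) : Prop :=
  [/\ open V, open (f @` V), C1_on V f & C1_on (f @` V) phi] /\
  [/\ phi @` (f @` V) `<=` V, {in f @` V, cancel phi f} & {in V, cancel f phi}].

Definition local_diffeo (f : torus -> torus) : Prop :=
  forall x, exists V phi, V x /\ inverse_branch f V phi.

Definition preorbit (f : torus -> torus) (x : torus) : set torus :=
  [set w | exists k, iter k f w = x].

(* A subspace is represented by the row space of a square matrix; continuity is
   expressed by local frames. *)
Definition continuous_subbundle (c : nat) (E : torus -> 'M[R]_n) : Prop :=
  forall x : torus, exists B : torus -> 'M[R]_(c, n), \forall y \near x,
    [/\ {for y, continuous B}, row_free (B y) & (E y == B y)%MS].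

Definition invariant_subbundle (f : torus -> torus) (E : torus -> 'M[R]_n) :
  Prop := forall x, (E x *m tderiv f x == E (f x))%MS.

Definition std_cone (d : nat) : set 'rV[R]_n :=
  [set v : 'rV[R]_n | \sum_(i < n | (d <= i)%N) v 0 i ^+ 2 <=
                      \sum_(i < n | (i < d)%N) v 0 i ^+ 2].

(* A d-dimensional cone is the image of the standard one {(u, w) : |w| <= |u|},
   u in R^d, under a linear isomorphism; apertures are absorbed in the
   isomorphism. *)
Definition continuous_cone_field (d : nat) (C : torus -> set 'rV[R]_n) : Prop :=
  forall x : torus, exists A : torus -> 'M[R]_n, \forall y \near x,
    [/\ {for y, continuous A}, A y \in unitmx
      & C y = [set v *m A y | v in std_cone d]].

Definition unstable_cone_field (f : torus -> torus) (d : nat)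
    (C : torus -> set 'rV[R]_n) : Prop :=
  continuous_cone_field d C /\
  forall x, [set v *m tderiv f x | v in C x] `<=` C (f x).

(* Unstable directions depend on the choice of an inverse path, so invariance
   is required along each inverse path. *)
Definition contains_invariant_subspace (f : torus -> torus) (d : nat)
    (C : torus -> set 'rV[R]_n) : Prop :=
  forall xs : nat -> torus, (forall k, f (xs k.+1) = xs k) ->
  exists W : nat -> 'M[R]_n, forall k,
    [/\ \rank (W k) = d,
        forall v : 'rV[R]_n, (v <= W k)%MS -> C (xs k) v
      & (W k.+1 *m tderiv f (xs k.+1) == W k)%MS].

Definition opnorm_on (E A : 'M[R]_n) : R :=
  sup [set enorm (v *m A) | v in [set v : 'rV[R]_n | (v <= E)%MS /\ enorm v = 1]].

(* m{A|_E}, for invertible A; the inverse of A|_E is defined on A(E) *)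
Definition conorm_on (E A : 'M[R]_n) : R := (opnorm_on (E *m A) (invmx A))^-1.

Definition partially_hyperbolic (f : torus -> torus) (c : nat)
    (Ec : torus -> 'M[R]_n) (Cu : torus -> set 'rV[R]_n) : Prop :=
  [/\ (0 < c < n)%N,
      continuous_subbundle c Ec /\ invariant_subbundle f Ec,
      unstable_cone_field f (n - c) Cu /\
        contains_invariant_subspace f (n - c) Cu
    & exists lambda : R, 0 < lambda < 1 /\
        forall V phi, inverse_branch f V phi ->
        forall x, (f @` V) x ->
        forall v, Cu x v -> enorm v = 1 ->
          enorm (v *m tderiv phi x) < lambda /\
          opnorm_on (Ec (phi x)) (tderiv f (phi x)) * enorm (v *m tderiv phi x) < lambda].

End Torus.

Arguments torus : clear implicits.

Section Discs.
Context {R : realType} {n d : nat}.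
Implicit Types (h : 'rV[R]_d -> 'rV[R]_n) (p q : 'rV[R]_d).

Definition unit_disc : set 'rV[R]_d := [set p | enorm p <= 1].

(* A disc in the torus is given by a lift h of its parametrization to R^n
   (a disc being simply connected). *)
Definition disc h : set (torus R n) := [set tproj (h p) | p in unit_disc].

Definition embedded_disc h : Prop :=
  [/\ forall p, differentiable h p,
      continuous (fun p => 'J h p),
      forall p, unit_disc p -> row_free ('J h p)
    & {in unit_disc &, injective (fun p => tproj (h p))}].

Definition tangent_disc h (C : torus R n -> set 'rV[R]_n) : Prop :=
  forall p, unit_disc p -> forall w, C (tproj (h p)) (w *m 'J h p).

Definition disc_path p q (s : R -> 'rV[R]_d) : Prop :=
  [/\ forall t, derivable s t 1,
      continuous (derive1 s),
      s 0 = p, s 1 = q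
    & forall t, 0 <= t <= 1 -> unit_disc (s t)].

Definition path_length h (s : R -> 'rV[R]_d) : \bar R :=
  (\int[lebesgue_measure]_(t in `[0%R, 1%R]) (enorm (derive1 (h \o s) t))%:E)%E.

Definition internal_dist h p q : \bar R :=
  ereal_inf [set path_length h s | s in disc_path p q].

Definition internal_diameter h : \bar R :=
  ereal_sup [set internal_dist h p q | p in unit_disc & q in unit_disc].

End Discs.

(* Main.v *)
Require Import Defs.
From HB Require Import structures.
From mathcomp Require Import all_boot all_order all_algebra.
From mathcomp Require Import all_classical all_reals all_analysis.
From mathcomp Require Import ring lra zify.
Set Implicit Arguments.
Unset Strict Implicit.
Unset Printing Implicit Defensive.
Import Order.TTheory GRing.Theory Num.Theory.
Import numFieldNormedType.Exports.
Local Open Scope classical_set_scope.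
Local Open Scope ring_scope.

(* Density of the preorbits of [f] makes truncated preorbits of [g] nearly dense, uniformly, so it suffices that every
   small ball contains a ball which some iterate of [g] maps onto a ball of fixed radius.  A ball grows when iterates of
   [g] expand in all directions along blocks of fixed length.  Such blocks are found on a small disc in the unstable
   cones: its iterates stay tangent to the cones and become long, hence pass near a point whose forward orbit expands
   the center.  In unstable dimension at least 2, strips around spirals are discs of arbitrarily large internal diameter
   inside any small ball.  In dimension 1, a long embedded disc must be extracted from an iterated arc which may cross
   itself: one takes an inscribed polygon, in general position when [n >= 3]; when [n = 2], either half of it is
   injective or its first returns form a loop or a barbell, around which an embedded curve can wind many times. *)

(** Hypothesis [f_exp] applies to embedded discs tangent to the cones, whereas the curves to be
    iterated are images under [g], for which no invariant splitting is constructed. Of [g] one keeps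
    that each iterate is uniformly close to that of [f] and that its small displacements nearly
    follow the derivative cocycle of [f] ([capprox]). Tangency of a curve is a condition on its
    short chords, in cones thickened along the center ([tang]). Such a curve is compared with the
    [f]-image of a straight segment taken well inside the cones: domination makes the two as close
    as desired ([shadow]), and chords of images of the segment stay in the interior of the cones,
    which leaves room to bend them into discs. A block starts where the arc, grown for [M] steps,
    meets a good orbit, but the subarc kept for the next block is controlled only for [N - M] steps
    after that; so [N] is chosen after [M], and earlier expansion pays for the last [M] steps. In
    unstable dimension at least 2 the good points turn out to be dense, so that a power of [f]
    itself expands at every point. *)

Section Enorm.
Context {R : realType}.

(** * Euclidean norm and scalar product *)

Definition edot {n : nat} (u v : 'rV[R]_n) : R := \sum_i u 0 i * v 0 i.

Lemma enorm_ge0 n (v : 'rV[R]_n) : 0 <= enorm v.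
Proof. exact: sqrtr_ge0. Qed.

Lemma sumsq_ge0 n (v : 'rV[R]_n) : 0 <= \sum_i v 0 i ^+ 2.
Proof. by apply: sumr_ge0 => i _; exact: sqr_ge0. Qed.

Lemma sqr_enorm n (v : 'rV[R]_n) : enorm v ^+ 2 = \sum_i v 0 i ^+ 2.
Proof. by rewrite sqr_sqrtr// sumsq_ge0. Qed.

Lemma enorm_le n (v : 'rV[R]_n) (c : R) :
  0 <= c -> (enorm v <= c) = (\sum_i v 0 i ^+ 2 <= c ^+ 2).
Proof. by move=> c0; rewrite -sqr_enorm ler_sqr// nnegrE ?enorm_ge0. Qed.

Lemma coord_le_enorm n (v : 'rV[R]_n) i : `|v 0 i| <= enorm v.
Proof.
rewrite -ler_sqr ?nnegrE ?enorm_ge0// sqr_enorm real_normK ?num_real//.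
by rewrite (bigD1 i)//= lerDl; apply: sumr_ge0 => j _; exact: sqr_ge0.
Qed.

Lemma coord_le_norm m n (v : 'M[R]_(m, n)) i j : `|v i j| <= `|v|.
Proof.
rewrite /Num.Def.normr/= mx_normrE.
exact: (le_bigmax 0 (fun ij => `|v ij.1 ij.2|) (i, j)).
Qed.

Lemma norm_le_bound m n (v : 'M[R]_(m, n)) (c : R) :
  0 <= c -> (forall i j, `|v i j| <= c) -> `|v| <= c.
Proof.
move=> c0 h; rewrite /Num.Def.normr/= mx_normrE.
by apply: bigmax_le => // -[i j] _.
Qed.

Lemma norm_le_enorm n (v : 'rV[R]_n) : `|v| <= enorm v.
Proof.
apply: norm_le_bound => [|i j]; first exact: enorm_ge0.
by rewrite ord1; exact: coord_le_enorm.
Qed.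

Lemma enorm_le_norm n (v : 'rV[R]_n) : enorm v <= n%:R * `|v|.
Proof.
rewrite enorm_le; last by rewrite mulr_ge0.
rewrite (@le_trans _ _ (n%:R * `|v| ^+ 2))//.
  rewrite mulr_natl -[X in _ *+ X]card_ord -sumr_const.
  apply: ler_sum => i _; rewrite -[v 0 i ^+ 2]ger0_norm ?sqr_ge0// normrX.
  by rewrite ler_sqr ?nnegrE//; exact: coord_le_norm.
rewrite exprMn ler_wpM2r ?sqr_ge0// -natrX ler_nat.
by case: n {v} => // n; rewrite leq_pmulr.
Qed.

Lemma enorm0 n : enorm (0 : 'rV[R]_n) = 0.
Proof.
apply/eqP; rewrite eq_le enorm_ge0 andbT.
by apply: le_trans (enorm_le_norm _) _; rewrite normr0 mulr0.
Qed.

Lemma enorm_eq0 n (v : 'rV[R]_n) : enorm v = 0 -> v = 0.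
Proof.
move=> v0; apply/eqP; rewrite -normr_le0.
by apply: le_trans (norm_le_enorm _) _; rewrite v0.
Qed.

Lemma enorm_gt0 n (v : 'rV[R]_n) : v != 0 -> 0 < enorm v.
Proof.
by rewrite lt_def enorm_ge0 andbT; apply: contraNneq => /enorm_eq0 ->.
Qed.

Lemma enormZ n (a : R) (v : 'rV[R]_n) : enorm (a *: v) = `|a| * enorm v.
Proof.
rewrite /enorm -[`|a|]sqrtr_sqr -sqrtrM ?sqr_ge0//.
by congr Num.sqrt; rewrite mulr_sumr; apply: eq_bigr => i _; rewrite mxE exprMn.
Qed.

Lemma enormN n (v : 'rV[R]_n) : enorm (- v) = enorm v.
Proof. by rewrite -scaleN1r enormZ normrN1 mul1r. Qed.

Lemma edotvv n (v : 'rV[R]_n) : edot v v = enorm v ^+ 2.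
Proof. by rewrite sqr_enorm; apply: eq_bigr => i _; rewrite expr2. Qed.

Lemma edotC n (u v : 'rV[R]_n) : edot u v = edot v u.
Proof. by apply: eq_bigr => i _; rewrite mulrC. Qed.

Lemma edotDl n (u v w : 'rV[R]_n) : edot (u + v) w = edot u w + edot v w.
Proof. by rewrite -big_split; apply: eq_bigr => i _; rewrite mxE mulrDl. Qed.

Lemma edotZl n a (u w : 'rV[R]_n) : edot (a *: u) w = a * edot u w.
Proof. by rewrite mulr_sumr; apply: eq_bigr => i _; rewrite mxE mulrA. Qed.

Lemma edotNl n (u w : 'rV[R]_n) : edot (- u) w = - edot u w.
Proof. by rewrite -scaleN1r edotZl mulN1r. Qed.

Lemma edotDr n (u v w : 'rV[R]_n) : edot w (u + v) = edot w u + edot w v.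
Proof. by rewrite ![edot w _]edotC edotDl. Qed.

Lemma edotZr n a (u w : 'rV[R]_n) : edot w (a *: u) = a * edot w u.
Proof. by rewrite ![edot w _]edotC edotZl. Qed.

Lemma edotNr n (u w : 'rV[R]_n) : edot w (- u) = - edot w u.
Proof. by rewrite ![edot w _]edotC edotNl. Qed.

Lemma edot_le n (u v : 'rV[R]_n) : `|edot u v| <= enorm u * enorm v.
Proof.
have [->|v0] := eqVneq v 0.
  by rewrite enorm0 mulr0 /edot big1 ?normr0// => i _; rewrite mxE mulr0.
have vp := enorm_gt0 v0.
rewrite -ler_sqr ?nnegrE ?mulr_ge0 ?enorm_ge0// real_normK ?num_real//.
set s := edot u v.
have := sqr_ge0 (enorm (enorm v ^+ 2 *: u - s *: v)).
rewrite -(edotvv (_ - _)) !(edotDl, edotDr, edotZl, edotZr, edotNl, edotNr) -/s.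
rewrite (edotC v u) -/s !edotvv.
set a := enorm u; set b := enorm v in vp *.
have -> : b ^+ 2 * (b ^+ 2 * a ^+ 2 - s * s) - s * (b ^+ 2 * s - s * b ^+ 2) =
  b ^+ 2 * ((a * b) ^+ 2 - s ^+ 2) by ring.
by rewrite pmulr_rge0 ?exprn_gt0// subr_ge0.
Qed.

Lemma enormD n (u v : 'rV[R]_n) : enorm (u + v) <= enorm u + enorm v.
Proof.
rewrite -ler_sqr ?nnegrE ?addr_ge0 ?enorm_ge0//.
rewrite -edotvv !(edotDl, edotDr) (edotC v u) !edotvv.
have := le_trans (ler_norm _) (edot_le u v); lra.
Qed.

Lemma enormB n (u v : 'rV[R]_n) : enorm (u - v) <= enorm u + enorm v.
Proof. by rewrite -[enorm v]enormN; exact: enormD. Qed.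

Lemma enorm_distC n (u v : 'rV[R]_n) : enorm (u - v) = enorm (v - u).
Proof. by rewrite -enormN opprB. Qed.

Lemma enorm_lower n (u v : 'rV[R]_n) : enorm u - enorm v <= enorm (u + v).
Proof. by rewrite lerBlDr -{1}[u](addrK v); exact: enormB. Qed.

Lemma enorm_sum n (I : Type) (s : seq I) (P : pred I) (F : I -> 'rV[R]_n) :
  enorm (\sum_(i <- s | P i) F i) <= \sum_(i <- s | P i) enorm (F i).
Proof.
elim/big_ind2 : _ => //; first by rewrite enorm0.
by move=> a b c d h1 h2; apply: le_trans (enormD _ _) (lerD h1 h2).
Qed.

(** The entry norm times the dimensions dominates the operator norm for [enorm] and remains
    subadditive. *)
Definition mxbnd {m n} (A : 'M[R]_(m, n)) : R := (n%:R * m%:R) * `|A|.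

Lemma mxbnd_ge0 m n (A : 'M[R]_(m, n)) : 0 <= mxbnd A.
Proof. by rewrite !mulr_ge0. Qed.

Lemma enorm_mulmx m n (v : 'rV[R]_m) (A : 'M[R]_(m, n)) :
  enorm (v *m A) <= mxbnd A * enorm v.
Proof.
apply: le_trans (enorm_le_norm _) _; rewrite /mxbnd -!mulrA ler_wpM2l//.
apply: norm_le_bound => [|i j]; first by rewrite !mulr_ge0 ?enorm_ge0.
rewrite ord1 mxE; apply: le_trans (ler_norm_sum _ _ _) _.
rewrite mulr_natl -[X in _ *+ X]card_ord -sumr_const.
apply: ler_sum => k _; rewrite normrM mulrC.
by apply: ler_pM => //; [exact: coord_le_norm|exact: coord_le_enorm].
Qed.

Lemma mxbndD m n (A B : 'M[R]_(m, n)) : mxbnd (A + B) <= mxbnd A + mxbnd B.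
Proof. by rewrite /mxbnd -mulrDr ler_wpM2l ?mulr_ge0// ler_normD. Qed.

End Enorm.

(* [lra] compares atoms up to conversion, which is slow on distances and norms of large terms; [qlra] first turns them
   into variables.  A hypothesis of type [True] marks the beginning of the facts it uses. *)
Local Ltac abstract_atoms :=
  repeat (lazymatch goal with H : ?P |- _ =>
    lazymatch P with
    | True => fail
    | is_true (@Order.le _ _ _ _) => revert H
    | is_true (@Order.lt _ _ _ _) => revert H
    | is_true (andb _ _) => revert H
    | and _ _ => revert H
    | @eq (torus _ _) _ _ => first [clear H | revert H]
    | @eq (matrix _ _ _) _ _ => first [clear H | revert H]
    | @eq nat _ _ => first [clear H | revert H]
    | @eq _ _ _ => revert H
    | _ => first [clear H | revert H]
    end end);
  let acc := fresh in pose proof I as acc;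
  repeat (lazymatch goal with
    | |- forall x : ?P, _ => let H := fresh in intro H;
      lazymatch type of P with Prop => generalize (conj H acc); clear acc; intro acc; try clear H | _ => idtac end
    | |- let x := _ in _ => intro
    end);
  revert acc;
  repeat (match goal with
    | |- context [@enorm ?R ?n ?v] => generalize (@enorm R n v)
    | |- context [@tdist ?R ?n ?x ?y] => generalize (@tdist R n x y)
    | |- context [@edot ?R ?n ?x ?y] => generalize (@edot R n x y)
    end); intros;
  repeat (match goal with H : and _ _ |- _ => destruct H end).
Local Ltac qlra := first [solve [abstract_atoms; lra] | lra].

(** * The flat metric of the torus, and compactness *)

Section TorusMetric.
Context {R : realType} {n : nat}.
Local Notation T := (torus R n).
Local Notation V := ('rV[R]_n).

Lemma tproj_is_zmod_morphism : zmod_morphism (@tproj R n).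
Proof. exact: (@pi_is_zmod_morphism _ _ _ (Quotient.quot int_lattice)). Qed.

Lemma tprojB (u v : V) : tproj (u - v) = tproj u - tproj v.
Proof. exact: tproj_is_zmod_morphism. Qed.

Lemma tproj0 : tproj (0 : V) = 0.
Proof. by rewrite -[X in tproj X](subrr (0 : V)) tprojB subrr. Qed.

Lemma tprojN (u : V) : tproj (- u) = - tproj u.
Proof. by rewrite -[- u]sub0r tprojB tproj0 sub0r. Qed.

Lemma tprojD (u v : V) : tproj (u + v) = tproj u + tproj v.
Proof. by rewrite -[v in LHS]opprK tprojB tprojN opprK. Qed.

Lemma tproj_eq (u v : V) : (tproj u == tproj v) = ((u - v) \is a mxOver Num.int).
Proof. exact: (esym (@Quotient.idealrBE _ int_lattice u v)). Qed.

Lemma tprojP (u v : V) :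
  tproj u = tproj v <-> (forall i, (u - v) 0 i \is a Num.int).
Proof.
split=> [/eqP|h]; first by rewrite tproj_eq => /mxOverP h i; exact: h.
by apply/eqP; rewrite tproj_eq; apply/mxOverP => i j; rewrite ord1; exact: h.
Qed.

Lemma tlogK (x : T) : tproj (tlog x) = x.
Proof.
rewrite -[RHS]reprK; apply/tprojP => i.
rewrite !mxE addrAC subrr add0r rpredN; exact: intr_int.
Qed.

Lemma tlog_itv (x : T) i : - 2^-1 <= tlog x 0 i < 2^-1.
Proof.
rewrite mxE; set r := repr x 0 i.
have := floor_itv (r + 2^-1); rewrite intrD; lra.
Qed.

Lemma int_lt1 (r : R) : r \is a Num.int -> `|r| < 1 -> r = 0.
Proof.
move=> /intrP[m ->]; rewrite -intr_norm (_ : 1 = 1%:~R)// ltr_int => h.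
by have -> : m = 0 by lia.
Qed.

Lemma tlog_uniq (u : V) : (forall i, - 2^-1 <= u 0 i < 2^-1) -> tlog (tproj u) = u.
Proof.
move=> hu; apply/rowP => i.
have /tprojP/(_ i) : tproj (tlog (tproj u)) = tproj u by rewrite tlogK.
rewrite !mxE => /int_lt1 => h.
apply/eqP; rewrite -subr_eq0; apply/eqP; have := hu i.
have := tlog_itv (tproj u) i; rewrite mxE => h1 h2; apply: h.
rewrite ltr_norml; lra.
Qed.

Lemma tlog_small (u : V) : enorm u < 2^-1 -> tlog (tproj u) = u.
Proof.
move=> hu; apply: tlog_uniq => i.
have := le_lt_trans (coord_le_enorm u i) hu; rewrite ltr_norml; lra.
Qed.

Lemma tlog0 : tlog (0 : T) = 0.
Proof. by rewrite -tproj0 tlog_small// enorm0; lra. Qed.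

(** Coordinatewise, the two lifts differ by an integer: either they agree, or they are at least 1
    apart and, [tlog] being at most 1/2 in absolute value, the other is at least 1/2. *)
Lemma tlog_min (u : V) : enorm (tlog (tproj u)) <= enorm u.
Proof.
rewrite -ler_sqr ?nnegrE ?enorm_ge0// !sqr_enorm; apply: ler_sum => i _.
rewrite -[_ ^+ 2]ger0_norm ?sqr_ge0// -[leRHS]ger0_norm ?sqr_ge0// !normrX.
rewrite ler_sqr ?nnegrE//.
have /tprojP/(_ i) : tproj (tlog (tproj u)) = tproj u by rewrite tlogK.
have := tlog_itv (tproj u) i.
set a := tlog _ 0 i; rewrite mxE [(- u) _ _]mxE -/a => ha.
have [h|h] := ltP `|a - u 0 i| 1.
  by move=> /int_lt1/(_ h)/eqP; rewrite subr_eq0 => /eqP ->.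
move=> _; have : `|a| <= 2^-1 by rewrite ler_norml; lra.
have := ler_normB a (u 0 i); lra.
Qed.

Definition tnorm (x : T) : R := enorm (tlog x).

Lemma tdistE (x y : T) : tdist x y = tnorm (x - y). Proof. by []. Qed.

Lemma tnorm_proj (u : V) : tnorm (tproj u) <= enorm u.
Proof. exact: tlog_min. Qed.

Lemma tnorm_projE (u : V) : enorm u < 2^-1 -> tnorm (tproj u) = enorm u.
Proof. by move=> h; rewrite /tnorm tlog_small. Qed.

Lemma tnorm0 : tnorm 0 = 0. Proof. by rewrite /tnorm tlog0 enorm0. Qed.

Lemma tnorm_eq0 x : tnorm x = 0 -> x = 0.
Proof. by move=> /enorm_eq0 h; rewrite -[x]tlogK h tproj0. Qed.

Lemma tnormN x : tnorm (- x) = tnorm x.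
Proof.
have h y : tnorm (- y) <= tnorm y.
  by rewrite -{1}[y]tlogK -tprojN (le_trans (tnorm_proj _))// enormN.
by apply/eqP; rewrite eq_le h -{1}[x]opprK h.
Qed.

Lemma tnormD x y : tnorm (x + y) <= tnorm x + tnorm y.
Proof.
rewrite -{1}[x]tlogK -{1}[y]tlogK -tprojD.
by apply: (le_trans (tnorm_proj _)); exact: enormD.
Qed.

Lemma tlogD x y : tnorm x + tnorm y < 2^-1 -> tlog (x + y) = tlog x + tlog y.
Proof.
move=> h; rewrite -{1}[x]tlogK -{1}[y]tlogK -tprojD tlog_small//.
exact: le_lt_trans (enormD _ _) h.
Qed.

Lemma tlogN x : tnorm x < 2^-1 -> tlog (- x) = - tlog x.
Proof. by move=> h; rewrite -{1}[x]tlogK -tprojN tlog_small// enormN. Qed.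

Lemma tdist_ge0 (x y : T) : 0 <= tdist x y. Proof. exact: enorm_ge0. Qed.

Lemma tdistxx (x : T) : tdist x x = 0. Proof. by rewrite tdistE subrr tnorm0. Qed.

Lemma tdistC (x y : T) : tdist x y = tdist y x.
Proof. by rewrite !tdistE -tnormN opprB. Qed.

Lemma tdistD (y x z : T) : tdist x z <= tdist x y + tdist y z.
Proof. by rewrite !tdistE -[x - z](subrKA y) tnormD. Qed.

Lemma tdist_eq0 (x y : T) : tdist x y = 0 -> x = y.
Proof. by move=> /tnorm_eq0 /eqP; rewrite subr_eq0 => /eqP. Qed.

Lemma tdist_proj (u v : V) : tdist (tproj u) (tproj v) <= enorm (u - v).
Proof. by rewrite tdistE -tprojB tnorm_proj. Qed.

Lemma tdist_addr (x : T) (u : V) : tdist x (x + tproj u) <= enorm u.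
Proof. by rewrite tdistC tdistE addrAC subrr add0r tnorm_proj. Qed.

Lemma tdist_ex (x y : T) : exists2 u : V, y = x + tproj u & enorm u = tdist x y.
Proof.
exists (tlog (y - x)); first by rewrite tlogK addrC subrK.
by rewrite tdistC.
Qed.

Lemma tdist_open (x : T) (r : R) : open [set y | tdist x y < r].
Proof.
suff : torus_open [set y | tdist x y < r] by [].
rewrite /torus_open openE => v /= hv.
suff : \forall w \near v, tdist x (tproj w) < r by [].
apply/nbhs_normP.
set d := (r - tdist x (tproj v)) / (n%:R + 1).
have n1 : (0 : R) < n%:R + 1 by rewrite ltr_wpDl.
exists d => [|w /= hw]; first by rewrite /= divr_gt0 // subr_gt0.
apply: le_lt_trans (tdistD (tproj v) _ _) _; rewrite -ltrBrDl.
apply: le_lt_trans (tdist_proj _ _) _.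
apply: le_lt_trans (enorm_le_norm _) _.
move: hw; rewrite ltr_pdivlMr// mulrC mulrDl mul1r; apply: le_lt_trans.
by rewrite lerDl.
Qed.

Lemma torus_nbhsP (x : T) (U : set T) :
  nbhs x U <-> exists2 r, 0 < r & forall y, tdist x y < r -> U y.
Proof.
split=> [|[r r0 h]]; last first.
  apply: filterS (h) _ => //; apply: open_nbhs_nbhs; split.
    exact: tdist_open.
  by rewrite /= tdistxx.
rewrite nbhsE => -[W [oW Wx] WU].
have : torus_open W by [].
rewrite /torus_open openE => /(_ (tlog x)) h.
have Wt : W (tproj (tlog x)) by rewrite tlogK.
have /nbhs_normP[r /= r0 {}h] : \forall w \near tlog x, W (tproj w) := h Wt.
exists r => // y xy; apply: WU.
have [u uy ur] := tdist_ex x y; rewrite uy.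
rewrite -[x in x + _]tlogK -tprojD; apply: h => /=.
rewrite opprD addrA subrr sub0r normrN.
by apply: le_lt_trans (norm_le_enorm _) _; rewrite ur.
Qed.

Lemma torus_nbhs_nearP (x : T) (P : T -> Prop) :
  (\forall y \near x, P y) <-> exists2 r, 0 < r & forall y, tdist x y < r -> P y.
Proof. exact: torus_nbhsP. Qed.

(** The cube of half-side 1/2 is compact and covers the torus. One parameter [s] plays the part of
    all radii and constants at once, so that each uniform estimate below is an instance, proved near
    one point. *)
Lemma torus_uniform (P : R -> T -> Prop) :
  (forall x0, exists2 r, 0 < r & forall s x, 0 < s < r -> tdist x0 x < r -> P s x) ->
  exists2 r, 0 < r & forall s x, 0 < s < r -> P s x.
Proof.
move=> hP.
have cK : compact [set v : V | forall i, v ord0 i \in `[- 2^-1, 2^-1] ].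
  have := @rV_compact R n (fun _ => `[- 2^-1, 2^-1]%classic).
  by apply=> i; exact: segment_compact.
have [] := (compact_near_coveringP _).1 cK R (0 : R)^'+ (fun s v => P s (tproj v)).
  move=> v _; have [r r0 h] := hP (tproj v).
  have n1 : (0 : R) < n%:R + 1 by rewrite ltr_wpDl.
  exists (ball v (r / (n%:R + 1)), [set s | 0 < s < r]) => /=.
    split; first by apply: nbhsx_ballx; rewrite divr_gt0.
    near=> s; apply/andP; split; near: s; first exact: nbhs_right_gt.
    exact: nbhs_right_lt.
  move=> [w s] /= [vw sr]; apply: h => //.
  apply: le_lt_trans (tdist_proj _ _) _.
  apply: le_lt_trans (enorm_le_norm _) _.
  move: vw; rewrite -ball_normE /= ltr_pdivlMr// mulrC mulrDl mul1r.
  by apply: le_lt_trans; rewrite lerDl.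
move=> r r0 h; exists r => // s x sr; rewrite -[x]tlogK.
apply: (h s) => /=.
- by rewrite sub0r normrN gtr0_norm; case/andP: sr.
- by case/andP: sr.
- by move=> i; have := tlog_itv x i; rewrite in_itv /= => /andP[-> /ltW].
Unshelve. all: by end_near. Qed.

Lemma torus_continuousP (f : T -> T) (x : T) :
  {for x, continuous f} <->
  forall e, 0 < e -> exists2 r, 0 < r & forall y, tdist x y < r -> tdist (f x) (f y) < e.
Proof.
split=> [fx e e0|h U /torus_nbhsP[e e0 eU]].
  have /fx/torus_nbhsP : nbhs (f x) [set y | tdist (f x) y < e].
    by apply/torus_nbhsP; exists e.
  by [].
by have [r r0 hr] := h e e0; apply/torus_nbhsP; exists r => // y /hr/eU.
Qed.

Lemma torus_continuous_normP (W : normedModType R) (f : T -> W) (x : T) :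
  {for x, continuous f} <->
  forall e, 0 < e -> exists2 r, 0 < r & forall y, tdist x y < r -> `|f x - f y| < e.
Proof.
split=> [fx e e0|h U /nbhs_normP[e /= e0 eU]].
  have /fx/torus_nbhsP : nbhs (f x) [set y | `|f x - y| < e].
    by apply/nbhs_normP; exists e.
  by [].
by have [r r0 hr] := h e e0; apply/torus_nbhsP; exists r => // y /hr/eU.
Qed.

End TorusMetric.

Lemma tdist_chain {R : realType} {n : nat} (a b c d : torus R n) :
  tdist a d <= tdist b a + tdist c b + tdist c d.
Proof.
have := tdistD b a d; have := tdistD c b d.
rewrite (tdistC a b) (tdistC b c); lra.
Qed.

Lemma tdist_lip {R : realType} {n : nat} (e : R) (p1 q1 p2 q2 : torus R n) : tdist p1 q1 < e / 2 -> tdist p2 q2 < e / 2 ->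
  `|tdist p1 p2 - tdist q1 q2| <= e.
Proof.
move=> l1 l2; have i1 := tdist_chain p1 q1 q2 p2; have i2 := tdist_chain q1 p1 p2 q2.
rewrite (tdistC q1 p1) (tdistC q2 q1) (tdistC q2 p2) in i1; rewrite (tdistC p2 p1) in i2.
by rewrite ler_norml; apply/andP; split; lra.
Qed.

(** * Local displacements and C^1-neighbourhoods *)

Section Calculus.
Context {R : realType} {n : nat}.
Local Notation T := (torus R n).
Local Notation V := ('rV[R]_n).
Implicit Types (f g p : T -> T) (A : T -> 'M[R]_n).

Lemma local_exprE g (x : T) (v : V) : g (x + tproj v) = g x + tproj (local_expr g x v).
Proof. by rewrite /local_expr tlogK [RHS]addrC subrK. Qed.

Lemma enorm_local_expr g x (v : V) :
  enorm (local_expr g x v) = tdist (g x) (g (x + tproj v)).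
Proof. by rewrite tdistC. Qed.

Lemma local_expr_add g x (v w : V) :
  enorm (local_expr g x v) + enorm (local_expr g (x + tproj v) w) < 2^-1 ->
  local_expr g x (v + w) = local_expr g x v + local_expr g (x + tproj v) w.
Proof.
move=> h; rewrite {1}/local_expr tprojD addrA !local_exprE.
set a := tproj (local_expr g x v); set b := tproj _.
have -> : g x + a + b - g x = a + b by rewrite addrAC [g x + a]addrC addrK.
rewrite -tprojD tlog_small//.
exact: le_lt_trans (enormD _ _) h.
Qed.

Lemma rV0E (i : 'I_n) : (0 : V) 0 i = 0.
Proof. by rewrite mxE. Qed.

Lemma rVDE (u v : V) (i : 'I_n) : (u + v) 0 i = u 0 i + v 0 i.
Proof. by rewrite mxE. Qed.

Lemma rVBE (u v : V) (i : 'I_n) : (u - v) 0 i = u 0 i - v 0 i.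
Proof. by rewrite !mxE. Qed.

Lemma enorm_cvg0 (e : R) : 0 < e -> exists2 r : R, 0 < r &
  forall v : V, `|v| < r -> enorm v < e.
Proof.
move=> e0; have n1 : (0 : R) < n%:R + 1 by rewrite ltr_wpDl.
exists (e / (n%:R + 1)) => [|v]; first by rewrite divr_gt0.
rewrite ltr_pdivlMr// mulrC mulrDl mul1r; apply: le_lt_trans.
by apply: le_trans (enorm_le_norm _) _; rewrite lerDl.
Qed.

Lemma local_expr0 g x : local_expr g x 0 = 0.
Proof. by rewrite /local_expr tproj0 addr0 subrr tlog0. Qed.

Lemma C1_local_small g x (e : R) : C1_map g -> 0 < e ->
  exists2 r, 0 < r & forall v : V, `|v| < r -> enorm (local_expr g x v) < e.
Proof.
move=> Cg e0; have [/differentiable_continuous dg _] := Cg x I.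
have [r r0 hr] := enorm_cvg0 e0.
have /nbhs_normP[d /= d0 hd] : \forall v \near (0 : V), `|local_expr g x v| < r.
  have /dg : nbhs (local_expr g x 0) [set w | `|w| < r].
    rewrite local_expr0.
    suff : \forall w \near (0 : V), `|w| < r by [].
    by apply/nbhs_normP; exists r => //= w /=; rewrite sub0r normrN.
  by [].
by exists d => // v vd; apply/hr/hd => /=; rewrite sub0r normrN.
Qed.

Lemma C1_continuous g : C1_map g -> continuous g.
Proof.
move=> Cg x; apply/torus_continuousP => e e0.
have [r r0 hr] := C1_local_small x Cg e0.
exists r => // y xy; have [u uy ur] := tdist_ex x y.
rewrite uy -enorm_local_expr; apply: hr.
by apply: le_lt_trans (norm_le_enorm _) _; rewrite ur.
Qed.

Lemma C1_tderiv_continuous g : C1_map g -> continuous (tderiv g).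
Proof. by move=> Cg x; have [] := Cg x I. Qed.

Lemma uniform_continuous_torus f : continuous f -> forall e, 0 < e ->
  exists2 r, 0 < r & forall x y, tdist x y < r -> tdist (f x) (f y) < e.
Proof.
move=> cf e e0.
have [x0|r r0 h] := @torus_uniform R n
    (fun s x => forall y, tdist x y < s -> tdist (f x) (f y) < e).
  have e2 : 0 < e / 2 by lra.
  have [r r0 h] := (torus_continuousP _ _).1 (cf x0) _ e2.
  exists (r / 2) => [|s x /andP[s0 sr] x0x y xy]; first by lra.
  have h1 : tdist x0 x < r by lra.
  have h2 : tdist x0 y < r by have := tdistD x x0 y; lra.
  by have := tdistD (f x0) (f x) (f y); have := h _ h1; have := h _ h2; rewrite [tdist (f x) (f x0)]tdistC; lra.
exists (r / 2) => [|x y]; first by lra.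
by apply: h; lra.
Qed.

Lemma uniform_continuous_norm (W : normedModType R) (F : T -> W) :
  continuous F -> forall e, 0 < e ->
  exists2 r, 0 < r & forall x y, tdist x y < r -> `|F x - F y| < e.
Proof.
move=> cf e e0.
have [x0|r r0 h] := @torus_uniform R n
    (fun s x => forall y, tdist x y < s -> `|F x - F y| < e).
  have e2 : 0 < e / 2 by lra.
  have [r r0 h] := (torus_continuous_normP _ _).1 (cf x0) _ e2.
  exists (r / 2) => [|s x /andP[s0 sr] x0x y xy]; first by lra.
  have h1 : tdist x0 x < r by lra.
  have h2 : tdist x0 y < r by have := tdistD x x0 y; lra.
  have := ler_distD (F x0) (F x) (F y); have := h _ h1; have := h _ h2.
  rewrite [`|F x - F x0|]distrC; lra.
exists (r / 2) => [|x y]; first by lra.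
by apply: h; lra.
Qed.

Lemma uniform_continuous_mx A : continuous A -> forall e, 0 < e ->
  exists2 r, 0 < r & forall x y, tdist x y < r -> mxbnd (A x - A y) < e.
Proof.
move=> cA e e0; have n1 : (0 : R) < n%:R * n%:R + 1 by rewrite ltr_wpDl ?mulr_ge0.
have [||r r0 h] := @uniform_continuous_norm _ A _ (e / (n%:R * n%:R + 1)).
- exact: cA.
- by rewrite divr_gt0.
exists r => // x y /h; rewrite ltr_pdivlMr// mulrC mulrDl mul1r.
by apply: le_lt_trans; rewrite lerDl.
Qed.

Lemma bounded_mx_torus A : continuous A -> exists2 B, 0 < B &
  forall x, mxbnd (A x) <= B.
Proof.
move=> cA.
have [x0|r r0 h] := @torus_uniform R n (fun s x => mxbnd (A x) <= s^-1); last first.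
  exists (r / 2)^-1 => [|x]; first by rewrite invr_gt0; lra.
  by apply: h; lra.
have [r r0 h] := uniform_continuous_mx cA ltr01.
pose B := mxbnd (A x0) + 1.
have B0 : 0 < B by rewrite ltr_wpDl ?mxbnd_ge0.
exists (Num.min r B^-1) => [|s x /andP[s0]]; first by rewrite lt_min r0 invr_gt0.
rewrite !lt_min => /andP[sr sB] /andP[xr _].
have := h x x0; rewrite tdistC => /(_ xr) h1.
rewrite -[A x](subrK (A x0)); apply: le_trans (mxbndD _ _) _.
apply: (@le_trans _ _ B); first by rewrite /B; lra.
by rewrite -[B]invrK lef_pV2 ?posrE ?invr_gt0// ltW.
Qed.

(** Local expressions add along the line as long as they stay in the chart, so the derivative at
    time [t] is that of the local expression at the moving point, taken at 0. *)
Lemma line_derive g x (v : V) (t : R) (i : 'I_n) : C1_map g ->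
  enorm (local_expr g x (t *: v)) < 2^-1 ->
  is_derive t 1 (fun s => local_expr g x (s *: v) 0 i)
    ((v *m tderiv g (x + tproj (t *: v))) 0 i).
Proof.
move=> Cg ht; set y := x + tproj (t *: v).
have [dg _] := Cg y I.
have D1 : is_derive (0 : V) v (local_expr g y) (v *m tderiv g y).
  by apply: DeriveDef; [exact: diff_derivable|rewrite deriveEjacobian].
have D2 : is_derive (0 : R) 1 (fun h : R => local_expr g y (h *: v) 0 i) ((v *m tderiv g y) 0 i).
  have [dv vE] := D1.
  have cv : (fun h : R => h^-1 *: (local_expr g y (h *: v + 0) - local_expr g y 0)) @ 0^' --> v *m tderiv g y.
    by rewrite -vE; exact: dv.
  have cvi : (fun h : R => h^-1 * (local_expr g y (h *: v) 0 i)) @ 0^' --> (v *m tderiv g y) 0 i.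
    have := cvg_comp _ _ cv (@coord_continuous R 1 n 0 i (v *m tderiv g y)).
    apply: cvg_trans; apply: near_eq_cvg; near=> h => /=.
    by rewrite addr0 local_expr0 subr0 [LHS]mxE.
  have cvi' : (fun h : R => h^-1 *: (((fun h : R => local_expr g y (h *: v) 0 i) \o shift 0) (h *: 1) - (local_expr g y (0 *: v) 0 i))) @ 0^' --> (v *m tderiv g y) 0 i.
    apply: cvg_trans cvi; apply: near_eq_cvg; near=> h => /=.
    by rewrite addr0 scale0r local_expr0 rV0E subr0 /GRing.scale/= mulr1.
  apply: DeriveDef; first by apply/cvg_ex; exists ((v *m tderiv g y) 0 i).
  exact: cvg_lim cvi'.
have [r r0 hr] := @C1_local_small g y (2^-1 - enorm (local_expr g x (t *: v))) Cg ltac:(by rewrite subr_gt0).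
have nearE : \forall h \near (0 : R),
   local_expr g x ((h + t) *: v) = local_expr g x (t *: v) + local_expr g y (h *: v).
  have d0 : 0 < r / (`|v| + 1) by rewrite divr_gt0// ltr_wpDl.
  apply/nbhs_normP; exists (r / (`|v| + 1)) => //= h; rewrite /= sub0r normrN => hd.
  rewrite scalerDl addrC local_expr_add// -ltrBrDl; apply: hr.
  rewrite normrZ; move: hd; rewrite ltr_pdivlMr ?ltr_wpDl// mulrDr mulr1.
  by apply: le_lt_trans; rewrite lerDl.
have [d2 e2] := D2.
have cv : (fun h : R => h^-1 *: (((fun s => local_expr g x (s *: v) 0 i) \o shift t) (h *: 1) - local_expr g x (t *: v) 0 i)) @ 0^' --> (v *m tderiv g y) 0 i.
  have d2' : (fun h : R => h^-1 *: (((fun h : R => local_expr g y (h *: v) 0 i) \o shift 0) (h *: 1) - (local_expr g y (0 *: v) 0 i))) @ 0^' --> (v *m tderiv g y) 0 i.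
    by rewrite -e2; exact: d2.
  apply: cvg_trans d2'; apply: near_eq_cvg.
  near=> h => /=; congr (_ *: _).
  rewrite scale0r local_expr0 rV0E subr0 addr0 [h *: 1]mulr1.
  have -> : local_expr g x ((h + t) *: v) = local_expr g x (t *: v) + local_expr g y (h *: v).
    near: h; exact: cvg_within nearE.
  by rewrite rVDE [RHS]addrC addKr.
apply: DeriveDef; first by apply/cvg_ex; exists ((v *m tderiv g y) 0 i).
exact: cvg_lim cv.
Unshelve. all: by end_near. Qed.

Definition near_lin A (eta r : R) g := forall x (v : V), enorm v <= r ->
  enorm (local_expr g x v - v *m A x) <= eta * enorm v.

(** C^1-closeness stated on finite displacements: [A] is a matrix field attached to [f], and the
    radius [r] is common to all nearby [g]. In this form closeness passes to iterates. *)
Definition capprox f A (eta r : R) g :=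
  (forall x, tdist (f x) (g x) < eta) /\ near_lin A eta r g.

(** The filter of C^1-neighbourhoods of [f]. *)
Definition evC1 f (P : (T -> T) -> Prop) := exists2 e : R, 0 < e &
  forall g, C1_map g -> C1_close e f g -> P g.

Lemma evC1_and f (P Q : (T -> T) -> Prop) :
  evC1 f P -> evC1 f Q -> evC1 f (fun g => P g /\ Q g).
Proof.
move=> [a a0 ha] [b b0 hb]; exists (Num.min a b) => [|g Cg cg].
  by rewrite lt_min a0.
by split; [apply: ha|apply: hb] => // x; have := cg x; rewrite !lt_min => -[/andP[? ?] /andP[? ?]].
Qed.

Lemma evC1_imp f (P Q : (T -> T) -> Prop) :
  (forall g, P g -> Q g) -> evC1 f P -> evC1 f Q.
Proof. by move=> PQ [a a0 ha]; exists a => // g Cg cg; apply/PQ/ha. Qed.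

Lemma evC1_forall f (P : nat -> (T -> T) -> Prop) k :
  (forall i, evC1 f (P i)) -> evC1 f (fun g => forall i, (i <= k)%N -> P i g).
Proof.
move=> h; elim: k => [|k IH].
  by apply: evC1_imp (h 0%N) => g Pg i; rewrite leqn0 => /eqP ->.
apply: evC1_imp (evC1_and IH (h k.+1)) => g [h1 h2] i.
by rewrite leq_eqVlt => /predU1P[->//|]; exact: h1.
Qed.

Lemma mean_value_local g x (v : V) (M : 'M[R]_n) (eta : R) : C1_map g ->
  (forall t : R, 0 <= t <= 1 -> enorm (local_expr g x (t *: v)) < 2^-1) ->
  (forall t : R, 0 <= t <= 1 -> mxbnd (tderiv g (x + tproj (t *: v)) - M) <= eta) ->
  enorm (local_expr g x v - v *m M) <= n%:R * (eta * enorm v).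
Proof.
move=> Cg sm dm; apply: le_trans (enorm_le_norm _) _; rewrite ler_wpM2l//.
have eta0 : 0 <= eta by apply: le_trans (dm 0 _); rewrite ?mxbnd_ge0// lexx ler01.
apply: norm_le_bound => [|i j]; first by rewrite mulr_ge0 ?enorm_ge0.
rewrite ord1 {i}.
pose psi (t : R) := local_expr g x (t *: v) 0 j - t * (v *m M) 0 j.
have dpsi (t : R) : 0 <= t <= 1 ->
    is_derive t 1 psi ((v *m (tderiv g (x + tproj (t *: v)) - M)) 0 j).
  move=> t01; have D1 := line_derive j Cg (sm t t01).
  have D2 : is_derive t 1 (fun s : R => s * (v *m M) 0 j) ((v *m M) 0 j).
    apply: is_derive_eq; rewrite /GRing.scale/= mulr0 add0r mulr1//.
  by rewrite mulmxBr rVBE; exact: is_deriveB.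
have [||c cin] := @MVT R psi (fun t => (v *m (tderiv g (x + tproj (t *: v)) - M)) 0 j) 0 1 ltr01.
- by move=> t; rewrite in_itv/= => /andP[? ?]; apply: dpsi; rewrite !ltW.
- apply: derivable_within_continuous => t; rewrite in_itv/= => t01.
  by have [] := dpsi t t01.
rewrite /psi scale1r scale0r local_expr0 rV0E !mul0r !subr0 mul1r mulr1 => E.
rewrite rVBE E; apply: le_trans (coord_le_enorm _ _) _.
apply: le_trans (enorm_mulmx _ _) _; rewrite ler_wpM2r ?enorm_ge0//.
by apply: dm; move: cin; rewrite in_itv/= => /andP[? ?]; rewrite !ltW.
Qed.

(** Mean value inequality against the derivative of [f] at the base point. The radius comes from the
    moduli of continuity of [f] and [tderiv f], hence precedes [g]. *)
Lemma C1_capprox f : C1_map f -> forall eta, 0 < eta ->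
  exists2 r, 0 < r & evC1 f (capprox f (tderiv f) eta r).
Proof.
move=> Cf eta eta0.
have n1 : (0 : R) < n%:R + 1 by rewrite ltr_wpDl.
pose e1 := eta / (n%:R + 1) / 2.
have e10 : 0 < e1 by rewrite !divr_gt0.
(* Three distances below 1/8 add up to less than 1/2, so the images stay in the chart. *)
have h8 : (0 : R) < 8^-1 by lra.
have [r1 r10 hr1] := uniform_continuous_torus (C1_continuous Cf) h8.
have [r2 r20 hr2] := uniform_continuous_mx (C1_tderiv_continuous Cf) e10.
have nn1 : (0 : R) < n%:R * n%:R + 1 by rewrite ltr_wpDl ?mulr_ge0.
exists (Num.min r1 r2 / 2); first by rewrite divr_gt0// lt_min r10.
exists (Num.min (Num.min eta 8^-1) (e1 / (n%:R * n%:R + 1))).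
  by rewrite !lt_min eta0 h8 divr_gt0.
move=> g Cg cg.
have cg1 x : tdist (f x) (g x) < eta by have [] := cg x; rewrite !lt_min => /andP[/andP[]].
have cg2 x : tdist (f x) (g x) < 8^-1 by have [] := cg x; rewrite !lt_min => /andP[/andP[]].
have cg3 x : mxbnd (tderiv f x - tderiv g x) < e1.
  have [_] := cg x; rewrite !lt_min => /andP[_].
  by rewrite ltr_pdivlMr// mulrC mulrDl mul1r; apply: le_lt_trans; rewrite lerDl.
split=> // x v hv.
have {hv} hv : enorm v < Num.min r1 r2.
  have : 0 < Num.min r1 r2 by rewrite lt_min r10.
  lra.
move: hv; rewrite lt_min => /andP[v1 v2].
have tv (t : R) : 0 <= t <= 1 -> enorm (t *: v) <= enorm v.
  by move=> /andP[t0 t1]; rewrite enormZ ger0_norm// ler_piMl ?enorm_ge0.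
apply: (@le_trans _ _ (n%:R * ((e1 + e1) * enorm v))); last first.
  rewrite mulrA ler_wpM2r ?enorm_ge0// /e1 -splitr mulrCA ger_pMr//.
  by rewrite ler_pdivrMr// mul1r lerDl.
apply: mean_value_local => // t t01.
  rewrite enorm_local_expr; set y := x + _.
  have h1 := cg2 x; have h2 := cg2 y.
  have h3 : tdist (f x) (f y) < 8^-1.
    by apply: hr1; apply: le_lt_trans (tdist_addr _ _) (le_lt_trans (tv _ t01) v1).
  have := tdistD (f x) (g x) (g y); have := tdistD (f y) (f x) (g y).
  rewrite (tdistC (g x) (f x)); lra.
set y := x + _.
have -> : tderiv g y - tderiv f x = - (tderiv f y - tderiv g y) + (tderiv f y - tderiv f x).
  by rewrite opprB subrKA.
apply: le_trans (mxbndD _ _) _; apply: lerD.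
  by rewrite /mxbnd normrN -/(mxbnd _) ltW.
apply/ltW/hr2; rewrite tdistC.
exact: le_lt_trans (tdist_addr _ _) (le_lt_trans (tv _ t01) v2).
Qed.

End Calculus.

(** * Covering of balls, and iterates of nearby maps *)

Section Iterates.
Context {R : realType} {n : nat}.
Local Notation T := (torus R n).
Local Notation V := ('rV[R]_n).
Implicit Types (f g p : T -> T) (A : T -> 'M[R]_n).

Lemma continuous_at_eps (V1 W : normedModType R) (F : V1 -> W) (x : V1) :
  (forall e, 0 < e -> exists2 r, 0 < r & forall y, `|x - y| < r -> `|F x - F y| < e) ->
  {for x, continuous F}.
Proof.
move=> h U /nbhs_normP[e /= e0 eU]; have [r r0 hr] := h e e0.
suff : \forall y \near x, U (F y) by [].
by apply/nbhs_normP; exists r => // y /= /hr; exact: eU.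
Qed.

Lemma enorm_continuous : continuous (@enorm R n).
Proof.
move=> v; apply: continuous_at_eps => e e0.
have [r r0 hr] := @enorm_cvg0 R n e e0; exists r => // w vw.
have := hr _ vw; rewrite ltr_norml.
have := enorm_lower v (w - v); have := enorm_lower w (v - w).
rewrite !subrKC (enorm_distC w v); lra.
Qed.

Lemma compact_enorm_ball (s : R) : compact [set v : V | enorm v <= s].
Proof.
apply: bounded_closed_compact.
  exists s; split; first exact: num_real.
  move=> M sM v /= vs; apply: ltW; apply: le_lt_trans sM.
  exact: le_trans (norm_le_enorm _) vs.
rewrite (_ : [set _ | _] = enorm @^-1` [set t | t <= s])//.
by apply: closed_comp; [move=> v _; exact: enorm_continuous|exact: closed_le].
Qed.

Lemma near_lin_continuous g A (eta r : R) : continuous A -> 0 < r -> near_lin A eta r g ->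
  continuous g.
Proof.
move=> cA r0 hg x; apply/torus_continuousP => e e0.
pose K := `|eta| + mxbnd (A x) + 1.
have K0 : 0 < K by rewrite ltr_wpDl// addr_ge0// mxbnd_ge0.
exists (Num.min r (e / K)) => [|y]; first by rewrite lt_min r0 divr_gt0.
have [u -> <-] := tdist_ex x y; rewrite lt_min => /andP[ur].
rewrite ltr_pdivlMr// => ue.
rewrite -enorm_local_expr; apply: le_lt_trans ue.
have := hg x u (ltW ur); have := enorm_mulmx u (A x).
have := enormD (local_expr g x u - u *m A x) (u *m A x); rewrite subrK.
have : eta * enorm u <= `|eta| * enorm u by rewrite ler_wpM2r ?enorm_ge0// ler_norm.
have := enorm_ge0 u; rewrite /K !mulrDr; lra.
Qed.

(* Ekeland's trick: a minimizer of [tdist (p z) y + theta * |z - x|] lies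
   inside the ball, and there the expansion of [A] would allow a further
   decrease unless [p z = y]. *)
Lemma covering p A (eta kap r s : R) (x y : T) :
  continuous p -> 0 <= eta < kap -> 0 < r -> 0 < s -> near_lin A eta r p ->
  (forall z, tdist x z <= s -> forall v, kap * enorm v <= enorm (v *m A z)) ->
  tdist (p x) y < (kap - eta) * s ->
  exists2 z, tdist x z < s & p z = y.
Proof.
have locals := I.
move=> cp /andP[eta0 etak] r0 s0 hl hA hy.
(* A slope below the expansion [kap - eta], yet large enough to keep the minimizer off the boundary
   of the ball. *)
have [th [th1 th2]] : exists th, tdist (p x) y < th * s /\ th < kap - eta.
  exists ((tdist (p x) y / s + (kap - eta)) / 2).
  have : tdist (p x) y / s < kap - eta by rewrite ltr_pdivrMr.
  have : tdist (p x) y / s * s = tdist (p x) y by rewrite divfK// gt_eqF.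
  set q := tdist _ _ / s => qs ql; split; last by qlra.
  rewrite -qs ltr_pM2r//; qlra.
have th0 : 0 < th by have := tdist_ge0 (p x) y; rewrite -(pmulr_lgt0 _ s0); qlra.
pose phi (u : V) := tdist (p (x + tproj u)) y + th * enorm u.
have cphi : continuous phi.
  move=> u; apply: (@continuousD _ _ _ (fun u => tdist (p (x + tproj u)) y) (fun u => th * enorm u)).
    apply: continuous_at_eps => e e0.
    have [d d0 hd] := (torus_continuousP _ _).1 (cp (x + tproj u)) _ e0.
    have [q q0 hq] := @enorm_cvg0 R n d d0.
    exists q => // w uw.
    have : tdist (x + tproj u) (x + tproj w) < d.
      rewrite tdistE opprD addrACA subrr add0r -tprojB.
      exact: le_lt_trans (tnorm_proj _) (hq _ uw).
    move=> /hd; rewrite ltr_norml.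
    have := tdistD (p (x + tproj w)) (p (x + tproj u)) y.
    have := tdistD (p (x + tproj u)) (p (x + tproj w)) y.
    rewrite (tdistC (p (x + tproj w)) (p (x + tproj u))); qlra.
  by apply: continuousM; [exact: cst_continuous|exact: enorm_continuous].
have [|u us umin] := compact_EVT_min _ (@compact_enorm_ball s) (continuous_subspaceT cphi).
  by exists 0; rewrite /= enorm0 ltW.
move: us; rewrite inE /= => us.
have {}umin (w : V) : enorm w <= s -> phi u <= phi w by move=> ws; apply: umin; rewrite inE.
have u_lt : enorm u < s.
  have := umin 0; rewrite enorm0 (ltW s0) => /(_ isT).
  rewrite /phi tproj0 addr0 enorm0 mulr0 addr0.
  have := tdist_ge0 (p (x + tproj u)) y => h1 h2.
  have : th * enorm u < th * s by qlra.
  by rewrite ltr_pM2l.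
exists (x + tproj u); first exact: le_lt_trans (tdist_addr _ _) u_lt.
set z := x + tproj u.
have xz : tdist x z <= s by apply: le_trans (tdist_addr _ _) us.
apply: tdist_eq0; apply/eqP; rewrite eq_le tdist_ge0 andbT leNgt; apply/negP => D0.
have [w wy wD] := tdist_ex (p z) y.
have uA : A z \in unitmx.
  rewrite -row_free_unit; apply/row_freeP.
  have /row_freeP : row_free (A z).
    rewrite -kermx_eq0; apply/rowV0P => v /sub_kermxP v0.
    have := hA z xz v; rewrite v0 enorm0 pmulr_rle0; last qlra.
    by move=> h; apply: enorm_eq0; apply/eqP; rewrite eq_le h enorm_ge0.
  by [].
pose a := w *m invmx (A z).
have aA : a *m A z = w by rewrite mulmxKV.
have a_le : kap * enorm a <= enorm w by rewrite -aA; exact: hA.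
have a0 : 0 < enorm a.
  apply: enorm_gt0; apply/eqP => a0.
  by move: D0; rewrite -wD -aA a0 mul0mx enorm0 ltxx.
pose t := Num.min 1 (Num.min (r / enorm a) ((s - enorm u) / enorm a)).
have t0 : 0 < t by rewrite !lt_min ltr01 !divr_gt0// subr_gt0.
have [t1 [t2 t3]] : t <= 1 /\ t <= r / enorm a /\ t <= (s - enorm u) / enorm a.
  by rewrite /t !ge_min !lexx !orbT.
move: t2 t3; rewrite !ler_pdivlMr// => t2 t3.
have nta : enorm (t *: a) = t * enorm a by rewrite enormZ gtr0_norm.
have := umin (u + t *: a).
have -> : enorm (u + t *: a) <= s.
  by apply: le_trans (enormD _ _) _; rewrite nta; qlra.
move=> /(_ isT); apply/negP; rewrite -ltNge /phi -/z.
have E : local_expr p z (t *: a) = t *: w + (local_expr p z (t *: a) - (t *: a) *m A z).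
  by rewrite -scalemxAl aA addrC subrK.
have h1 : enorm (local_expr p z (t *: a) - (t *: a) *m A z) <= eta * (t * enorm a).
  by rewrite -nta; apply: hl; rewrite nta.
have h2 : tdist (p (x + tproj (u + t *: a))) y <= (1 - t) * enorm w + eta * (t * enorm a).
  rewrite tprojD addrA -/z local_exprE wy tdistE opprD addrACA subrr add0r -tprojB.
  apply: le_trans (tnorm_proj _) _; rewrite E.
  set q := _ - _ in h1 *.
  have -> : t *: w + q - w = q - (1 - t) *: w.
    by rewrite scalerBl scale1r opprB [RHS]addrA [q + _]addrC.
  apply: le_trans (enormB _ _) _; rewrite enormZ (ger0_norm (_ : 0 <= 1 - t)); qlra.
have h3 := enormD u (t *: a); rewrite nta in h3.
have h4 : th * enorm (u + t *: a) <= th * enorm u + th * (t * enorm a).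
  by rewrite -mulrDr ler_wpM2l// ltW.
have h5 : (eta + th) * (t * enorm a) < t * enorm w.
  apply: (@lt_le_trans _ _ (kap * (t * enorm a))).
    by rewrite ltr_pM2r ?mulr_gt0//; qlra.
  by rewrite mulrCA ler_wpM2l// ltW.
rewrite wD in h2 h5; qlra.
Qed.

(** For [A] the derivative of [f], this is the derivative of [iter k f] at [x], in reading order. *)
Fixpoint cocyc f A (k : nat) (x : T) : 'M[R]_n :=
  if k is k'.+1 then cocyc f A k' x *m A (iter k' f x) else 1%:M.

Lemma iter_continuous f k : continuous f -> continuous (iter k f).
Proof.
move=> cf; elim: k => [|k IH] x; first exact: cvg_id.
by apply: (@continuous_comp _ _ _ (iter k f) f); [exact: IH|exact: cf].
Qed.

Lemma cocycD f A i j x : cocyc f A (i + j) x = cocyc f A i x *m cocyc f A j (iter i f x).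
Proof.
elim: j => [|j IH]; first by rewrite addn0 mulmx1.
by rewrite addnS /= IH mulmxA -iterD addnC.
Qed.

Lemma continuous_mulmx (A B' : T -> 'M[R]_n) : continuous A -> continuous B' ->
  continuous (fun x : T => A x *m B' x).
Proof.
move=> cA cB x; apply/torus_continuous_normP => e e0.
pose a := `|A x|; pose b := `|B' x| + 1.
have a0 : 0 <= a := normr_ge0 _.
have b0 : 0 < b by rewrite ltr_wpDl.
pose K := n%:R * (a + b) + 1.
have K0 : 0 < K by rewrite ltr_wpDl// mulr_ge0// addr_ge0// ltW.
pose d := Num.min 1 (e / K).
have d0 : 0 < d by rewrite lt_min ltr01 divr_gt0.
have [r1 r10 h1] := (torus_continuous_normP _ _).1 (cA x) _ d0.
have [r2 r20 h2] := (torus_continuous_normP _ _).1 (cB x) _ d0.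
exists (Num.min r1 r2) => [|y]; first by rewrite lt_min r10.
rewrite lt_min => /andP[/h1 {}h1 /h2 {}h2].
have Bb : `|B' y| <= b.
  have := ler_normB (B' x) (B' x - B' y); rewrite opprB addrC subrK.
  have : d <= 1 by rewrite ge_min lexx.
  rewrite /b; lra.
have mn (M N : 'M[R]_n) : `|M *m N| <= n%:R * (`|M| * `|N|).
  apply: norm_le_bound => [|i j]; first by rewrite !mulr_ge0.
  rewrite mxE; apply: le_trans (ler_norm_sum _ _ _) _.
  rewrite mulr_natl -[X in _ *+ X]card_ord -sumr_const; apply: ler_sum => k _.
  by rewrite normrM ler_pM// coord_le_norm.
have -> : A x *m B' x - A y *m B' y = (A x - A y) *m B' y + A x *m (B' x - B' y).
  by rewrite mulmxBl mulmxBr [RHS]addrC subrKA.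
apply: (@le_lt_trans _ _ (d * (n%:R * (a + b)))).
  apply: le_trans (ler_normD _ _) _.
  have := mn (A x - A y) (B' y); have := mn (A x) (B' x - B' y).
  have : n%:R * (`|A x - A y| * `|B' y|) <= n%:R * (d * b).
    by rewrite ler_wpM2l// ler_pM// ltW.
  have : n%:R * (`|A x| * `|B' x - B' y|) <= n%:R * (a * d).
    by rewrite ler_wpM2l// ler_wpM2l// ltW.
  have -> : d * (n%:R * (a + b)) = n%:R * (a * d) + n%:R * (d * b) by ring.
  lra.
apply: (@lt_le_trans _ _ (d * K)); first by rewrite ltr_pM2l// /K; lra.
by rewrite -ler_pdivlMr// ge_min lexx orbT.
Qed.

Lemma cocyc_continuous f A k : continuous f -> continuous A -> continuous (cocyc f A k).
Proof.
move=> cf cA; elim: k => [|k IH]; first exact: cst_continuous.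
apply: continuous_mulmx; first exact: IH.
move=> x.
by apply: (@continuous_comp _ _ _ (iter k f) A); [exact: iter_continuous|exact: cA].
Qed.

(** The error after one more step splits into the nonlinearity of [g] at its own orbit, the image of
    the previous error, and the variation of [A] between the orbits of [f] and [g], which uniform
    continuity controls. *)
Lemma iter_capprox f A k : continuous f -> continuous A ->
  (forall eta, 0 < eta -> exists2 r, 0 < r & evC1 f (capprox f A eta r)) ->
  forall eta, 0 < eta -> exists2 r, 0 < r &
    evC1 f (fun g => capprox (iter k f) (cocyc f A k) eta r (iter k g)).
Proof.
move=> cf cA hA; elim: k => [|k IH] eta eta0.
  exists 4^-1; first lra.
  exists 1 => // g _ _; split=> [x|x v hv /=]; first by rewrite tdistxx.
  have -> : local_expr (iter 0 g) x v = tlog (tproj v).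
    by rewrite /local_expr /= addrAC subrr add0r.
  rewrite tlog_small; last by apply: le_lt_trans hv _; lra.
  by rewrite mulmx1 subrr enorm0 mulr_ge0 ?enorm_ge0 ?ltW.
have [B B0 hB] := bounded_mx_torus cA.
have [C C0 hC] := bounded_mx_torus (@cocyc_continuous f A k cf cA).
have BC0 : 0 < B + C + (C + 1) by lra.
have [eta1 [eta10 eta11 eta1E]] :
    exists eta1 : R, [/\ 0 < eta1, eta1 <= 1 & eta1 * (B + C + (C + 1)) <= eta].
  exists (Num.min 1 (eta / (B + C + (C + 1)))); split.
  - by rewrite lt_min ltr01 !divr_gt0.
  - by rewrite ge_min lexx.
  - by rewrite -ler_pdivlMr// ge_min lexx orbT.
have [r3 r30 h3] := uniform_continuous_mx cA eta10.
have eta20 : 0 < eta / 2 by lra.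
have [r4 r40 h4] := uniform_continuous_torus cf eta20.
have [r1 r10 ev1] := IH (Num.min eta1 (Num.min r3 r4)) ltac:(by rewrite !lt_min eta10 r30).
have [r2 r20 ev2] := hA (Num.min eta1 (eta / 2)) ltac:(by rewrite !lt_min eta10).
exists (Num.min r1 (r2 / (C + 1))); first by rewrite lt_min r10 divr_gt0//; lra.
apply: evC1_imp (evC1_and ev1 ev2) => g [[d1 l1] [d2 l2]]; split=> [x|x v].
  apply: le_lt_trans (tdistD (f (iter k g x)) _ _) _ => /=.
  have := d2 (iter k g x); rewrite !lt_min => /andP[_].
  have : tdist (iter k f x) (iter k g x) < r4.
    by have := d1 x; rewrite !lt_min => /and3P[].
  move=> /h4; lra.
rewrite le_min ler_pdivlMr; last lra.
move=> /andP[v1 v2].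
set w := local_expr (iter k g) x v.
have e1 := le_trans (l1 x v v1) (ler_wpM2r (enorm_ge0 v) (_ : _ <= eta1)).
have {}e1 : enorm (w - v *m cocyc f A k x) <= eta1 * enorm v.
  by apply: e1; rewrite ge_min lexx.
have c1 : enorm (v *m cocyc f A k x) <= C * enorm v.
  by apply: le_trans (enorm_mulmx _ _) _; rewrite ler_wpM2r ?enorm_ge0.
have wv : enorm w <= (C + 1) * enorm v.
  have := enormD (w - v *m cocyc f A k x) (v *m cocyc f A k x); rewrite subrK.
  have : eta1 * enorm v <= 1 * enorm v by rewrite ler_wpM2r ?enorm_ge0.
  lra.
have -> : local_expr (iter k.+1 g) x v = local_expr g (iter k g x) w.
  by rewrite /local_expr/= -local_exprE.
have e2 : enorm (local_expr g (iter k g x) w - w *m A (iter k g x)) <= eta1 * ((C + 1) * enorm v).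
  apply: le_trans (l2 _ _ _) _; first by apply: le_trans wv _; lra.
  apply: ler_pM => //; rewrite ?enorm_ge0//; first by rewrite le_min !ltW.
  by rewrite ge_min lexx.
have m3 : mxbnd (A (iter k g x) - A (iter k f x)) <= eta1.
  by apply/ltW/h3; rewrite tdistC; have := d1 x; rewrite !lt_min => /and3P[].
set q := local_expr g _ _ in e2 *.
have -> : q - v *m cocyc f A k.+1 x = (q - w *m A (iter k g x)) +
   ((w - v *m cocyc f A k x) *m A (iter k g x) +
    (v *m cocyc f A k x) *m (A (iter k g x) - A (iter k f x))).
  by rewrite /= mulmxBl mulmxBr mulmxA [RHS]addrA !subrKA.
apply: (@le_trans _ _ (eta1 * (B + C + (C + 1)) * enorm v)); last first.
  by rewrite ler_wpM2r ?enorm_ge0.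
apply: le_trans (enormD _ _) _.
have := enormD ((w - v *m cocyc f A k x) *m A (iter k g x)) ((v *m cocyc f A k x) *m (A (iter k g x) - A (iter k f x))).
have f1 : enorm ((w - v *m cocyc f A k x) *m A (iter k g x)) <= B * (eta1 * enorm v).
  apply: le_trans (enorm_mulmx _ _) _; apply: ler_pM; rewrite ?mxbnd_ge0 ?enorm_ge0//.
have f2 : enorm ((v *m cocyc f A k x) *m (A (iter k g x) - A (iter k f x))) <= eta1 * (C * enorm v).
  by apply: le_trans (enorm_mulmx _ _) _; apply: ler_pM; rewrite ?mxbnd_ge0 ?enorm_ge0.
have -> : eta1 * (B + C + (C + 1)) * enorm v = B * (eta1 * enorm v) + eta1 * (C * enorm v) + eta1 * ((C + 1) * enorm v) by ring.
lra.
Qed.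

End Iterates.

(** * The standard cone *)

Section StandardCone.
Context {R : realType} {n : nat}.
Local Notation V := ('rV[R]_n).
Implicit Types (u v w : V) (d : nat).

Definition lo_part d v : V := \row_i (if (i < d)%N then v 0 i else 0).
Definition hi_part d v : V := \row_i (if (i < d)%N then 0 else v 0 i).

Lemma lo_partD d u v : lo_part d (u + v) = lo_part d u + lo_part d v.
Proof. by apply/rowP => i; rewrite !mxE; case: ifP; rewrite ?addr0. Qed.

Lemma hi_partD d u v : hi_part d (u + v) = hi_part d u + hi_part d v.
Proof. by apply/rowP => i; rewrite !mxE; case: ifP; rewrite ?addr0. Qed.

Lemma lo_partZ d a v : lo_part d (a *: v) = a *: lo_part d v.
Proof. by apply/rowP => i; rewrite !mxE; case: ifP; rewrite ?mulr0. Qed.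

Lemma hi_partZ d a v : hi_part d (a *: v) = a *: hi_part d v.
Proof. by apply/rowP => i; rewrite !mxE; case: ifP; rewrite ?mulr0. Qed.

Lemma lo_hi d v : v = lo_part d v + hi_part d v.
Proof. by apply/rowP => i; rewrite !mxE; case: ifP; rewrite ?addr0 ?add0r. Qed.

Lemma lo_lo d v : lo_part d (lo_part d v) = lo_part d v.
Proof. by apply/rowP => i; rewrite !mxE; case: ltnP. Qed.

Lemma hi_hi d v : hi_part d (hi_part d v) = hi_part d v.
Proof. by apply/rowP => i; rewrite !mxE; case: ltnP. Qed.

Lemma lo_of_hi d v : lo_part d (hi_part d v) = 0.
Proof. by apply/rowP => i; rewrite !mxE; case: ifP => // ->. Qed.

Lemma hi_of_lo d v : hi_part d (lo_part d v) = 0.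
Proof. by apply/rowP => i; rewrite !mxE; case: ifP => // ->. Qed.

Lemma enorm_lo d v : enorm (lo_part d v) <= enorm v.
Proof.
rewrite enorm_le ?enorm_ge0// sqr_enorm; apply: ler_sum => i _; rewrite mxE.
by case: ifP; rewrite ?expr0n ?sqr_ge0.
Qed.

Lemma enorm_hi d v : enorm (hi_part d v) <= enorm v.
Proof.
rewrite enorm_le ?enorm_ge0// sqr_enorm; apply: ler_sum => i _; rewrite mxE.
by case: ifP; rewrite ?expr0n ?sqr_ge0.
Qed.

Lemma std_coneE d v : std_cone d v <-> enorm (hi_part d v) <= enorm (lo_part d v).
Proof.
rewrite -ler_sqr ?nnegrE ?enorm_ge0// !sqr_enorm /std_cone /=.
have <- : \sum_i hi_part d v 0 i ^+ 2 = \sum_(i < n | (d <= i)%N) v 0 i ^+ 2.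
  rewrite [RHS]big_mkcond.
  by apply: eq_bigr => i _; rewrite mxE; case: ltnP; rewrite ?expr0n.
have <- // : \sum_i lo_part d v 0 i ^+ 2 = \sum_(i < n | (i < d)%N) v 0 i ^+ 2.
rewrite [RHS]big_mkcond.
by apply: eq_bigr => i _; rewrite mxE; case: ltnP; rewrite ?expr0n.
Qed.

Lemma std_coneZ d a v : std_cone d v -> std_cone d (a *: v).
Proof. by rewrite !std_coneE lo_partZ hi_partZ !enormZ => h; rewrite ler_wpM2l. Qed.

(** Scaling the high part by [1 - eta] opens a gap of [eta * enorm (lo_part d u)] in the cone
    inequality. Since [enorm u] is at most twice [enorm (lo_part d u)], an error of
    [eta / 4 * enorm u] on each part fits in it. *)
Lemma std_cone_deep d (eta : R) u v : 0 < eta <= 1 -> std_cone d u ->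
  enorm (v - (lo_part d u + (1 - eta) *: hi_part d u)) <= eta / 4 * enorm u ->
  std_cone d v.
Proof.
move=> /andP[eta0 eta1]; rewrite !std_coneE => cu.
set u' := lo_part d u + _; set w := v - u'.
have vE : v = u' + w by rewrite /w addrC subrK.
move=> hw.
have lov : lo_part d v = lo_part d u + lo_part d w.
  by rewrite vE !lo_partD lo_partZ lo_of_hi scaler0 addr0 lo_lo.
have hiv : hi_part d v = (1 - eta) *: hi_part d u + hi_part d w.
  by rewrite vE !hi_partD hi_partZ hi_of_lo add0r hi_hi.
have u2 : enorm u <= enorm (lo_part d u) + enorm (lo_part d u).
  by rewrite {1}(lo_hi d u); apply: le_trans (enormD _ _) _; rewrite lerD2l.
have := enormD ((1 - eta) *: hi_part d u) (hi_part d w); rewrite -hiv enormZ.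
have := enorm_lower (lo_part d u) (lo_part d w); rewrite -lov.
have := enorm_lo d w; have := enorm_hi d w.
rewrite ger0_norm ?subr_ge0//.
have : (1 - eta) * enorm (hi_part d u) <= (1 - eta) * enorm (lo_part d u).
  by rewrite ler_wpM2l ?subr_ge0.
have : eta / 4 * enorm u <= eta / 4 * (enorm (lo_part d u) + enorm (lo_part d u)).
  by rewrite ler_wpM2l// divr_ge0// ltW.
have := enorm_ge0 (lo_part d u); nra.
Qed.

Lemma lipschitz_continuous (W : normedModType R) (F : V -> W) (K : R) :
  (forall u v, `|F u - F v| <= K * enorm (u - v)) -> continuous F.
Proof.
move=> h v; apply: continuous_at_eps => e e0.
have K0 : 0 < `|K| + 1 by rewrite ltr_wpDl.
have [r r0 hr] := @enorm_cvg0 R n (e / (`|K| + 1)) ltac:(by rewrite divr_gt0).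
exists r => // w /hr; rewrite ltr_pdivlMr// => h1.
apply: le_lt_trans (h _ _) _; apply: le_lt_trans h1; rewrite mulrC.
by rewrite ler_wpM2l ?enorm_ge0//; have := ler_norm K; lra.
Qed.

Lemma enorm_dist_le u v : `|enorm u - enorm v| <= enorm (u - v).
Proof.
have := enorm_lower v (u - v); have := enorm_lower u (v - u).
rewrite !subrKC (enorm_distC v u) ler_norml; lra.
Qed.

Lemma std_cone_closed d (M : 'M[R]_n) : closed [set u : V | std_cone d (u *m M)].
Proof.
pose F u : R := enorm (lo_part d (u *m M)) - enorm (hi_part d (u *m M)).
have -> : [set u | std_cone d (u *m M)] = F @^-1` [set t | 0 <= t].
  by apply/seteqP; split=> u /=; rewrite std_coneE subr_ge0.
apply: closed_comp; last exact: closed_ge.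
move=> u _; apply: (@lipschitz_continuous _ F (mxbnd M + mxbnd M)) => {}u v.
have hl (L : V -> V) : (forall a b, L (a + b) = L a + L b) ->
    (forall a b, L (a *: b) = a *: L b) -> (forall a, enorm (L a) <= enorm a) ->
    `|enorm (L (u *m M)) - enorm (L (v *m M))| <= mxbnd M * enorm (u - v).
  move=> LD LZ Lb; apply: le_trans (enorm_dist_le _ _) _.
  rewrite -scaleN1r -LZ -LD scaleN1r -mulmxBl; apply: le_trans (Lb _) _.
  exact: enorm_mulmx.
have h1 := hl _ (lo_partD d) (lo_partZ d) (enorm_lo d).
have h2 := hl _ (hi_partD d) (hi_partZ d) (enorm_hi d).
set a := enorm _ in h1; set b := enorm _ in h1.
set a' := enorm _ in h2; set b' := enorm _ in h2.
have -> : F u - F v = (a - b) - (a' - b') by rewrite /F -/a -/a' -/b -/b'; ring.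
by apply: le_trans (ler_normB _ _) _; rewrite mulrDl lerD.
Qed.

End StandardCone.

(** * Uniform estimates for cone fields and subbundles *)

Section LinearFacts.
Context {R : realType} {n : nat}.
Local Notation T := (torus R n).
Local Notation V := ('rV[R]_n).
Implicit Types (f : T -> T) (E : T -> 'M[R]_n) (C : T -> set V).

(** Chain rule for [phi] after [f], whose composite local expression is the identity near 0. *)
Lemma tderiv_inverse f : C1_map f -> local_diffeo f -> forall x,
  exists W phi, [/\ inverse_branch f W phi, W x &
    tderiv f x *m tderiv phi (f x) = 1%:M].
Proof.
move=> Cf df x; have [W [phi [Wx br]]] := df x.
exists W, phi; split=> //.
have [[oW oW' _ Cphi] [_ _ phiK]] := br.
have [dfx _] := Cf x I.
have [dphi _] : differentiable (local_expr phi (f x)) 0 /\ {for f x, continuous (tderiv phi)}.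
  by apply: Cphi; exists x.
apply/row_matrixP => i; rewrite !rowE mulmx1 mulmxA.
set v := delta_mx 0 i.
have E0 : local_expr f x 0 = 0 by exact: local_expr0.
have dphi' : differentiable (local_expr phi (f x)) (local_expr f x 0) by rewrite E0.
have dc := differentiable_comp dfx dphi'.
have : 'D_v (local_expr phi (f x) \o local_expr f x) 0 = v *m tderiv f x *m tderiv phi (f x).
  rewrite (deriveE _ dc) (diff_comp dfx dphi') /=.
  rewrite -(deriveE _ dphi') (deriveEjacobian _ dphi') -(deriveE _ dfx) (deriveEjacobian _ dfx).
  by rewrite E0.
move=> <-.
have /torus_nbhsP[r r0 hr] : nbhs x W by exact: open_nbhs_nbhs.
have rr : 0 < Num.min r 2^-1 by rewrite lt_min r0 /=; lra.
have [s s0 hs] := @enorm_cvg0 R n _ rr.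
have -> : 'D_v (local_expr phi (f x) \o local_expr f x) 0 = 'D_v (@id V) 0; last exact: derive_id.
apply: near_eq_derive; apply/nbhs_normP; exists s => // w /=; rewrite sub0r normrN => /hs.
rewrite lt_min => /andP[wr w2].
rewrite /= {1}/local_expr -local_exprE phiK; last first.
  by rewrite inE; apply/hr/(le_lt_trans (tdist_addr _ _)).
by rewrite phiK ?inE// addrAC subrr add0r tlog_small.
Qed.

Lemma std_cone_field_scale d C : continuous_cone_field d C ->
  forall x a v, C x v -> C x (a *: v).
Proof.
move=> hC x a v; have [A /nbhs_singleton[_ _ ->]] := hC x.
by move=> [u cu <-]; exists (a *: u); [exact: std_coneZ|rewrite scalemxAl].
Qed.

Lemma unitmx_lower (M : 'M[R]_n) (w : V) : M \in unitmx ->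
  enorm w <= mxbnd (invmx M) * enorm (w *m M).
Proof. by move=> uM; rewrite -{1}[w](mulmxK uM) enorm_mulmx. Qed.

(** In a local frame, shrinking the high part moves a cone vector inside its cone by a definite
    relative amount, which absorbs the change of frame between nearby points as well as a
    perturbation of the vector. *)
Lemma cone_field_deep d C : continuous_cone_field d C -> forall eta : R, 0 < eta ->
  exists2 s, 0 < s & forall x u, C x u -> exists2 u', enorm (u - u') <= eta * enorm u &
    forall y v, tdist x y < s -> enorm (v - u') <= s * enorm u -> C y v.
Proof.
have locals := I.
move=> hC eta eta0.
have [x0|s s0 h] := @torus_uniform R n (fun s x => forall u, C x u ->
  exists2 u', enorm (u - u') <= eta * enorm u &
  forall y v, tdist x y < s -> enorm (v - u') <= s * enorm u -> C y v); last first.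
  by exists (s / 2) => [|x]; [qlra|apply: h; qlra].
have [A /torus_nbhs_nearP[r0 r00 hA]] := hC x0.
have [cA uA _] := hA x0 ltac:(by rewrite tdistxx).
pose N := mxbnd (invmx (A x0)) + 1.
have N0 : 0 < N by rewrite ltr_wpDl ?mxbnd_ge0.
pose b := N^-1 / 2.
have b0 : 0 < b by rewrite divr_gt0 ?invr_gt0.
pose B := mxbnd (A x0) + 1.
have B0 : 0 < B by rewrite ltr_wpDl ?mxbnd_ge0.
have [e0 [e00 e01 e0E]] : exists e0 : R, [/\ 0 < e0, e0 <= 1 & B * e0 <= eta * b].
  exists (Num.min 1 (eta * b / B)); split.
  - by rewrite lt_min ltr01 divr_gt0// mulr_gt0.
  - by rewrite ge_min lexx.
  - by rewrite mulrC -ler_pdivlMr// ge_min lexx orbT.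
have [z [z0 z1 z2 z3]] : exists z : R, [/\ 0 < z, z <= 1, z <= b & 4 * z <= b * e0 / 8].
  have h1 : 0 < b * e0 / 8 / 4 by rewrite !divr_gt0// mulr_gt0.
  exists (Num.min 1 (Num.min b (b * e0 / 8 / 4))); split.
  - by rewrite !lt_min ltr01 b0.
  - by rewrite ge_min lexx.
  - by rewrite !ge_min lexx orbT.
  - have : Num.min 1 (Num.min b (b * e0 / 8 / 4)) <= b * e0 / 8 / 4 by rewrite !ge_min lexx !orbT.
    qlra.
have nn1 : (0 : R) < n%:R * n%:R + 1 by rewrite ltr_wpDl ?mulr_ge0.
have zn0 : 0 < z / (n%:R * n%:R + 1) by rewrite divr_gt0.
have [r1 r10 h1] := (torus_continuous_normP _ _).1 cA _ zn0.
have Az y : tdist x0 y < r1 -> mxbnd (A x0 - A y) <= z.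
  move=> /h1; rewrite ltr_pdivlMr// mulrC mulrDl mul1r => h2.
  by rewrite ltW//; apply: le_lt_trans h2; rewrite lerDl.
have Ab y w : tdist x0 y < r1 -> b * enorm w <= enorm (w *m A y).
  move=> /Az hy; have := unitmx_lower w uA.
  have := enorm_mulmx w (A x0 - A y).
  have := enorm_lower (w *m A x0) (w *m (A y - A x0)).
  rewrite -mulmxDr subrKC -(opprB (A x0)) mulmxN enormN.
  have : mxbnd (A x0 - A y) * enorm w <= z * enorm w by rewrite ler_wpM2r ?enorm_ge0.
  have : z * enorm w <= b * enorm w by rewrite ler_wpM2r ?enorm_ge0.
  have : mxbnd (invmx (A x0)) * enorm (w *m A x0) <= N * enorm (w *m A x0).
    by rewrite ler_wpM2r ?enorm_ge0// lerDl.
  move=> k1 k2 k3 k4 k5 k6.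
  have k7 : enorm w <= N * enorm (w *m A x0) by exact: le_trans k6 k1.
  have : N^-1 * enorm w <= enorm (w *m A x0) by rewrite mulrC ler_pdivrMr// mulrC.
  rewrite (_ : N^-1 = b + b); last by rewrite /b -splitr.
  rewrite mulrDl; qlra.
have AB y : tdist x0 y < r1 -> mxbnd (A y) <= B.
  move=> /Az hy; rewrite -[A y](subKr (A x0)); apply: le_trans (mxbndD _ _) _.
  by rewrite {2}/mxbnd normrN -/(mxbnd _) /B lerD2l (le_trans hy).
pose s1 := b * e0 / 8 / B.
have s10 : 0 < s1 by rewrite !divr_gt0// mulr_gt0.
exists (Num.min (Num.min r0 r1 / 2) s1) => [|s x /andP[s0]].
  by rewrite lt_min s10 andbT divr_gt0// lt_min r00.
rewrite !lt_min => /andP[sr ss1] /andP[xr _].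
have {}sr : s < r0 / 2 /\ s < r1 / 2.
  by move: sr; rewrite /Num.min; case: ifP; qlra.
have {}xr : tdist x0 x < r0 / 2 /\ tdist x0 x < r1 / 2.
  by move: xr; rewrite /Num.min; case: ifP; qlra.
move=> u; have [_ uAx ->] := hA x ltac:(qlra); move=> [u0 cu0 <-].
have x1 : tdist x0 x < r1 by qlra.
pose u0' := lo_part d u0 + (1 - e0) *: hi_part d u0.
have d1 : enorm (u0 - u0') <= e0 * enorm u0.
  have -> : u0 - u0' = e0 *: hi_part d u0.
    by rewrite {1}(lo_hi d u0) opprD addrACA subrr add0r scalerBl scale1r subKr.
  by rewrite enormZ gtr0_norm// ler_wpM2l ?enorm_hi// ltW.
have d2 : enorm u0' <= 2 * enorm u0.
  have := enormB u0 (u0 - u0'); rewrite subKr.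
  have : e0 * enorm u0 <= 1 * enorm u0 by rewrite ler_wpM2r ?enorm_ge0.
  qlra.
exists (u0' *m A x).
  rewrite -mulmxBl; apply: le_trans (enorm_mulmx _ _) _.
  apply: (@le_trans _ _ (B * (e0 * enorm u0))).
    by apply: ler_pM => //; rewrite ?mxbnd_ge0 ?enorm_ge0// AB.
  apply: (@le_trans _ _ (eta * (b * enorm u0))).
    by rewrite (mulrA B e0) (mulrA eta b) ler_wpM2r ?enorm_ge0.
  by rewrite ler_wpM2l ?Ab// ltW.
move=> y v xy hv.
have x0y := tdistD x x0 y.
have y1 : tdist x0 y < r1 by qlra.
have [_ uAy ->] := hA y ltac:(qlra).
exists (v *m invmx (A y)); last by rewrite mulmxKV.
apply: (@std_cone_deep _ _ _ e0 u0) => //; first by rewrite e00.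
rewrite -/u0' -(ler_pM2l b0).
apply: le_trans (Ab y _ y1) _; rewrite mulmxBl mulmxKV//.
have -> : v - u0' *m A y = (v - u0' *m A x) + u0' *m (A x - A y).
  by rewrite mulmxBr subrKA.
apply: le_trans (enormD _ _) _.
have k1 : enorm (u0' *m (A x - A y)) <= (z + z) * (2 * enorm u0).
  apply: le_trans (enorm_mulmx _ _) _.
  apply: ler_pM => //; rewrite ?mxbnd_ge0 ?enorm_ge0//.
  have -> : A x - A y = - (A x0 - A x) + (A x0 - A y) by rewrite opprB subrKA.
  apply: le_trans (mxbndD _ _) _; rewrite {1}/mxbnd normrN -/(mxbnd _).
  by apply: lerD; exact: Az.
have k2 : s * enorm (u0 *m A x) <= s1 * (B * enorm u0).
  have k20 : enorm (u0 *m A x) <= B * enorm u0.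
    by apply: le_trans (enorm_mulmx _ _) _; rewrite ler_wpM2r ?enorm_ge0// AB.
  by apply: ler_pM => //; [exact: ltW|exact: enorm_ge0|exact: ltW].
have k3 : s1 * (B * enorm u0) = b * e0 / 8 * enorm u0.
  by rewrite mulrA /s1 divfK// gt_eqF.
have k4 : (4 * z) * enorm u0 <= (b * e0 / 8) * enorm u0 by rewrite ler_wpM2r ?enorm_ge0.
have := enorm_ge0 u0; qlra.
Qed.

Lemma cone_field_continuous d C : continuous_cone_field d C -> forall eta : R, 0 < eta ->
  exists2 s, 0 < s & forall x y u, tdist x y < s -> C x u ->
    exists2 u', C y u' & enorm (u - u') <= eta * enorm u.
Proof.
move=> hC eta eta0; have [s s0 h] := cone_field_deep hC eta0.
exists s => // x y u xy /h[u' uu' hu']; exists u' => //.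
by apply: hu' => //; rewrite subrr enorm0 mulr_ge0 ?enorm_ge0 ?ltW.
Qed.

Lemma subbundle_continuous c E : continuous_subbundle c E -> forall eta : R, 0 < eta ->
  exists2 s, 0 < s & forall x y e, tdist x y < s -> (e <= E x)%MS ->
    exists2 e', (e' <= E y)%MS & enorm (e - e') <= eta * enorm e.
Proof.
have locals := I.
move=> hE eta eta0.
have [x0|s s0 h] := @torus_uniform R n (fun s x => forall y e, tdist x y < s ->
  (e <= E x)%MS -> exists2 e', (e' <= E y)%MS & enorm (e - e') <= eta * enorm e); last first.
  by exists (s / 2) => [|x]; [qlra|apply: h; qlra].
have [B /torus_nbhs_nearP[r0 r00 hB]] := hE x0.
have [cB fB _] := hB x0 ltac:(by rewrite tdistxx).
have /row_freeP[N BN] := fB.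
pose K := mxbnd N + 1.
have K0 : 0 < K by rewrite ltr_wpDl ?mxbnd_ge0.
have [z [z0 z1 z2]] : exists z : R, [/\ 0 < z, K * z <= 2^-1 & 4 * z * K <= eta].
  exists (Num.min (2^-1 / K) (eta / 4 / K)); split.
  - by rewrite lt_min !divr_gt0.
  - by rewrite mulrC -ler_pdivlMr// ge_min lexx.
  - by rewrite -mulrA mulrC -ler_pdivlMr// -ler_pdivlMr// ge_min lexx orbT.
have nn1 : (0 : R) < n%:R * c%:R + 1 by rewrite ltr_wpDl ?mulr_ge0.
have zn0 : 0 < z / (n%:R * c%:R + 1) by rewrite divr_gt0.
have [r1 r10 h1] := (torus_continuous_normP _ _).1 cB _ zn0.
have Bz y : tdist x0 y < r1 -> mxbnd (B x0 - B y) <= z.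
  move=> /h1; rewrite ltr_pdivlMr// mulrC mulrDl mul1r => h2.
  by rewrite ltW//; apply: le_lt_trans h2; rewrite lerDl.
exists (Num.min r0 r1 / 2) => [|s x /andP[s0]].
  by rewrite divr_gt0// lt_min r00.
move=> sr xr y e xy.
have {}sr : s < r0 / 2 /\ s < r1 / 2.
  by move: sr; rewrite /Num.min; case: ifP; qlra.
have {}xr : tdist x0 x < r0 / 2 /\ tdist x0 x < r1 / 2.
  by move: xr; rewrite /Num.min; case: ifP; qlra.
have x0y := tdistD x x0 y.
have [_ _ /eqmxP Ex] := hB x ltac:(qlra).
have [_ _ /eqmxP Ey] := hB y ltac:(qlra).
rewrite Ex => /submxP[w ->]; exists (w *m B y); first by rewrite Ey submxMl.
have wE : w = (w *m B x + w *m (B x0 - B x)) *m N.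
  by rewrite -mulmxDr subrKC -mulmxA BN mulmx1.
have w1 : enorm w <= 2 * K * enorm (w *m B x).
  have : enorm w <= K * (enorm (w *m B x) + z * enorm w).
    rewrite {1}wE; apply: le_trans (enorm_mulmx _ _) _.
    apply: ler_pM; rewrite ?mxbnd_ge0 ?enorm_ge0// ?lerDl//.
    apply: le_trans (enormD _ _) _; rewrite lerD2l.
    apply: le_trans (enorm_mulmx _ _) _; rewrite ler_wpM2r ?enorm_ge0//.
    by apply: Bz; qlra.
  rewrite mulrDr [K * (z * _)]mulrA.
  have : K * z * enorm w <= 2^-1 * enorm w by rewrite ler_wpM2r ?enorm_ge0.
  qlra.
rewrite -mulmxBr; apply: le_trans (enorm_mulmx _ _) _.
apply: (@le_trans _ _ ((z + z) * (2 * K * enorm (w *m B x)))).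
  apply: ler_pM; rewrite ?mxbnd_ge0 ?enorm_ge0//.
  have -> : B x - B y = - (B x0 - B x) + (B x0 - B y) by rewrite opprB subrKA.
  apply: le_trans (mxbndD _ _) _; rewrite {1}/mxbnd normrN -/(mxbnd _).
  by apply: lerD; apply: Bz; qlra.
rewrite (_ : _ * _ = 4 * z * K * enorm (w *m B x)); last ring.
by rewrite ler_wpM2r ?enorm_ge0.
Qed.

(** At one point, [cokermx] measures the distance to the subspace, and it is bounded below on the
    compact set of unit cone vectors. Continuity of both fields makes the bound uniform. *)
Lemma cone_transversal c d E C : continuous_subbundle c E -> continuous_cone_field d C ->
  (forall x v, C x v -> (v <= E x)%MS -> v = 0) ->
  exists2 k : R, 0 < k & forall x u e, C x u -> (e <= E x)%MS -> k * enorm u <= enorm (u + e).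
Proof.
have locals := I.
move=> hE hC tr.
have [x0|s s0 h] := @torus_uniform R n (fun s x => forall u e, C x u ->
  (e <= E x)%MS -> s * enorm u <= enorm (u + e)); last first.
  by exists (s / 2) => [|x]; [qlra|apply: h; qlra].
have [k0 k00 hk0] : exists2 k : R, 0 < k <= 1 & forall u e, C x0 u -> (e <= E x0)%MS ->
    k * enorm u <= enorm (u + e).
  have [A /nbhs_singleton[_ uA CA]] := hC x0.
  have CE u : C x0 u <-> std_cone d (u *m invmx (A x0)).
    rewrite CA; split=> [[w cw <-]|cu]; first by rewrite mulmxK.
    by exists (u *m invmx (A x0)); rewrite ?mulmxKV.
  pose K := [set u | std_cone d (u *m invmx (A x0))] `&` [set u : V | enorm u = 1].
  have cK : compact K.
    apply: (@subclosed_compact _ _ [set u : V | enorm u <= 1]).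
    - apply: closedI; first exact: std_cone_closed.
      rewrite (_ : [set _ | _] = enorm @^-1` [set t | t = 1])//.
      by apply: closed_comp; [move=> v _; exact: enorm_continuous|exact: closed_eq].
    - exact: compact_enorm_ball.
    - by move=> u [_ /= ->].
  have [K0|/set0P K0] := eqVneq K set0.
    exists 1; first by rewrite ltr01 lexx.
    move=> u e /CE cu _; have [->|u0] := eqVneq u 0.
      by rewrite enorm0 mulr0 enorm_ge0.
    suff : K ((enorm u)^-1 *: u) by rewrite K0.
    split; first by rewrite /= -scalemxAl; exact: std_coneZ.
    by rewrite /= enormZ gtr0_norm ?invr_gt0 ?enorm_gt0// mulVf// gt_eqF// enorm_gt0.
  pose F (u : V) := enorm (u *m cokermx (E x0)).
  have cF : continuous F.
    apply: (@lipschitz_continuous R n _ F (mxbnd (cokermx (E x0)))) => u v.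
    by apply: le_trans (enorm_dist_le _ _) _; rewrite -mulmxBl enorm_mulmx.
  have [m mK hm] := compact_EVT_min K0 cK (continuous_subspaceT cF).
  move: mK; rewrite inE => -[mc m1].
  have Fm : 0 < F m.
    apply: enorm_gt0; apply/eqP => Fm0.
    have : m = 0 by apply: (tr x0); [exact/CE|rewrite submxE Fm0].
    by move=> m0; move: m1; rewrite /= m0 enorm0 => /eqP; rewrite eq_sym oner_eq0.
  pose q := mxbnd (cokermx (E x0)) + 1.
  have q0 : 0 < q by rewrite ltr_wpDl ?mxbnd_ge0.
  exists (Num.min 1 (F m / q)); first by rewrite ge_min lexx lt_min ltr01 divr_gt0.
  move=> u e cu eE; have [->|u0] := eqVneq u 0.
    by rewrite enorm0 mulr0 enorm_ge0.
  have up := enorm_gt0 u0.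
  apply: (@le_trans _ _ (F m / q * enorm u)).
    by rewrite ler_wpM2r ?enorm_ge0// ge_min lexx orbT.
  rewrite mulrAC ler_pdivrMr// mulrC.
  have h1 : F m <= F ((enorm u)^-1 *: u).
    apply: hm; rewrite inE; split.
      by rewrite /= -scalemxAl; apply/std_coneZ/CE.
    by rewrite /= enormZ gtr0_norm ?invr_gt0// mulVf// gt_eqF.
  move: h1; rewrite /F -[in X in _ <= X -> _]scalemxAl [in X in _ <= X -> _]enormZ gtr0_norm ?invr_gt0//.
  move=> {}h1; have {}h1 : F m * enorm u <= enorm (u *m cokermx (E x0)).
    by rewrite -ler_pdivlMr// mulrC.
  rewrite mulrC; apply: le_trans h1 _.
  have -> : u *m cokermx (E x0) = (u + e) *m cokermx (E x0).
    by move: eE; rewrite submxE mulmxDl => /eqP ->; rewrite addr0.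
  apply: le_trans (enorm_mulmx _ _) _; rewrite mulrC ler_wpM2l ?enorm_ge0//.
  by rewrite lerDl.
have /andP[k0p k01] := k00.
pose eta := k0 / 8.
have eta0 : 0 < eta by rewrite divr_gt0.
have [s1 s10 h1] := cone_field_continuous hC eta0.
have [s2 s20 h2] := subbundle_continuous hE eta0.
exists (Num.min (k0 / 8) (Num.min s1 s2)); first by rewrite !lt_min eta0 s10.
move=> s x /andP[s0]; rewrite !lt_min => /and3P[sk _ _] /and3P[_ xs1 xs2] u e cu eE.
rewrite tdistC in xs1 xs2.
have [u' cu' uu'] := h1 x x0 u xs1 cu.
have [e' eE' ee'] := h2 x x0 e xs2 eE.
have := hk0 _ _ cu' eE'.
have := enormD (u + e) (- (u - u') - (e - e')).
have -> : u + e + (- (u - u') - (e - e')) = u' + e'.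
  by rewrite addrACA !subKr.
have := enormB (- (u - u')) (e - e'); rewrite enormN.
have := enormB (u + e) u; rewrite addrAC subrr add0r.
have := enorm_lower u (- (u - u')); rewrite subKr enormN.
have k0u : k0 * (enorm u - eta * enorm u) <= k0 * enorm u' -> k0 * enorm u - k0 * (eta * enorm u) <= k0 * enorm u'.
  by rewrite mulrBr.
have : k0 * (eta * enorm u) <= 1 * (eta * enorm u).
  by rewrite ler_wpM2r// mulr_ge0 ?enorm_ge0// ltW.
have : s * enorm u <= k0 / 8 * enorm u by rewrite ler_wpM2r ?enorm_ge0// ltW.
move=> q1 q2 q3 q4 q5 q6 q7.
have q8 : k0 * (enorm u - eta * enorm u) <= k0 * enorm u'.
  by rewrite ler_pM2l//; qlra.
have := k0u q8; have := enorm_ge0 u; have := enorm_ge0 (u + e).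
have : eta * enorm e <= eta * (enorm (u + e) + enorm u) by rewrite ler_wpM2l// ltW.
have : eta * enorm (u + e) <= 1 * enorm (u + e) by rewrite ler_wpM2r ?enorm_ge0// /eta; qlra.
rewrite /eta in q2 uu' ee' q8 *; qlra.
Qed.

Lemma subbundle_rank c E x : continuous_subbundle c E -> \rank (E x) = c.
Proof.
by move=> /(_ x)[B /nbhs_singleton[_ /eqP fB /eqmxP ->]].
Qed.

Lemma cone_complement c d E C x (W : 'M[R]_n) : continuous_subbundle c E ->
  (c + d = n)%N -> (forall v, C x v -> (v <= E x)%MS -> v = 0) -> \rank W = d ->
  (forall v : V, (v <= W)%MS -> C x v) ->
  forall v : V, exists w e : V, [/\ (w <= W)%MS, (e <= E x)%MS & v = w + e].
Proof.
move=> hE cdn tr rW CW v.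
have cap0 : (W :&: E x)%MS = 0.
  apply/eqP; rewrite -submx0; apply/rV_subP => w; rewrite sub_capmx => /andP[wW wE].
  by rewrite (tr w (CW _ wW) wE) sub0mx.
have : (v <= W + E x)%MS.
  apply: submx_full; rewrite /row_full; apply/eqP.
  by have := mxrank_sum_cap W (E x); rewrite cap0 mxrank0 addn0 rW (subbundle_rank x hE) addnC cdn.
by move=> /sub_addsmxP[[a b] /= ->]; exists (a *m W), (b *m E x); rewrite !submxMl.
Qed.

Lemma cone_contains_subspace d C x : continuous_cone_field d C -> (d <= n)%N ->
  exists2 W : 'M[R]_n, \rank W = d & forall v : V, (v <= W)%MS -> C x v.
Proof.
move=> hC dn; have [A /nbhs_singleton[_ uA ->]] := hC x.
exists (pid_mx d *m A x); first by rewrite mxrankMfree ?row_free_unit// rank_pid_mx.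
move=> v /submxP[w ->]; exists (w *m pid_mx d); last by rewrite mulmxA.
apply/std_coneE; rewrite (_ : hi_part _ _ = 0) ?enorm0 ?enorm_ge0//.
apply/rowP => i; rewrite !mxE; case: ltnP => // di.
rewrite big1// => j _; rewrite mxE.
by case: eqP => [->|_]; rewrite ?(ltnNge i d) ?di /= mulr0.
Qed.

End LinearFacts.

(** * Norms restricted to a subspace *)

Section OperatorNorms.
Context {R : realType} {n : nat}.
Implicit Types (E A : 'M[R]_n) (e : 'rV[R]_n).

Lemma opnorm_on_ub E A e : (e <= E)%MS -> enorm (e *m A) <= opnorm_on E A * enorm e.
Proof.
move=> eE; have [->|e0] := eqVneq e 0.
  by rewrite mul0mx !enorm0 mulr0.
have ep := enorm_gt0 e0.
rewrite -ler_pdivrMr// mulrC -[X in X * _]gtr0_norm ?invr_gt0// -enormZ scalemxAl.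
apply: ub_le_sup.
  exists (mxbnd A) => _ [v [_ v1] <-].
  by apply: le_trans (enorm_mulmx _ _) _; rewrite v1 mulr1.
exists ((enorm e)^-1 *: e) => //; split; first exact: scalemx_sub.
by rewrite enormZ gtr0_norm ?invr_gt0// mulVf// gt_eqF.
Qed.

Lemma conorm_on_lb E A (l : R) : A \in unitmx -> 0 < l -> l < conorm_on E A ->
  forall e, (e <= E)%MS -> l * enorm e <= enorm (e *m A).
Proof.
move=> uA l0 lc e eE.
(* [conorm_on] is an inverse, equal to 0 when the norm is 0; a positive lower bound therefore makes
   the norm positive. *)
have s0 : 0 < opnorm_on (E *m A) (invmx A).
  by rewrite -invr_gt0; exact: lt_trans lc.
have : enorm e <= opnorm_on (E *m A) (invmx A) * enorm (e *m A).
  by rewrite -{1}[e](mulmxK uA); apply: opnorm_on_ub; exact: submxMr.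
move: lc; rewrite /conorm_on -[X in X < _ -> _]invrK ltf_pV2 ?posrE ?invr_gt0// => h1 h2.
rewrite mulrC -ler_pdivlMr//; apply: le_trans h2 _.
by rewrite mulrC ler_wpM2l ?enorm_ge0// ltW.
Qed.

End OperatorNorms.

(** * Stability of truncated preorbits *)

Section Preorbits.
Context {R : realType} {n : nat} (f : torus R n -> torus R n)
  (A : torus R n -> 'M[R]_n).
Local Notation T := (torus R n).
Local Notation V := ('rV[R]_n).
Hypotheses (cf : continuous f) (cA : continuous A) (uA : forall x, A x \in unitmx).

Lemma unit_cocycle_lower : exists2 b : R, 0 < b <= 1 & forall x (v : V), b * enorm v <= enorm (v *m A x).
Proof using cA uA.
have [x0|s s0 h] := @torus_uniform R n (fun s x => forall v : V, s * enorm v <= enorm (v *m A x)); last first.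
  exists (Num.min 1 (s / 2)) => [|x v]; first by rewrite ge_min lexx lt_min ltr01; lra.
  apply: (@le_trans _ _ (s / 2 * enorm v)); last by apply: h; lra.
  by rewrite ler_wpM2r ?enorm_ge0// ge_min lexx orbT.
have [N N0 hN] : exists2 N : R, 0 < N & mxbnd (invmx (A x0)) <= N.
  by exists (mxbnd (invmx (A x0)) + 1); [rewrite ltr_wpDl ?mxbnd_ge0|rewrite lerDl].
have b0 : 0 < N^-1 / 2 by rewrite divr_gt0 ?invr_gt0.
have [r r0 hr] := uniform_continuous_mx cA b0.
exists (Num.min r (N^-1 / 2)) => [|s x]; first by rewrite lt_min r0.
rewrite !lt_min => /and3P[s0 _ sb] /andP[/hr/ltW h _] v.
have h1 := unitmx_lower v (uA x0).
have h2 : enorm v <= N * enorm (v *m A x0).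
  by apply: le_trans h1 _; rewrite ler_wpM2r ?enorm_ge0.
have h3 : N^-1 * enorm v <= enorm (v *m A x0) by rewrite mulrC ler_pdivrMr// mulrC.
have h4 := enorm_mulmx v (A x0 - A x).
have h5 := enorm_lower (v *m A x0) (- (v *m (A x0 - A x))).
rewrite enormN -mulmxN -mulmxDr opprB subrKC in h5.
have h6 : mxbnd (A x0 - A x) * enorm v <= N^-1 / 2 * enorm v by rewrite ler_wpM2r ?enorm_ge0.
have h7 : s * enorm v <= N^-1 / 2 * enorm v by rewrite ler_wpM2r ?enorm_ge0// ltW.
have h8 : N^-1 * enorm v = N^-1 / 2 * enorm v + N^-1 / 2 * enorm v.
  by rewrite -mulrDl -splitr.
lra.
Qed.

Hypothesis f_capprox : forall eta, 0 < eta ->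
  exists2 r, 0 < r & evC1 f (capprox f A eta r).
Hypothesis f_dense : forall x, dense (preorbit f x).

(** The derivatives of [f] are uniformly invertible, so [covering] applies to [iter k g] with half
    their lower bound: a ball of radius [r] covers a ball whose radius [q] depends neither on [g]
    nor on the center. *)
Lemma preimage_stable (r : R) (k : nat) : 0 < r ->
  exists q, 0 < q /\ evC1 f (fun g => forall w x : T,
    tdist (iter k f w) x < q -> exists2 w', tdist w w' < r & iter k g w' = x).
Proof using cf cA uA f_capprox.
move=> r0; have [b /andP[b0 b1] hb] := unit_cocycle_lower.
have hbk x (v : V) : b ^+ k * enorm v <= enorm (v *m cocyc f A k x).
  elim: k => [|k IH]; first by rewrite expr0 mul1r mulmx1.
  rewrite exprS -mulrA /= mulmxA; apply: le_trans (hb _ _).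
  by rewrite ler_wpM2l// ltW.
have [B [B0 {}hbk]] : exists B : R, 0 < B /\ forall x (v : V), B * enorm v <= enorm (v *m cocyc f A k x).
  by exists (b ^+ k); rewrite exprn_gt0.
have [q [q0 qE]] : exists q, 0 < q /\ q + q <= B / 2 * r.
  exists (B / 2 * r / 2); rewrite -splitr lexx !divr_gt0// mulr_gt0//; lra.
have e0 : 0 < Num.min (B / 2) q by rewrite lt_min q0 andbT; lra.
have [s s0 ev] := iter_capprox k cf cA f_capprox e0; exists q; split=> //.
apply: evC1_imp ev => g [d l] w x wx.
have cg : continuous (iter k g).
  by apply: near_lin_continuous l => //; exact: cocyc_continuous.
have h1 : Num.min (B / 2) q <= B / 2 by rewrite ge_min lexx.
apply: (@covering R n (iter k g) (cocyc f A k) (Num.min (B / 2) q) B s r w x) => //.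
  by rewrite ltW//=; lra.
have h2 := tdistD (iter k f w) (iter k g w) x.
have := d w; rewrite lt_min tdistC => /andP[_ h3].
have : B / 2 * r <= (B - Num.min (B / 2) q) * r by rewrite ler_wpM2r//; lra.
lra.
Qed.

(** Compactness is used twice. For a fixed [y] the times needed by all [x] are bounded, so finitely
    many stability conditions on [g] suffice; then the neighbourhood of [f] is made independent of
    [y]. *)
Lemma preorbits_nearly_dense (r : R) : 0 < r ->
  evC1 f (fun g => forall x y, exists k w, tdist y w < r /\ iter k g w = x).
Proof using cf cA uA f_capprox f_dense.
move=> r0; have r4 : 0 < r / 4 by lra.
have [q hq] := choice (fun k => preimage_stable k r4).
have hy y : evC1 f (fun g => forall x, exists k w, tdist y w < 3 / 4 * r /\ iter k g w = x).
  (* The clause [k%:R <= s^-1] turns the uniform constant into a bound on the times. *)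
  have [x0|s s0 h] := @torus_uniform R n (fun s x => exists k w,
      [/\ k%:R <= s^-1, tdist y w < r / 2 & tdist (iter k f w) x < q k]).
    have O0 : [set z | tdist y z < r / 2] !=set0 by exists y; rewrite /= tdistxx; lra.
    have oO : open [set z | tdist y z < r / 2] by exact: tdist_open.
    have [w [/= yw [k kw]]] := f_dense x0 O0 oO.
    have [qk0 _] := hq k.
    exists (Num.min (q k) (k.+1%:R)^-1) => [|s x].
      by rewrite lt_min qk0 invr_gt0 ltr0Sn.
    rewrite !lt_min => /and3P[s0 _ sk] /andP[xq _].
    exists k, w; split=> //; last by rewrite kw.
    apply: (@le_trans _ _ k.+1%:R); first by rewrite ler_nat.
    by rewrite -[X in X <= _]invrK lef_pV2 ?posrE ?invr_gt0// ltW.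
  have [N hN] : exists N : nat, (s / 2)^-1 <= N%:R.
    by exists (Num.bound (s / 2)^-1); rewrite ltW// archi_boundP// invr_ge0; lra.
  have ev := @evC1_forall R n f _ N (fun k => (hq k).2).
  apply: evC1_imp ev => g hg x.
  have [k [w [ks yw wx]]] := h (s / 2) x ltac:(lra).
  have kN : (k <= N)%N by rewrite -(ler_nat R); exact: le_trans ks hN.
  have [w' ww' E] := hg k kN w x wx.
  exists k, w'; split=> //; have := tdistD w y w'; lra.
have [y0|s s0 h] := @torus_uniform R n (fun s y => forall g, C1_map g ->
    C1_close s f g -> forall x, exists k w, tdist y w < r /\ iter k g w = x).
  have [e e0 he] := hy y0; exists (Num.min e (r / 4)) => [|s y].
    by rewrite lt_min e0.
  rewrite !lt_min => /and3P[s0 se _] /andP[_ y0y] g Cg cg x.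
  have cg' : C1_close e f g by move=> z; have [h1 h2] := cg z; split; [exact: lt_trans se|exact: lt_trans se].
  have [k [w [y0w E]]] := he g Cg cg' x; exists k, w; split=> //.
  by have := tdistD y0 y w; rewrite (tdistC y y0); lra.
exists (s / 2); first lra.
by move=> g Cg cg x y; apply: (h (s / 2)) => //; lra.
Qed.

End Preorbits.

(** * Consequences of partial hyperbolicity *)

Section PartialHyperbolicity.
Context {R : realType} {n : nat} (f : torus R n -> torus R n)
  (c : nat) (Ec : torus R n -> 'M[R]_n) (Cu : torus R n -> set 'rV[R]_n)
  (f_C1 : C1_map f) (f_diffeo : local_diffeo f)
  (f_ph : partially_hyperbolic f c Ec Cu)
  (f_dense : forall x, dense (preorbit f x)).
Local Notation T := (torus R n).
Local Notation V := ('rV[R]_n).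

Lemma tderiv_unit x : tderiv f x \in unitmx.
Proof.
have [W [phi [_ _ E]]] := tderiv_inverse f_C1 f_diffeo x.
by case: (mulmx1_unit E) => h _; exact: h.
Qed.

(** The inequalities for the inverse branch at [f x], applied to the unit vector along
    [u *m tderiv f x]. This is why the cone condition bears on the image vector. *)
Lemma ph_rates : exists2 lam : R, 0 < lam < 1 &
  forall x (u : V), Cu (f x) (u *m tderiv f x) ->
    enorm u <= lam * enorm (u *m tderiv f x) /\
    forall e : V, (e <= Ec x)%MS ->
      enorm (e *m tderiv f x) * enorm u <= lam * (enorm e * enorm (u *m tderiv f x)).
Proof.
have [_ _ [[hC _] _] [lam [lam01 hl]]] := f_ph.
exists lam => // x u Cv; set v := u *m tderiv f x in Cv *.
have [u0|u0] := eqVneq u 0.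
  rewrite /v u0 mul0mx !enorm0 !mulr0; split=> // e _.
  by rewrite !mulr0.
have v0 : v != 0.
  by apply: contraNneq u0 => v0; rewrite -[u](mulmxK (tderiv_unit x)) -/v v0 mul0mx.
have vp := enorm_gt0 v0.
have [W [phi [br Wx E1]]] := tderiv_inverse f_C1 f_diffeo x.
have [_ [_ _ phiK]] := br.
pose v1 := (enorm v)^-1 *: v.
have v11 : enorm v1 = 1.
  by rewrite enormZ gtr0_norm ?invr_gt0// mulVf// gt_eqF.
have [] := hl W phi br (f x) _ v1 _ v11.
- by exists x.
- exact: std_cone_field_scale hC _ _ _ Cv.
have -> : v1 *m tderiv phi (f x) = (enorm v)^-1 *: u.
  by rewrite -scalemxAl -mulmxA E1 mulmx1.
rewrite phiK ?inE// enormZ gtr0_norm ?invr_gt0//.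
rewrite mulrC => h1 h2; split; first by rewrite -ler_pdivrMr// ltW.
move=> e eE; have h3 := opnorm_on_ub (tderiv f x) eE.
have h4 : opnorm_on (Ec x) (tderiv f x) * enorm u <= lam * enorm v.
  by rewrite -ler_pdivrMr// -mulrA ltW.
apply: (@le_trans _ _ (opnorm_on (Ec x) (tderiv f x) * enorm e * enorm u)).
  by rewrite ler_wpM2r ?enorm_ge0.
by rewrite mulrAC [lam * (_ * _)]mulrCA [enorm e * _]mulrC ler_wpM2r ?enorm_ge0.
Qed.

(** The open ball of radius 1/4 around a point at distance exactly 1/4 from [x] misses [x], so a
    point of the preorbit in it has positive time. *)
Lemma dense_surjective x : exists y, f y = x.
Proof.
have [cn _ _ _] := f_ph.
have n0 : (0 < n)%N by lia.
pose v : V := 4^-1 *: delta_mx 0 (Ordinal n0).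
have v4 : enorm v = 4^-1.
  rewrite enormZ gtr0_norm; last lra.
  rewrite /enorm (bigD1 (Ordinal n0))//= big1 ?addr0 => [|i i0].
    by rewrite mxE !eqxx expr1n sqrtr1 mulr1.
  by rewrite mxE (negPf i0) andbF expr0n.
pose z := x + tproj v.
have zx : tdist z x = 4^-1.
  by rewrite tdistE /z addrAC subrr add0r tnorm_projE v4//; lra.
have O0 : [set y | tdist z y < 4^-1] !=set0 by exists z; rewrite /= tdistxx; lra.
have oO : open [set y | tdist z y < 4^-1] by exact: tdist_open.
have [y [/= yz [[|k] ky]]] := f_dense x O0 oO.
- by move: yz; rewrite -[y]/(iter 0 f y) ky zx ltxx.
- by exists (iter k f y).
Qed.

(** By surjectivity and invariance [v] is the image of a center vector [u]. Domination with [e = u]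
    then reads [enorm v * enorm u <= lam * (enorm u * enorm v)], with [lam < 1]. *)
Lemma cone_center_trivial x (v : V) : Cu x v -> (v <= Ec x)%MS -> v = 0.
Proof.
have [y yx] := dense_surjective x; rewrite -yx => Cv vE.
have [lam /andP[lam0 lam1] hl] := ph_rates.
have [_ [_ invE] _ _] := f_ph.
have := invE y => /eqmxP E1; move: vE; rewrite -E1 => /submxP[w vE].
pose u := w *m Ec y.
have vu : v = u *m tderiv f y by rewrite vE mulmxA.
rewrite vu in Cv *; have [h1 /(_ u)] := hl y u Cv.
rewrite submxMl => /(_ isT) h2; apply: enorm_eq0; apply/eqP.
rewrite eq_le enorm_ge0 andbT leNgt; apply/negP => p0.
have up : 0 < enorm u.
  rewrite lt_def enorm_ge0 andbT; apply/eqP => u0.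
  by move: p0; rewrite (enorm_eq0 u0) mul0mx enorm0 ltxx.
by move: h2; rewrite [enorm u * _]mulrC mulrA ler_pM2r// leNgt gtr_pMl// lam1.
Qed.

End PartialHyperbolicity.

Section Powers.
Context {R : realType}.

Lemma bernoulli_ineq (a : R) k : 1 <= a -> 1 + k%:R * (a - 1) <= a ^+ k.
Proof.
move=> a1; elim: k => [|k IH]; first by rewrite mul0r addr0 expr0.
rewrite exprS; apply: (@le_trans _ _ (a * (1 + k%:R * (a - 1)))); last first.
  by rewrite ler_wpM2l//; lra.
have : 0 <= k%:R * (a - 1) * (a - 1) by rewrite !mulr_ge0//; lra.
rewrite -natr1; nra.
Qed.

Lemma expr_unbounded (a B : R) : 1 < a -> exists N0, forall N, (N0 <= N)%N -> B <= a ^+ N.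
Proof.
move=> a1; have a0 : 0 < a - 1 by lra.
exists (Num.bound (`|B| / (a - 1))) => N hN.
have h1 : `|B| / (a - 1) <= N%:R.
  apply/ltW/(lt_le_trans (archi_boundP _)); first by rewrite divr_ge0// ltW.
  by rewrite ler_nat.
rewrite ler_pdivrMr// in h1.
have := bernoulli_ineq N (ltW a1); have := ler_norm B; lra.
Qed.

End Powers.

(** * Expansion in all directions along a block *)

Section BlockExpansion.
Context {R : realType} {n : nat} (f : torus R n -> torus R n)
  (A E : torus R n -> 'M[R]_n) (C : torus R n -> set 'rV[R]_n)
  (lam kap b l0 : R) (k0 : nat).
Local Notation T := (torus R n).
Local Notation V := ('rV[R]_n).
Hypotheses (cf : continuous f) (cA : continuous A) (lam01 : 0 < lam < 1)
  (CA : forall x u, C x u -> C (f x) (u *m A x))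
  (C_exp : forall x u, C x u -> enorm u <= lam * enorm (u *m A x))
  (EA : forall x (e : V), (e <= E x)%MS -> (e *m A x <= E (f x))%MS)
  (kap0 : 0 < kap)
  (tr : forall x u (e : V), C x u -> (e <= E x)%MS -> kap * enorm u <= enorm (u + e))
  (dec : forall x (v : V), exists u e : V, [/\ C x u, (e <= E x)%MS & v = u + e])
  (contE : forall eta : R, 0 < eta -> exists2 s, 0 < s & forall x y e, tdist x y < s ->
     (e <= E x)%MS -> exists2 e', (e' <= E y)%MS & enorm (e - e') <= eta * enorm e)
  (b01 : 0 < b <= 1) (A_lower : forall x (v : V), b * enorm v <= enorm (v *m A x))
  (l01 : 1 < l0).

(** The points provided by [f_exp], through one-step expansion of the center from time [k0] on. *)
Definition good_point (y : T) := forall k, (k0 <= k)%N ->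
  forall e, (e <= E (iter k f y))%MS -> l0 * enorm e <= enorm (e *m A (iter k f y)).

Lemma near_good_expansion : exists2 r2 : R, 0 < r2 & forall z y, tdist z y < r2 ->
  (forall e, (e <= E y)%MS -> l0 * enorm e <= enorm (e *m A y)) ->
  forall e, (e <= E z)%MS -> (1 + l0) / 2 * enorm e <= enorm (e *m A z).
Proof using cA contE l01.
have locals := I.
have l01' := l01; have [B B0 hB] := bounded_mx_torus cA.
have [eta [eta0 eta1 etaE]] : exists eta : R, [/\ 0 < eta, eta <= 1 &
    eta * (l0 + B + 2) <= (l0 - 1) / 2].
  have h : 0 < l0 + B + 2 by qlra.
  exists (Num.min 1 ((l0 - 1) / 2 / (l0 + B + 2))); split.
  - by rewrite lt_min ltr01 !divr_gt0//; qlra.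
  - by rewrite ge_min lexx.
  - by rewrite -ler_pdivlMr// ge_min lexx orbT.
have [s1 s10 h1] := contE eta0.
have [s2 s20 h2] := uniform_continuous_mx cA eta0.
exists (Num.min s1 s2) => [|z y]; first by rewrite lt_min s10.
rewrite lt_min => /andP[zy1 zy2] hy e eE.
have [e' e'E ee'] := h1 z y e zy1 eE.
have g1 := hy e' e'E.
have g2 := h2 z y zy2.
have g3 : enorm (e' *m (A z - A y)) <= eta * enorm e'.
  by apply: le_trans (enorm_mulmx _ _) _; rewrite ler_wpM2r ?enorm_ge0// ltW.
have g4 : enorm ((e - e') *m A z) <= B * enorm (e - e').
  by apply: le_trans (enorm_mulmx _ _) _; rewrite ler_wpM2r ?enorm_ge0.
have g5 := enorm_lower (e' *m A y) (e' *m (A z - A y) + (e - e') *m A z).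
have g5E : e' *m A y + (e' *m (A z - A y) + (e - e') *m A z) = e *m A z.
  by rewrite addrA -mulmxDr subrKC -mulmxDl subrKC.
rewrite g5E in g5.
have g6 := enormD (e' *m (A z - A y)) ((e - e') *m A z).
have g7 := enorm_lower e (- (e - e')); rewrite subKr enormN in g7.
have g8 := enorm_lower e' (e - e'); rewrite subrKC in g8.
have g9 := enorm_ge0 e.
have g10 : B * enorm (e - e') <= B * (eta * enorm e) by rewrite ler_pM2l.
have g11 : l0 * (enorm e - eta * enorm e) <= l0 * enorm e' by rewrite ler_pM2l; qlra.
have g12 : eta * enorm e' <= eta * (2 * enorm e).
  rewrite ler_pM2l//.
  have : eta * enorm e <= 1 * enorm e by rewrite ler_wpM2r.
  qlra.
have g13 : eta * (l0 + B + 2) * enorm e <= (l0 - 1) / 2 * enorm e by rewrite ler_wpM2r.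
qlra.
Qed.

Lemma cocyc_cone k x u : C x u -> C (iter k f x) (u *m cocyc f A k x) /\
  enorm u <= lam ^+ k * enorm (u *m cocyc f A k x).
Proof using CA C_exp lam01.
move=> Cu; elim: k => [|k [IH1 IH2]]; first by rewrite /= mulmx1 expr0 mul1r.
rewrite /= mulmxA; split; first exact: CA.
apply: le_trans IH2 _; rewrite exprSr -mulrA ler_wpM2l ?exprn_ge0//; first by case/andP: lam01 => /ltW.
exact: C_exp.
Qed.

Lemma cocyc_center k x (e : V) : (e <= E x)%MS -> (e *m cocyc f A k x <= E (iter k f x))%MS.
Proof using EA.
move=> eE; elim: k => [|k IH]; first by rewrite /= mulmx1.
by rewrite /= mulmxA; exact: EA.
Qed.

Lemma cocyc_lower k x (v : V) : b ^+ k * enorm v <= enorm (v *m cocyc f A k x).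
Proof using A_lower b01.
have /andP[b0 b1] := b01; elim: k => [|k IH]; first by rewrite expr0 mul1r mulmx1.
rewrite exprS -mulrA /= mulmxA; apply: le_trans (A_lower _ _).
by rewrite ler_wpM2l// ltW.
Qed.

(** The first [k0] and the last [M] steps cost at most the factor [b ^+ (k0 + M)]; the steps between
    expand the center, and [N] is taken large after [M]. Cone vectors expand all along, and
    transversality recombines the two components. The radius [r2] is chosen before [M]. *)
Lemma block_expansion : exists2 r2 : R, 0 < r2 & forall M K0, exists N,
  [/\ (K0 <= N)%N, (M <= N)%N & forall z y, good_point y ->
    (forall k, (k <= N - M)%N -> tdist (iter k f z) (iter k f y) < r2) ->
    forall v, 4 * enorm v <= enorm (v *m cocyc f A N z)].
Proof using A_lower CA C_exp EA b01 cA contE dec kap0 l01 lam01 tr.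
have locals := I.
have l01' := l01; have [r2 r20 h2] := near_good_expansion; exists r2 => // M K0.
have /andP[b0 b1] := b01; have /andP[lam0 lam1] := lam01.
have [l1 [l11 l1E]] : exists l1 : R, 1 < l1 /\ l1 = (1 + l0) / 2.
  by exists ((1 + l0) / 2); split=> //; qlra.
have [k3 [k30 k31]] : exists k3 : R, 0 < k3 /\ forall x u (e : V), C x u -> (e <= E x)%MS ->
    k3 * enorm e <= enorm (u + e).
  exists (1 + kap^-1)^-1; split; first by rewrite invr_gt0 ltr_wpDr// invr_ge0 ltW.
  have kk : 0 < 1 + kap^-1 by rewrite ltr_wpDr// invr_ge0 ltW.
  move=> x u e Cu eE; rewrite mulrC ler_pdivrMr//.
  have h1 := tr Cu eE; have h3 := enormB (u + e) u; rewrite addrAC subrr add0r in h3.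
  have h4 : enorm u <= enorm (u + e) / kap by rewrite ler_pdivlMr// mulrC.
  rewrite mulrDr mulr1; qlra.
have c0 : 0 < b ^+ (k0 + M) by rewrite exprn_gt0.
(* A factor 8 on each component, up to the transversality constants [k3] and [kap], leaves a factor
   4 on the sum. *)
have [N1 hN1] := expr_unbounded (8 / (k3 * b ^+ (k0 + M))) l11.
have lami : 1 < lam^-1 by rewrite invf_gt1.
have [N2 hN2] := expr_unbounded (8 / kap) lami.
have [N [NK NM NN2 NN1]] : exists N,
    [/\ (K0 <= N)%N, (M <= N)%N, (N2 <= N)%N & (N1 + k0 + M <= N)%N].
  by exists (K0 + N2 + (N1 + k0 + M))%N; split; clear; lia.
exists N; split=> // z y gy hy v.
have cen (e : V) : (e <= E z)%MS -> 8 * enorm e <= k3 * enorm (e *m cocyc f A N z).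
  move=> eE.
  have st1 j : (j + k0 <= N - M)%N -> b ^+ k0 * l1 ^+ j * enorm e <= enorm (e *m cocyc f A (j + k0) z).
    elim: j => [|j IH] jN; first by rewrite expr0 mulr1 cocyc_lower.
    have jN' : (j + k0 <= N - M)%N by move: jN; clear; lia.
    rewrite addSn /= mulmxA; apply: le_trans (_ : l1 * enorm (e *m cocyc f A (j + k0) z) <= _).
      rewrite exprS (mulrCA (b ^+ k0)) -mulrA ler_wpM2l//; first by qlra.
      exact: IH.
    rewrite l1E; apply: (h2 _ (iter (j + k0) f y)); first exact: hy.
      by move=> e' e'E; apply: gy => //; clear; lia.
    exact: cocyc_center.
  have st2 := st1 (N - M - k0)%N.
  have E1 : (N - M - k0 + k0 = N - M)%N by move: NN1; clear; lia.
  rewrite E1 in st2; have {}st2 := st2 (leqnn _).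
  have E2 : (N = N - M + M)%N by move: NM; clear; lia.
  have st3 : b ^+ M * (b ^+ k0 * l1 ^+ (N - M - k0) * enorm e) <= enorm (e *m cocyc f A N z).
    rewrite [X in cocyc f A X z]E2 cocycD mulmxA; apply: le_trans (cocyc_lower _ _ _).
    by rewrite ler_wpM2l// exprn_ge0// ltW.
  have st4 : 8 / (k3 * b ^+ (k0 + M)) <= l1 ^+ (N - M - k0) by apply: hN1; move: NN1; clear; lia.
  rewrite ler_pdivrMr ?mulr_gt0// in st4.
  apply: (@le_trans _ _ (l1 ^+ (N - M - k0) * (k3 * b ^+ (k0 + M)) * enorm e)).
    by rewrite ler_wpM2r ?enorm_ge0.
  have -> : l1 ^+ (N - M - k0) * (k3 * b ^+ (k0 + M)) * enorm e =
      k3 * (b ^+ M * (b ^+ k0 * l1 ^+ (N - M - k0) * enorm e)) by rewrite exprD; ring.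
  by rewrite ler_wpM2l// ltW.
have con u : C z u -> 8 * enorm u <= kap * enorm (u *m cocyc f A N z).
  move=> Cu; have [_ h3] := cocyc_cone N Cu.
  have h4 := hN2 N NN2; rewrite exprVn ler_pdivrMr// in h4.
  have lN0 : 0 < lam ^+ N by rewrite exprn_gt0.
  have h5 : (lam ^+ N)^-1 * enorm u <= enorm (u *m cocyc f A N z).
    by rewrite mulrC ler_pdivrMr// mulrC.
  apply: (@le_trans _ _ ((lam ^+ N)^-1 * kap * enorm u)); first by rewrite ler_wpM2r ?enorm_ge0.
  by rewrite mulrAC mulrC ler_wpM2l// ltW.
have [u [e [Cu eE ->]]] := dec z v.
have [Cu' _] := cocyc_cone N Cu; have eE' := cocyc_center N eE.
have h4 := con u Cu; have h5 := cen e eE.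
have h6 := tr Cu' eE'; have h7 := k31 _ _ _ Cu' eE'.
rewrite mulmxDl; have := enormD u e; qlra.
Qed.

End BlockExpansion.

(** * Growth of balls *)

Section Growth.
Context {R : realType} {n : nat} (f : torus R n -> torus R n)
  (A : torus R n -> 'M[R]_n).
Local Notation T := (torus R n).
Local Notation V := ('rV[R]_n).
Hypotheses (cf : continuous f) (cA : continuous A) (uA : forall x, A x \in unitmx)
  (f_capprox : forall eta, 0 < eta -> exists2 r, 0 < r & evC1 f (capprox f A eta r)).

(** Of the factor 4, one unit is lost to the variation of the cocycle on a small ball and one to the
    nonlinearity of [iter N g], so that radii double. *)
Definition expanding_at N (z : T) := forall v : V, 4 * enorm v <= enorm (v *m cocyc f A N z).

Lemma iter_iter (X : Type) (h : X -> X) i j x : iter i (iter j h) x = iter (i * j) h x.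
Proof. by elim: i => //= i ->; rewrite -iterD. Qed.

Lemma block_covering N : exists2 r3 : R, 0 < r3 & evC1 f (fun g => forall y s z,
  0 < s <= r3 -> expanding_at N y -> tdist (iter N g y) z < 2 * s ->
  exists2 u, tdist y u < s & iter N g u = z).
Proof using cf cA f_capprox.
have cN := @cocyc_continuous R n f A N cf cA.
have [r r0 hr] := uniform_continuous_mx cN (ltr01).
have [r' r'0 ev] := iter_capprox N cf cA f_capprox (ltr01).
exists (r / 2); first by lra.
apply: evC1_imp ev => g [_ l] y s z /andP[s0 sr] ey yz.
apply: (@covering R n (iter N g) (cocyc f A N) 1 3 r' s y z) => //.
- exact: near_lin_continuous l.
- by rewrite ler01/=; lra.
- move=> w yw v.
  have yw' : tdist y w < r by lra.
  have h1 := hr _ _ yw'; have h2 := ey v.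
  have h3 := enorm_mulmx v (cocyc f A N y - cocyc f A N w).
  have h4 : mxbnd (cocyc f A N y - cocyc f A N w) * enorm v <= 1 * enorm v.
    by rewrite ler_wpM2r ?enorm_ge0// ltW.
  have h5 := enorm_lower (v *m cocyc f A N y) (- (v *m (cocyc f A N y - cocyc f A N w))).
  rewrite enormN -mulmxN -mulmxDr opprB subrKC in h5.
  lra.
- by lra.
Qed.

Lemma one_step_covering : exists2 q : R, 0 < q & evC1 f (fun g => forall y s z,
  0 < s -> tdist (g y) z < q * s -> exists2 u, tdist y u < s & g u = z).
Proof using cf cA uA f_capprox.
have [b /andP[b0 b1] hb] := unit_cocycle_lower cA uA.
have b20 : 0 < b / 2 by lra.
have [r r0 ev] := f_capprox b20; exists (b / 2) => //.
apply: evC1_imp ev => g [_ l] y s z s0 yz.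
apply: (@covering R n g A (b / 2) b r s y z) => //.
- exact: near_lin_continuous l.
- by rewrite ltW//=; lra.
- by have -> : b - b / 2 = b / 2 by lra.
Qed.

(** The [N0] preliminary steps shrink the radius by [q ^+ N0] at worst, and each block doubles it up
    to [r3]. The number [J] of blocks is chosen after [N0], and the center [u] after [J]. *)
Lemma growth N (H : (T -> T) -> Prop) :
  (forall g, H g -> forall x0 s, 0 < s -> exists N0, forall J, exists u,
     tdist x0 u < s /\ forall i, (i < J)%N -> expanding_at N (iter (i * N) g (iter N0 g u))) ->
  evC1 f H -> exists2 r : R, 0 < r & evC1 f (fun g => forall x0 s, 0 < s ->
    exists M y, forall z, tdist y z < r -> exists2 u, tdist x0 u < s & iter M g u = z).
Proof using cf cA uA f_capprox.
have locals := I.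
move=> hH evH.
have [r3 r30 ev3] := block_covering N; have [q q0 ev1] := one_step_covering.
exists r3 => //; apply: evC1_imp (evC1_and evH (evC1_and ev3 ev1)) => g [Hg [c3 c1]] x0 s s0.
have s20 : 0 < s / 2 by qlra.
have [N0 hN0] := hH g Hg x0 (s / 2) s20.
have cov0 M : forall y s z, 0 < s -> tdist (iter M g y) z < q ^+ M * s ->
    exists2 u, tdist y u < s & iter M g u = z.
  elim: M => [|M IH] y t z t0 yz; first by exists z => //; rewrite expr0 mul1r in yz.
  rewrite exprS -mulrA in yz.
  have [w yw <-] := c1 _ _ _ (mulr_gt0 (exprn_gt0 M q0) t0) yz.
  by have [u yu <-] := IH _ _ _ t0 yw; exists u.
have covJ J : forall y t z, 0 < t -> t * 2 ^+ J <= r3 ->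
    (forall i, (i < J)%N -> expanding_at N (iter (i * N) g y)) ->
    tdist (iter (J * N) g y) z < 2 ^+ J * t ->
    exists2 u, tdist y u < t & iter (J * N) g u = z.
  elim: J => [|J IH] y t z t0 tr he yz; first by exists z => //; rewrite expr0 mul1r in yz.
  have t2 : 0 < 2 * t by qlra.
  have p1 : (1 : R) <= 2 ^+ J by rewrite exprn_ege1//; qlra.
  rewrite mulSnr iterD in yz *.
  have [|||w yw wz] := IH (iter N g y) (2 * t) z t2.
  - by rewrite mulrAC -exprS mulrC.
  - by move=> i iJ; rewrite -iterD -mulSnr; apply: he.
  - by rewrite mulrA -exprSr.
  have tt : 0 < t <= r3.
    rewrite t0 /=; apply: le_trans tr; rewrite exprS.
    by rewrite ler_peMr ?ltW//; qlra.
  have [u yu uw] := c3 y t w tt (he 0%N isT) yw.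
  by exists u => //; rewrite iterD uw.
have p0 : 0 < q ^+ N0 * (s / 2) by rewrite mulr_gt0 ?exprn_gt0.
have [J hJ] : exists J, r3 / (q ^+ N0 * (s / 2)) <= 2 ^+ J.
  have l2 : (1 : R) < 2 by qlra.
  have [J h] := expr_unbounded (r3 / (q ^+ N0 * (s / 2))) l2.
  by exists J; apply: h.
rewrite ler_pdivrMr// in hJ.
have [u [x0u he]] := hN0 J.
exists (J * N + N0)%N, (iter (J * N) g (iter N0 g u)) => z hz.
have p2 : (0 : R) < 2 ^+ J by rewrite exprn_gt0.
have t0 : 0 < r3 / 2 ^+ J by rewrite divr_gt0.
have [|||w uw <-] := covJ J (iter N0 g u) (r3 / 2 ^+ J) z t0.
- by rewrite divfK// gt_eqF.
- exact: he.
- by rewrite mulrC divfK// gt_eqF.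
have [|u' uu' u'w] := cov0 N0 u (s / 2) w s20.
  by apply: lt_le_trans uw _; rewrite ler_pdivrMr// mulrC.
exists u'; last by rewrite iterD u'w.
by have := tdistD u x0 u'; qlra.
Qed.

Lemma growth_dense N (H : (T -> T) -> Prop) :
  (forall x, dense (preorbit f x)) ->
  (forall g, H g -> forall x0 s, 0 < s -> exists N0, forall J, exists u,
     tdist x0 u < s /\ forall i, (i < J)%N -> expanding_at N (iter (i * N) g (iter N0 g u))) ->
  evC1 f H -> evC1 f (fun g => forall x, dense (preorbit g x)).
Proof using cf cA uA f_capprox.
move=> fd hH evH; have [r r0 ev1] := growth hH evH.
have ev2 := preorbits_nearly_dense cf cA uA f_capprox fd r0.
apply: evC1_imp (evC1_and ev1 ev2) => g [c1 c2] x U [x0 Ux0] oU.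
have /torus_nbhsP[s s0 sU] : nbhs x0 U by exact: open_nbhs_nbhs.
have [M [y hy]] := c1 x0 s s0.
have [k [w [yw wx]]] := c2 x y.
have [u x0u uw] := hy w yw.
exists u; split; first exact: sU.
by exists (k + M)%N; rewrite iterD uw.
Qed.

End Growth.

(** * Lower bounds for internal diameters *)

Section InternalDiameter.
Context {R : realType}.

Lemma mulmx_continuous (X : topologicalType) m p q (F : X -> 'M[R]_(m, p))
    (G : X -> 'M[R]_(p, q)) :
  continuous F -> continuous G -> continuous (fun x => F x *m G x).
Proof.
move=> cF cG x; apply/cvgrPdist_lt => e e0.
have K0 : 0 < p%:R * (`|F x| + (`|G x| + 1)) + 1 :> R.
  by rewrite ltr_wpDl// mulr_ge0// addr_ge0// addr_ge0.
have [d [d0 d1 dE]] : exists d : R, [/\ 0 < d, d <= 1 &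
    d * (p%:R * (`|F x| + (`|G x| + 1)) + 1) <= e].
  exists (Num.min 1 (e / (p%:R * (`|F x| + (`|G x| + 1)) + 1))); split.
  - by rewrite lt_min ltr01 divr_gt0.
  - by rewrite ge_min lexx.
  - by rewrite -ler_pdivlMr// ge_min lexx orbT.
have mn a b c (M : 'M[R]_(a, b)) (N : 'M[R]_(b, c)) : `|M *m N| <= b%:R * (`|M| * `|N|).
  apply: norm_le_bound => [|i j]; first by rewrite !mulr_ge0.
  rewrite mxE; apply: le_trans (ler_norm_sum _ _ _) _.
  rewrite mulr_natl -[X in _ *+ X]card_ord -sumr_const; apply: ler_sum => k _.
  by rewrite normrM ler_pM// coord_le_norm.
near=> y.
have h1 : `|F x - F y| < d by near: y; exact: (cvgrPdist_lt _ _).1 (cF x) d d0.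
have h2 : `|G x - G y| < d by near: y; exact: (cvgrPdist_lt _ _).1 (cG x) d d0.
have h3 : `|G y| <= `|G x| + 1.
  have := ler_normB (G x) (G x - G y); rewrite subKr; lra.
have -> : F x *m G x - F y *m G y = (F x - F y) *m G y + F x *m (G x - G y).
  by rewrite mulmxBl mulmxBr [RHS]addrC subrKA.
have h4 := mn _ _ _ (F x - F y) (G y); have h5 := mn _ _ _ (F x) (G x - G y).
have h6 : p%:R * (`|F x - F y| * `|G y|) <= p%:R * (d * (`|G x| + 1)).
  by rewrite ler_wpM2l// ler_pM// ltW.
have h7 : p%:R * (`|F x| * `|G x - G y|) <= p%:R * (`|F x| * d).
  by rewrite ler_wpM2l// ler_wpM2l// ltW.
have h8 := ler_normD ((F x - F y) *m G y) (F x *m (G x - G y)).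
have h9 : d * (p%:R * (`|F x| + (`|G x| + 1)) + 1) =
  p%:R * (`|F x| * d) + p%:R * (d * (`|G x| + 1)) + d by ring.
lra.
Unshelve. all: by end_near. Qed.

Lemma path_derive (d n : nat) (h : 'rV[R]_d -> 'rV[R]_n) (s : R -> 'rV[R]_d) t :
  (forall p, differentiable h p) -> derivable s t 1 ->
  derive1 (h \o s) t = derive1 s t *m 'J h (s t).
Proof.
move=> dh ds; have dfs := (derivable1_diffP _ _).1 ds.
have dc := differentiable_comp dfs (dh (s t)).
rewrite !derive1E (deriveE _ dc) (diff_comp dfs (dh (s t))) /= -(deriveE _ dfs).
by rewrite -(deriveE _ (dh (s t))) (deriveEjacobian _ (dh (s t))).
Qed.

Lemma path_coord_derive (d : nat) (s : R -> 'rV[R]_d) t i : derivable s t 1 ->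
  is_derive t 1 (fun u => s u 0 i) (derive1 s t 0 i).
Proof.
move=> ds; apply: DeriveDef; first by move/derivable_mxP: ds; apply.
by rewrite derive1E derive_mx// mxE.
Qed.

(** A path from [- e] to [e] changes the coordinate [i] by 2, and the speed of its image is at least
    [k] times that of the coordinate. *)
Lemma internal_diameter_ge (d n : nat) (h : 'rV[R]_d -> 'rV[R]_n) (i : 'I_d) (k : R) :
  embedded_disc h -> 0 <= k ->
  (forall p, unit_disc p -> forall v : 'rV[R]_d, k * `|v 0 i| <= enorm (v *m 'J h p)) ->
  ((2 * k)%:E <= internal_diameter h)%E.
Proof.
move=> [dh cJ _ _] k0 hk.
pose e : 'rV[R]_d := delta_mx 0 i.
have ei : e 0 i = 1 by rewrite mxE !eqxx.
have e1 : enorm e = 1.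
  rewrite /enorm (bigD1 i)//= big1 ?addr0 => [|j ji]; first by rewrite ei expr1n sqrtr1.
  by rewrite mxE (negPf ji) andbF expr0n.
apply: (@le_trans _ _ (internal_dist h (- e) e)); last first.
  apply: ereal_sup_ubound; exists (- e); first by rewrite /unit_disc /= enormN e1.
  by exists e => //; rewrite /unit_disc /= e1.
apply: le_ereal_inf_tmp => _ [s [ds cs s0 s1 us] <-].
have cpt : compact (`[0, 1]%classic : set R) by exact: segment_compact.
have cD : continuous (fun t => derive1 s t *m 'J h (s t)).
  apply: mulmx_continuous => // t.
  apply: (@continuous_comp _ _ _ s (jacobian h)); last exact: cJ.
  by apply: differentiable_continuous; apply/derivable1_diffP; exact: ds.
pose F (t : R) := k * s t 0 i.
pose f (t : R) := k * derive1 s t 0 i.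
have cf : continuous f.
  move=> t; apply: continuousM; first exact: cst_continuous.
  by apply: (@continuous_comp _ _ _ (derive1 s) (fun v : 'rV[R]_d => v 0 i));
    [exact: cs|exact: coord_continuous].
have dF (t : R) : is_derive t 1 F (f t).
  have D := path_coord_derive i (ds t).
  by have := is_deriveZ k D; exact.
have E : (\int[lebesgue_measure]_(x in `[0%R, 1%R]) (f x)%:E)%E = ((F 1)%:E - (F 0)%:E)%E.
  apply: continuous_FTC2 => //; first exact: continuous_subspaceT.
    have cF t : {for t, continuous F}.
      apply: differentiable_continuous; apply/derivable1_diffP.
      by have [] := dF t.
    split.
    - by move=> t _; have [] := dF t.
    - exact: cvg_at_right_filter (cF 0).
    - exact: cvg_at_left_filter (cF 1).
  by move=> t _; rewrite derive1E; have [_ ->] := dF t.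
apply: (@le_trans _ _ (\int[lebesgue_measure]_(x in `[0%R, 1%R]) (f x)%:E)%E).
  rewrite E /F s0 s1 -EFinB lee_fin [(- e) 0 i]mxE ei; lra.
have gE (t : R) : enorm (derive1 (h \o s) t) = enorm (derive1 s t *m 'J h (s t)).
  by rewrite path_derive.
rewrite /path_length; apply: le_integral.
- exact: measurable_itv.
- by apply: continuous_compact_integrable => //; exact: continuous_subspaceT.
- apply: continuous_compact_integrable => //; apply: continuous_subspaceT => t.
  rewrite (funext gE).
  by apply: (@continuous_comp _ _ _ (fun t => derive1 s t *m 'J h (s t)) (@enorm R n));
    [exact: cD|exact: enorm_continuous].
- move=> t; rewrite inE /= in_itv /= => t01; rewrite lee_fin gE.
  apply: le_trans (hk _ (us t t01) _); rewrite /f ler_wpM2l//; exact: ler_norm.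
Qed.

End InternalDiameter.

(** * Strips around logarithmic spirals *)

Section SpiralStrip.
Context {R : realType} {d n : nat} (i0 i1 : 'I_d) (B : 'M[R]_(d, n))
  (x0 : 'rV[R]_n) (mu K eta : R).
Hypothesis i01 : i0 != i1.

Lemma jacobian_line (F : 'rV[R]_d -> 'rV[R]_n) p v (D : 'rV[R]_n) :
  differentiable F p ->
  (forall j, is_derive (0 : R) 1 (fun t => F (t *: v + p) 0 j) (D 0 j)) ->
  v *m 'J F p = D.
Proof.
move=> dF hD; rewrite -(deriveEjacobian _ dF).
have dv : derivable F p v by exact: diff_derivable.
apply/rowP => j; rewrite derive_mx// mxE.
have [d1 <-] := hD j.
have E : (fun h : R => h^-1 *: (((fun t : R => F (t *: v + p) 0 j) \o shift 0) (h *: 1) -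
      F (0 *: v + p) 0 j)) =
    (fun h : R => h^-1 *: (((fun q => F q 0 j) \o shift p) (h *: v) - F p 0 j)).
  by apply/funext => h /=; rewrite addr0 scale0r add0r [h *: 1]mulr1.
exact: (congr1 (fun G : R -> R => lim (G @ (0 : R)^')) (esym E)).
Qed.

(** With the plane of [i0] and [i1] seen as the complex plane, [spiral_lin1 + i spiral_lin2] is the
    product of [1 + i K] and [p_0 + i eta p_1], and the strip is [mu] times its exponential: a
    logarithmic spiral thickened by [eta]. The other coordinates are only scaled. *)
Definition spiral_lin1 (p : 'rV[R]_d) : R := p 0 i0 - K * eta * p 0 i1.
Definition spiral_lin2 (p : 'rV[R]_d) : R := K * p 0 i0 + eta * p 0 i1.
Definition spiral_x (p : 'rV[R]_d) : R := mu * (expR (spiral_lin1 p) * cos (spiral_lin2 p)).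
Definition spiral_y (p : 'rV[R]_d) : R := mu * (expR (spiral_lin1 p) * sin (spiral_lin2 p)).
Definition spiral_row (a c : R) (q : 'rV[R]_d) : 'rV[R]_d :=
  \row_j (if j == i0 then a else if j == i1 then c else q 0 j).

Definition spiral_strip (p : 'rV[R]_d) : 'rV[R]_n :=
  x0 + spiral_row (spiral_x p) (spiral_y p) (mu *: p) *m B.

Lemma spiral_strip_coord p j : spiral_strip p 0 j = x0 0 j +
  (spiral_x p * B i0 j + (spiral_y p * B i1 j +
   \sum_(k | (k != i0) && (k != i1)) mu * p 0 k * B k j)).
Proof.
rewrite mxE; congr (_ + _); rewrite mxE (bigD1 i0)//= mxE eqxx; congr (_ + _).
rewrite (bigD1 i1) 1?eq_sym//= mxE eqxx eq_sym (negPf i01); congr (_ + _).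
by apply: eq_bigr => k /andP[/negPf h1 /negPf h2]; rewrite !mxE h1 h2.
Qed.

Lemma differentiable_rV (p : 'rV[R]_d) (F : 'rV[R]_d -> 'rV[R]_n) :
  (forall j, differentiable (fun q => F q 0 j) p) -> differentiable F p.
Proof.
move=> h.
have -> : F = \sum_(j < n) (fun q => F q 0 j *: (delta_mx 0 j : 'rV[R]_n)).
  apply/funext => q; rewrite [LHS]row_sum_delta fct_sumE; by apply: eq_bigr.
by apply: differentiable_sum => j; exact: differentiableZl.
Qed.

Lemma spiral_lin_differentiable p : differentiable spiral_lin1 p /\ differentiable spiral_lin2 p.
Proof.
split; rewrite /spiral_lin1 /spiral_lin2.
  apply: (@differentiableB _ _ _ (fun p : 'rV[R]_d => p 0 i0) (fun p => K * eta * p 0 i1)).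
    exact: differentiable_coord.
  by apply: differentiableM; [exact: differentiable_cst|exact: differentiable_coord].
apply: (@differentiableD _ _ _ (fun p : 'rV[R]_d => K * p 0 i0) (fun p => eta * p 0 i1)).
  by apply: differentiableM; [exact: differentiable_cst|exact: differentiable_coord].
by apply: differentiableM; [exact: differentiable_cst|exact: differentiable_coord].
Qed.

Lemma spiral_xy_differentiable p : differentiable spiral_x p /\ differentiable spiral_y p.
Proof.
have [h1 h2] := spiral_lin_differentiable p.
have e1 : differentiable (fun p => expR (spiral_lin1 p)) p.
  apply: (@differentiable_comp _ _ _ _ spiral_lin1 expR) => //.
  by apply/derivable1_diffP; exact: derivable_expR.
split; (apply: differentiableM; first exact: differentiable_cst).
  apply: differentiableM => //.
  apply: (@differentiable_comp _ _ _ _ spiral_lin2 cos) => //.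
  by apply/derivable1_diffP; exact: derivable_cos.
apply: differentiableM => //.
apply: (@differentiable_comp _ _ _ _ spiral_lin2 sin) => //.
by apply/derivable1_diffP; exact: derivable_sin.
Qed.

Lemma spiral_strip_differentiable p : differentiable spiral_strip p.
Proof.
apply: differentiable_rV => j.
have [h1 h2] := spiral_xy_differentiable p.
rewrite (_ : (fun q => _) = (fun q => x0 0 j +
  (spiral_x q * B i0 j + (spiral_y q * B i1 j +
   \sum_(k | (k != i0) && (k != i1)) mu * q 0 k * B k j)))); last first.
  by apply/funext => q; rewrite spiral_strip_coord.
apply: differentiableD; first exact: differentiable_cst.
apply: differentiableD.
  by apply: differentiableM => //; exact: differentiable_cst.
apply: differentiableD.
  by apply: differentiableM => //; exact: differentiable_cst.
rewrite (_ : (fun q : 'rV[R]_d => \sum_(k | _) _) =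
  \sum_(k < d) (fun q : 'rV[R]_d => if (k != i0) && (k != i1) then mu * q 0 k * B k j else 0)).
  apply: differentiable_sum => k; case: ((k != i0) && (k != i1)); last exact: differentiable_cst.
  apply: differentiableM; last exact: differentiable_cst.
  by apply: differentiableM; [exact: differentiable_cst|exact: differentiable_coord].
by apply/funext => q; rewrite fct_sumE big_mkcond.
Qed.

Lemma spiral_strip_jacobian p v : v *m 'J spiral_strip p =
  spiral_row (spiral_lin1 v * spiral_x p - spiral_lin2 v * spiral_y p)
             (spiral_lin1 v * spiral_y p + spiral_lin2 v * spiral_x p) (mu *: v) *m B.
Proof.
apply: jacobian_line; first exact: spiral_strip_differentiable.
move=> j.
set a := spiral_lin1 v; set b := spiral_lin2 v.
have l1 (t : R) : spiral_lin1 (t *: v + p) = t * a + spiral_lin1 p.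
  by rewrite /a /spiral_lin1 !mxE; ring.
have l2 (t : R) : spiral_lin2 (t *: v + p) = t * b + spiral_lin2 p.
  by rewrite /b /spiral_lin2 !mxE; ring.
set S := \sum_(k | (k != i0) && (k != i1)) mu * v 0 k * B k j.
set S' := \sum_(k | (k != i0) && (k != i1)) mu * p 0 k * B k j.
rewrite (_ : (fun t => _) = (fun t : R => x0 0 j +
  (mu * (expR (t * a + spiral_lin1 p) * cos (t * b + spiral_lin2 p)) * B i0 j +
  (mu * (expR (t * a + spiral_lin1 p) * sin (t * b + spiral_lin2 p)) * B i1 j +
   (t * S + S'))))); last first.
  apply/funext => t; rewrite spiral_strip_coord /spiral_x /spiral_y l1 l2.
  congr (_ + (_ + (_ + _))); rewrite /S /S' mulr_sumr -big_split /=.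
  by apply: eq_bigr => k _; rewrite !mxE; ring.
have -> : (spiral_row (a * spiral_x p - b * spiral_y p) (a * spiral_y p + b * spiral_x p) (mu *: v) *m B) 0 j
   = (a * spiral_x p - b * spiral_y p) * B i0 j + ((a * spiral_y p + b * spiral_x p) * B i1 j + S).
  rewrite mxE (bigD1 i0)//= mxE eqxx; congr (_ + _).
  rewrite (bigD1 i1) 1?eq_sym//= mxE eqxx eq_sym (negPf i01); congr (_ + _).
  by apply: eq_bigr => k /andP[/negPf h1 /negPf h2]; rewrite !mxE h1 h2.
have De : is_derive (0 : R) 1 (fun t : R => expR (t * a + spiral_lin1 p)) (a * expR (spiral_lin1 p)).
  have D1 : is_derive (0 : R) 1 (fun t : R => t * a + spiral_lin1 p) a.
    by apply: is_derive_eq; rewrite /GRing.scale/= !(mulr0, mul0r, add0r, addr0, mulr1).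
  have := @is_derive1_comp _ expR (fun t : R => t * a + spiral_lin1 p) 0 _ _ (is_derive_expR _) D1.
  by rewrite mul0r add0r mulrC.
have Dc : is_derive (0 : R) 1 (fun t : R => cos (t * b + spiral_lin2 p)) (- (b * sin (spiral_lin2 p))).
  have D1 : is_derive (0 : R) 1 (fun t : R => t * b + spiral_lin2 p) b.
    by apply: is_derive_eq; rewrite /GRing.scale/= !(mulr0, mul0r, add0r, addr0, mulr1).
  have := @is_derive1_comp _ cos (fun t : R => t * b + spiral_lin2 p) 0 _ _ (is_derive_cos _) D1.
  by rewrite mul0r add0r mulNr mulrC.
have Ds : is_derive (0 : R) 1 (fun t : R => sin (t * b + spiral_lin2 p)) (b * cos (spiral_lin2 p)).
  have D1 : is_derive (0 : R) 1 (fun t : R => t * b + spiral_lin2 p) b.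
    by apply: is_derive_eq; rewrite /GRing.scale/= !(mulr0, mul0r, add0r, addr0, mulr1).
  have := @is_derive1_comp _ sin (fun t : R => t * b + spiral_lin2 p) 0 _ _ (is_derive_sin _) D1.
  by rewrite mul0r add0r mulrC.
apply: is_derive_eq.
rewrite /GRing.scale/= !mul0r !add0r /spiral_x /spiral_y; ring.
Qed.

Lemma spiral_strip_jacobian_continuous : continuous (fun p => 'J spiral_strip p).
Proof.
pose M1 : 'M[R]_(d, n) := \matrix_(i, j) (spiral_lin1 (delta_mx 0 i) * B i0 j + spiral_lin2 (delta_mx 0 i) * B i1 j).
pose M2 : 'M[R]_(d, n) := \matrix_(i, j) (spiral_lin1 (delta_mx 0 i) * B i1 j - spiral_lin2 (delta_mx 0 i) * B i0 j).
pose M3 : 'M[R]_(d, n) := \matrix_(i, j) (\sum_(k | (k != i0) && (k != i1)) (mu *: (delta_mx 0 i : 'rV[R]_d)) 0 k * B k j).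
have -> : (fun p => 'J spiral_strip p) = (fun p => spiral_x p *: M1 + (spiral_y p *: M2 + M3)).
  apply/funext => p; apply/row_matrixP => i; rewrite rowE spiral_strip_jacobian.
  apply/rowP => j; rewrite mxE (bigD1 i0)//= mxE eqxx (bigD1 i1) 1?eq_sym//= mxE eqxx eq_sym (negPf i01).
  rewrite !mxE [in LHS](eq_bigr (fun k => (mu *: (delta_mx 0 i : 'rV[R]_d)) 0 k * B k j)); last first.
    by move=> k /andP[/negPf h1 /negPf h2]; rewrite !mxE h1 h2.
  by ring.
move=> p; have [h1 h2] := spiral_xy_differentiable p.
apply: (@continuousD _ _ _ (fun p => spiral_x p *: M1) (fun p => spiral_y p *: M2 + M3)).
  by apply: continuousZl; exact: differentiable_continuous.
apply: (@continuousD _ _ _ (fun p => spiral_y p *: M2) (fun p => M3)); last exact: cst_continuous.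
by apply: continuousZl; exact: differentiable_continuous.
Qed.

Lemma enorm_spiral_row a c (q : 'rV[R]_d) :
  enorm (spiral_row a c q) <= `|a| + `|c| + enorm q.
Proof.
have e1 (i : 'I_d) : enorm (delta_mx 0 i : 'rV[R]_d) = 1.
  rewrite /enorm (bigD1 i)//= big1 ?addr0 => [|j ji]; first by rewrite mxE !eqxx expr1n sqrtr1.
  by rewrite mxE (negPf ji) andbF expr0n.
have -> : spiral_row a c q = a *: delta_mx 0 i0 + c *: delta_mx 0 i1 + spiral_row 0 0 q.
  apply/rowP => j; rewrite !mxE !eqxx /=; have [->|ji0] := eqVneq j i0.
    by rewrite (negPf i01) !(mulr1, mulr0, addr0).
  by case: (j == i1); rewrite !(mulr1, mulr0, addr0, add0r).
apply: le_trans (enormD _ _) _; apply: lerD.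
  by apply: le_trans (enormD _ _) _; rewrite !enormZ !e1 !mulr1.
rewrite enorm_le ?enorm_ge0// sqr_enorm; apply: ler_sum => j _; rewrite mxE.
by case: eqP => _; [|case: eqP => _]; rewrite ?expr0n /= ?sqr_ge0.
Qed.

Lemma spiral_row_lower a c (q : 'rV[R]_d) : Num.sqrt (a ^+ 2 + c ^+ 2) <= enorm (spiral_row a c q).
Proof.
rewrite /enorm ler_wsqrtr// (bigD1 i0)//= mxE eqxx lerD2l.
rewrite (bigD1 i1) 1?eq_sym//= mxE eqxx eq_sym (negPf i01) lerDl.
by apply: sumr_ge0 => j _; exact: sqr_ge0.
Qed.

(** The map is conformal in [p_0 + i eta p_1]: the exponential multiplies lengths by
    [mu * expR (spiral_lin1 p)], the linear map by the modulus of [1 + i K]. *)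
Lemma spiral_jacobian_sq p v :
  (spiral_lin1 v * spiral_x p - spiral_lin2 v * spiral_y p) ^+ 2 +
  (spiral_lin1 v * spiral_y p + spiral_lin2 v * spiral_x p) ^+ 2 =
  (mu * expR (spiral_lin1 p)) ^+ 2 * ((1 + K ^+ 2) * (v 0 i0 ^+ 2 + (eta * v 0 i1) ^+ 2)).
Proof.
rewrite /spiral_x /spiral_y.
set c := cos _; set s := sin _; set e := expR _.
have h : c ^+ 2 + s ^+ 2 = 1 by exact: cos2Dsin2.
transitivity ((mu * e) ^+ 2 * (spiral_lin1 v ^+ 2 + spiral_lin2 v ^+ 2) * (c ^+ 2 + s ^+ 2)).
  by ring.
rewrite h /spiral_lin1 /spiral_lin2; ring.
Qed.

End SpiralStrip.

Lemma mx_free_lower {R : realType} (d n : nat) (B : 'M[R]_(d, n)) : row_free B ->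
  exists2 b : R, 0 < b & forall w : 'rV[R]_d, b * enorm w <= enorm (w *m B).
Proof.
move=> /row_freeP[N BN].
have h : 0 < mxbnd N + 1 by rewrite ltr_wpDl ?mxbnd_ge0.
exists (mxbnd N + 1)^-1 => [|w]; first by rewrite invr_gt0.
rewrite mulrC ler_pdivrMr// mulrC -{1}[w]mulmx1 -BN mulmxA.
apply: le_trans (enorm_mulmx _ _) _; rewrite ler_wpM2r ?enorm_ge0//; lra.
Qed.

Lemma row_freeP_ker {F : fieldType} (d n : nat) (M : 'M[F]_(d, n)) :
  (forall v : 'rV[F]_d, v *m M = 0 -> v = 0) -> row_free M.
Proof.
by move=> h; rewrite -kermx_eq0; apply/rowV0P => v /sub_kermxP; exact: h.
Qed.

Lemma sqrtr_sqr_le {R : realType} (a x : R) : 0 <= a -> a ^+ 2 <= x -> a <= Num.sqrt x.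
Proof. by move=> a0 ax; rewrite -[a]ger0_norm// -sqrtr_sqr ler_wsqrtr. Qed.

(* A thin strip around a spiral has large internal diameter although it lies in
   a small ball of a plane. *)
Lemma flat_disc_of_large_diameter {R : realType} (d n : nat) (B : 'M[R]_(d, n))
    (x0 : 'rV[R]_n) (rho D : R) :
  (1 < d)%N -> row_free B -> 0 < rho -> exists h : 'rV[R]_d -> 'rV[R]_n,
  [/\ embedded_disc h, forall p, unit_disc p -> enorm (h p - x0) <= rho,
      forall p (v : 'rV[R]_d), exists w, v *m 'J h p = w *m B
    & (D%:E < internal_diameter h)%E].
Proof.
(* A radius of at most 1/8 makes [tproj] injective on the disc. *)
move=> d1 Bf; wlog r4 : rho / rho <= 8^-1.
  move=> hw r0; have [||h [h1 h2 h3 h4]] := hw (Num.min rho 8^-1).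
  - by rewrite ge_min lexx orbT.
  - by rewrite lt_min r0 /=; lra.
  - exists h; split=> // p up; apply: le_trans (h2 p up) _; by rewrite ge_min lexx.
move=> r0.
pose i0 : 'I_d := Ordinal (ltnW d1); pose i1 : 'I_d := Ordinal d1.
have i01 : i0 != i1 by [].
have [b b0 hb] := mx_free_lower Bf.
have e20 : 0 < expR 2 :> R := expR_gt0 _.
(* On the unit disc [spiral_lin1] lies in [[-2, 2]], so [mu * expR 2] bounds the radius of the
   spiral. *)
have [mu [mu0 muE]] : exists mu : R, 0 < mu /\ mxbnd B * (mu * (2 * expR 2 + 1)) <= rho.
  have [mb [mb0 ->]] : exists m : R, 0 <= m /\ mxbnd B = m by exists (mxbnd B); rewrite mxbnd_ge0.
  have q0 : 0 < 2 * expR 2 + 1 :> R by lra.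
  move: (2 * expR 2 + 1) q0 => q q0.
  have h : 0 < (mb + 1) * q by apply: mulr_gt0 => //; lra.
  exists (rho / ((mb + 1) * q)); rewrite divr_gt0//; split=> //.
  have -> : mb * (rho / ((mb + 1) * q) * q) = rho * (mb / (mb + 1)).
    by field; rewrite !gt_eqF//; lra.
  have m1 : mb / (mb + 1) <= 1 by rewrite ler_pdivrMr ?mul1r; lra.
  by rewrite ler_piMr//; exact: ltW.
(* A large [K] makes the spiral turn often: speeds along [i0] are at least
   [b * (mu * expR (- 2) * K)]. *)
have [K [K0 KE]] : exists K : R, 0 < K /\ D < 2 * (b * (mu * expR (- 2) * K)).
  have h : 0 < 2 * (b * (mu * expR (- 2))) by rewrite !mulr_gt0// expR_gt0.
  exists ((`|D| + 1) / (2 * (b * (mu * expR (- 2))))).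
  have D1 : 0 < `|D| + 1 by rewrite ltr_wpDl.
  split; first by rewrite divr_gt0.
  have -> : 2 * (b * (mu * expR (- 2) * ((`|D| + 1) / (2 * (b * (mu * expR (- 2))))))) = `|D| + 1.
    have := expR_gt0 (- 2 : R); set e := expR (- 2) => e0.
    by field; rewrite !gt_eqF.
  have := ler_norm D; lra.
have K10 : 0 < 2 * (K ^+ 2 + 1) by have := sqr_ge0 K; lra.
(* Thinness: points of equal modulus differ in angle by [(K ^+ 2 + 1) * eta * (p 0 i1 - q 0 i1)], at
   most 1 in absolute value, so the strip does not reach its next turn. *)
have [eta [eta0 eta1 eta2]] : exists eta : R, [/\ 0 < eta, K * eta <= 1 & (K ^+ 2 + 1) * eta <= 2^-1].
  exists (2 * (K ^+ 2 + 1))^-1; split; first by rewrite invr_gt0.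
    rewrite ler_pdivrMr// mul1r; have := sqr_ge0 (K - 1); nra.
  have h : K ^+ 2 + 1 != 0 by have := sqr_ge0 K; lra.
  by rewrite invfM mulrCA divff// mulr1.
pose h := spiral_strip i0 i1 B x0 mu K eta.
have lin1b p : unit_disc p -> - 2 <= spiral_lin1 i0 i1 K eta p <= 2.
  rewrite /unit_disc /= => up; rewrite /spiral_lin1.
  have := le_trans (coord_le_enorm p i0) up; have := le_trans (coord_le_enorm p i1) up.
  rewrite !ler_norml => /andP[h1 h2] /andP[h3 h4].
  have Ke : 0 < K * eta by rewrite mulr_gt0.
  by apply/andP; split; nra.
have rowb p (v : 'rV[R]_d) : unit_disc p -> mu * expR (- 2) * K * `|v 0 i0| <=
    Num.sqrt ((spiral_lin1 i0 i1 K eta v * spiral_x i0 i1 mu K eta p - spiral_lin2 i0 i1 K eta v * spiral_y i0 i1 mu K eta p) ^+ 2 +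
     (spiral_lin1 i0 i1 K eta v * spiral_y i0 i1 mu K eta p + spiral_lin2 i0 i1 K eta v * spiral_x i0 i1 mu K eta p) ^+ 2).
  move=> up; rewrite spiral_jacobian_sq; apply: sqrtr_sqr_le.
    by rewrite !mulr_ge0 ?expR_ge0// ltW.
  have /andP[l1 _] := lin1b p up.
  have e1 : expR (- 2) <= expR (spiral_lin1 i0 i1 K eta p) by rewrite ler_expR.
  have e2 := expR_gt0 (- 2 : R).
  rewrite -mulrA exprMn; apply: ler_pM; rewrite ?sqr_ge0//.
    have mu0' := ltW mu0; rewrite ler_sqr ?nnegrE ?mulr_ge0 ?expR_ge0//.
    by rewrite ler_pM2l.
  rewrite exprMn real_normK ?num_real//; apply: ler_pM; rewrite ?sqr_ge0//; last by rewrite lerDl sqr_ge0.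
  by rewrite lerDr.
have small p : unit_disc p -> enorm (h p - x0) <= rho.
  move=> up; rewrite /h /spiral_strip addrAC subrr add0r.
  apply: le_trans (enorm_mulmx _ _) _; apply: le_trans muE.
  rewrite ler_wpM2l ?mxbnd_ge0//; apply: le_trans (enorm_spiral_row i01 _ _ _) _.
  rewrite enormZ (gtr0_norm mu0) mulrDr mulr1; apply: lerD; last first.
    by rewrite ger_pMr.
  have /andP[_ l1] := lin1b p up.
  have e1 : expR (spiral_lin1 i0 i1 K eta p) <= expR 2 by rewrite ler_expR.
  have e0 := expR_gt0 (spiral_lin1 i0 i1 K eta p).
  have ha x : `|x| <= 1 -> `|mu * (expR (spiral_lin1 i0 i1 K eta p) * x)| <= mu * expR 2.
    move=> x1; rewrite !normrM (gtr0_norm mu0) (gtr0_norm e0) ler_pM2l//.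
    by rewrite -[X in _ <= X]mulr1 ler_pM// ltW.
  have c1 : `|cos (spiral_lin2 i0 i1 K eta p)| <= 1 by rewrite ler_norml cos_geN1 cos_le1.
  have s1 : `|sin (spiral_lin2 i0 i1 K eta p)| <= 1 by rewrite ler_norml sin_geN1 sin_le1.
  have := ha _ c1; have := ha _ s1; rewrite /spiral_x /spiral_y; lra.
have dif p : differentiable h p by exact: spiral_strip_differentiable.
have emb : embedded_disc h.
  split=> //.
  - exact: spiral_strip_jacobian_continuous.
  - move=> p up; apply: row_freeP_ker => v; rewrite /h spiral_strip_jacobian// => h0.
    have r0' : spiral_row i0 i1 (spiral_lin1 i0 i1 K eta v * spiral_x i0 i1 mu K eta p - spiral_lin2 i0 i1 K eta v * spiral_y i0 i1 mu K eta p)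
       (spiral_lin1 i0 i1 K eta v * spiral_y i0 i1 mu K eta p + spiral_lin2 i0 i1 K eta v * spiral_x i0 i1 mu K eta p) (mu *: v) = 0.
      have := hb (spiral_row i0 i1 (spiral_lin1 i0 i1 K eta v * spiral_x i0 i1 mu K eta p - spiral_lin2 i0 i1 K eta v * spiral_y i0 i1 mu K eta p)
       (spiral_lin1 i0 i1 K eta v * spiral_y i0 i1 mu K eta p + spiral_lin2 i0 i1 K eta v * spiral_x i0 i1 mu K eta p) (mu *: v)).
      rewrite h0 enorm0 pmulr_rle0// => hh; apply: enorm_eq0; apply/eqP.
      by rewrite eq_le hh enorm_ge0.
    have s0 := spiral_jacobian_sq i0 i1 mu K eta p v.
    have c0 := congr1 (fun w : 'rV[R]_d => w 0 i0) r0'; rewrite !mxE eqxx in c0.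
    have c1 := congr1 (fun w : 'rV[R]_d => w 0 i1) r0'; rewrite !mxE eqxx eq_sym (negPf i01) in c1.
    rewrite c0 c1 expr0n /= addr0 in s0.
    have me : 0 < (mu * expR (spiral_lin1 i0 i1 K eta p)) ^+ 2 by rewrite exprn_gt0// mulr_gt0// expR_gt0.
    have K1 : 0 < 1 + K ^+ 2 by have := sqr_ge0 K; lra.
    move/esym/eqP: s0; rewrite mulf_eq0 (gt_eqF me) /= mulf_eq0 (gt_eqF K1) /=.
    rewrite paddr_eq0 ?sqr_ge0// !sqrf_eq0 mulf_eq0 (gt_eqF eta0) /= => /andP[/eqP v0 /eqP v1].
    apply/rowP => j; rewrite [RHS]mxE; have [->//|ji0] := eqVneq j i0.
    have [->//|ji1] := eqVneq j i1.
    have := congr1 (fun w : 'rV[R]_d => w 0 j) r0'; rewrite !mxE (negPf ji0) (negPf ji1).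
    by move/eqP; rewrite mulf_eq0 (gt_eqF mu0) => /eqP.
  - move=> p q; rewrite !inE => up uq /tprojP hpq.
    have hh : h p = h q.
      apply/rowP => j; apply/eqP; rewrite -subr_eq0; apply/eqP.
      have := hpq j; rewrite rVBE => /int_lt1; apply.
      have e1 := coord_le_enorm (h p - h q) j; rewrite rVBE in e1.
      have e2 := enormB (h p - x0) (h q - x0).
      have e3 : h p - x0 - (h q - x0) = h p - h q by rewrite opprB subrKA.
      rewrite e3 in e2; have := small p up; have := small q uq; lra.
    move: hh; rewrite /h /spiral_strip => /addrI/(row_free_inj Bf) hh.
    have c0 := congr1 (fun w : 'rV[R]_d => w 0 i0) hh; rewrite !mxE eqxx in c0.
    have c1 := congr1 (fun w : 'rV[R]_d => w 0 i1) hh; rewrite !mxE eqxx eq_sym (negPf i01) in c1.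
    rewrite /spiral_x /spiral_y in c0 c1.
    have {}c0 := mulfI (lt0r_neq0 mu0) c0; have {}c1 := mulfI (lt0r_neq0 mu0) c1.
    set cp := cos (spiral_lin2 i0 i1 K eta p) in c0; set sp := sin (spiral_lin2 i0 i1 K eta p) in c1.
    set cq := cos (spiral_lin2 i0 i1 K eta q) in c0; set sq := sin (spiral_lin2 i0 i1 K eta q) in c1.
    set ep := expR (spiral_lin1 i0 i1 K eta p) in c0 c1.
    set eq := expR (spiral_lin1 i0 i1 K eta q) in c0 c1.
    have ep0 : 0 < ep := expR_gt0 _; have eq0 : 0 < eq := expR_gt0 _.
    have hp : cp ^+ 2 + sp ^+ 2 = 1 by exact: cos2Dsin2.
    have hq : cq ^+ 2 + sq ^+ 2 = 1 by exact: cos2Dsin2.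
    have e2 : ep ^+ 2 = eq ^+ 2.
      transitivity ((ep * cp) ^+ 2 + (ep * sp) ^+ 2); first by rewrite !exprMn -mulrDr hp mulr1.
      by rewrite c0 c1 !exprMn -mulrDr hq mulr1.
    have e1 : ep = eq by apply/eqP; rewrite -(eqrXn2 (ltn0Sn 1)) ?ltW// e2.
    have L1 : spiral_lin1 i0 i1 K eta p = spiral_lin1 i0 i1 K eta q by apply: expR_inj.
    rewrite e1 in c0 c1.
    have {}c0 := mulfI (lt0r_neq0 eq0) c0; have {}c1 := mulfI (lt0r_neq0 eq0) c1.
    set dl := spiral_lin2 i0 i1 K eta p - spiral_lin2 i0 i1 K eta q.
    have cd : cos dl = 1.
      by rewrite cosB -/cp -/sp -/cq -/sq c0 c1 -!expr2 hq.
    have p1 := le_trans (coord_le_enorm p i1) up; have q1 := le_trans (coord_le_enorm q i1) uq.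
    rewrite ler_norml in p1; rewrite ler_norml in q1.
    have dlE : dl = (K ^+ 2 + 1) * eta * (p 0 i1 - q 0 i1).
      have : p 0 i0 - q 0 i0 = K * eta * (p 0 i1 - q 0 i1).
        by move: L1; rewrite /spiral_lin1 mulrBr; lra.
      rewrite /dl /spiral_lin2 => hE.
      rewrite (_ : K * p 0 i0 + eta * p 0 i1 - _ = K * (p 0 i0 - q 0 i0) + eta * (p 0 i1 - q 0 i1)); last ring.
      by rewrite hE; ring.
    have ke : 0 < (K ^+ 2 + 1) * eta by rewrite mulr_gt0//; have := sqr_ge0 K; lra.
    have dl1 : `|dl| <= 1.
      rewrite dlE normrM (gtr0_norm ke).
      have : `|p 0 i1 - q 0 i1| <= 2 by rewrite ler_norml; lra.
      have := normr_ge0 (p 0 i1 - q 0 i1); nra.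
    have dl0 : `|dl| = 0.
      apply: cos_inj; rewrite ?in_itv /= ?lexx ?normr_ge0 ?pi_ge0 //=.
        by apply: le_trans dl1 _; have := @pi_ge2 R; lra.
      rewrite cos0; case: (ger0P dl) => _; by rewrite ?cosN.
    move/eqP: dl0; rewrite normr_eq0 dlE mulf_eq0 (gt_eqF ke) subr_eq0 => /eqP pq1.
    have pq0 : p 0 i0 = q 0 i0 by move: L1; rewrite /spiral_lin1 pq1; lra.
    apply/rowP => j; have [->//|ji0] := eqVneq j i0.
    have [->//|ji1] := eqVneq j i1.
    have := congr1 (fun w : 'rV[R]_d => w 0 j) hh; rewrite !mxE (negPf ji0) (negPf ji1).
    by move/(mulfI (lt0r_neq0 mu0)).
exists h; split=> //.
- by move=> p v; eexists; rewrite /h spiral_strip_jacobian.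
- apply: (@lt_le_trans _ _ (2 * (b * (mu * expR (- 2) * K)))%:E); first by rewrite lte_fin.
  apply: (internal_diameter_ge (i := i0)) => //.
    by rewrite !mulr_ge0 ?expR_ge0// ltW.
  move=> p up v; rewrite /h spiral_strip_jacobian// -mulrA.
  apply: le_trans (hb _); rewrite ler_pM2l//.
  by apply: le_trans (rowb p v up) _; exact: spiral_row_lower.
Qed.

(** * First hitting times and curves *)

Section FirstHit.
Context {R : realType}.

Lemma first_hit (G : R -> R) (r t0 t1 : R) : continuous G -> t0 <= t1 -> G t0 <= r -> r <= G t1 ->
  exists t, [/\ t0 <= t <= t1, G t = r & forall u, t0 <= u <= t -> G u <= r].
Proof.
move=> cG t01 G0 G1.
pose S := `[t0, t1]%classic `&` (G @^-1` [set y | r <= y]).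
have cS : compact S.
  apply: (@subclosed_compact _ _ `[t0, t1]%classic); last by move=> x [].
    apply: closedI; first exact: itv_closed.
    by apply: closed_comp; [move=> x _; exact: cG|exact: closed_ge].
  exact: segment_compact.
have S0 : S !=set0 by exists t1; split; rewrite //= in_itv /= t01 lexx.
have cid : continuous (fun x : R => x) by move=> x; exact: cvg_id.
have [t tS tmin] := compact_EVT_min S0 cS (continuous_subspaceT cid).
move: tS; rewrite inE => -[]; rewrite /= in_itv /= => /andP[t0t tt1] rG.
have before u : t0 <= u -> u < t -> G u < r.
  move=> u0 ut; rewrite ltNge; apply/negP => rGu.
  have := tmin u; rewrite inE => /(_ _); rewrite leNgt ut => h.
  suff : false by []; apply: h; split => //=; rewrite in_itv /= u0 /=; exact: le_trans (ltW ut) tt1.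
have Gt : G t = r.
  apply/eqP; rewrite eq_le rG andbT leNgt; apply/negP => rGt.
  have [c] := @IVT _ G t0 t r t0t (continuous_subspaceT cG) ltac:(by rewrite ge_min G0 le_max (ltW rGt) orbT).
  rewrite in_itv /= => /andP[c0 ct] Gc.
  have [ct'|ct'] := ltP c t; first by have := before c c0 ct'; rewrite Gc ltxx.
  by move: rGt; rewrite (_ : t = c) ?Gc ?ltxx//; apply/eqP; rewrite eq_le ct ct'.
exists t; split=> //; first by rewrite t0t tt1.
move=> u /andP[u0]; rewrite le_eqVlt => /predU1P[->|ut]; first by rewrite Gt.
exact/ltW/before.
Qed.

End FirstHit.

Section Curves.
Context {R : realType} {n : nat}.
Local Notation T := (torus R n).
Local Notation V := ('rV[R]_n).

Lemma tdist_curve_continuous (g : R -> T) (x : T) : continuous g -> continuous (fun t => tdist x (g t)).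
Proof.
move=> cg t; apply/cvgrPdist_lt => e e0.
have nb : nbhs (g t) [set y | tdist (g t) y < e] by apply/torus_nbhsP; exists e.
have h' : \forall u \near t, tdist (g t) (g u) < e := cg t _ nb.
near=> u; have h : tdist (g t) (g u) < e by near: u.
have := tdistD (g t) x (g u); have := tdistD (g u) x (g t); rewrite (tdistC (g u) (g t)) => h1 h2.
rewrite ltr_norml; lra.
Unshelve. all: by end_near.
Qed.

Lemma line_continuous (x : T) (u : V) : continuous (fun t : R => x + tproj (t *: u)).
Proof.
move=> t U /torus_nbhsP[e e0 eU].
have d0 : 0 < e / (enorm u + 1) by rewrite divr_gt0// ltr_wpDl ?enorm_ge0.
suff : \forall s \near t, U (x + tproj (s *: u)) by [].
apply/nbhs_normP; exists (e / (enorm u + 1)) => //= s /= ts; apply: eU.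
have -> : x + tproj (s *: u) = x + tproj (t *: u) + tproj ((s - t) *: u).
  by rewrite -addrA -tprojD scalerBl subrKC.
apply: le_lt_trans (tdist_addr _ _) _; rewrite enormZ distrC.
move: ts; rewrite ltr_pdivlMr ?ltr_wpDl ?enorm_ge0// mulrDr mulr1.
by apply: le_lt_trans; rewrite lerDl.
Qed.

(* Disjoint consecutive arcs, each with endpoints at distance at least [r]. *)
Fixpoint steps (g : R -> T) (r : R) (m : nat) (s e : R) : Prop :=
  if m is m'.+1 then exists s' t, [/\ s <= s', s' <= t, r <= tdist (g s') (g t) & steps g r m' t e]
  else s <= e.

Lemma steps_le g r m s e : steps g r m s e -> s <= e.
Proof.
elim: m s => //= m IH s [s' [t [ss' s't _ /IH te]]].
by apply: le_trans ss' (le_trans s't te).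
Qed.

Lemma steps_mono g r m s0 s e : s0 <= s -> steps g r m s e -> steps g r m s0 e.
Proof.
case: m => [|m] s0s /=; first exact: le_trans.
by move=> [s' [t [ss' h1 h2 h3]]]; exists s', t; split=> //; exact: le_trans ss'.
Qed.

End Curves.

(** * Curves tangent to thickened cones *)

Section CurveDynamics.
Context {R : realType} {n : nat} (F : torus R n -> torus R n)
  (A E : torus R n -> 'M[R]_n) (C : torus R n -> set 'rV[R]_n)
  (lam kap b : R).
Local Notation T := (torus R n).
Local Notation V := ('rV[R]_n).

(** Domination maps the cone of aperture [a] into that of aperture [lam * a] ([thick_image]); strict
    invariance is what survives perturbation, while [C] is only known to be invariant. *)
Definition thick (a : R) (x : T) (v : V) := exists u e : V,
  [/\ C x u, (e <= E x)%MS, v = u + e & enorm e <= a * enorm u].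

(** Tangency through chords makes sense for continuous curves and passes to their images. Only arcs
    that stay within [r] of their origin count, since a curve may come back. *)
Definition tang (a r : R) (g : R -> T) (s e : R) := forall t t', s <= t -> t < t' -> t' <= e ->
  (forall u, t <= u <= t' -> tdist (g t) (g u) <= r) ->
  g t <> g t' /\ thick a (g t) (tlog (g t' - g t)).

Lemma tang_sub a r g s e s' e' : s <= s' -> e' <= e -> tang a r g s e -> tang a r g s' e'.
Proof. by move=> ss' ee' h t t' st tt' t'e; apply: h => //; [exact: le_trans st|exact: le_trans ee']. Qed.

Hypotheses (cF : continuous F) (cA : continuous A) (lam0 : 0 < lam) (lam8 : lam <= 8^-1)
  (CZ : forall x a u, C x u -> C x (a *: u))
  (CA : forall x u, C x u -> C (F x) (u *m A x))
  (C_exp : forall x u, C x u -> enorm u <= lam * enorm (u *m A x))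
  (EA : forall x (e : V), (e <= E x)%MS -> (e *m A x <= E (F x))%MS)
  (CE_dom : forall x u (e : V), C x u -> (e <= E x)%MS ->
     enorm (e *m A x) * enorm u <= lam * (enorm e * enorm (u *m A x)))
  (kap0 : 0 < kap)
  (tr : forall x u (e : V), C x u -> (e <= E x)%MS -> kap * enorm u <= enorm (u + e))
  (dec1 : forall x u v, C x u -> u != 0 -> exists (s : R) (e : V), (e <= E x)%MS /\ v = s *: u + e)
  (C_nontrivial : forall x, exists2 u, C x u & u != 0)
  (contC : forall eta : R, 0 < eta -> exists2 s, 0 < s & forall x y u, tdist x y < s -> C x u ->
     exists2 u', C y u' & enorm (u - u') <= eta * enorm u)
  (contE : forall eta : R, 0 < eta -> exists2 s, 0 < s & forall x y e, tdist x y < s ->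
     (e <= E x)%MS -> exists2 e', (e' <= E y)%MS & enorm (e - e') <= eta * enorm e)
  (b0 : 0 < b) (A_lower : forall x (v : V), b * enorm v <= enorm (v *m A x)).

(** The perturbation [q] is decomposed along the new cone vector and the center; transversality
    bounds both components, and they fit in the margin [a - a']. *)
Lemma thick_perturb (a' a : R) : 0 <= a' -> a' < a -> a <= 1 ->
  exists eta s, [/\ 0 < eta, 0 < s & forall x y v w, thick a' x v ->
    enorm (w - v) <= eta * enorm v -> tdist x y < s -> thick a y w].
Proof using CZ contC contE dec1 kap0 tr.
have locals := I.
move=> a'0 a'a a1; have kp := kap0.
have [K [K1 KE]] : exists K : R, 1 <= K /\ forall x u (e q : V), C x u -> (e <= E x)%MS ->
    enorm u <= K * enorm (u + e) /\ enorm e <= K * enorm (u + e).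
  have h : 0 < kap^-1 by rewrite invr_gt0.
  exists (1 + kap^-1); split; first by qlra.
  move=> x u e _ Cu eE; have h1 := tr Cu eE; have h3 := enormB (u + e) u; rewrite addrAC subrr add0r in h3.
  have h4 : enorm u <= kap^-1 * enorm (u + e) by rewrite mulrC ler_pdivlMr// mulrC.
  by rewrite mulrDl mul1r; have := enorm_ge0 (u + e); qlra.
have [eta [eta0 eta1 etaE]] : exists eta : R, [/\ 0 < eta, eta <= 1 & eta * (2 + 8 * K) <= a - a'].
  have h : 0 < 2 + 8 * K by qlra.
  exists (Num.min 1 ((a - a') / (2 + 8 * K))); split.
  - by rewrite lt_min ltr01 divr_gt0//; qlra.
  - by rewrite ge_min lexx.
  - by rewrite -ler_pdivlMr// ge_min lexx orbT.
have [s1 s10 h1] := contC eta0; have [s2 s20 h2] := contE eta0.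
exists eta, (Num.min s1 s2); split=> //; first by rewrite lt_min s10.
move=> x y v w [u [e [Cu eE -> eu]]] wv; rewrite lt_min => /andP[xy1 xy2].
have [u' Cu' uu'] := h1 x y u xy1 Cu; have [e' eE' ee'] := h2 x y e xy2 eE.
have a'1 : a' <= 1 by qlra.
have eu1 : enorm e <= enorm u.
  by apply: le_trans eu _; rewrite ler_piMl ?enorm_ge0.
have [u0|u0] := eqVneq u 0.
  move: wv; rewrite u0 enorm0 in eu1 *; have -> : e = 0.
    by apply: enorm_eq0; apply/eqP; rewrite eq_le eu1 enorm_ge0.
  rewrite addr0 enorm0 mulr0 subr0 => w0.
  have {w0} -> : w = 0 by apply: enorm_eq0; apply/eqP; rewrite eq_le w0 enorm_ge0.
  exists 0, 0; rewrite addr0 enorm0 mulr0 sub0mx; split=> //.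
  by rewrite -(scale0r u'); exact: CZ.
have up := enorm_gt0 u0.
pose q := (u - u') + (e - e') + (w - (u + e)).
have wE : w = u' + e' + q.
  by apply/rowP => j; rewrite /q !mxE; ring.
have k0 : enorm (w - (u + e)) <= 2 * (eta * enorm u).
  apply: le_trans wv _; rewrite mulrCA ler_pM2l//.
  by have := enormD u e; qlra.
have k1 : enorm q <= 4 * (eta * enorm u).
  apply: le_trans (enormD _ _) _; have := enormD (u - u') (e - e').
  have : eta * enorm e <= eta * enorm u by rewrite ler_pM2l.
  qlra.
have k2 : enorm u - eta * enorm u <= enorm u'.
  have := enorm_lower u (- (u - u')); rewrite subKr enormN; qlra.
have k20 : eta * enorm u <= 2^-1 * enorm u.
  rewrite ler_pM2r//; nra.
have u'0 : u' != 0.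
  by apply/eqP => h; move: k2; rewrite h enorm0; qlra.
have [sg [ep [epE qE]]] := dec1 q Cu' u'0.
have [k3 k4] := KE y (sg *: u') ep 0 (CZ sg Cu') epE.
rewrite -qE in k3 k4.
have k5 : K * enorm q <= K * (4 * (eta * enorm u)) by rewrite ler_pM2l//; qlra.
exists ((1 + sg) *: u'), (e' + ep); split.
- exact: CZ.
- exact: addmx_sub.
- rewrite wE qE scalerDl scale1r; apply/rowP => j; rewrite !mxE; ring.
- have k6 : enorm u' - enorm (sg *: u') <= enorm ((1 + sg) *: u').
    by rewrite scalerDl scale1r; exact: enorm_lower.
  have k7 := enormD e' ep.
  have k8 : enorm e' <= enorm e + eta * enorm e.
    by have := enormB e (e - e'); rewrite subKr; qlra.
  have k9 : eta * enorm e <= eta * (a' * enorm u) by rewrite ler_pM2l.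
  have a0 : 0 <= a by qlra.
  have k10 : a * (enorm u - eta * enorm u - K * (4 * (eta * enorm u))) <= a * enorm ((1 + sg) *: u').
    by rewrite ler_wpM2l//; qlra.
  have k11 : eta * (2 + 8 * K) * enorm u <= (a - a') * enorm u by rewrite ler_wpM2r// ltW.
  have k12 : eta * (a' * enorm u) <= eta * (1 * enorm u).
    by rewrite ler_pM2l// ler_pM2r.
  have p1 : 0 <= K * (eta * enorm u) by rewrite !mulr_ge0 ?enorm_ge0//; qlra.
  have k13 : a * (K * (eta * enorm u)) <= 1 * (K * (eta * enorm u)) by rewrite ler_wpM2r.
  have k14 : a * (eta * enorm u) <= 1 * (eta * enorm u) by rewrite ler_wpM2r// mulr_ge0 ?enorm_ge0// ltW.
  qlra.
Qed.

Lemma thick_image (a : R) x v : 0 <= a -> thick a x v -> thick (lam * a) (F x) (v *m A x).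
Proof using CA EA CE_dom lam0.
move=> a0 [u [e [Cu eE -> ea]]].
exists (u *m A x), (e *m A x); split; rewrite ?mulmxDl//; [exact: CA|exact: EA|].
have [u0|u0] := eqVneq u 0.
  move: ea; rewrite u0 enorm0 mulr0 => e0.
  have -> : e = 0 by apply: enorm_eq0; apply/eqP; rewrite eq_le e0 enorm_ge0.
  by rewrite !mul0mx enorm0 mulr0.
rewrite -(ler_pM2r (enorm_gt0 u0)); apply: le_trans (CE_dom Cu eE) _.
rewrite -!mulrA ler_pM2l// mulrA [X in _ <= X](_ : _ = a * enorm u * enorm (u *m A x)); last ring.
by rewrite ler_wpM2r ?enorm_ge0.
Qed.

Lemma thick_step (a : R) : 0 < a -> a <= 1 -> exists eta s, [/\ 0 < eta, 0 < s &
  forall x y v w, thick a x v -> enorm (w - v *m A x) <= eta * enorm v ->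
    tdist (F x) y < s -> thick a y w].
Proof using A_lower CA CE_dom CZ EA b0 contC contE dec1 kap0 lam0 lam8 tr.
move=> a0 a1; have l0 := lam0; have l8 := lam8; have bp := b0.
have la0 : 0 <= lam * a by rewrite mulr_ge0 ?ltW.
have laa : lam * a < a by rewrite gtr_pMl//; lra.
have [eta [s [eta0 s0 h]]] := thick_perturb la0 laa a1.
exists (eta * b), s; split=> //; first exact: mulr_gt0.
move=> x y v w tv wv; apply: h; first exact: thick_image (ltW a0) tv.
by apply: le_trans wv _; rewrite -mulrA ler_pM2l.
Qed.

(** Here the rate [8^-1] is used: the cone component grows 8 times, the image of the center
    component is at most a quarter of that of the cone component, and the error costs half of
    [enorm v]. *)
Lemma thick_growth (a : R) x v w : 0 < a -> a <= 4^-1 -> thick a x v ->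
  enorm (w - v *m A x) <= 2^-1 * enorm v -> 4 * enorm v <= enorm w.
Proof using CA CE_dom C_exp EA lam0 lam8.
move=> a0 a4 [u [e [Cu eE -> ea]]] wv; have l0 := lam0; have l8 := lam8.
have tv : thick a x (u + e) by exists u, e.
have h1 := C_exp Cu.
have h2 : enorm (e *m A x) <= 4^-1 * enorm (u *m A x).
  have [u0|u0] := eqVneq u 0.
    move: ea; rewrite u0 enorm0 mulr0 => e0.
    have -> : e = 0 by apply: enorm_eq0; apply/eqP; rewrite eq_le e0 enorm_ge0.
    by rewrite !mul0mx enorm0 mulr0.
  have up := enorm_gt0 u0.
  rewrite -(ler_pM2r up); apply: le_trans (CE_dom Cu eE) _.
  have h : enorm e * enorm (u *m A x) <= 4^-1 * enorm u * enorm (u *m A x).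
    rewrite ler_wpM2r ?enorm_ge0//; apply: le_trans ea _.
    by rewrite ler_wpM2r ?enorm_ge0.
  rewrite mulrAC; apply: le_trans h; rewrite ler_piMl ?mulr_ge0 ?enorm_ge0//; lra.
have h3 : enorm u <= 8^-1 * enorm (u *m A x).
  by apply: le_trans h1 _; rewrite ler_wpM2r ?enorm_ge0.
have h4 := enorm_lower (u *m A x) (e *m A x); rewrite -mulmxDl in h4.
have h5 := enorm_lower ((u + e) *m A x) (w - (u + e) *m A x); rewrite subrKC in h5.
have h6 := enormD u e.
have h7 : a * enorm u <= 4^-1 * enorm u by rewrite ler_wpM2r ?enorm_ge0.
have := enorm_ge0 (u *m A x); lra.
Qed.

(* The conditions on a perturbation [g] of [F]. *)
Definition tame (a r : R) (g : T -> T) := forall x v, thick a x v -> enorm v <= r ->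
  thick a (g x) (local_expr g x v) /\ 4 * enorm v <= enorm (local_expr g x v).

Lemma near_lin_tame (a : R) : 0 < a -> a <= 4^-1 -> exists2 eta, 0 < eta &
  forall r g, capprox F A eta r g -> tame a r g.
Proof using A_lower CA CE_dom C_exp CZ EA b0 contC contE dec1 kap0 lam0 lam8 tr.
move=> a0 a4; have a1 : a <= 1 by lra.
have [eta [s [eta0 s0 h]]] := thick_step a0 a1.
exists (Num.min 2^-1 (Num.min eta s)); first by rewrite !lt_min invr_gt0 ltr0n eta0.
move=> r g [hd hl] x v tv vr.
have := hd x; rewrite !lt_min => /and3P[_ _ ds].
have h1 := hl x v vr.
have m1 : Num.min 2^-1 (Num.min eta s) <= 2^-1 by rewrite ge_min lexx.
have m2 : Num.min 2^-1 (Num.min eta s) <= eta by rewrite !ge_min lexx orbT.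
split.
  by apply: (h x _ v) => //; apply: le_trans h1 _; rewrite ler_wpM2r ?enorm_ge0.
apply: thick_growth tv _ => //; apply: le_trans h1 _.
by rewrite ler_wpM2r ?enorm_ge0.
Qed.

Section OneMap.
Variables (g : T -> T) (a0 r0 : R).
Hypotheses (cg : continuous g) (a00 : 0 < a0) (r00 : 0 < r0) (tame0 : tame a0 r0 g).

Lemma tlog_diff_local (x y : T) : tlog (g y - g x) = local_expr g x (tlog (y - x)).
Proof. by rewrite /local_expr tlogK [x + _]addrC subrK. Qed.

Lemma tang_growth a r c s e t t' : tame a r g -> tang a r c s e -> s <= t -> t < t' -> t' <= e ->
  (forall u, t <= u <= t' -> tdist (c t) (c u) <= r) ->
  4 * tdist (c t) (c t') <= tdist (g (c t)) (g (c t')).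
Proof.
move=> tm tg st tt' t'e h; have [_ tv] := tg t t' st tt' t'e h.
have vr : enorm (tlog (c t' - c t)) <= r by rewrite -/(tnorm _) -tdistE tdistC; apply: h; rewrite (ltW tt') lexx.
have [_] := tm _ _ tv vr.
by rewrite -tlog_diff_local -!/(tnorm _) -!tdistE ![tdist _ (c t)]tdistC ![tdist _ (g (c t))]tdistC.
Qed.

(* An arc whose image stays [r]-close to its origin was itself [r]-close: up to
   its first exit it is tangent to the cones, hence expanded. *)
Lemma tang_pullback a r c s e t t' : continuous c -> 0 < r -> tame a r g -> tang a r c s e ->
  s <= t -> t <= t' -> t' <= e ->
  (forall u, t <= u <= t' -> tdist (g (c t)) (g (c u)) <= r) ->
  forall u, t <= u <= t' -> tdist (c t) (c u) <= r.
Proof.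
move=> cc rp tm tg st tt' t'e h u /andP[tu ut']; rewrite leNgt; apply/negP => ru.
have [|w [/andP[tw wu] wr hw]] := first_hit (@tdist_curve_continuous R n c (c t) cc) tu _ (ltW ru).
  by rewrite tdistxx ltW.
have tw' : t < w.
  rewrite lt_def tw andbT; apply/eqP => E1; move: wr; rewrite E1 tdistxx => r0'.
  by move: rp; rewrite -r0' ltxx.
have := tang_growth tm tg st tw' (le_trans wu (le_trans ut' t'e)) hw.
have := h w; rewrite tw (le_trans wu ut') => /(_ isT); rewrite wr; lra.
Qed.

Lemma tang_image a r c s e : continuous c -> 0 < r -> tame a r g -> tang a r c s e -> tang a r (g \o c) s e.
Proof.
move=> cc rp tm tg t t' st tt' t'e h.
have h' := tang_pullback cc rp tm tg st (ltW tt') t'e h.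
have [ne tv] := tg t t' st tt' t'e h'.
have vr : enorm (tlog (c t' - c t)) <= r by rewrite -/(tnorm _) -tdistE tdistC; apply: h'; rewrite (ltW tt') lexx.
have [tw gr] := tm _ _ tv vr; split; last by rewrite /= tlog_diff_local.
move=> /= E1; move: gr; rewrite -tlog_diff_local E1 subrr tlog0 enorm0.
rewrite -/(tnorm _) -tdistE pmulr_rle0// => d0; apply: ne; apply/esym/tdist_eq0/eqP.
by rewrite eq_le d0 tdist_ge0.
Qed.

Lemma iter_curve_continuous k (c : R -> T) : continuous c -> continuous (iter k g \o c).
Proof.
move=> cc t; apply: (@continuous_comp _ _ _ c (iter k g)); first exact: cc.
exact: iter_continuous.
Qed.

Lemma tang_iter a r c s e k : continuous c -> 0 < r -> tame a r g -> tang a r c s e ->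
  tang a r (iter k g \o c) s e.
Proof.
move=> cc rp tm tg; elim: k => // k IH.
by apply: (@tang_image a r (iter k g \o c)) => //; exact: iter_curve_continuous.
Qed.

(** Up to its first exit from the ball of radius [q] the arc is short enough for the cone estimate,
    which multiplies its displacement by 4. *)
Lemma exit_persists c s e q t t' : continuous c -> tang a0 r0 c s e -> 0 < q -> q <= r0 ->
  s <= t -> t <= t' -> t' <= e -> q <= tdist (c t) (c t') ->
  exists w, [/\ t <= w <= t', tdist (c t) (c w) = q, forall u, t <= u <= w -> tdist (c t) (c u) <= q
    & 4 * q <= tdist (g (c t)) (g (c w))].
Proof.
move=> cc tg q0 qr st tt' t'e qd.
have [|w [/andP[tw wt'] wr hw]] := first_hit (@tdist_curve_continuous R n c (c t) cc) tt' _ qd.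
  by rewrite tdistxx ltW.
exists w; rewrite tw wt'; split=> //.
have tw' : t < w.
  rewrite lt_def tw andbT; apply/eqP => E1; move: wr; rewrite E1 tdistxx => r0'.
  by move: q0; rewrite -r0' ltxx.
rewrite -wr; apply: (tang_growth tame0 tg st tw' (le_trans wt' t'e)).
by move=> u /hw h; exact: le_trans qr.
Qed.

(** The image of an arc of displacement [r] moves by [4 * r]; cut at its first exit from the ball of
    radius [r], it keeps at least [3 * r] for a second step. *)
Lemma steps_double c s0 s e r m : continuous c -> tang a0 r0 c s0 e -> s0 <= s -> 0 < r -> r <= r0 ->
  steps c r m s e -> steps (g \o c) r (m + m) s e.
Proof.
move=> cc tg s0s rp rr; elim: m s s0s => // m IH s s0s [s' [t [ss' s't rd hs]]].
have te := steps_le hs.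
have s0t : s0 <= t by apply: le_trans s0s (le_trans ss' s't).
have [w [/andP[sw wt] wr hw h4]] := exit_persists cc tg rp rr (le_trans s0s ss') s't te rd.
have cgc : continuous (g \o c) by exact: (@iter_curve_continuous 1 c cc).
have [||w1 [/andP[sw1 w1w] w1r hw1]] := first_hit (@tdist_curve_continuous R n _ ((g \o c) s') cgc) (r := r) sw _ _.
- by rewrite tdistxx ltW.
- by apply: le_trans h4; lra.
have := IH _ s0t hs => h2m; rewrite addSn addnS /=.
exists s', w1; split=> //; first by rewrite /= in w1r; rewrite w1r.
exists w1, w; split=> //.
  have := tdistD ((g \o c) w1) ((g \o c) s') ((g \o c) w); move: w1r h4 => /=; lra.
exact: steps_mono h2m.
Qed.

Lemma steps_iter c s0 s e r m k : continuous c -> tang a0 r0 c s0 e -> s0 <= s -> 0 < r -> r <= r0 ->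
  steps c r m s e -> steps (iter k g \o c) r (m * 2 ^ k) s e.
Proof.
move=> cc tg s0s rp rr hs; elim: k => [|k IH]; first by rewrite muln1.
rewrite expnS mul2n -addnn mulnDr.
apply: (@steps_double (iter k g \o c) s0) => //.
  exact: iter_curve_continuous.
exact: tang_iter.
Qed.

(** At each time the arc is cut on the right, at the first exit of the new image from the ball of
    radius [q]; the earlier images only get shorter. *)
Lemma exit_iterates c s e q t t' k : continuous c -> tang a0 r0 c s e -> 0 < q -> q <= r0 ->
  s <= t -> t <= t' -> t' <= e -> q <= tdist (c t) (c t') ->
  exists w, [/\ t <= w <= t', tdist (iter k g (c t)) (iter k g (c w)) = q &
    forall j u, (j <= k)%N -> t <= u <= w -> tdist (iter j g (c t)) (iter j g (c u)) <= q].
Proof.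
move=> cc tg q0 qr st tt' t'e qd; elim: k => [|k [w [/andP[tw wt'] wq hw]]].
  have [w [tw wq hw _]] := exit_persists cc tg q0 qr st tt' t'e qd.
  by exists w; split=> // j u; rewrite leqn0 => /eqP ->; exact: hw.
have ck := @iter_curve_continuous k c cc.
have tk := @tang_iter a0 r0 c s e k cc r00 tame0 tg.
have [|v [/andP[tv vw] vq hv h4]] := exit_persists ck tk q0 qr st tw (le_trans wt' t'e).
  by rewrite /= wq.
have ck1 := @iter_curve_continuous k.+1 c cc.
have [||w1 [/andP[tw1 w1v] w1q hw1]] :=
    first_hit (@tdist_curve_continuous R n _ ((iter k.+1 g \o c) t) ck1) (r := q) tv.
- by rewrite tdistxx ltW.
- by apply: le_trans h4; lra.
exists w1; split=> //.
  by rewrite tw1 (le_trans w1v (le_trans vw wt')).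
move=> j u; rewrite leq_eqVlt => /predU1P[->|jk]; first exact: hw1.
move=> /andP[tu uw1]; apply: hw => //; rewrite tu; exact: le_trans uw1 (le_trans w1v vw).
Qed.

(** Otherwise all images stay small, and each iterate multiplies the distance between the end points
    by 4. *)
Lemma tiny_curve_grows c s e r : continuous c -> tang a0 r0 c s e -> s < e -> 0 < r -> r <= r0 ->
  exists k, steps (iter k g \o c) r 1 s e.
Proof.
move=> cc tg se rp rr; apply: contrapT => /forallNP no.
have sm k u : s <= u <= e -> tdist (iter k g (c s)) (iter k g (c u)) < r.
  move=> /andP[su ue]; rewrite ltNge; apply/negP => h.
  by apply: (no k); exists s, u; split.
have d0 : 0 < tdist (c s) (c e).
  rewrite lt_def tdist_ge0 andbT; apply/eqP => E1.
  have [|ne _] := tg s e (lexx _) se (lexx _).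
    by move=> u /(sm 0%N) /= h; apply/ltW/(lt_le_trans h).
  by apply: ne; exact: tdist_eq0.
have gr k : 4 ^+ k * tdist (c s) (c e) <= tdist (iter k g (c s)) (iter k g (c e)).
  elim: k => [|k IH]; first by rewrite expr0 mul1r.
  rewrite exprS -mulrA.
  have tk := @tang_iter a0 r0 c s e k cc r00 tame0 tg.
  have := tang_growth tame0 tk (lexx _) se (lexx _).
  have hh u : s <= u <= e -> tdist ((iter k g \o c) s) ((iter k g \o c) u) <= r0.
    by move=> /(sm k) h; apply/ltW/(lt_le_trans h).
  move=> /(_ hh) /=; apply: le_trans; by rewrite ler_pM2l.
have l4 : (1 : R) < 4 by lra.
have [k0 hk0] := expr_unbounded (r / tdist (c s) (c e)) l4.
have := hk0 k0 (leqnn _); rewrite ler_pdivrMr// => h1.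
by have := sm k0 e; rewrite (ltW se) lexx => /(_ isT); have := gr k0; lra.
Qed.

End OneMap.

Lemma segment_tang (a : R) (x0 : T) : 0 < a -> a <= 1 -> exists (u : V) (d : R),
  [/\ u != 0, 0 < d & forall e r, e <= d -> tang a r (fun t => x0 + tproj (t *: u)) 0 e].
Proof using CZ C_nontrivial contC contE dec1 kap0 tr.
move=> a00 a1; have [u Cu u0] := C_nontrivial x0.
have [eta [s [eta0 s0 h]]] := thick_perturb (lexx 0) a00 a1.
have up := enorm_gt0 u0.
have [d [d0 ds d4]] : exists d : R, [/\ 0 < d, d * enorm u < s & d * enorm u < 2^-1].
  have m0 : 0 < Num.min s 2^-1 by rewrite lt_min s0 /=; lra.
  exists (Num.min s 2^-1 / 2 / enorm u); rewrite divr_gt0 ?divr_gt0//.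
  have h2 : Num.min s 2^-1 / 2 < Num.min s 2^-1 by lra.
  by rewrite divfK ?gt_eqF//; split=> //; apply: (lt_le_trans h2); rewrite ge_min lexx ?orbT.
exists u, d; split=> //.
move=> e r ed t t' t0 tt' t'e _.
have nz y : 0 <= y -> y <= d -> enorm (y *: u) <= d * enorm u.
  by move=> y0 yd; rewrite enormZ ger0_norm// ler_wpM2r ?enorm_ge0.
have E1 : x0 + tproj (t' *: u) - (x0 + tproj (t *: u)) = tproj ((t' - t) *: u).
  by rewrite opprD addrACA subrr add0r -tprojB scalerBl.
have sm : enorm ((t' - t) *: u) < 2^-1.
  apply: le_lt_trans d4; apply: nz; lra.
have z0 : enorm ((t' - t) *: u) != 0.
  by rewrite enormZ mulf_neq0 ?gt_eqF// normr_gt0; lra.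
split.
  move=> E2; move/eqP: z0; apply; rewrite -(tlog_small sm) -E1 E2 subrr tlog0 enorm0 //.
rewrite E1 tlog_small//; apply: (h x0 _ ((t' - t) *: u)).
- by exists ((t' - t) *: u), 0; rewrite addr0 sub0mx enorm0 mul0r; split=> //; exact: CZ.
- by rewrite subrr enorm0 mulr_ge0 ?enorm_ge0 ?ltW.
apply: le_lt_trans (tdist_addr _ _) _; apply: le_lt_trans ds; apply: nz; lra.
Qed.

End CurveDynamics.

(** * The two halves of a one-dimensional cone *)

Section HalfCones.
Context {R : realType} {n : nat} (C : torus R n -> set 'rV[R]_n).
Local Notation T := (torus R n).
Local Notation V := ('rV[R]_n).

Lemma std_cone1_lo (i0 : 'I_n) (z : V) : i0 = 0%N :> nat -> enorm (lo_part 1 z) = `|z 0 i0|.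
Proof.
move=> i00; rewrite (_ : lo_part 1 z = z 0 i0 *: delta_mx 0 i0); last first.
  apply/rowP => j; rewrite !mxE eqxx /= -[j == i0]/(nat_of_ord j == nat_of_ord i0) i00.
  by rewrite ltnS leqn0; case: eqP => [e|_]; rewrite ?mulr0// mulr1; congr (z _ _); apply/val_inj; rewrite /= e.
rewrite enormZ (_ : enorm _ = 1) ?mulr1//.
apply/eqP; rewrite -[_ == _](@eqrXn2 _ 2) ?enorm_ge0 ?ler01// sqr_enorm expr1n.
rewrite (bigD1 i0)//= big1 ?addr0 => [|j ji0]; rewrite !mxE !eqxx ?expr1n//.
by rewrite (negbTE ji0) expr0n.
Qed.

(** A cone of dimension 1 is a double cone. The sign of [edot _ l] separates its halves,
    quantitatively and for all cones near [x], and each half is convex. *)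
Definition half_functional (s : R) (x : T) (l : V) := [/\ forall v, `|edot v l| <= enorm v,
  forall y u, tdist x y < s -> C y u -> s * enorm u <= `|edot u l| &
  forall y u v, tdist x y < s -> C y u -> C y v -> 0 <= edot u l -> 0 <= edot v l -> C y (u + v)].

(** The first coordinate in the frame at the center point, normalized. On vectors of nearby cones it
    differs from the first coordinate in their own frame by at most half of the latter. *)
Lemma cone_functional : (0 < n)%N -> continuous_cone_field 1 C ->
  exists2 s : R, 0 < s & forall x, exists l, half_functional s x l.
Proof.
have locals := I.
move=> n0 hC; pose i0 := Ordinal n0.
have [x0|s s0 h] := @torus_uniform R n (fun s x => exists l, half_functional s x l); last first.
  by exists (s / 2) => [|x]; [qlra|apply: h; qlra].
have [A /torus_nbhs_nearP[r0 r00 hA]] := hC x0.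
have [cA uA _] := hA x0 ltac:(by rewrite tdistxx).
pose N := mxbnd (invmx (A x0)) + 1.
have N0 : 0 < N by rewrite ltr_wpDl ?mxbnd_ge0.
pose B := mxbnd (A x0) + 1.
have B1 : 1 <= B by rewrite lerDr mxbnd_ge0.
have B0 : 0 < B by qlra.
have [z [z0 z1 z2]] : exists z : R, [/\ 0 < z, z <= 1 & N * z <= 4^-1].
  exists (Num.min 1 (4^-1 / N)); split.
  - by rewrite lt_min ltr01 divr_gt0.
  - by rewrite ge_min lexx.
  - by rewrite mulrC -ler_pdivlMr// ge_min lexx orbT.
have nn1 : (0 : R) < n%:R * n%:R + 1 by rewrite ltr_wpDl ?mulr_ge0.
have zn0 : 0 < z / (n%:R * n%:R + 1) by rewrite divr_gt0.
have [r1 r10 h1] := (torus_continuous_normP _ _).1 cA _ zn0.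
have Az y : tdist x0 y < r1 -> mxbnd (A x0 - A y) <= z.
  move=> /h1; rewrite ltr_pdivlMr// mulrC mulrDl mul1r => h2.
  by rewrite ltW//; apply: le_lt_trans h2; rewrite lerDl.
have AB y : tdist x0 y < r1 -> mxbnd (A y) <= B.
  move=> /Az hy; rewrite -[A y](subKr (A x0)); apply: le_trans (mxbndD _ _) _.
  by rewrite {2}/mxbnd normrN -/(mxbnd _) /B lerD2l (le_trans hy).
pose l' : V := \row_j invmx (A x0) j i0.
have l'E v : edot v l' = (v *m invmx (A x0)) 0 i0.
  by rewrite mxE; apply: eq_bigr => j _; rewrite mxE.
have key y (w : V) : tdist x0 y < r1 -> std_cone 1 w ->
    `|edot (w *m A y) l' - w 0 i0| <= 2^-1 * `|w 0 i0| /\ enorm (w *m A y) <= 2 * B * `|w 0 i0|.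
  move=> xy /std_coneE; rewrite (std_cone1_lo _ (erefl : i0 = 0%N :> nat)) => cw.
  have w2 : enorm w <= 2 * `|w 0 i0|.
    rewrite {1}(lo_hi 1 w); apply: le_trans (enormD _ _) _.
    by rewrite (std_cone1_lo _ (erefl : i0 = 0%N :> nat)); qlra.
  split.
    have -> : edot (w *m A y) l' - w 0 i0 = - (w *m (A x0 - A y) *m invmx (A x0)) 0 i0.
      by rewrite l'E mulmxBr mulmxBl mulmxK// !mxE opprB.
    rewrite normrN; apply: le_trans (coord_le_enorm _ _) _.
    apply: le_trans (enorm_mulmx _ _) _.
    have k1 : enorm (w *m (A x0 - A y)) <= z * enorm w.
      apply: le_trans (enorm_mulmx _ _) _; rewrite ler_wpM2r ?enorm_ge0//; exact: Az.
    have k2 : mxbnd (invmx (A x0)) * enorm (w *m (A x0 - A y)) <= N * (z * enorm w).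
      by apply: ler_pM => //; rewrite ?mxbnd_ge0 ?enorm_ge0// lerDl.
    have k3 : N * z * enorm w <= 4^-1 * enorm w by rewrite ler_wpM2r ?enorm_ge0.
    rewrite mulrA in k2; qlra.
  apply: le_trans (enorm_mulmx _ _) _.
  have k1 : mxbnd (A y) * enorm w <= B * enorm w by rewrite ler_wpM2r ?enorm_ge0// AB.
  have k2 : B * enorm w <= B * (2 * `|w 0 i0|) by rewrite ler_pM2l.
  qlra.
have [G [G1 hG]] : exists G, 1 <= G /\ enorm l' <= G.
  by exists (enorm l' + 1); rewrite lerDr lerDl enorm_ge0 ler01.
have G0 : 0 < G by qlra.
pose l := G^-1 *: l'.
have lE v : edot v l = G^-1 * edot v l' by rewrite edotZr.
have Gi : 0 < G^-1 by rewrite invr_gt0.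
exists (Num.min (Num.min r0 r1 / 2) ((4 * B * G)^-1)) => [|s x /andP[s0]].
  by rewrite lt_min divr_gt0 ?lt_min ?r00 ?invr_gt0 ?mulr_gt0.
rewrite !lt_min => /andP[sr sk] /andP[xr _].
have {}sr : s < r0 / 2 /\ s < r1 / 2.
  by move: sr; rewrite /Num.min; case: ifP; qlra.
have {}xr : tdist x0 x < r0 / 2 /\ tdist x0 x < r1 / 2.
  by move: xr; rewrite /Num.min; case: ifP; qlra.
have near y : tdist x y < s -> tdist x0 y < r0 /\ tdist x0 y < r1.
  by have := tdistD x x0 y; qlra.
exists l; split.
- move=> v; rewrite lE normrM gtr0_norm// mulrC ler_pdivrMr//.
  apply: le_trans (edot_le _ _) _; by rewrite ler_wpM2l ?enorm_ge0.
- move=> y u /near[y0 y1]; have [_ _ ->] := hA y y0 => -[w cw <-].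
  have [k1 k2] := key y w y1 cw.
  rewrite lE normrM (gtr0_norm Gi).
  have k3 : 2^-1 * `|w 0 i0| <= `|edot (w *m A y) l'|.
    by move: k1; rewrite ler_norml; case: (ger0P (w 0 i0)); case: (ger0P (edot _ _)); qlra.
  have k4 : s * enorm (w *m A y) <= (4 * B * G)^-1 * (2 * B * `|w 0 i0|).
    by apply: ler_pM => //; rewrite ?enorm_ge0// ltW.
  apply: le_trans k4 _; rewrite (_ : _ * _ = G^-1 * (2^-1 * `|w 0 i0|)) ?ler_pM2l//.
  by field; rewrite !gt_eqF.
- move=> y u v /near[y0 y1]; have [_ _ ->] := hA y y0 => -[w cw <-] [w' cw' <-].
  rewrite !lE !pmulr_rge0// => p p'.
  have [k1 _] := key y w y1 cw; have [k1' _] := key y w' y1 cw'.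
  have q : 0 <= w 0 i0 by move: k1; rewrite ler_norml; case: (ger0P (w 0 i0)) => //; qlra.
  have q' : 0 <= w' 0 i0 by move: k1'; rewrite ler_norml; case: (ger0P (w' 0 i0)) => //; qlra.
  exists (w + w'); last by rewrite mulmxDl.
  move/std_coneE: cw; move/std_coneE: cw'.
  rewrite !(std_cone1_lo _ (erefl : i0 = 0%N :> nat)) !ger0_norm// => d' d.
  apply/std_coneE; rewrite hi_partD !(std_cone1_lo _ (erefl : i0 = 0%N :> nat)) mxE ger0_norm ?addr_ge0//.
  by apply: le_trans (enormD _ _) _; qlra.
Qed.

End HalfCones.

Section Transfer.
Context {R : realType} {n : nat} (C : torus R n -> set 'rV[R]_n) (s : R) (lf : torus R n -> 'rV[R]_n).
Local Notation T := (torus R n).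
Local Notation V := ('rV[R]_n).
Hypotheses (s0 : 0 < s) (CZ : forall x a u, C x u -> C x (a *: u))
  (hl : forall x, half_functional C s x (lf x)).

Lemma edot0l (l : V) : edot 0 l = 0.
Proof. by rewrite -(scale0r 0) edotZl mul0r. Qed.

Lemma half_convex x y (u v : V) a b : tdist x y < s -> C y u -> C y v ->
  0 <= edot u (lf x) * edot v (lf x) -> 0 <= a -> 0 <= b -> C y (a *: u + b *: v).
Proof using CZ hl.
move=> xy Cu Cv uv a0 b0; have [_ _ h] := hl x.
have [|] := leP 0 (edot u (lf x)) => pu; have [|] := leP 0 (edot v (lf x)) => pv.
- by apply: (h y) => //; rewrite ?edotZl ?mulr_ge0//; exact: CZ.
- have {}pu : edot u (lf x) = 0 by nra.
  have -> : a *: u + b *: v = - 1 *: (- a *: u + - b *: v).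
    by rewrite !scaleN1r !scaleNr -opprD opprK.
  apply: CZ; apply: (h y) => //; rewrite ?edotZl ?pu; [exact: CZ|exact: CZ|lra|nra].
- have {}pv : edot v (lf x) = 0 by nra.
  have -> : a *: u + b *: v = - 1 *: (- a *: u + - b *: v).
    by rewrite !scaleN1r !scaleNr -opprD opprK.
  apply: CZ; apply: (h y) => //; rewrite ?edotZl ?pv; [exact: CZ|exact: CZ|nra|lra].
- have -> : a *: u + b *: v = - 1 *: (- a *: u + - b *: v).
    by rewrite !scaleN1r !scaleNr -opprD opprK.
  apply: CZ; apply: (h y) => //; rewrite ?edotZl; [exact: CZ|exact: CZ|nra|nra].
Qed.

(** If the signs disagreed at [x'], a positive combination of [u] and [v], which lies in the cone,
    would be killed by [lf x'] and hence vanish; but [lf x] does not vanish on it. *)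
Lemma half_transfer x x' y (u v : V) : tdist x y < s -> tdist x' y < s -> C y u -> C y v ->
  0 < edot u (lf x) * edot v (lf x) -> 0 < edot u (lf x') * edot v (lf x').
Proof using CZ hl s0.
have locals := I.
move=> xy x'y Cu Cv uv; have sp := s0.
have [_ k _] := hl x; have [_ k' _] := hl x'.
have nz (w : V) z : C y w -> edot w (lf z) != 0 -> tdist z y < s -> 0 < enorm w.
  move=> _ h _; apply: enorm_gt0; apply: contra_neq h => ->; exact: edot0l.
have u0 : edot u (lf x) != 0 by apply/eqP => h; move: uv; rewrite h mul0r ltxx.
have v0 : edot v (lf x) != 0 by apply/eqP => h; move: uv; rewrite h mulr0 ltxx.
have u0' : edot u (lf x') != 0.
  by apply/eqP => h; have := k' y u x'y Cu; rewrite h normr0 pmulr_rle0// leNgt (nz u x).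
have v0' : edot v (lf x') != 0.
  by apply/eqP => h; have := k' y v x'y Cv; rewrite h normr0 pmulr_rle0// leNgt (nz v x).
rewrite lt_def mulf_neq0//= leNgt; apply/negP => neg.
pose a := `|edot v (lf x')|; pose b := `|edot u (lf x')|.
have ap : 0 < a by rewrite normr_gt0.
have bp : 0 < b by rewrite normr_gt0.
have Cw : C y (a *: u + b *: v) by apply: (half_convex xy) => //; rewrite ltW.
have E0 : edot (a *: u + b *: v) (lf x') = 0.
  rewrite edotDl !edotZl /a /b; move: neg.
  by case: (ger0P (edot u (lf x'))); case: (ger0P (edot v (lf x'))) => p q pq; nra.
have w0 : enorm (a *: u + b *: v) = 0.
  apply/eqP; rewrite eq_le enorm_ge0 andbT.
  by have := k' y _ x'y Cw; rewrite E0 normr0 pmulr_rle0.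
have : edot (a *: u + b *: v) (lf x) = 0 by rewrite (enorm_eq0 w0) edot0l.
rewrite edotDl !edotZl => h.
have [pu|pu] := ltP 0 (edot u (lf x)).
  have pv : 0 < edot v (lf x) by rewrite -(pmulr_rgt0 _ pu).
  by have := mulr_gt0 ap pu; have := mulr_gt0 bp pv; qlra.
have {}pu : edot u (lf x) < 0 by rewrite lt_neqAle u0.
have pv : edot v (lf x) < 0 by rewrite -(nmulr_rgt0 _ pu).
have : a * edot u (lf x) < 0 by rewrite pmulr_rlt0.
have : b * edot v (lf x) < 0 by rewrite pmulr_rlt0.
qlra.
Qed.

Lemma half_lower x y (u v : V) a b : tdist x y < s -> C y u -> C y v ->
  0 <= edot u (lf x) * edot v (lf x) -> 0 <= a -> 0 <= b ->
  s * (a * enorm u + b * enorm v) <= `|edot (a *: u + b *: v) (lf x)|.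
Proof using hl.
move=> xy Cu Cv uv a0 b0; have [_ k _] := hl x.
have ku := k y u xy Cu; have kv := k y v xy Cv.
rewrite edotDl !edotZl.
have -> : `|a * edot u (lf x) + b * edot v (lf x)| = a * `|edot u (lf x)| + b * `|edot v (lf x)|.
  move: uv; case: (ger0P (edot u (lf x))); case: (ger0P (edot v (lf x))) => p q pq.
  - by rewrite ger0_norm// addr_ge0// mulr_ge0.
  - have -> : edot u (lf x) = 0 by nra.
    by rewrite mulr0 !add0r normrM (ger0_norm b0) (ltr0_norm p).
  - have -> : edot v (lf x) = 0 by nra.
    by rewrite mulr0 !addr0 normrM (ger0_norm a0) (ltr0_norm q).
  - by rewrite ler0_norm; [lra|nra].
have h1 : a * (s * enorm u) <= a * `|edot u (lf x)| by rewrite ler_wpM2l.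
have h2 : b * (s * enorm v) <= b * `|edot v (lf x)| by rewrite ler_wpM2l.
lra.
Qed.

End Transfer.

(** * Polygons and their smoothing *)

Section PolygonalCurves.
Context {R : realType} {n : nat}.
Local Notation V := ('rV[R]_n).

Definition pos (t : R) : R := Num.max 0 t.
Definition psq (t : R) : R := pos t ^+ 2.

Lemma pos_p t : 0 <= t -> pos t = t. Proof. by move=> h; rewrite /pos max_r. Qed.
Lemma pos_n t : t <= 0 -> pos t = 0. Proof. by move=> h; rewrite /pos max_l. Qed.

Lemma pos_lip x y : `|pos x - pos y| <= `|x - y|.
Proof.
rewrite /pos; case: (leP 0 x) => hx; case: (leP 0 y) => hy; rewrite ?(max_r hx) ?(max_l (ltW hx)) ?(max_r hy) ?(max_l (ltW hy));
 rewrite ?subr0 ?sub0r ?subrr ?normr0// !ler_norml; case: (ger0P (x - y)) => h; lra.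
Qed.

Lemma psq_taylor x k : `|psq (x + k) - psq x - 2 * pos x * k| <= k ^+ 2.
Proof.
rewrite /psq; case: (leP 0 x) => hx; case: (leP 0 (x + k)) => hk;
  rewrite ?(pos_p hx) ?(pos_n (ltW hx)) ?(pos_p hk) ?(pos_n (ltW hk)) ler_norml; nra.
Qed.

Lemma psq_derive (x : R) : is_derive x 1 psq (2 * pos x).
Proof.
have h : (fun k : R => k^-1 *: ((psq \o shift x) (k *: 1) - psq x)) @ 0^' --> 2 * pos x.
  apply/cvgrPdist_le => e e0; near=> k.
  have k0 : k != 0 by near: k; exact: nbhs_dnbhs_neq.
  have kk : 0 < `|k| by rewrite normr_gt0.
  have ke : `|k| <= e.
    near: k; apply: cvg_within; apply/nbhs_normP; exists e => //= z /=.
    by rewrite sub0r normrN => /ltW.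
  rewrite /= [k *: 1]mulr1 [k + x]addrC -(ler_pM2l kk) -normrM.
  have -> : k * (2 * pos x - k^-1 *: (psq (x + k) - psq x)) = - (psq (x + k) - psq x - 2 * pos x * k).
    rewrite mulrBr (mulVKf k0 (psq (x + k) - psq x)); ring.
  rewrite normrN; apply: le_trans (psq_taylor _ _) _.
  by rewrite -real_normK ?num_real// expr2 ler_wpM2l.
split; first by apply/cvg_ex; exists (2 * pos x).
exact: cvg_lim h.
Unshelve. all: by end_near.
Qed.

(* [spos b] is the average of [pos] over the interval of radius [b]. *)
Definition spos (b t : R) : R := (psq (t + b) - psq (t - b)) / (4 * b).

Lemma spos_close b t : 0 < b -> `|spos b t - pos t| <= b.
Proof.
move=> b0; have b4 : 0 < 4 * b by lra.
have h : `|psq (t + b) - psq (t - b) - pos t * (4 * b)| <= b * (4 * b).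
  rewrite /psq; case: (leP 0 (t + b)) => h1; case: (leP 0 (t - b)) => h2; case: (leP 0 t) => h3;
    rewrite ?(pos_p h1) ?(pos_n (ltW h1)) ?(pos_p h2) ?(pos_n (ltW h2)) ?(pos_p h3) ?(pos_n (ltW h3)) ler_norml; nra.
rewrite -(ler_pM2r b4); apply: le_trans h.
by rewrite -[X in _ * X](gtr0_norm b4) -normrM mulrBl /spos divfK ?gt_eqF// gtr0_norm.
Qed.

Lemma spos_derive (b t : R) : 0 < b -> is_derive t 1 (spos b) ((pos (t + b) - pos (t - b)) / (2 * b)).
Proof.
move=> b0.
have d1 (c : R) : is_derive t 1 (fun u => psq (u + c)) (2 * pos (t + c)).
  have d : is_derive t 1 (fun u : R => u + c) 1.
    by have := is_deriveD (is_derive_id t (1 : R)) (is_derive_cst c t 1); rewrite addr0.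
  have := @is_derive1_comp _ psq (fun u => u + c) t _ _ (psq_derive (t + c)) d.
  by rewrite mulr1.
have -> : spos b = (4 * b)^-1 \*: ((fun u => psq (u + b)) - (fun u => psq (u + - b))).
  by apply/funext => u; rewrite /spos mulrC.
have := is_deriveZ (4 * b)^-1 (is_deriveB (d1 b) (d1 (- b))).
rewrite [X in is_derive _ _ _ X](_ : _ = (pos (t + b) - pos (t - b)) / (2 * b))//.
have sE (x y : R) : x *: y = x * y by [].
by rewrite sE; field; rewrite gt_eqF.
Qed.

Variables (K : nat) (Q : nat -> V).
Local Notation w j := (Q j.+1 - Q j).

(** The coefficient of the [j]-th edge is a ramp from 0 to 1 over [[j, j + 1]], constant outside;
    vertices are reached at integer times. *)
Definition pl (t : R) : V := Q 0 + \sum_(j < K) (pos (t - j%:R) - pos (t - j.+1%:R)) *: w j.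

(** The average of [pl] over intervals of radius [b]. Its derivative is a chord of [pl] divided by
    [2 * b], which reduces tangency of the smooth curve to chords of the polygon. *)
Definition spl (b t : R) : V := Q 0 + \sum_(j < K) (spos b (t - j%:R) - spos b (t - j.+1%:R)) *: w j.

Lemma plE k (th : R) : (k < K)%N -> 0 <= th -> th <= 1 -> pl (k%:R + th) = Q k + th *: w k.
Proof.
move=> kK t0 t1; rewrite /pl -(big_mkord xpredT (fun j => (pos (k%:R + th - j%:R) - pos (k%:R + th - j.+1%:R)) *: w j)).
rewrite (big_cat_nat (n := k)) ?(ltnW kK)//= (big_ltn kK) [X in _ + (_ + (_ + X))]big1_seq ?addr0; last first.
  move=> j; rewrite mem_index_iota => /andP[_ /andP[kj _]].
  have : k%:R + 1 <= j%:R :> R by rewrite natr1 ler_nat.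
  by move=> h; rewrite !pos_n ?subrr ?scale0r// -?natr1; lra.
have -> : pos (k%:R + th - k%:R) - pos (k%:R + th - k.+1%:R) = th.
  by rewrite pos_p ?pos_n -?natr1; lra.
rewrite addrA; congr (_ + _).
have -> : \sum_(0 <= j < k) (pos (k%:R + th - j%:R) - pos (k%:R + th - j.+1%:R)) *: w j = Q k - Q 0.
  rewrite -(telescope_sumr Q (leq0n k)); apply: eq_big_nat => j /andP[_ jk].
  have h : j%:R + 1 <= k%:R :> R by rewrite natr1 ler_nat.
  by rewrite !pos_p -?natr1; [rewrite (_ : _ - _ = 1) ?scale1r//; lra|lra|lra].
by rewrite addrC subrK.
Qed.

Lemma edge_split (t : R) : (0 < K)%N -> 0 <= t -> t <= K%:R ->
  exists k th, [/\ (k < K)%N, 0 <= th, th <= 1 & t = k%:R + th].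
Proof.
move=> K0 t0 tK; have [E|/eqP tK'] := eqVneq t K%:R.
  exists K.-1, 1; rewrite prednK//; split=> //; by rewrite E natr1 prednK.
have := truncn_itv t0; set k := Num.truncn t => /andP[kt tk].
exists k, (t - k%:R); split.
- by rewrite -(ltr_nat R); apply: le_lt_trans kt _; rewrite lt_neqAle tK andbT; apply/eqP.
- lra.
- by move: tk; rewrite -natr1; lra.
- by rewrite addrC subrK.
Qed.

Lemma pl_chord (t t' : R) : (0 < K)%N -> 0 <= t -> t < t' -> t' <= K%:R -> t' - t <= 1 ->
  exists k a b th, [/\ (k < K)%N, 0 <= th <= 1, t = k%:R + th,
    [/\ 0 <= a, 0 <= b, a + b = t' - t & b = 0 \/ (k.+1 < K)%N] &
    pl t' - pl t = a *: w k + b *: w k.+1].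
Proof.
move=> K0 t0 tt' t'K d1.
have [k [th [kK th0 th1 tE]]] := edge_split K0 t0 (le_trans (ltW tt') t'K).
have [h|h] := leP t' k.+1%:R.
  have t'E : t' = k%:R + (t' - k%:R) by ring.
  exists k, (t' - t), 0, th; rewrite th0 th1; split=> //.
    by split; [lra|lra|lra|left].
  rewrite -natr1 in h.
  have e1 : pl t' = Q k + (t' - k%:R) *: w k by rewrite {1}t'E plE//; lra.
  have e2 : pl t = Q k + th *: w k by rewrite tE plE.
  rewrite e1 e2 scale0r addr0 opprD addrACA subrr add0r -scalerBl; congr (_ *: _); lra.
have k1K : (k.+1 < K)%N by rewrite -(ltr_nat R); exact: lt_le_trans h t'K.
have t'E : t' = k.+1%:R + (t' - k.+1%:R) by ring.
exists k, (1 - th), (t' - k.+1%:R), th; rewrite th0 th1; split=> //.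
  by split; [lra|lra|rewrite -natr1; lra|right].
have e1 : pl t' = Q k.+1 + (t' - k.+1%:R) *: w k.+1.
  rewrite {1}t'E plE//; first lra; by move: th1; rewrite -natr1; lra.
have e2 : pl t = Q k + th *: w k by rewrite tE plE.
rewrite e1 e2; by apply/rowP => i; rewrite !mxE; ring.
Qed.

Lemma pl_continuous : continuous pl.
Proof.
have cp (c : R) : continuous (fun t : R => pos (t - c)).
  move=> t; apply/cvgrPdist_le => e e0; near=> u.
  apply: le_trans (pos_lip _ _) _; rewrite opprB addrA subrK.
  near: u; apply/nbhs_normP; exists e => //= u /= ; exact: ltW.
move=> t; apply: cvgD; first exact: cvg_cst.
apply: cvg_big => [|j _]; first exact: add_continuous.
apply: cvgZl; apply: cvgB; exact: cp.
Unshelve. all: by end_near.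
Qed.

Lemma spl_close b (D t : R) : 0 < b -> (forall j, (j < K)%N -> enorm (w j) <= D) ->
  enorm (spl b t - pl t) <= K%:R * (2 * b * D).
Proof.
move=> b0 hD; rewrite /spl /pl opprD addrACA subrr add0r -sumrB.
apply: le_trans (enorm_sum _ _ _) _.
have -> : K%:R * (2 * b * D) = \sum_(j < K) (2 * b * D) by rewrite sumr_const card_ord mulr_natl.
apply: ler_sum => j _; rewrite -scalerBl enormZ; apply: ler_pM; rewrite ?enorm_ge0//; last exact: hD.
set x := t - j%:R; set y := t - j.+1%:R.
have := spos_close x b0; have := spos_close y b0; rewrite !ler_norml; lra.
Qed.

Lemma spl_derive b (t : R) (i : 'I_n) : 0 < b ->
  is_derive t 1 (fun t => spl b t 0 i) (((2 * b)^-1 *: (pl (t + b) - pl (t - b))) 0 i).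
Proof.
move=> b0.
have d1 (c : R) : is_derive t 1 (fun u => spos b (u - c)) ((pos (t - c + b) - pos (t - c - b)) / (2 * b)).
  have d : is_derive t 1 (fun u : R => u - c) 1.
    by have := is_deriveB (is_derive_id t (1 : R)) (is_derive_cst c t 1); rewrite subr0.
  have := @is_derive1_comp _ (spos b) (fun u => u - c) t _ _ (spos_derive (t - c) b0) d.
  by rewrite mulr1.
have -> : (fun t => spl b t 0 i) = cst (Q 0 0 i) +
    \sum_(j < K) (w j 0 i) \*: ((fun u => spos b (u - j%:R)) - (fun u => spos b (u - j.+1%:R))).
  apply/funext => u; rewrite /spl mxE summxE fctE; congr (_ + _).
  rewrite fct_sumE; apply: eq_bigr => j _; rewrite mxE mulrC //.
have dd : forall j : 'I_K, is_derive t 1 ((w j 0 i) \*: ((fun u => spos b (u - j%:R)) - (fun u => spos b (u - j.+1%:R))))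
    (w j 0 i *: ((pos (t - j%:R + b) - pos (t - j%:R - b)) / (2 * b) - (pos (t - j.+1%:R + b) - pos (t - j.+1%:R - b)) / (2 * b))).
  by move=> j; apply: is_deriveZ; apply: is_deriveB.
have := is_deriveD (is_derive_cst (Q 0 0 i) t 1) (is_derive_sum dd).
rewrite add0r [X in is_derive _ _ _ X](_ : _ = ((2 * b)^-1 *: (pl (t + b) - pl (t - b))) 0 i)//.
rewrite /pl opprD addrACA subrr add0r -sumrB mxE summxE mulr_sumr; apply: eq_bigr => j _.
have sE (x y : R) : x *: y = x * y by [].
rewrite !mxE sE.
have -> : t - j%:R + b = t + b - j%:R by ring.
have -> : t - j%:R - b = t - b - j%:R by ring.
have -> : t - j.+1%:R + b = t + b - j.+1%:R by ring.
have -> : t - j.+1%:R - b = t - b - j.+1%:R by ring.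
ring.
Qed.

End PolygonalCurves.

(** * Intermediate values for chords *)

Section CurveIVT.
Context {R : realType} {n : nat}.
Local Notation T := (torus R n).
Local Notation V := ('rV[R]_n).

(** Composing a curve with it extends the smallness known on [[a, b]] to the whole line, where
    [tlog] of the differences is then continuous. *)
Definition clamp (a b u : R) : R := a + pos (u - a) - pos (u - b).

Lemma clamp_id (a b u : R) : a <= u -> u <= b -> clamp a b u = u.
Proof. by move=> h1 h2; rewrite /clamp pos_p ?pos_n; lra. Qed.

Lemma clamp_itv (a b u : R) : a <= b -> a <= clamp a b u <= b.
Proof.
move=> ab; rewrite /clamp; case: (leP 0 (u - a)) => h1; case: (leP 0 (u - b)) => h2;
 rewrite ?(pos_p h1) ?(pos_n (ltW h1)) ?(pos_p h2) ?(pos_n (ltW h2)); lra.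
Qed.

Lemma clamp_continuous (a b : R) : continuous (clamp a b).
Proof.
have cp (c : R) : continuous (fun t : R => pos (t - c)).
  move=> t; apply/cvgrPdist_le => e e0; near=> u.
  apply: le_trans (pos_lip _ _) _; rewrite opprB addrA subrK.
  near: u; apply/nbhs_normP; exists e => //= u /= ; exact: ltW.
move=> t; apply: cvgB; last exact: cp.
by apply: cvgD; [exact: cvg_cst|exact: cp].
Unshelve. all: by end_near.
Qed.

Lemma edotBl (u v l : V) : edot (u - v) l = edot u l - edot v l.
Proof. by rewrite edotDl edotNl. Qed.

Lemma chord_ivt (G : R -> T) (z : T) (l : V) (a b : R) : continuous G -> a <= b ->
  (forall u, a <= u <= b -> tdist z (G u) < 4^-1) ->
  edot (tlog (G a - z)) l <= 0 -> 0 <= edot (tlog (G b - z)) l ->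
  exists2 t, a <= t <= b & edot (tlog (G t - z)) l = 0.
Proof.
move=> cG ab small Ga Gb.
pose H u := G (clamp a b u); pose psi (u : R) : R := edot (tlog (H u - z)) l.
have sm u : tdist z (H u) < 4^-1 by apply/small/clamp_itv.
have cpsi : continuous psi.
  move=> u; apply/cvgrPdist_le => e e0.
  have e1 : 0 < Num.min 4^-1 (e / (enorm l + 1)).
    by rewrite lt_min divr_gt0 ?ltr_wpDl ?enorm_ge0// andbT; lra.
  have cH : {for u, continuous H}.
    by apply: continuous_comp; [exact: clamp_continuous|exact: cG].
  have nb : nbhs (H u) [set y | tdist (H u) y < Num.min 4^-1 (e / (enorm l + 1))].
    by apply/torus_nbhsP; eexists; [exact: e1|].
  have h' : \forall v \near u, tdist (H u) (H v) < Num.min 4^-1 (e / (enorm l + 1)) := cH _ nb.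
  near=> v; have : tdist (H u) (H v) < Num.min 4^-1 (e / (enorm l + 1)) by near: v.
  rewrite lt_min => /andP[h1 h2].
  have E : tlog (H u - z) = tlog (H u - H v) + tlog (H v - z).
    have sm2 : tnorm (H u - H v) + tnorm (H v - z) < 2^-1.
      by move: h1 (sm v); rewrite (tdistC z) !tdistE; lra.
    by rewrite -tlogD// addrA subrK.
  rewrite /psi E edotDl addrK; apply: le_trans (edot_le _ _) _.
  rewrite -/(tnorm _) -tdistE; have := h2; rewrite ltr_pdivlMr ?ltr_wpDl ?enorm_ge0// => h3.
  by apply: le_trans (ltW h3); rewrite ler_wpM2l ?tdist_ge0// lerDl.
have Ha : psi a = edot (tlog (G a - z)) l by rewrite /psi /H clamp_id.
have Hb : psi b = edot (tlog (G b - z)) l by rewrite /psi /H clamp_id.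
have [t] := @IVT _ psi a b 0 ab (continuous_subspaceT cpsi) ltac:(by rewrite ge_min le_max Ha Hb Ga Gb orbT).
rewrite in_itv /= => /andP[t1 t2] h; exists t; first by rewrite t1.
by move: h; rewrite /psi /H clamp_id.
Unshelve. all: by end_near.
Qed.

Lemma chord_sign (G : R -> T) (z : T) (l : V) (a b : R) : continuous G -> a <= b ->
  (forall u, a <= u <= b -> tdist z (G u) < 4^-1) ->
  (forall u, a <= u <= b -> edot (tlog (G u - z)) l != 0) ->
  0 < edot (tlog (G a - z)) l * edot (tlog (G b - z)) l.
Proof.
move=> cG ab small nz.
have na : edot (tlog (G a - z)) l != 0 by apply: nz; rewrite lexx.
have nb : edot (tlog (G b - z)) l != 0 by apply: nz; rewrite lexx ab.
rewrite lt_def mulf_neq0//= leNgt; apply/negP => neg.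
have [t tab t0] : exists2 t, a <= t <= b & edot (tlog (G t - z)) l = 0.
  have [Ga|Ga] := leP (edot (tlog (G a - z)) l) 0.
    apply: chord_ivt => //; rewrite leNgt; apply/negP => Gb.
    by move: neg; rewrite ltNge mulr_le0// ltW.
  have Gb : edot (tlog (G b - z)) l < 0 by rewrite -(pmulr_rlt0 _ Ga).
  have [||t tab] := @chord_ivt G z (- l) a b cG ab small.
  - by rewrite edotC edotNl edotC oppr_le0 ltW.
  - by rewrite edotC edotNl edotC oppr_ge0 ltW.
  by rewrite edotC edotNl edotC => /eqP; rewrite oppr_eq0 => /eqP t0; exists t.
by move/eqP: (nz t tab).
Qed.

End CurveIVT.

(** One step for a displacement with cone component [s] and center component [e], up to an error
    [c]: the wide cone of aperture [G] is preserved. *)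
Lemma scalar_cone {R : realType} (G s s' e e' c : R) : 1 <= G -> `|s' - s| <= c ->
  e' <= 8^-1 * e + c -> c <= 8^-1 * `|s| -> e <= G * `|s| -> 0 <= e ->
  [/\ e' <= G * `|s'|, 7 / 8 * `|s| <= `|s'| & 0 < s -> 0 < s'].
Proof.
move=> G1 h1 h2 k1 i1 e0.
have h7 : 7 / 8 * `|s| <= `|s'|.
  by have := lerB_dist s (s - s'); rewrite subKr distrC; lra.
split=> //.
- have := normr_ge0 s; have : G * (7 / 8 * `|s|) <= G * `|s'| by rewrite ler_wpM2l//; lra.
  have : `|s| <= G * `|s| by rewrite ler_peMl.
  lra.
- move=> sp; move: h1; rewrite ler_norml (gtr0_norm sp) in k1 *; move=> /andP[]; lra.
Qed.

(** * Displacements in frames along an orbit *)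

Section Displacements.
Context {R : realType} {n : nat} (F : torus R n -> torus R n)
  (A E : torus R n -> 'M[R]_n) (C : torus R n -> set 'rV[R]_n)
  (lam kap b : R).
Local Notation T := (torus R n).
Local Notation V := ('rV[R]_n).
Hypotheses (cF : continuous F) (cA : continuous A) (lam0 : 0 < lam) (lam8 : lam <= 8^-1)
  (CZ : forall x a u, C x u -> C x (a *: u))
  (CA : forall x u, C x u -> C (F x) (u *m A x))
  (C_exp : forall x u, C x u -> enorm u <= lam * enorm (u *m A x))
  (EA : forall x (e : V), (e <= E x)%MS -> (e *m A x <= E (F x))%MS)
  (CE_dom : forall x u (e : V), C x u -> (e <= E x)%MS ->
     enorm (e *m A x) * enorm u <= lam * (enorm e * enorm (u *m A x)))
  (kap0 : 0 < kap)
  (tr : forall x u (e : V), C x u -> (e <= E x)%MS -> kap * enorm u <= enorm (u + e))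
  (dec1 : forall x u v, C x u -> u != 0 -> exists (s : R) (e : V), (e <= E x)%MS /\ v = s *: u + e)
  (nlF : forall eta : R, 0 < eta -> exists2 r, 0 < r & near_lin A eta r F).

(** A cone vector together with the functional dual to it along the center: [edot v l] is the
    coefficient of [u] in the decomposition of [v]. *)
Definition frame (x : T) (u l : V) :=
  [/\ C x u, u != 0, edot u l = 1 & forall e : V, (e <= E x)%MS -> edot e l = 0].

Lemma E_notin_C x u : C x u -> (u <= E x)%MS -> u = 0.
Proof using kap0 tr.
move=> Cu uE; apply: enorm_eq0; apply/eqP; rewrite eq_le enorm_ge0 andbT.
have uE' : (- u <= E x)%MS by rewrite eqmx_opp.
have := tr Cu uE'; rewrite subrr enorm0.
by rewrite pmulr_rle0.
Qed.

Lemma frame_ex x u : C x u -> u != 0 -> exists l, frame x u l.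
Proof using dec1 kap0 tr.
move=> Cu u0.
have uE : ~~ (u <= E x)%MS by apply: contra_neqN u0; exact: E_notin_C.
rewrite submxE in uE.
have [j hj] : exists j, (u *m cokermx (E x)) 0 j != 0.
  apply: contrapT => /forallNP h; move/negP: uE; apply; apply/eqP/rowP => j.
  by rewrite [RHS]mxE; apply/eqP/negPn/negP/h.
pose k := (u *m cokermx (E x)) 0 j; pose l : V := k^-1 *: \row_i cokermx (E x) i j.
have lE v : edot v l = k^-1 * (v *m cokermx (E x)) 0 j.
  rewrite edotZr; congr (_ * _); rewrite mxE; apply: eq_bigr => i _; by rewrite mxE.
exists l; split=> //; first by rewrite lE mulVf.
by move=> e; rewrite submxE => /eqP h; rewrite lE h mxE mulr0.
Qed.

Lemma frame_dec x u l v : frame x u l -> (v - edot v l *: u <= E x)%MS.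
Proof using dec1.
move=> [Cu u0 ul El]; have [s [e [eE ->]]] := dec1 v Cu u0.
by rewrite edotDl edotZl ul El// mulr1 addr0 addrAC subrr add0r.
Qed.

(** Measured in units of [enorm u]: when [u] is transported by the cocycle, the cone component of a
    displacement is then nearly constant while the center component contracts. *)
Definition center_part (u l v : V) : R := enorm (v - edot v l *: u) / enorm u.

Lemma frame_bound x u l v : frame x u l ->
  kap * (`|edot v l| * enorm u) <= enorm v /\
  center_part u l v * enorm u <= (1 + kap^-1) * enorm v.
Proof using CZ dec1 kap0 tr.
move=> fr; have [Cu u0 _ _] := fr; have eE := frame_dec v fr.
have up := enorm_gt0 u0.
have h : kap * (`|edot v l| * enorm u) <= enorm v.
  by have := tr (CZ (edot v l) Cu) eE; rewrite enormZ subrKC.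
split=> //; rewrite /center_part divfK ?gt_eqF// mulrDl mul1r.
apply: le_trans (enormB _ _) _; rewrite lerD2l enormZ [X in _ <= X]mulrC ler_pdivlMr//.
by rewrite mulrC.
Qed.

Lemma frame_norm u l v : u != 0 -> enorm v <= (`|edot v l| + center_part u l v) * enorm u.
Proof.
move=> u0; have up := enorm_gt0 u0.
rewrite mulrDl /center_part divfK ?gt_eqF//.
rewrite -{1}(subrK (edot v l *: u) v) addrC; apply: le_trans (enormD _ _) _.
by rewrite enormZ.
Qed.

Lemma center_part_ge0 u l v : 0 <= center_part u l v.
Proof. by rewrite divr_ge0 ?enorm_ge0. Qed.

(** The linear part keeps the cone component and multiplies the relative center component by [lam]
    at most; the error contributes through transversality. *)
Lemma frame_step eta x u l l' v v' : 0 <= eta -> frame x u l -> frame (F x) (u *m A x) l' ->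
  enorm (v' - v *m A x) <= eta * enorm v ->
  `|edot v' l' - edot v l| <= kap^-1 * eta * (`|edot v l| + center_part u l v) /\
  center_part (u *m A x) l' v' <= lam * center_part u l v +
     (1 + kap^-1) * eta * (`|edot v l| + center_part u l v).
Proof using CE_dom C_exp CZ EA dec1 kap0 lam0 lam8 tr.
move=> eta0 fr fr' err; have [Cu u0 ul El] := fr; have [Cu' u0' ul' El'] := fr'.
have l0 := lam0; have l8 := lam8; have kp : 0 < kap^-1 by rewrite invr_gt0.
have up := enorm_gt0 u0; have up' := enorm_gt0 u0'.
set s := edot v l; set w := v - s *: u; set d := v' - v *m A x.
have wE : (w <= E x)%MS by exact: frame_dec.
have vE : v = s *: u + w by rewrite /w subrKC.
have v'E : v' = s *: (u *m A x) + (w *m A x + d).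
  by rewrite addrA scalemxAl -mulmxDl -vE /d subrKC.
have se : edot v' l' = s + edot d l'.
  by rewrite v'E !edotDl edotZl ul' mulr1 (El' _ (EA wE)) add0r.
have [bd1 bd2] := frame_bound d fr'.
have uu : enorm u <= enorm (u *m A x).
  by apply: le_trans (C_exp Cu) _; rewrite ler_piMl ?enorm_ge0//; lra.
have dn : enorm d <= eta * (`|s| + center_part u l v) * enorm (u *m A x).
  apply: le_trans err _; rewrite -mulrA ler_wpM2l//.
  apply: le_trans (frame_norm l v u0) _; rewrite ler_wpM2l//.
  by rewrite addr_ge0 ?center_part_ge0.
have P : `|edot d l'| <= kap^-1 * eta * (`|s| + center_part u l v).
  rewrite -(ler_pM2r up') -(ler_pM2l kap0); apply: le_trans bd1 _.
  rewrite [X in _ <= X](_ : _ = eta * (`|s| + center_part u l v) * enorm (u *m A x))//.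
  by field; rewrite gt_eqF.
split; first by rewrite se addrAC subrr add0r.
rewrite -(ler_pM2r up') {1}/center_part divfK ?gt_eqF//.
have -> : v' - edot v' l' *: (u *m A x) = w *m A x + (d - edot d l' *: (u *m A x)).
  have gen (U W D : V) (s1 t : R) : s1 *: U + (W + D) - (s1 + t) *: U = W + (D - t *: U).
    by apply/rowP => j; rewrite !mxE; ring.
  by rewrite se {1}v'E; exact: gen.
apply: le_trans (enormD _ _) _.
have e1 : enorm (w *m A x) <= lam * center_part u l v * enorm (u *m A x).
  rewrite -(ler_pM2r up); apply: le_trans (CE_dom Cu wE) _.
  rewrite [X in _ <= X](_ : _ = lam * (enorm w * enorm (u *m A x)))//.
  by rewrite /center_part -/s -/w; field; rewrite gt_eqF.
have e2 : enorm (d - edot d l' *: (u *m A x)) <=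
    (1 + kap^-1) * eta * (`|s| + center_part u l v) * enorm (u *m A x).
  move: bd2; rewrite /center_part divfK ?gt_eqF// => /le_trans; apply.
  rewrite -!mulrA ler_pM2l; last lra.
  by rewrite mulrA.
rewrite mulrDl; lra.
Qed.

(* Chords seen from points close to the orbit of [x] follow the linear cocycle
   along this orbit. *)
Lemma displacement_step (eta : R) : 0 < eta -> exists2 r, 0 < r & forall x y z,
  tdist x y < r -> tdist y z < r ->
  enorm (tlog (F z - F y) - tlog (z - y) *m A x) <= eta * enorm (tlog (z - y)).
Proof using cA nlF.
move=> eta0; have e2 : 0 < eta / 2 by lra.
have [r1 r10 h1] := nlF e2; have [r2 r20 h2] := uniform_continuous_mx cA e2.
exists (Num.min r1 r2) => [|x y z]; first by rewrite lt_min r10.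
rewrite !lt_min => /andP[_ xy] /andP[yz _].
have -> : tlog (F z - F y) = local_expr F y (tlog (z - y)).
  by rewrite /local_expr tlogK [y + _]addrC subrK.
set v := tlog (z - y).
have vr : enorm v <= r1 by rewrite /v -/(tnorm _) -tdistE tdistC ltW.
have k1 := h1 y v vr.
have k2 : enorm (v *m (A y - A x)) <= eta / 2 * enorm v.
  apply: le_trans (enorm_mulmx _ _) _; rewrite ler_wpM2r ?enorm_ge0//.
  by apply/ltW/h2; rewrite tdistC.
have -> : local_expr F y v - v *m A x = (local_expr F y v - v *m A y) + v *m (A y - A x).
  by rewrite mulmxBr addrA subrK.
apply: le_trans (enormD _ _) _; lra.
Qed.

Section Orbit.
Variables (G : R) (x : T) (u : V) (l : nat -> V) (y z : T) (N : nat) (eta : R).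
Local Notation xk k := (iter k F x).
Local Notation uk k := (u *m cocyc F A k x).
Local Notation vk k := (tlog (iter k F z - iter k F y)).
Local Notation sk k := (edot (vk k) (l k)).
Local Notation ek k := (center_part (uk k) (l k) (vk k)).
Hypotheses (G1 : 1 <= G) (eta0 : 0 <= eta) (etaG : (1 + kap^-1) * eta * (1 + G) <= 8^-1)
  (fr : forall k, frame (xk k) (uk k) (l k))
  (st : forall k, (k < N)%N -> enorm (vk k.+1 - vk k *m A (xk k)) <= eta * enorm (vk k)).

Lemma orbit_step k : (k < N)%N ->
  `|sk k.+1 - sk k| <= (1 + kap^-1) * eta * (`|sk k| + ek k) /\
  ek k.+1 <= 8^-1 * ek k + (1 + kap^-1) * eta * (`|sk k| + ek k).
Proof using CE_dom C_exp CZ EA dec1 eta0 fr kap0 lam0 lam8 st tr.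
move=> kN; have fr' : frame (F (xk k)) (uk k *m A (xk k)) (l k.+1).
  by have := fr k.+1; rewrite /= mulmxA.
have [h1 h2] := frame_step eta0 (fr k) fr' (st kN).
have p0 : 0 <= `|sk k| + ek k by rewrite addr_ge0 ?center_part_ge0.
have p1 : 0 <= eta * (`|sk k| + ek k) by rewrite mulr_ge0.
have p2 := center_part_ge0 (uk k) (l k) (vk k).
split; first by apply: le_trans h1 _; rewrite -!mulrA mulrDl mul1r lerDr.
rewrite /= mulmxA; apply: le_trans h2 _; rewrite lerD2r ler_wpM2r//.
Qed.

Lemma orbit_cone k : (k <= N)%N -> ek 0 <= G * `|sk 0| ->
  [/\ ek k <= G * `|sk k|, `|sk 0| * (7 / 8) ^+ k <= `|sk k| & 0 < sk 0 -> 0 < sk k].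
Proof using CE_dom C_exp CZ EA G1 dec1 eta0 etaG fr kap0 lam0 lam8 st tr.
move=> + h0; elim: k => [|k IH] kN; first by rewrite expr0 mulr1.
have [i1 i2 i3] := IH (ltnW kN); have [h1 h2] := orbit_step kN.
have kp : 0 < kap^-1 by rewrite invr_gt0.
have e0 := center_part_ge0 (uk k) (l k) (vk k).
have c0 : 0 <= (1 + kap^-1) * eta by rewrite mulr_ge0//; lra.
have k1 : (1 + kap^-1) * eta * (`|sk k| + ek k) <= 8^-1 * `|sk k|.
  have : (1 + kap^-1) * eta * (1 + G) * `|sk k| <= 8^-1 * `|sk k| by rewrite ler_wpM2r.
  by apply: le_trans; rewrite -!mulrA !ler_wpM2l//; lra.
have [j1 j2 j3] := scalar_cone G1 h1 h2 k1 i1 e0.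
split=> [//||/i3/j3//].
rewrite exprS mulrCA; apply: le_trans j2; rewrite ler_wpM2l//; lra.
Qed.

(** A displacement outside the wide cone at time [N] was outside at all earlier times. Its center
    part then dominates the errors and contracts by [8^-1 + 8^-1] at each step. *)
Lemma orbit_center : G * `|sk N| < ek N -> ek N <= ek 0 * (1 / 4) ^+ N.
Proof using CE_dom C_exp CZ EA G1 dec1 eta0 etaG fr kap0 lam0 lam8 st tr.
have locals := I.
move=> hN.
have kp : 0 < kap^-1 by rewrite invr_gt0.
have c0 : 0 <= (1 + kap^-1) * eta by rewrite mulr_ge0//; qlra.
have all k : (k <= N)%N -> G * `|sk (N - k)| < ek (N - k).
  elim: k => [|k IH] kN; first by rewrite subn0.
  have := IH (ltnW kN); have EN : (N - k)%N = (N - k.+1).+1 by move: kN; clear; lia.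
  rewrite EN; set j := (N - k.+1)%N => hj.
  have jN : (j < N)%N by rewrite /j; move: kN; clear; lia.
  have [h1 h2] := orbit_step jN; rewrite ltNge; apply/negP => i1.
  have e0 := center_part_ge0 (uk j) (l j) (vk j).
  have k1 : (1 + kap^-1) * eta * (`|sk j| + ek j) <= 8^-1 * `|sk j|.
    have : (1 + kap^-1) * eta * (1 + G) * `|sk j| <= 8^-1 * `|sk j| by rewrite ler_wpM2r.
    by apply: le_trans; rewrite -!mulrA !ler_wpM2l//; qlra.
  by have [j1 _ _] := scalar_cone G1 h1 h2 k1 i1 e0; move: hj; rewrite ltNge j1.
have {}all k : (k <= N)%N -> `|sk k| <= ek k.
  move=> kN; have := all (N - k)%N (leq_subr _ _); rewrite subKn// => h.
  by apply: le_trans (ltW h); rewrite ler_peMl.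
suff h k : (k <= N)%N -> ek k <= ek 0 * (1 / 4) ^+ k by exact: h.
elim: k => [|k IH] kN; first by rewrite expr0 mulr1.
have [_ h2] := orbit_step kN; have i1 := IH (ltnW kN); have i2 := all k (ltnW kN).
have e0 := center_part_ge0 (uk k) (l k) (vk k).
have k1 : (1 + kap^-1) * eta * (`|sk k| + ek k) <= 8^-1 * ek k.
  have k2 : (1 + kap^-1) * eta * 2 * ek k <= (1 + kap^-1) * eta * (1 + G) * ek k.
    by rewrite ler_wpM2r// ler_wpM2l//; have := G1; qlra.
  have k3 : (1 + kap^-1) * eta * (1 + G) * ek k <= 8^-1 * ek k by rewrite ler_wpM2r.
  have k4 : (1 + kap^-1) * eta * (`|sk k| + ek k) <= (1 + kap^-1) * eta * 2 * ek k.
    rewrite -[X in _ <= X]mulrA ler_wpM2l//; qlra.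
  qlra.
rewrite exprSr mulrA; qlra.
Qed.

End Orbit.

End Displacements.

(** * One-dimensional discs from smooth curves *)

Section CurveDisc.
Context {R : realType} {n : nat}.
Local Notation V := ('rV[R]_n).
Variables (c D : R -> V) (a b : R).
Hypotheses (dc : forall (t : R) (i : 'I_n), is_derive t 1 (fun t => c t 0 i) (D t 0 i)) (cD : continuous D).

Definition curve_param (p : 'rV[R]_1) : R := (a + b) / 2 + (b - a) / 2 * p 0 0.
Definition curve_disc (p : 'rV[R]_1) : V := c (curve_param p).

Lemma curve_param_differentiable p : differentiable curve_param p.
Proof.
apply: differentiableD; first exact: differentiable_cst.
by apply: differentiableM; [exact: differentiable_cst|exact: differentiable_coord].
Qed.

Lemma curve_disc_differentiable p : differentiable curve_disc p.
Proof using dc.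
apply: differentiable_rV => j.
apply: (@differentiable_comp _ _ _ _ curve_param (fun t => c t 0 j)).
  exact: curve_param_differentiable.
by apply/derivable1_diffP; have [] := dc (curve_param p) j.
Qed.

Lemma curve_disc_jacobian p v :
  v *m 'J curve_disc p = (v 0 0 * ((b - a) / 2)) *: D (curve_param p).
Proof using dc.
apply: jacobian_line; first exact: curve_disc_differentiable.
move=> j; set k := v 0 0 * ((b - a) / 2).
have E (t : R) : curve_param (t *: v + p) = t * k + curve_param p.
  by rewrite /k /curve_param !mxE; ring.
have -> : (fun t : R => curve_disc (t *: v + p) 0 j) = (fun t : R => c (t * k + curve_param p) 0 j).
  by apply/funext => t; rewrite /curve_disc E.
have D1 : is_derive (0 : R) 1 (fun t : R => t * k + curve_param p) k.
  by apply: is_derive_eq; rewrite /GRing.scale/= !(mulr0, mul0r, add0r, addr0, mulr1).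
have := @is_derive1_comp _ (fun t => c t 0 j) (fun t : R => t * k + curve_param p) 0 _ _ (dc _ j) D1.
by rewrite mul0r add0r mxE mulrC.
Qed.

Lemma curve_disc_jacobianE p : 'J curve_disc p = ((b - a) / 2) *: D (curve_param p).
Proof using dc.
have := curve_disc_jacobian p (1%:M : 'rV[R]_1); rewrite mul1mx => ->.
by rewrite mxE eqxx mul1r.
Qed.

Lemma curve_disc_jacobian_continuous : continuous (fun p => 'J curve_disc p).
Proof using cD dc.
rewrite (_ : (fun p => _) = (fun p => ((b - a) / 2) *: D (curve_param p))); last first.
  by apply/funext => p; exact: curve_disc_jacobianE.
move=> p; have h : {for p, continuous (D \o curve_param)}.
  apply: continuous_comp; last exact: cD.
  exact: differentiable_continuous (curve_param_differentiable p).
by apply: cvgZr; [exact: (nbhs_filter p)|exact: h].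
Qed.

Lemma curve_param_itv p : a <= b -> unit_disc p -> a <= curve_param p <= b.
Proof.
move=> ab h; have : `|p 0 0| <= 1 by apply: le_trans (coord_le_enorm _ _) h.
by rewrite ler_norml /curve_param => /andP[h1 h2]; apply/andP; split; nra.
Qed.

End CurveDisc.

(** * Discs from embedded polygons *)

Section EmbeddedPolygons.
Context {R : realType} {n : nat} (C : torus R n -> set 'rV[R]_n) (s : R) (lf : torus R n -> 'rV[R]_n).
Local Notation T := (torus R n).
Local Notation V := ('rV[R]_n).
Hypotheses (s0 : 0 < s) (CZ : forall x a u, C x u -> C x (a *: u))
  (hl : forall x, half_functional C s x (lf x)).

Definition cone_polygon (dl d : R) (K : nat) (Q : nat -> V) :=
  (forall k, (k < K)%N -> dl <= enorm (Q k.+1 - Q k) <= d /\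
     forall y, tdist (tproj (Q k)) y < 6 * d -> C y (Q k.+1 - Q k)) /\
  (forall k, (k.+1 < K)%N ->
     0 < edot (Q k.+1 - Q k) (lf (tproj (Q k))) * edot (Q k.+2 - Q k.+1) (lf (tproj (Q k)))).

Variables (dl d : R) (K : nat) (Q : nat -> V).
Hypotheses (dl0 : 0 < dl) (d0 : 0 < d) (ds : 6 * d <= s) (d1 : 24 * d <= 1) (K3 : (2 < K)%N) (cQ : cone_polygon dl d K Q).
Local Notation w k := (Q k.+1 - Q k).
Local Notation S := (pl K Q).

(** A chord of parameter length at most 1 is a nonnegative combination of two consecutive edges in
    the same half cone: it lies in the cone, and the edges do not cancel. *)
Lemma polygon_chord (t t' : R) : 0 <= t -> t < t' -> t' <= K%:R -> t' - t <= 1 ->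
  [/\ forall y, tdist (tproj (S t)) y < 4 * d -> C y (S t' - S t),
      s * dl * (t' - t) <= enorm (S t' - S t) & enorm (S t' - S t) <= d * (t' - t)].
Proof using CZ K3 cQ d0 dl0 ds hl s0.
have locals := I.
move=> t0 tt' t'K td; have dp := d0; have dlp := dl0; have dss := ds; have sp := s0.
have K0 : (0 < K)%N by exact: ltn_trans K3.
have [k [a [b [th [kK /andP[th0 th1] tE [a0 b0 ab bk] ->]]]]] := pl_chord Q K0 t0 tt' t'K td.
have [hw hc] := cQ.
have [/andP[w1 w2] Cw] := hw k kK.
have near : tdist (tproj (Q k)) (tproj (S t)) <= d.
  rewrite tE plE//; apply: le_trans (tdist_proj _ _) _.
  rewrite opprD addrA subrr sub0r enormN enormZ ger0_norm//.
  by apply: le_trans w2; rewrite ler_piMl ?enorm_ge0.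
have [lb _ _] := hl (tproj (Q k)).
have xx : tdist (tproj (Q k)) (tproj (Q k)) < s by rewrite tdistxx.
have up : enorm (a *: w k + b *: w k.+1) <= a * enorm (w k) + b * enorm (w k.+1).
  by apply: le_trans (enormD _ _) _; rewrite !enormZ !ger0_norm.
case: bk => [b0'|k1K].
  have at' : a = t' - t by qlra.
  rewrite b0' scale0r addr0 enormZ ger0_norm// at'.
  have p0 : 0 <= t' - t by qlra.
  split.
  - move=> y hy; apply/CZ/Cw; have := tdistD (tproj (S t)) (tproj (Q k)) y; qlra.
  - have s1 : s <= 1.
      have [] := hl (tproj (Q k)) => hb hk _.
      have Ck : C (tproj (Q k)) (w k) by apply: Cw; rewrite tdistxx; qlra.
      have := hk _ _ xx Ck; have := hb (w k); move=> k1 k2.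
      rewrite -(ler_pM2r (_ : 0 < enorm (w k))) ?mul1r; [exact: le_trans k1|qlra].
    rewrite mulrC ler_wpM2l//; nra.
  - by rewrite mulrC ler_wpM2r.
have [/andP[w1' w2'] Cw'] := hw k.+1 k1K.
have near' : tdist (tproj (Q k)) (tproj (Q k.+1)) <= d.
  by apply: le_trans (tdist_proj _ _) _; rewrite enorm_distC.
have sg := hc k k1K.
have Ck : C (tproj (Q k)) (w k) by apply: Cw; rewrite tdistxx; qlra.
have Ck' : C (tproj (Q k)) (w k.+1) by apply: Cw'; rewrite tdistC; qlra.
split.
- move=> y hy.
  have yk : tdist (tproj (Q k)) y < 5 * d by have := tdistD (tproj (S t)) (tproj (Q k)) y; qlra.
  apply: (half_convex CZ hl (x := tproj (Q k))) => //; [qlra| | |exact: ltW].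
    by apply: Cw; qlra.
  by apply: Cw'; have := tdistD (tproj (Q k)) (tproj (Q k.+1)) y; rewrite (tdistC (tproj (Q k.+1)) (tproj (Q k))); qlra.
- apply: le_trans (lb _); apply: le_trans (half_lower hl xx Ck Ck' (ltW sg) a0 b0).
  rewrite -ab -mulrA ler_pM2l// mulrDr mulrC [dl * b]mulrC lerD// ler_wpM2l//.
- apply: le_trans up _; rewrite -ab mulrDr mulrC [d * b]mulrC; apply: lerD; rewrite ?[_ * a]mulrC ?ler_wpM2l//.
Qed.

Lemma polygon_lipschitz t t' : 0 <= t -> t <= t' -> t' <= K%:R -> t' - t <= 1 ->
  enorm (S t' - S t) <= d * (t' - t).
Proof using CZ K3 cQ d0 dl0 ds hl s0.
move=> t0; rewrite le_eqVlt => /predU1P[-> _ _|tt' t'K h].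
  by rewrite !subrr enorm0 mulr0.
by have [] := polygon_chord t0 tt' t'K h.
Qed.

Hypothesis (S_inj : forall t t' : R, 0 <= t <= K%:R -> 0 <= t' <= K%:R -> tproj (S t) = tproj (S t') -> t = t').

(** Compactness of the set of pairs of parameters at distance at least 1/2. *)
Lemma polygon_separation : exists2 m : R, 0 < m & forall t t' : R,
  0 <= t <= K%:R -> 0 <= t' <= K%:R -> 2^-1 <= `|t - t'| -> m <= tdist (tproj (S t)) (tproj (S t')).
Proof using S_inj K3.
pose D := (`[0, K%:R]%classic `*` `[0, K%:R]%classic) `&` [set z : R * R | 2^-1 <= `|z.1 - z.2|].
have cabs : continuous (fun z : R * R => `|z.1 - z.2|).
  move=> z; apply: (@continuous_comp _ _ _ (fun z : R * R => z.1 - z.2) (@Num.Def.normr R R)).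
    by apply: cvgB; [exact: cvg_fst|exact: cvg_snd].
  exact: norm_continuous.
have cB : compact (`[0, K%:R]%classic `*` `[0, K%:R]%classic : set (R * R)).
  by apply: compact_setX; exact: segment_compact.
have clD : closed (D : set (R * R)).
  apply: closedI.
    have -> : `[0, K%:R]%classic `*` `[0, K%:R]%classic =
        (@fst R R) @^-1` `[0, K%:R]%classic `&` (@snd R R) @^-1` `[0, K%:R]%classic by [].
    apply: closedI.
      by apply: closed_comp; [move=> z _; exact: cvg_fst|exact: itv_closed].
    by apply: closed_comp; [move=> z _; exact: cvg_snd|exact: itv_closed].
  have -> : [set z : R * R | 2^-1 <= `|z.1 - z.2|] = (fun z : R * R => `|z.1 - z.2|) @^-1` [set t | 2^-1 <= t] by [].
  by apply: closed_comp; [move=> z _; exact: cabs|exact: closed_ge].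
have cD : compact (D : set (R * R)) by apply: (subclosed_compact clD cB) => z [].
have K1 : 1 <= K%:R :> R by rewrite ler1n (ltn_trans _ K3).
have D0 : D !=set0.
  exists (0, 1); split.
    by split; rewrite /= in_itv /=; apply/andP; split; lra.
  by rewrite /= sub0r normrN normr1; lra.
pose G (z : R * R) := enorm (tlog (tproj (S z.1) - tproj (S z.2))).
have cG : continuous G.
  move=> z; apply/cvgrPdist_le => e e0.
  have e2 : 0 < e / 2 by lra.
  have near1 (pr : R * R -> R) : continuous pr -> \forall y \near z, enorm (S (pr z) - S (pr y)) < e / 2.
    move=> cpr; have [r r0 hr] := @enorm_cvg0 R n (e / 2) e2.
    have c : {for z, continuous (S \o pr)}.
      by apply: continuous_comp; [exact: cpr|exact: pl_continuous].
    move/cvgrPdist_lt: c => /(_ r r0); apply: filterS => u; exact: hr.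
  near=> y.
  have h1 : enorm (S z.1 - S y.1) < e / 2.
    by near: y; apply: (near1 fst) => u; exact: cvg_fst.
  have h2 : enorm (S z.2 - S y.2) < e / 2.
    by near: y; apply: (near1 snd) => u; exact: cvg_snd.
  rewrite /G -!/(tnorm _) -!tdistE.
  exact: tdist_lip (le_lt_trans (tdist_proj _ _) h1) (le_lt_trans (tdist_proj _ _) h2).
have [z zD zmin] := compact_EVT_min D0 cD (continuous_subspaceT cG).
move: zD; rewrite inE => -[[/= z1 z2] z3].
exists (G z).
  rewrite lt_def enorm_ge0 andbT; apply/eqP => E0.
  have := @S_inj z.1 z.2; rewrite !in_itv /= in z1 z2 => /(_ z1 z2).
  have : tproj (S z.1) = tproj (S z.2) by exact: tdist_eq0.
  by move=> e /(_ e) ee; move: z3; rewrite ee subrr normr0; lra.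
move=> t t' h h' tt'; have := zmin (t, t'); apply.
by rewrite inE; split; [split|]; rewrite //= in_itv.
Unshelve. all: by end_near.
Qed.

(** The polygon is smoothed at a small scale [be], so that all derivatives are chords in the cones.
    Far parameters are kept apart by [polygon_separation], near ones by Rolle's theorem for a
    functional of the cones. Trimming [be] at both ends keeps the chords inside the parameter
    interval. *)
Lemma polygon_disc (rho : R) : 0 < rho -> exists h : 'rV[R]_1 -> V, [/\ embedded_disc h, tangent_disc h C,
  forall p, unit_disc p -> exists2 t, 0 <= t <= K%:R & tdist (tproj (h p)) (tproj (S t)) < rho &
  (((K%:R - 2) * (s * dl))%:E <= internal_diameter h)%E].
Proof using CZ K3 S_inj cQ d0 d1 dl0 ds hl s0.
have locals := I.
move=> rho0; have dp := d0; have dlp := dl0; have dss := ds; have sp := s0; have d1' := d1.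
have [m m0 hm] := polygon_separation.
have K3' : 3 <= K%:R :> R by rewrite (ler_nat R 3).
have [mu [mu0 mu1 mu2 mu3]] : exists mu : R, [/\ 0 < mu, mu <= m / 4, mu <= d & mu < rho].
  exists (Num.min (m / 4) (Num.min d (rho / 2))); split.
  - by rewrite !lt_min d0 !divr_gt0.
  - by rewrite ge_min lexx.
  - by rewrite !ge_min lexx orbT.
  - have h : rho / 2 < rho by qlra.
    by rewrite !gt_min h !orbT.
have [be [be0 be1 be2]] : exists be : R, [/\ 0 < be, be <= 4^-1 & K%:R * (2 * be * d) <= mu].
  have h : 0 < K%:R * 2 * d by rewrite !mulr_gt0//; qlra.
  exists (Num.min 4^-1 (mu / (K%:R * 2 * d))); split.
  - by rewrite lt_min divr_gt0// andbT; qlra.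
  - by rewrite ge_min lexx.
  - have : Num.min 4^-1 (mu / (K%:R * 2 * d)) * (K%:R * 2 * d) <= mu.
      by rewrite -ler_pdivlMr// ge_min lexx orbT.
    by apply: le_trans; rewrite le_eqVlt; apply/orP; left; apply/eqP; ring.
have be20 : 0 < (2 * be)^-1 by rewrite invr_gt0; qlra.
have dw j : (j < K)%N -> enorm (w j) <= d by move=> /(cQ.1 j)[/andP[]].
have close t : enorm (spl K Q be t - S t) <= mu.
  by apply: le_trans (spl_close t be0 dw) be2.
pose D t := (2 * be)^-1 *: (S (t + be) - S (t - be)).
have cD : continuous D.
  have cS (x : R) : continuous (fun t : R => S (t + x)).
    move=> t; apply: (@continuous_comp _ _ _ (fun t : R => t + x) S).
      by apply: cvgD; [exact: cvg_id|exact: cvg_cst].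
    exact: pl_continuous.
  by move=> t; apply: cvgZr; apply: cvgB; exact: cS.
have dc (t : R) (i : 'I_n) : is_derive t 1 (fun t => spl K Q be t 0 i) (D t 0 i) by exact: spl_derive.
have ab : be <= K%:R - be by qlra.
pose h := curve_disc (spl K Q be) be (K%:R - be).
have chord t : be <= t <= K%:R - be -> [/\ forall y, tdist (tproj (S (t - be))) y < 4 * d -> C y (D t),
    s * dl <= enorm (D t) & enorm (D t) <= d].
  move=> /andP[t1 t2].
  have [||||k1 k2 k3] := @polygon_chord (t - be) (t + be); try qlra.
  have E : t + be - (t - be) = 2 * be by ring.
  rewrite E in k2 k3; split.
  - by move=> y hy; apply/CZ/k1.
  - by rewrite enormZ gtr0_norm// [X in _ <= X]mulrC ler_pdivlMr//; qlra.
  - by rewrite enormZ gtr0_norm// [X in X <= _]mulrC ler_pdivrMr//; qlra.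
have nearS t t' : 0 <= t -> t <= t' -> t' <= K%:R -> t' - t <= 1 -> tdist (tproj (S t)) (tproj (S t')) <= d.
  move=> k1 k2 k3 k4; apply: le_trans (tdist_proj _ _) _; rewrite enorm_distC.
  by apply: le_trans (polygon_lipschitz k1 k2 k3 k4) _; rewrite ler_piMr//; qlra.
have nearP t : tdist (tproj (S t)) (tproj (spl K Q be t)) <= mu.
  by apply: le_trans (tdist_proj _ _) _; rewrite enorm_distC.
have emb : embedded_disc h.
  split.
  - by move=> p; exact: curve_disc_differentiable.
  - exact: curve_disc_jacobian_continuous.
  - move=> p /(curve_param_itv ab)/chord[_ k _].
    rewrite /row_free (curve_disc_jacobianE _ _ dc) rank_rV.
    have q0 : 0 < (K%:R - be - be) / 2 by qlra.
    rewrite scaler_eq0 negb_or (gt_eqF q0) (_ : D _ != 0)//.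
    apply/eqP => E; move: k; rewrite E enorm0 leNgt mulr_gt0//; qlra.
  - move=> p p'; rewrite !inE => /(curve_param_itv ab) hp /(curve_param_itv ab) hp' E.
    have inj t t' : be <= t -> t < t' -> t' <= K%:R - be ->
        tproj (spl K Q be t) = tproj (spl K Q be t') -> False.
      move=> t0 tt' t'K E'.
      have [far|near] := leP 2^-1 (t' - t).
        have := hm t t'; rewrite distrC ger0_norm; last by qlra.
        have -> : 0 <= t <= K%:R by qlra.
        have -> : 0 <= t' <= K%:R by qlra.
        move=> /(_ isT isT far).
        have := tdistD (tproj (spl K Q be t)) (tproj (S t)) (tproj (S t')).
        have := nearP t; have := nearP t'; rewrite E' (tdistC (tproj (S t'))); qlra.
      (* The lifts differ by an integer vector of norm below 1. *)
      have e1 : spl K Q be t' = spl K Q be t.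
        apply/eqP; rewrite -subr_eq0; apply/eqP/rowP => i; rewrite rV0E.
        apply: int_lt1; first exact: ((tprojP _ _).1 (esym E')).
        apply: le_lt_trans (coord_le_enorm _ _) _.
        have -> : spl K Q be t' - spl K Q be t =
            (spl K Q be t' - S t') + (S t' - S t) + (S t - spl K Q be t).
          by rewrite [X in _ = X + _]addrA subrK addrA subrK.
        have i1 := enormD (spl K Q be t' - S t' + (S t' - S t)) (S t - spl K Q be t).
        have i2 := enormD (spl K Q be t' - S t') (S t' - S t).
        have i3 := close t'; have i4 := close t; rewrite enorm_distC in i4.
        have i5 := @polygon_lipschitz t t'.
        have {}i5 : enorm (S t' - S t) <= d * (t' - t) by apply: i5; qlra.
        have : d * (t' - t) <= d by rewrite ler_piMr//; qlra.
        qlra.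
      (* Equal end values would make this functional vanish on some derivative, a nonzero cone
         vector. *)
      pose l := lf (tproj (S t)).
      pose phi (u : R) := edot (spl K Q be u) l.
      have dphi (u : R) : is_derive u 1 phi (edot (D u) l).
        have -> : phi = \sum_(i < n) (l 0 i) \*: (fun u => spl K Q be u 0 i).
          by apply/funext => v; rewrite fct_sumE; apply: eq_bigr => i _; rewrite mulrC.
        have dd : forall i : 'I_n, is_derive u 1 (l 0 i \*: (fun u => spl K Q be u 0 i)) (l 0 i *: D u 0 i).
          by move=> i; apply: is_deriveZ.
        have := is_derive_sum dd.
        rewrite [X in is_derive _ _ _ X](_ : _ = edot (D u) l)//.
        by apply: eq_bigr => i _; rewrite mulrC.
      have cphi : {within `[t, t'], continuous phi}.
        by apply: derivable_within_continuous => u _; have [] := dphi u.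
      have [u] := @MVT R phi (fun u => edot (D u) l) t t' tt' (fun u _ => dphi u) cphi.
      rewrite in_itv /= => /andP[tu ut']; rewrite /phi e1 subrr => /esym/eqP.
      rewrite mulf_eq0 => /orP[/eqP z|/eqP]; last by qlra.
      have [|k1 k2 _] := chord u; first by qlra.
      have [_ hk _] := hl (tproj (S t)).
      have yd : tdist (tproj (S t)) (tproj (S (u - be))) <= d.
        have [tu'|tu'] := leP t (u - be); first by apply: nearS; qlra.
        by rewrite tdistC; apply: nearS; qlra.
      have := hk (tproj (S (u - be))) (D u); rewrite -/l z normr0 pmulr_rle0// => hh.
      have : enorm (D u) <= 0 by apply: hh; [qlra|apply: k1; rewrite tdistxx; qlra].
      have : 0 < s * dl by rewrite mulr_gt0//; qlra.
      qlra.
    have P : curve_param be (K%:R - be) p = curve_param be (K%:R - be) p'.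
      move: hp hp' E; rewrite /h /curve_disc; move: (curve_param _ _ p) (curve_param _ _ p').
      move=> t t' /andP[k1 k2] /andP[k3 k4] E.
      have [tt'|tt'|//] := ltgtP t t'; first by have := inj t t' k1 tt' k4 E.
      by have := inj t' t k3 tt' k2 (esym E).
    apply/rowP => i; rewrite ord1; move: P; rewrite /curve_param => /addrI.
    by apply: mulfI; rewrite gt_eqF// divr_gt0//; qlra.
exists h; split=> //.
- move=> p hp v; have := curve_param_itv ab hp; rewrite (curve_disc_jacobian _ _ dc) => ht.
  have [k1 _ _] := chord _ ht; apply/CZ/k1.
  rewrite /h /curve_disc; set t := curve_param _ _ p in ht *.
  have := nearS (t - be) t; have := nearP t.
  have := tdistD (tproj (S t)) (tproj (S (t - be))) (tproj (spl K Q be t)) => i1 i2 i3.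
  have : tdist (tproj (S (t - be))) (tproj (S t)) <= d by apply: i3; qlra.
  qlra.
- move=> p hp; have := curve_param_itv ab hp => ht; exists (curve_param be (K%:R - be) p); first qlra.
  by rewrite tdistC; apply: le_lt_trans mu3; exact: nearP.
- have k0 : 0 <= (K%:R / 2 - be) * (s * dl) by rewrite !mulr_ge0//; qlra.
  have hk p : unit_disc p -> forall v : 'rV[R]_1,
      (K%:R / 2 - be) * (s * dl) * `|v 0 0| <= enorm (v *m 'J h p).
    move=> /(curve_param_itv ab)/chord[_ k _] v; rewrite (curve_disc_jacobian _ _ dc) enormZ normrM.
    have -> : `|(K%:R - be - be) / 2| = K%:R / 2 - be by rewrite ger0_norm; qlra.
    rewrite mulrC -mulrA ler_wpM2l// ler_wpM2l//; qlra.
  apply: le_trans (internal_diameter_ge emb k0 hk); rewrite lee_fin.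
  have p0 : 0 <= s * dl by rewrite mulr_ge0//; qlra.
  rewrite [X in _ <= X]mulrA ler_wpM2r//; qlra.
Qed.

End EmbeddedPolygons.

(** At each step the center component loses the factor [7 / 2 = (7 / 8) / (1 / 4)] against the cone
    component, whose length [sN * nu] at time [N] is bounded by [K]. *)
Lemma shadow_bound {R : realType} (N : nat) (epN ep0 s0 sN nu G K rho : R) : 0 < rho -> 1 <= G ->
  epN <= ep0 * (1 / 4) ^+ N -> ep0 <= G * s0 -> s0 * (7 / 8) ^+ N <= sN -> sN * nu <= K ->
  G * K / rho < (7 / 2) ^+ N -> 0 < nu -> epN * nu < rho.
Proof.
move=> rho0 G1 hc e0 hsN hK hN nu0.
have E1 : (1 / 4 : R) = (7 / 8) * (7 / 2)^-1 by field.
have P0 : 0 < (7 / 2) ^+ N :> R by rewrite exprn_gt0//; lra.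
have P1 : 0 < ((7 / 2) ^+ N)^-1 :> R by rewrite invr_gt0.
have h1 : epN * nu <= G * K * ((7 / 2) ^+ N)^-1.
  apply: (@le_trans _ _ (G * (s0 * (7 / 8) ^+ N * nu) * ((7 / 2) ^+ N)^-1)).
    have -> : G * (s0 * (7 / 8) ^+ N * nu) * ((7 / 2) ^+ N)^-1 = G * s0 * (1 / 4) ^+ N * nu.
      have -> : (1 / 4 : R) ^+ N = (7 / 8) ^+ N * ((7 / 2) ^+ N)^-1.
        by rewrite -exprVn -exprMn E1.
      by move: ((7 / 8) ^+ N) ((7 / 2) ^+ N)^-1 => p1 p2; ring.
    rewrite (ler_pM2r nu0); apply: le_trans hc _; rewrite ler_wpM2r// exprn_ge0//; lra.
  rewrite (ler_pM2r P1) ler_wpM2l//; first lra.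
  by apply: le_trans hK; rewrite ler_pM2r.
by apply: le_lt_trans h1 _; rewrite ltr_pdivrMr// -ltr_pdivrMl// mulrC.
Qed.

(** * Shadowing of curves by images of segments *)

Section Shadow.
Context {R : realType} {n : nat} (F : torus R n -> torus R n)
  (A E : torus R n -> 'M[R]_n) (C : torus R n -> set 'rV[R]_n)
  (lam kap : R).
Local Notation T := (torus R n).
Local Notation V := ('rV[R]_n).
Hypotheses (cF : continuous F) (cA : continuous A) (lam0 : 0 < lam) (lam8 : lam <= 8^-1)
  (CZ : forall x a u, C x u -> C x (a *: u))
  (CA : forall x u, C x u -> C (F x) (u *m A x))
  (C_exp : forall x u, C x u -> enorm u <= lam * enorm (u *m A x))
  (EA : forall x (e : V), (e <= E x)%MS -> (e *m A x <= E (F x))%MS)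
  (CE_dom : forall x u (e : V), C x u -> (e <= E x)%MS ->
     enorm (e *m A x) * enorm u <= lam * (enorm e * enorm (u *m A x)))
  (kap0 : 0 < kap)
  (tr : forall x u (e : V), C x u -> (e <= E x)%MS -> kap * enorm u <= enorm (u + e))
  (dec1 : forall x u v, C x u -> u != 0 -> exists (s : R) (e : V), (e <= E x)%MS /\ v = s *: u + e)
  (nlF : forall eta : R, 0 < eta -> exists2 r, 0 < r & near_lin A eta r F)
  (deep : forall eta : R, 0 < eta -> exists2 s, 0 < s & forall x u, C x u ->
     exists2 u', enorm (u - u') <= eta * enorm u &
       forall y v, tdist x y < s -> enorm (v - u') <= s * enorm u -> C y v)
  (r0 : R) (r00 : 0 < r0) (tmF : tame E C 4^-1 r0 F).

Lemma thick_frame x u l v : frame E C x u l -> thick E C 4^-1 x v ->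
  center_part u l v <= (1 + 2 * kap^-1) * `|edot v l|.
Proof using CZ dec1 kap0 tr.
move=> fr [w [e [Cw eE -> ew]]]; have [Cu u0 ul El] := fr; have up := enorm_gt0 u0.
have wE := frame_dec dec1 w fr; set s := edot w l.
have -> : edot (w + e) l = s by rewrite edotDl (El _ eE) addr0.
have e' : ((w - s *: u) *+ 0 - (w - s *: u) <= E x)%MS by rewrite mulr0n sub0r eqmx_opp.
have := tr Cw e'; rewrite mulr0n sub0r subKr enormZ => kw.
have hw : enorm w <= kap^-1 * (`|s| * enorm u) by rewrite mulrC ler_pdivlMr// mulrC.
rewrite -(ler_pM2r up) /center_part edotDl (El _ eE) addr0 -/s divfK ?gt_eqF//.
have i1 := enormD (w - s *: u) e; have i2 := enormB w (s *: u).
rewrite addrAC in i1; rewrite enormZ in i2.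
have kp : 0 < kap^-1 by rewrite invr_gt0.
have p0 : 0 <= kap^-1 * (`|s| * enorm u) by rewrite !mulr_ge0 ?enorm_ge0// ltW.
lra.
Qed.

Lemma cocyc_cone_neq0 x u k : C x u -> u != 0 ->
  C (iter k F x) (u *m cocyc F A k x) /\ u *m cocyc F A k x != 0.
Proof using CA C_exp.
move=> Cu u0; elim: k => [|k [IH1 IH2]]; first by rewrite mulmx1.
rewrite /= mulmxA; split; first exact: CA.
apply/eqP => h; have := C_exp IH1; rewrite h enorm0 mulr0 => h'.
have z : u *m cocyc F A k x = 0 by apply: enorm_eq0; apply/eqP; rewrite eq_le h' enorm_ge0.
by move/eqP: IH2.
Qed.

(** The room around [u] serves to keep the chords of a straight segment, and of its images, in the
    interior of the cones. *)
Definition deep_direction (s : R) (x : T) (u : V) := enorm u = 1 /\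
  forall y v, tdist x y < s -> enorm (v - u) <= s -> C y v.

Lemma deep_direction_tang s x u a r : 0 < a -> 0 < s -> s <= 2^-1 -> deep_direction s x u ->
  tang E C a r (fun t : R => x + tproj (t *: u)) 0 (s / 2).
Proof using CZ.
move=> a0 s0 s1 [u1 hu] t t' t0 tt' t's _.
have E1 : x + tproj (t' *: u) - (x + tproj (t *: u)) = tproj ((t' - t) *: u).
  by rewrite opprD addrACA subrr add0r -tprojB scalerBl.
have E2 : enorm ((t' - t) *: u) = t' - t by rewrite enormZ u1 mulr1 ger0_norm; lra.
have sm : enorm ((t' - t) *: u) < 2^-1 by rewrite E2; lra.
rewrite E1 tlog_small//; split.
  move=> h; have : tlog (tproj ((t' - t) *: u)) = 0 by rewrite -E1 h subrr tlog0.
  rewrite tlog_small// => z; move: E2; rewrite z enorm0; lra.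
exists ((t' - t) *: u), 0; rewrite addr0 sub0mx enorm0 mulr_ge0 ?enorm_ge0 ?ltW//; split=> //.
apply/CZ/hu; last by rewrite subrr enorm0 ltW.
by apply: le_lt_trans (tdist_addr _ _) _; rewrite enormZ u1 mulr1 ger0_norm//; lra.
Qed.

(** Downward induction on time: an arc whose image stays small was small itself. *)
Lemma size_history c s e q N : continuous c -> tang E C 4^-1 r0 c s e -> 0 < q -> q <= r0 ->
  (forall u, s <= u <= e -> tdist (iter N F (c s)) (iter N F (c u)) <= q) ->
  forall k u, (k <= N)%N -> s <= u <= e -> tdist (iter k F (c s)) (iter k F (c u)) <= q.
Proof using cF r00 tmF.
move=> cc tg q0 qr hN k; have [se|se] := leP s e; last by move=> u _ /andP[? ?]; lra.
have tmq : tame E C 4^-1 q F by move=> x v tv vq; apply: tmF => //; exact: le_trans qr.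
have all j : (j <= N)%N -> forall u, s <= u <= e -> tdist (iter (N - j) F (c s)) (iter (N - j) F (c u)) <= q.
  elim: j => [|j IH] jN; first by rewrite subn0.
  have := IH (ltnW jN); have -> : (N - j)%N = (N - j.+1).+1 by move: jN; clear; lia.
  set i := (N - j.+1)%N => hi u su.
  have ci : continuous (iter i F \o c) by exact: iter_curve_continuous.
  have ti : tang E C 4^-1 r0 (iter i F \o c) s e by exact: tang_iter.
  have tiq : tang E C 4^-1 q (iter i F \o c) s e.
    by move=> t t' h1 h2 h3 h4; apply: ti => // v hv; exact: le_trans (h4 v hv) qr.
  exact: (@tang_pullback _ _ _ _ _ _ _ _ s e s e ci q0 tmq tiq (lexx _) se (lexx _)).
by move=> u kN; have := all (N - k)%N (leq_subr _ _) u; rewrite subKn.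
Qed.

(** The cone component of [v] is pushed inside its cone and normalized; transversality shows that
    the result is still on the side of [v]. *)
Lemma deep_direction_ex : exists s, [/\ 0 < s, s <= 2^-1 & forall x v, thick E C 4^-1 x v -> v != 0 ->
  exists u, [/\ deep_direction s x u, C x u, u != 0 & forall l, frame E C x u l -> 0 < edot v l]].
Proof using CZ deep kap0 tr dec1.
have locals := I.
have [eta [eta0 eta1 eta2]] : exists eta : R, [/\ 0 < eta, eta <= 4^-1 & eta <= kap / 4].
  exists (Num.min 4^-1 (kap / 4)); rewrite lt_min divr_gt0 ?invr_gt0// !ge_min !lexx orbT.
  by split=> //; qlra.
have [s s0 hs] := deep eta0.
exists (Num.min (s / 2) 2^-1); rewrite lt_min divr_gt0 ?invr_gt0//= ge_min lexx orbT; split=> //.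
move=> x v [w [e [Cw eE vE ew]]] v0.
have w0 : w != 0.
  apply: contra_neq v0 => z; rewrite z enorm0 mulr0 in ew.
  by rewrite vE z (enorm_eq0 (_ : enorm e = 0)) ?addr0//; apply/eqP; rewrite eq_le ew enorm_ge0.
have wp := enorm_gt0 w0.
have [u' wu' hu'] := hs x w Cw.
have wu'4 : enorm (w - u') <= 4^-1 * enorm w by apply: le_trans wu' _; rewrite ler_wpM2r// ltW.
have u'l : 3 / 4 * enorm w <= enorm u'.
  by have := enorm_lower w (- (w - u')); rewrite enormN subKr; qlra.
have u'u : enorm u' <= 5 / 4 * enorm w.
  by have := enormB w (w - u'); rewrite subKr; qlra.
have u'p : 0 < enorm u' by qlra.
have u'0 : u' != 0 by apply/eqP => z; move: u'p; rewrite z enorm0 ltxx.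
pose u := (enorm u')^-1 *: u'.
have u1 : enorm u = 1 by rewrite enormZ gtr0_norm ?invr_gt0// mulVf ?gt_eqF.
have u'E : u' = enorm u' *: u by rewrite scalerA mulfV ?gt_eqF// scale1r.
have dd : deep_direction (Num.min (s / 2) 2^-1) x u.
  split=> // y z; rewrite lt_min => /andP[xy _]; rewrite le_min => /andP[zu _].
  have -> : z = (enorm u')^-1 *: (enorm u' *: z) by rewrite scalerA mulVf ?gt_eqF// scale1r.
  apply/CZ/hu'; first by qlra.
  rewrite [X in _ - X]u'E -scalerBr enormZ gtr0_norm//.
  have : enorm u' * enorm (z - u) <= 5 / 4 * enorm w * (s / 2) by apply: ler_pM; rewrite ?enorm_ge0.
  have : 0 <= s * enorm w by rewrite mulr_ge0// ltW.
  qlra.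
have Cu : C x u.
  have [_] := dd; apply; rewrite ?tdistxx ?subrr ?enorm0 ?lt_min ?le_min ?divr_gt0 ?invr_gt0//=.
  by rewrite !ltW ?divr_gt0 ?invr_gt0.
have u0 : u != 0 by apply/eqP => z; move: u1; rewrite z enorm0; qlra.
exists u; split=> // l fr; have [_ _ ul El] := fr.
have -> : edot v l = edot w l by rewrite vE edotDl (El _ eE) addr0.
have [kb _] := frame_bound CZ kap0 tr dec1 (w - u') fr.
have eu : edot u' l = enorm u' by rewrite {1}u'E edotZl ul mulr1.
rewrite u1 mulr1 edotBl eu in kb.
have : kap * `|edot w l - enorm u'| <= kap * (4^-1 * enorm w).
  apply: le_trans kb _; apply: le_trans wu' _; rewrite mulrA ler_wpM2r ?(ltW wp)//; qlra.
rewrite ler_pM2l// ler_norml => /andP[]; qlra.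
Qed.

(** For a point [p] of the segment, choose [t] such that the displacement from the [N]-th image of
    [p] to that of [c t] has no cone component. Being central at time [N], it has been contracted
    all along by [orbit_center]. The segment is stopped at the smaller size [q1] so that the curve
    reaches far enough for [t] to exist. *)
Lemma shadow : exists s1 q0 : R, [/\ 0 < s1, s1 <= 2^-1, 0 < q0, q0 <= r0 & forall q, 0 < q <= q0 ->
  exists q1, [/\ 0 < q1, q1 <= q, q1 <= s1 / 2 & forall rho, 0 < rho -> exists N, forall c s e, continuous c ->
    tang E C 4^-1 r0 c s e -> s < e ->
    (forall u, s <= u <= e -> tdist (iter N F (c s)) (iter N F (c u)) <= q) ->
    tdist (iter N F (c s)) (iter N F (c e)) = q ->
    exists u w, [/\ deep_direction s1 (c s) u, 0 < w <= s1 / 2,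
      tdist (iter N F (c s)) (iter N F (c s + tproj (w *: u))) = q1 &
      forall tau, 0 <= tau <= w -> exists2 t, s <= t <= e &
        tdist (iter N F (c s + tproj (tau *: u))) (iter N F (c t)) < rho]]].
Proof using CA CE_dom CZ C_exp EA cA cF dec1 deep kap0 lam0 lam8 nlF r00 tmF tr.
have locals := I.
have kp : 0 < kap^-1 by rewrite invr_gt0.
have [G [G1 GE]] : exists G : R, 1 <= G /\ G = 1 + 2 * kap^-1 by exists (1 + 2 * kap^-1); split=> //; qlra.
have pk : 0 < 1 + kap^-1 by qlra.
have pG : 0 < 1 + G by qlra.
have [eta [eta0 etaG]] : exists eta : R, 0 < eta /\ (1 + kap^-1) * eta * (1 + G) <= 8^-1.
  exists (8^-1 / ((1 + kap^-1) * (1 + G))); split; first by rewrite divr_gt0 ?mulr_gt0// invr_gt0.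
  move: pk pG; move: (1 + kap^-1) (1 + G) => a b pa pb.
  by have -> : a * (8^-1 / (a * b)) * b = 8^-1 by field; rewrite !gt_eqF.
have [r rp hr] := displacement_step cA nlF eta0.
have [s1 [s10 s12 hs1]] := deep_direction_ex.
have [q0 [q00 q0r q0r0 q08]] : exists q0 : R, [/\ 0 < q0, 2 * q0 < r, q0 <= r0 & 2 * q0 < 4^-1].
  have h : 0 < Num.min (r / 3) (Num.min r0 9^-1) by rewrite !lt_min r00 divr_gt0//=; qlra.
  have h1 : Num.min (r / 3) (Num.min r0 9^-1) <= r / 3 by rewrite ge_min lexx.
  have h2 : Num.min (r / 3) (Num.min r0 9^-1) <= r0 by rewrite !ge_min lexx orbT.
  have h3 : Num.min (r / 3) (Num.min r0 9^-1) <= 9^-1 by rewrite !ge_min lexx !orbT.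
  by exists (Num.min (r / 3) (Num.min r0 9^-1)); split=> //; qlra.
exists s1, q0; split=> // q /andP[qp qq0].
(* With this bound the cone component of the segment at time [N] never exceeds that of the end of
   the curve. *)
have [q1 [q10 q1q q1s q1G]] : exists q1 : R, [/\ 0 < q1, q1 <= q, q1 <= s1 / 2 & kap^-1 * q1 * (1 + G) <= q].
  have h0 : 0 < kap * q / (1 + G) by rewrite divr_gt0 ?mulr_gt0//; qlra.
  exists (Num.min q (Num.min (s1 / 2) (kap * q / (1 + G)))); split.
  - by rewrite !lt_min qp h0 divr_gt0.
  - by rewrite ge_min lexx.
  - by rewrite !ge_min lexx orbT.
  - apply: (@le_trans _ _ (kap^-1 * (kap * q / (1 + G)) * (1 + G))).
      by rewrite ler_wpM2r ?(ltW pG)// ler_wpM2l ?(ltW kp)// !ge_min lexx !orbT.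
    move: pG; move: (1 + G) => a pa.
    by have -> : kap^-1 * (kap * q / a) * a = q by field; rewrite !gt_eqF.
exists q1; split=> // rho rho0.
have [N hN] : exists N : nat, G * (kap^-1 * q) / rho < (7 / 2) ^+ N.
  have l : (1 : R) < 7 / 2 by qlra.
  have [N h] := expr_unbounded (G * (kap^-1 * q) / rho + 1) l.
  by exists N; have := h N (leqnn _); qlra.
exists N => c s e cc tg se hsz hqe.
have hist := size_history cc tg qp (le_trans qq0 q0r0) hsz.
have thk t : s < t -> t <= e -> c s <> c t /\ thick E C 4^-1 (c s) (tlog (c t - c s)).
  move=> st te; apply: tg => // u /andP[u1 u2].
  by apply: le_trans (hist 0%N u (leq0n _) _) (le_trans qq0 q0r0); rewrite u1 (le_trans u2 te).
have nz (a a' : T) : a <> a' -> tlog (a' - a) != 0.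
  move=> aa; apply/eqP => h; apply: aa; apply/esym/tdist_eq0.
  by rewrite tdistE /tnorm h enorm0.
have [ne0 th0] := thk e se (lexx _).
have [u [du Cu u0 hu]] := hs1 _ _ th0 (nz _ _ ne0).
have u1 : enorm u = 1 := du.1.
set x := c s in du Cu thk nz hist hsz hqe th0 ne0 hu *.
pose sg := fun t : R => x + tproj (t *: u).
have csg : continuous sg by exact: line_continuous.
have p4 : (0 : R) < 4^-1 by qlra.
have tsg : tang E C 4^-1 r0 sg 0 (s1 / 2) by exact: deep_direction_tang.
have sg0 : sg 0 = x by rewrite /sg scale0r tproj0 addr0.
have sgd (t : R) : 0 <= t -> t <= s1 / 2 -> tlog (sg t - x) = t *: u.
  move=> t0 t1; rewrite /sg addrAC subrr add0r tlog_small//.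
  by rewrite enormZ u1 mulr1 ger0_norm//; qlra.
have s20 : 0 <= s1 / 2 by qlra.
have q1sg : q1 <= tdist (sg 0) (sg (s1 / 2)).
  by rewrite sg0 tdistC tdistE /tnorm sgd// enormZ u1 mulr1 ger0_norm.
have [w [/andP[w0 w1] wq hw]] := exit_iterates cF r00 tmF N csg tsg q10 (le_trans q1q (le_trans qq0 q0r0))
  (lexx _) s20 (lexx _) q1sg.
rewrite sg0 in wq hw.
have wp : 0 < w.
  rewrite lt_def w0 andbT; apply/eqP => z; move: wq; rewrite z sg0 tdistxx => h; move: q10; rewrite -h ltxx.
  by [].
exists u, w; split=> //; first by rewrite wp.
have frk k : exists l, frame E C (iter k F x) (u *m cocyc F A k x) l.
  by have [h1 h2] := cocyc_cone_neq0 k Cu u0; exact: (frame_ex kap0 tr dec1 h1 h2).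
have [l hl] := choice frk.
have st (y z : T) : (forall k, (k <= N)%N -> tdist (iter k F x) (iter k F y) < r) ->
  (forall k, (k <= N)%N -> tdist (iter k F y) (iter k F z) < r) ->
  forall k, (k < N)%N ->
    enorm (tlog (iter k.+1 F z - iter k.+1 F y) - tlog (iter k F z - iter k F y) *m A (iter k F x)) <=
    eta * enorm (tlog (iter k F z - iter k F y)).
  by move=> h1 h2 k kN; apply: hr; [apply/h1/ltnW|apply/h2/ltnW].
have rx k : (k <= N)%N -> tdist (iter k F x) (iter k F x) < r by rewrite tdistxx.
have l00 : frame E C x u (l 0%N) by have := hl 0%N; rewrite /= mulmx1.
pose uN := u *m cocyc F A N x.
have [CuN uN0 uNl ENl] := hl N; have uNp := enorm_gt0 uN0; rewrite -/uN in uNl uNp uN0.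
have al t : s <= t -> t <= e ->
  [/\ center_part u (l 0%N) (tlog (c t - x)) <= G * `|edot (tlog (c t - x)) (l 0%N)|,
      center_part uN (l N) (tlog (iter N F (c t) - iter N F x)) <= G * `|edot (tlog (iter N F (c t) - iter N F x)) (l N)|,
      `|edot (tlog (c t - x)) (l 0%N)| * (7 / 8) ^+ N <= `|edot (tlog (iter N F (c t) - iter N F x)) (l N)| &
      0 < edot (tlog (c t - x)) (l 0%N) -> 0 < edot (tlog (iter N F (c t) - iter N F x)) (l N)].
  move=> st' te.
  have U0 : center_part u (l 0%N) (tlog (c t - x)) <= G * `|edot (tlog (c t - x)) (l 0%N)|.
    move: st'; rewrite le_eqVlt => /predU1P[<-|st'].
      by rewrite -/x subrr tlog0 /center_part edot0l scale0r subr0 enorm0 mul0r normr0 mulr0.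
    by have [_ h] := thk t st' te; rewrite GE; exact: (thick_frame l00 h).
  have rt k : (k <= N)%N -> tdist (iter k F x) (iter k F (c t)) < r.
    by move=> kN; apply: le_lt_trans (hist k t kN _) _; [rewrite st'|qlra].
  have := orbit_cone lam0 lam8 CZ C_exp EA CE_dom kap0 tr dec1 G1 (ltW eta0) etaG hl (st x (c t) rx rt) (leqnn N).
  by rewrite /= mulmx1 => /(_ U0)[h1 h2 h3].
have be tau : 0 <= tau -> tau <= w -> edot (tlog (iter N F (sg tau) - iter N F x)) (l N) >= 0.
  rewrite le_eqVlt => /predU1P[<-|t0] tw; first by rewrite sg0 subrr tlog0 edot0l.
  have E0 : tlog (sg tau - x) = tau *: u by apply: sgd; [exact: ltW|exact: le_trans w1].
  have ul : edot u (l 0%N) = 1 by have [] := l00.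
  have U0 : center_part u (l 0%N) (tlog (sg tau - x)) <= G * `|edot (tlog (sg tau - x)) (l 0%N)|.
    rewrite E0 /center_part edotZl ul mulr1 subrr enorm0 mul0r mulr_ge0//; qlra.
  have rt k : (k <= N)%N -> tdist (iter k F x) (iter k F (sg tau)) < r.
    by move=> kN; apply: le_lt_trans (hw k tau kN _) _; [rewrite (ltW t0)|qlra].
  have := orbit_cone lam0 lam8 CZ C_exp EA CE_dom kap0 tr dec1 G1 (ltW eta0) etaG hl (st x _ rx rt) (leqnn N).
  rewrite /= mulmx1 => /(_ U0)[_ _ h3]; apply/ltW/h3.
  by rewrite E0 edotZl ul mulr1.
move=> tau /andP[tau0 tauw]; rewrite -/(sg tau); set p := sg tau.
have xp k : (k <= N)%N -> tdist (iter k F x) (iter k F p) <= q1.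
  by move=> kN; apply: hw => //; rewrite tau0.
have xc k t : (k <= N)%N -> s <= t -> t <= e -> tdist (iter k F x) (iter k F (c t)) <= q.
  by move=> kN t1 t2; apply: hist => //; rewrite t1.
have pc k t : (k <= N)%N -> s <= t -> t <= e -> tdist (iter k F p) (iter k F (c t)) <= 2 * q.
  move=> kN t1 t2; have := tdistD (iter k F x) (iter k F p) (iter k F (c t)).
  have := xp k kN; have := xc k t kN t1 t2; rewrite (tdistC (iter k F p) (iter k F x)); qlra.
have chord_diff k t : (k <= N)%N -> s <= t -> t <= e -> tlog (iter k F (c t) - iter k F p) =
   tlog (iter k F (c t) - iter k F x) - tlog (iter k F p - iter k F x).
  move=> kN t1 t2; have i1 := xp k kN; have i2 := xc k t kN t1 t2.
  rewrite -(tlogN (x := iter k F p - _)); last by rewrite -tdistE tdistC; qlra.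
  rewrite opprB -tlogD ?addrA ?subrK//.
  rewrite -tnormN opprB -!tdistE; qlra.
have aN : 0 < edot (tlog (iter N F (c e) - iter N F x)) (l N).
  by have [_ _ _] := al e (ltW se) (lexx _); apply; exact: hu.
have bN : kap * (edot (tlog (iter N F p - iter N F x)) (l N) * enorm uN) <= q1.
  have [h _] := frame_bound CZ kap0 tr dec1 (tlog (iter N F p - iter N F x)) (hl N).
  rewrite ger0_norm in h; last exact: be.
  apply: le_trans h _; rewrite -/(tnorm _) -tdistE tdistC; exact: xp.
have aN' : q <= (1 + G) * (edot (tlog (iter N F (c e) - iter N F x)) (l N) * enorm uN).
  rewrite -hqe tdistC tdistE /tnorm; apply: le_trans (frame_norm (l N) _ uN0) _.
  rewrite mulrA ler_pM2r//; have [_ h _ _] := al e (ltW se) (lexx _).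
  rewrite (gtr0_norm aN) in h *; qlra.
have [t /andP[t1 t2] tz] : exists2 t, s <= t <= e & edot (tlog (iter N F (c t) - iter N F p)) (l N) = 0.
  apply: (@chord_ivt R n (iter N F \o c) (iter N F p) (l N) s e _ (ltW se)).
  - exact: iter_curve_continuous.
  - by move=> t /andP[t1 t2]; apply: le_lt_trans (pc N t (leqnn _) t1 t2) _; qlra.
  - rewrite /= (chord_diff N s (leqnn N) (lexx s) (ltW se)) -/x subrr tlog0 sub0r edotNl oppr_le0; exact: be.
  rewrite /= (chord_diff N e (leqnn N) (ltW se) (lexx e)) edotBl subr_ge0 -(ler_pM2r uNp).
  have h1 : edot (tlog (iter N F p - iter N F x)) (l N) * enorm uN <= kap^-1 * q1.
    by rewrite [kap^-1 * q1]mulrC ler_pdivlMr// mulrC.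
  apply: le_trans h1 _; rewrite -(ler_pM2r (_ : 0 < 1 + G)); last qlra.
  by apply: le_trans q1G _; rewrite [X in _ <= X]mulrC.
exists t; first by rewrite t1.
have vN := frame_norm (l N) (tlog (iter N F (c t) - iter N F p)) uN0.
rewrite tz normr0 add0r in vN.
rewrite tdistC tdistE /tnorm; apply: le_lt_trans vN _.
have ep0 := center_part_ge0 uN (l N) (tlog (iter N F (c t) - iter N F p)).
move: ep0; rewrite le_eqVlt => /predU1P[<-|epp]; first by rewrite mul0r.
have rp' k : (k <= N)%N -> tdist (iter k F x) (iter k F p) < r.
  by move=> kN; apply: le_lt_trans (xp k kN) _; qlra.
have rpc k : (k <= N)%N -> tdist (iter k F p) (iter k F (c t)) < r.
  by move=> kN; apply: le_lt_trans (pc k t kN t1 t2) _; qlra.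
have := orbit_center lam0 lam8 CZ C_exp EA CE_dom kap0 tr dec1 G1 (ltW eta0) etaG hl (st p (c t) rp' rpc).
rewrite -/uN tz normr0 mulr0 => /(_ epp); rewrite /= mulmx1 => hc.
(* At time 0 the segment has no center component, so displacements from [p] and from [x] have the
   same center part. *)
have e0 : center_part u (l 0%N) (tlog (c t - p)) <= G * `|edot (tlog (c t - x)) (l 0%N)|.
  have [h _ _ _] := al t t1 t2; apply: le_trans h.
  have := chord_diff 0%N t (leq0n _) t1 t2 => /= ->.
  rewrite /p sgd// ?(le_trans tauw)// /center_part edotBl edotZl.
  have -> : edot u (l 0%N) = 1 by have [] := l00.
  by rewrite mulr1 scalerBl opprB addrCA addrA [tau *: u + _]addrC subrK.
have [_ _ sN _] := al t t1 t2.
have [hb _] := frame_bound CZ kap0 tr dec1 (tlog (iter N F (c t) - iter N F x)) (hl N).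
rewrite -/uN in hb.
have hb' : `|edot (tlog (iter N F (c t) - iter N F x)) (l N)| * enorm uN <= kap^-1 * q.
  rewrite [kap^-1 * q]mulrC ler_pdivlMr// mulrC.
  apply: le_trans hb _; rewrite -/(tnorm _) -tdistE tdistC; exact: xc.
exact: (shadow_bound rho0 G1 hc e0 sN hb' hN uNp).
Qed.

End Shadow.

(** * Expanding blocks along a curve *)

Section CurveBlocks.
Context {R : realType} {n : nat} (F : torus R n -> torus R n)
  (A E : torus R n -> 'M[R]_n) (C : torus R n -> set 'rV[R]_n)
  (lam kap b : R).
Local Notation T := (torus R n).
Local Notation V := ('rV[R]_n).
Hypotheses (cF : continuous F) (cA : continuous A) (lam0 : 0 < lam) (lam8 : lam <= 8^-1)
  (CZ : forall x a u, C x u -> C x (a *: u))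
  (CA : forall x u, C x u -> C (F x) (u *m A x))
  (C_exp : forall x u, C x u -> enorm u <= lam * enorm (u *m A x))
  (EA : forall x (e : V), (e <= E x)%MS -> (e *m A x <= E (F x))%MS)
  (CE_dom : forall x u (e : V), C x u -> (e <= E x)%MS ->
     enorm (e *m A x) * enorm u <= lam * (enorm e * enorm (u *m A x)))
  (kap0 : 0 < kap)
  (tr : forall x u (e : V), C x u -> (e <= E x)%MS -> kap * enorm u <= enorm (u + e))
  (dec1 : forall x u v, C x u -> u != 0 -> exists (s : R) (e : V), (e <= E x)%MS /\ v = s *: u + e)
  (C_nontrivial : forall x, exists2 u, C x u & u != 0)
  (contC : forall eta : R, 0 < eta -> exists2 s, 0 < s & forall x y u, tdist x y < s -> C x u ->
     exists2 u', C y u' & enorm (u - u') <= eta * enorm u)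
  (contE : forall eta : R, 0 < eta -> exists2 s, 0 < s & forall x y e, tdist x y < s ->
     (e <= E x)%MS -> exists2 e', (e' <= E y)%MS & enorm (e - e') <= eta * enorm e)
  (deep : forall eta : R, 0 < eta -> exists2 s, 0 < s & forall x u, C x u ->
     exists2 u', enorm (u - u') <= eta * enorm u &
       forall y v, tdist x y < s -> enorm (v - u') <= s * enorm u -> C y v)
  (b0 : 0 < b) (b1 : b <= 1) (A_lower : forall x (v : V), b * enorm v <= enorm (v *m A x))
  (nlF : forall eta : R, 0 < eta -> exists2 r, 0 < r & near_lin A eta r F).

Lemma iter_uniform N (e : R) : 0 < e -> exists2 rho, 0 < rho & forall k x y, (k <= N)%N ->
  tdist x y < rho -> tdist (iter k F x) (iter k F y) < e.
Proof using cF.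
move=> e0; elim: N => [|N [r1 r10 h1]].
  by exists e => // k x y; rewrite leqn0 => /eqP ->.
have [r2 r20 h2] := uniform_continuous_torus (@iter_continuous R n F N.+1 cF) e0.
exists (Num.min r1 r2) => [|k x y]; first by rewrite lt_min r10.
rewrite leq_eqVlt lt_min => /predU1P[->|kN] /andP[d1 d2]; [exact: h2|exact: h1].
Qed.

(** [ev] stands for the C^1-neighbourhoods of the original map: [F] will be a power of it, and the
    perturbations of [F] the same powers of nearby maps. *)
Variables (ev : ((T -> T) -> Prop) -> Prop).
Hypotheses
  (ev_and : forall P Q, ev P -> ev Q -> ev (fun g => P g /\ Q g))
  (ev_imp : forall P Q : (T -> T) -> Prop, (forall g, P g -> Q g) -> ev P -> ev Q)
  (ev_iter : forall k eta, 0 < eta -> exists2 r, 0 < r &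
     ev (fun g => capprox (iter k F) (cocyc F A k) eta r (iter k g))).

Lemma ev_iter_close N (e : R) : 0 < e ->
  ev (fun g => forall k x, (k <= N)%N -> tdist (iter k F x) (iter k g x) < e).
Proof using ev_and ev_imp ev_iter.
move=> e0; elim: N => [|N IH].
  have [r r0 h] := ev_iter 0 e0; apply: ev_imp h => g _ k x.
  by rewrite leqn0 => /eqP -> /=; rewrite tdistxx.
have [r r0 h] := ev_iter N.+1 e0; apply: ev_imp (ev_and IH h) => g [h1 [h2 _]] k x.
by rewrite leq_eqVlt => /predU1P[->|kN]; [exact: h2|exact: h1].
Qed.

Lemma tame_mono a r r' g : r' <= r -> tame E C a r g -> tame E C a r' g.
Proof. by move=> rr h x v tv vr; apply: h => //; exact: le_trans rr. Qed.

Lemma ev_tame : exists r, [/\ 0 < r, tame E C 4^-1 r F & ev (tame E C 4^-1 r)].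
Proof using A_lower CA CE_dom C_exp CZ EA b0 contC contE dec1 ev_imp ev_iter kap0 lam0 lam8 nlF tr.
have p4 : (0 : R) < 4^-1 by rewrite invr_gt0.
have [eta eta0 h] := near_lin_tame lam0 lam8 CZ CA C_exp EA CE_dom kap0 tr dec1 contC contE b0 A_lower p4 (lexx _).
have [r rp hr] := ev_iter 1 eta0; have [r' rp' hr'] := nlF eta0.
exists (Num.min r r'); split; first by rewrite lt_min rp.
- apply: (tame_mono (r := r')); first by rewrite ge_min lexx orbT.
  by apply: h; split=> // x; rewrite tdistxx.
- apply: ev_imp hr => g; have -> : cocyc F A 1 = A by apply/funext => x /=; rewrite mul1mx.
  by move=> hg; apply: (tame_mono (r := r)); [rewrite ge_min lexx|exact: h hg].
Qed.

Lemma ev_continuous : ev (fun g => continuous g).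
Proof using cA ev_imp ev_iter.
have [r r0 hr] := ev_iter 1 (@ltr01 R); apply: ev_imp hr => g.
have -> : cocyc F A 1 = A by apply/funext => x /=; rewrite mul1mx.
by move=> [_ nl]; exact: near_lin_continuous cA r0 nl.
Qed.

(** Discs enter the dynamics only through [hit]: an image of a segment well inside the cones, once
    it makes [m] steps of size [r] with [m%:R * r] above a universal [L], passes arbitrarily near a
    good point. *)
Variables (l0 : R) (k0 : nat).
Hypotheses (l01 : 1 < l0)
  (hit : exists L : R, forall s x u w N m r rho, 0 < s -> s <= 2^-1 -> deep_direction C s x u -> 0 < w <= s / 2 ->
     0 < r -> steps (fun t : R => iter N F (x + tproj (t *: u))) r m 0 w -> L <= m%:R * r -> 0 < rho ->
     exists t y, [/\ 0 <= t <= w, good_point F A E l0 k0 y & tdist (iter N F (x + tproj (t *: u))) y < rho]).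

(** The state between two blocks: at time [N1] the arc has size exactly [2 * q], so that it can be
    shadowed. *)
Definition arc_curve (r0 q : R) N1 (g : T -> T) c s e :=
  [/\ continuous c, tang E C 4^-1 r0 c s e,
    forall u, s <= u <= e -> tdist (iter N1 g (c s)) (iter N1 g (c u)) <= 2 * q,
    tdist (iter N1 g (c s)) (iter N1 g (c e)) = 2 * q & s <= e].

(** The arc is shadowed at time [N1] by a segment, whose image grows for [M] more steps and then
    passes near a good point. From the corresponding parameter [ts] one keeps a subarc whose images
    remain small up to time [N1 + N] and reach the size [2 * q] there; from time [N1 + M] on it
    follows the good orbit. *)
Lemma arc_block : exists r0 q N1 M N, [/\ 0 < q, 2 * q <= r0, 0 < r0 & ev (fun g => [/\ continuous g,
    tame E C 4^-1 r0 g & forall c s e, arc_curve r0 q N1 g c s e -> exists s1 e1,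
     (forall u, s1 <= u <= e1 -> expanding_at F A N (iter (N1 + M) g (c u))) /\
     [/\ s <= s1, e1 <= e & arc_curve r0 q N1 g (iter N g \o c) s1 e1]])].
Proof using A_lower CA CE_dom CZ C_exp C_nontrivial EA b0 b1 cA cF contC contE dec1 deep ev_and ev_imp ev_iter hit kap0 l01 lam0 lam8 nlF tr.
have locals := I.
have l0' := lam0; have l8' := lam8.
have [r0 [r00 tmF evt]] := ev_tame.
have lam01 : 0 < lam < 1 by apply/andP; split; qlra.
have b01 : 0 < b <= 1 by rewrite b0 b1.
have dec x (v : V) : exists u e : V, [/\ C x u, (e <= E x)%MS & v = u + e].
  have [u Cu u0] := C_nontrivial x; have [s [e [eE vE]]] := dec1 v Cu u0.
  by exists (s *: u), e; split=> //; exact: CZ.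
have [r2 r20 hblock] := block_expansion k0 cA lam01 CA C_exp EA kap0 tr dec contE b01 A_lower l01.
have [s1 [q0 [s10 s12 q00 q0r0 hsh]]] := shadow cF cA lam0 lam8 CZ CA C_exp EA CE_dom kap0 tr dec1 nlF deep r00 tmF.
have [q [qp qq0 q2r0 qr2]] : exists q : R, [/\ 0 < q, q <= q0, 2 * q <= r0 & 2 * q <= r2 / 4].
  have h1 : Num.min q0 (Num.min (r0 / 2) (r2 / 8)) <= q0 by rewrite ge_min lexx.
  have h2 : Num.min q0 (Num.min (r0 / 2) (r2 / 8)) <= r0 / 2 by rewrite !ge_min lexx orbT.
  have h3 : Num.min q0 (Num.min (r0 / 2) (r2 / 8)) <= r2 / 8 by rewrite !ge_min lexx !orbT.
  exists (Num.min q0 (Num.min (r0 / 2) (r2 / 8))); split=> //; try qlra.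
  by rewrite !lt_min q00 !divr_gt0.
have qqq0 : 0 < q <= q0 by rewrite qp.
have [q1 [q10 q1q q1s hsh1]] := hsh q qqq0.
have [L hL] := hit.
(* Each iterate doubles the number of steps, so after [M] iterates there are [2 ^ M] steps of size
   [q1]. *)
have [M [M0 hM]] : exists M : nat, (0 < M)%N /\ L <= (2 ^ M)%:R * q1.
  have [M hM] : exists M : nat, L / q1 <= M%:R.
    exists (Num.bound `|L / q1|).
    exact: le_trans (ler_norm _) (ltW (archi_boundP (normr_ge0 _))).
  exists M.+1; split=> //; rewrite -ler_pdivrMr//; apply: le_trans hM _.
  by rewrite ler_nat; apply: leq_trans (leqnSn M) (ltnW (ltn_expl _ _)).
(* The length [N] follows [M]; the precisions [rho], [rho1], [ep] and the shadowing time [N1] follow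
   [N]. *)
have [N [N0 MN hN]] := hblock M 1%N.
have r24 : 0 < r2 / 4 by qlra.
have [rho rho0 hrho] := iter_uniform N r24.
have rho4 : 0 < rho / 4 by qlra.
have [rho1 rho10 hrho1] := iter_uniform M rho4.
have [N1 hN1] := hsh1 rho1 rho10.
have [ep [ep0 epq eprho epr]] : exists ep : R, [/\ 0 < ep, ep <= q / 4, ep <= rho / 4 & ep <= r2 / 4].
  exists (Num.min (q / 4) (Num.min (rho / 4) (r2 / 4))); split.
  - by rewrite !lt_min !divr_gt0.
  - by rewrite ge_min lexx.
  - by rewrite !ge_min lexx orbT.
  - by rewrite !ge_min lexx !orbT.
exists r0, q, N1, M, N; split=> //.
apply: ev_imp (ev_and (ev_and evt ev_continuous) (ev_iter_close (N1 + M + N) ep0)).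
move=> g [[tmg cg] close]; split=> // c s e [cc tg sz eq2 se].
have le1 : (N1 <= N1 + M + N)%N by rewrite -addnA leq_addr.
have le2 : (N1 + M <= N1 + M + N)%N by rewrite leq_addr.
have fg k x y : (k <= N1 + M + N)%N ->
    `|tdist (iter k F x) (iter k F y) - tdist (iter k g x) (iter k g y)| <= 2 * ep.
  move=> kK; have c1 := close k x kK; have c2 := close k y kK.
  have i1 := tdistD (iter k g x) (iter k F x) (iter k F y).
  have i2 := tdistD (iter k g y) (iter k g x) (iter k F y).
  have i3 := tdistD (iter k F x) (iter k g x) (iter k g y).
  have i4 := tdistD (iter k F y) (iter k F x) (iter k g y).
  rewrite (tdistC (iter k g y) (iter k F y)) in i2.
  rewrite (tdistC (iter k g x) (iter k F x)) in i3.
  rewrite ler_norml; apply/andP; split; qlra.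
have cF1 : continuous (iter N1 F \o c) by exact: iter_curve_continuous.
(* The image under [F] reaches the distance [q], since that under [g] reaches [2 * q] and they
   differ by at most [q / 2]. *)
have [| |e' [/andP[se' e'e] e'q he']] :=
    first_hit (@tdist_curve_continuous R n _ ((iter N1 F \o c) s) cF1) (r := q) se.
- by rewrite tdistxx ltW.
- by have := fg N1 (c s) (c e) le1; rewrite /= eq2 ler_norml => /andP[]; qlra.
have se'' : s < e'.
  rewrite lt_def se' andbT; apply/eqP => z; move: e'q; rewrite z tdistxx => h.
  by move: qp; rewrite -h ltxx.
have tg' : tang E C 4^-1 r0 c s e' by exact: tang_sub tg.
have [u [w [du wi wq shw]]] := hN1 c s e' cc tg' se'' he' e'q.
pose sg := fun t : R => c s + tproj (t *: u).
have csg : continuous sg by exact: line_continuous.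
have /andP[wp ws] := wi.
have p4 : (0 : R) < 4^-1 by rewrite invr_gt0.
have tsg : tang E C 4^-1 r0 sg 0 w.
  have t1 : tang E C 4^-1 r0 sg 0 (s1 / 2) by exact: deep_direction_tang.
  exact: tang_sub (lexx _) ws t1.
have tsg1 : tang E C 4^-1 r0 (iter N1 F \o sg) 0 w by exact: tang_iter.
have csg1 : continuous (iter N1 F \o sg) by exact: iter_curve_continuous.
have st1 : steps (iter N1 F \o sg) q1 1 0 w.
  exists 0, w; split; [exact: lexx|exact: ltW| |exact: lexx].
  by rewrite /= /sg scale0r tproj0 addr0 wq.
have q1r0 : q1 <= r0 by apply: le_trans q1q (le_trans qq0 q0r0).
have := steps_iter cF r00 tmF M csg1 tsg1 (lexx 0) q10 q1r0 st1.
rewrite mul1n (_ : iter M F \o (iter N1 F \o sg) = (fun t : R => iter (M + N1) F (c s + tproj (t *: u)))); last first.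
  by apply/funext => t /=; rewrite iterD.
move=> stM; have [t [y [/andP[t0 tw] gy ty]]] := hL s1 (c s) u w (M + N1)%N _ q1 _ s10 s12 du wi q10 stM hM rho4.
have t0w : 0 <= t <= w by rewrite t0.
have [ts /andP[sts tse'] tst] := shw t t0w.
have hy : tdist (iter (N1 + M) g (c ts)) y < rho.
  have k1 := hrho1 M _ _ (leqnn M) tst; rewrite -!iterD in k1.
  have k2 := close (N1 + M)%N (c ts) le2; rewrite addnC in k2 *.
  have := tdist_chain (iter (M + N1) g (c ts)) (iter (M + N1) F (c ts)) (iter (M + N1) F (sg t)) y.
  rewrite /sg; qlra.
have tse : ts <= e by exact: le_trans e'e.
(* Up to [e'] the image under [g] goes little beyond [q]; a displacement of [q / 2] remains from
   [ts] to [e], and one more step of [g] makes it [2 * q]. *)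
have far : q / 2 <= tdist ((iter N1 g \o c) ts) ((iter N1 g \o c) e).
  have sts' : s <= ts <= e' by rewrite sts.
  have := fg N1 (c s) (c ts) le1; have := he' ts sts'; rewrite /= ler_norml => k1 /andP[k2 k3].
  have := tdistD (iter N1 g (c ts)) (iter N1 g (c s)) (iter N1 g (c e)); rewrite eq2; qlra.
have cg1 : continuous (iter N1 g \o c) by exact: iter_curve_continuous.
have tg1 : tang E C 4^-1 r0 (iter N1 g \o c) s e by exact: tang_iter.
have q20 : 0 < q / 2 by qlra.
have q2r : q / 2 <= r0 by qlra.
have [w1 [/andP[tsw1 w1e] _ _ w14]] := exit_persists tmg cg1 tg1 q20 q2r sts tse (lexx _) far.
have cg2 : continuous (iter N1.+1 g \o c) by exact: iter_curve_continuous.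
have tg2 : tang E C 4^-1 r0 (iter N1.+1 g \o c) s e by exact: tang_iter.
have q2p : 0 < 2 * q by qlra.
have q2d : 2 * q <= tdist ((iter N1.+1 g \o c) ts) ((iter N1.+1 g \o c) w1).
  by apply: le_trans w14; qlra.
have [w2 [/andP[tsw2 w2w1] w2q hw2]] := exit_iterates cg r00 tmg N.-1 cg2 tg2 q2p q2r0 sts tsw1 w1e q2d.
have w2e := le_trans w2w1 w1e.
have lev j : (j < N)%N -> forall u', ts <= u' <= w2 ->
    tdist (iter (N1 + j.+1) g (c ts)) (iter (N1 + j.+1) g (c u')) <= 2 * q.
  move=> jN u' hu'; have jN' : (j <= N.-1)%N by move: jN; clear; lia.
  by have := hw2 j u' jN' hu'; rewrite /= -!iterSr -!iterD addnC addnS -addSn addnC.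
exists ts, w2; split.
  move=> v hv; apply: (hN _ y) => // k kN.
  have kN' : (k <= N)%N by apply: leq_trans kN (leq_subr _ _).
  have kK : (k <= N1 + M + N)%N by apply: leq_trans kN' (leq_addl _ _).
  have k1 : tdist (iter k g (iter (N1 + M) g (c ts))) (iter k g (iter (N1 + M) g (c v))) <= 2 * q.
    rewrite -!iterD (_ : (k + (N1 + M) = N1 + (k + M).-1.+1)%N); last by move: M0; clear; lia.
    by apply: lev => //; move: kN M0 MN; clear; lia.
  have k2 := close k (iter (N1 + M) g (c v)) kK; have k3 := close k (iter (N1 + M) g (c ts)) kK.
  have k4 := hrho k _ _ kN' hy.
  have i1 := tdistD (iter k g (iter (N1 + M) g (c v))) (iter k F (iter (N1 + M) g (c v))) (iter k F y).
  have i2 := tdistD (iter k g (iter (N1 + M) g (c ts))) (iter k g (iter (N1 + M) g (c v))) (iter k F y).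
  have i3 := tdistD (iter k F (iter (N1 + M) g (c ts))) (iter k g (iter (N1 + M) g (c ts))) (iter k F y).
  rewrite (tdistC (iter k g (iter (N1 + M) g (c v))) (iter k g (iter (N1 + M) g (c ts)))) in i2.
  rewrite (tdistC (iter k g (iter (N1 + M) g (c ts))) (iter k F (iter (N1 + M) g (c ts)))) in i3.
  qlra.
split=> //; split=> //.
- exact: iter_curve_continuous.
- by apply: tang_iter => //; exact: tang_sub tg.
- move=> v hv; rewrite /= -!iterD (_ : (N1 + N = N1 + N.-1.+1)%N) ?lev// ?prednK//.
- by move: w2q; rewrite /= -!iterSr -!iterD prednK// addnC.
Qed.

(** The subarcs of successive blocks are nested, so a point of the last one has all the expanding
    blocks in its orbit. *)
Lemma curve_blocks : exists N, ev (fun g => forall x0 s, 0 < s -> exists N0, forall J, exists u,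
  tdist x0 u < s /\ forall i, (i < J)%N -> expanding_at F A N (iter (i * N) g (iter N0 g u))).
Proof using A_lower CA CE_dom CZ C_exp C_nontrivial EA b0 b1 cA cF contC contE dec1 deep ev_and ev_imp ev_iter hit kap0 l01 lam0 lam8 nlF tr.
have [r0 [q [N1 [M [N [qp q2r0 r00 evb]]]]]] := arc_block.
exists N; apply: ev_imp evb => g [cg tmg blk] x0 s s0.
have p4 : (0 : R) < 4^-1 by rewrite invr_gt0.
have p41 : 4^-1 <= 1 :> R by lra.
have [v [d [v0 d0 hd]]] := segment_tang CZ kap0 tr dec1 C_nontrivial contC contE x0 p4 p41.
have vp := enorm_gt0 v0.
have [e [e0 ed es]] : exists e : R, [/\ 0 < e, e <= d & e * enorm v < s].
  have h : 0 < s / enorm v by rewrite divr_gt0.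
  exists (Num.min d (s / enorm v / 2)); split.
  - by rewrite lt_min d0 divr_gt0.
  - by rewrite ge_min lexx.
  - rewrite -ltr_pdivlMr//; apply: (@le_lt_trans _ _ (s / enorm v / 2)); last by lra.
    by rewrite ge_min lexx orbT.
pose c0 := fun t : R => x0 + tproj (t *: v).
have cc0 : continuous c0 by exact: line_continuous.
have tg0 : tang E C 4^-1 r0 c0 0 e := hd _ _ ed.
have q2p : 0 < 2 * q by lra.
have [k [s' [t [s'0 s't st te]]]] := tiny_curve_grows cg r00 tmg cc0 tg0 e0 q2p q2r0.
have ck : continuous (iter k g \o c0) by exact: iter_curve_continuous.
have tgk : tang E C 4^-1 r0 (iter k g \o c0) 0 e by exact: tang_iter.
have [w [/andP[s'w wt] wq hw]] := exit_iterates cg r00 tmg N1 ck tgk q2p q2r0 s'0 s't te st.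
have B0 : arc_curve r0 q N1 g (iter k g \o c0) s' w.
  split=> //; first by apply: tang_sub tgk => //; exact: le_trans te.
  by move=> u hu; exact: hw.
exists (N1 + M + k)%N.
have nest J : forall c' a e', arc_curve r0 q N1 g c' a e' -> exists2 u, a <= u <= e' &
    forall i, (i < J)%N -> expanding_at F A N (iter (i * N) g (iter (N1 + M) g (c' u))).
  elim: J => [|J IH] c' a e' B.
    by exists a => //; rewrite lexx /=; have [] := B.
  have [s1 [e1 [hx [ss1 e1e B1]]]] := blk _ _ _ B.
  have [u /andP[u1 u2] hu] := IH _ _ _ B1.
  exists u; first by rewrite (le_trans ss1 u1) (le_trans u2 e1e).
  move=> [|i] iJ; first by apply: hx; rewrite u1.
  rewrite mulSn addnC iterD -[iter N g _]iterD addnC iterD; exact: hu.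
move=> J; have [u /andP[u0 ue] hu] := nest J _ _ _ B0.
exists (c0 u); split; last by move=> i iJ; rewrite iterD; exact: hu.
apply: le_lt_trans (tdist_addr _ _) _; rewrite enormZ ger0_norm; last exact: le_trans u0.
by apply: le_lt_trans es; rewrite ler_pM2r//; apply: le_trans ue (le_trans wt te).
Qed.

End CurveBlocks.

(** * Chords in the interior of the cones *)

Section DeepChords.
Context {R : realType} {n : nat} (F : torus R n -> torus R n)
  (A E : torus R n -> 'M[R]_n) (C : torus R n -> set 'rV[R]_n) (b r0 : R).
Local Notation T := (torus R n).
Local Notation V := ('rV[R]_n).
Hypotheses (cF : continuous F) (cA : continuous A)
  (CZ : forall x a u, C x u -> C x (a *: u))
  (CA : forall x u, C x u -> C (F x) (u *m A x))
  (b0 : 0 < b) (A_lower : forall x (v : V), b * enorm v <= enorm (v *m A x))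
  (uA : forall x, A x \in unitmx)
  (nlF : forall eta : R, 0 < eta -> exists2 r, 0 < r & near_lin A eta r F)
  (r00 : 0 < r0) (tmF : tame E C 4^-1 r0 F).

Definition deepv (s : R) (x : T) (v : V) :=
  forall y w, tdist x y < s -> enorm (w - v) <= s * enorm v -> C y w.

Definition dtang (s : R) (P : R -> T) (a e : R) := forall t t', a <= t -> t < t' -> t' <= e ->
  (forall u, t <= u <= t' -> tdist (P t) (P u) <= s) ->
  P t <> P t' /\ deepv s (P t) (tlog (P t' - P t)).

Lemma deepv_mono s s' x v : s' <= s -> deepv s x v -> deepv s' x v.
Proof.
move=> ss h y w xy wv; apply: h; first exact: lt_le_trans ss.
by apply: le_trans wv _; rewrite ler_wpM2r ?enorm_ge0.
Qed.

(** A point near [F x] and a vector near [v'] are pulled back, by [covering] and by the inverse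
    matrix, to a point near [x] and a vector near [v]. The new room [s'] may be much smaller than
    [s]: only finitely many iterates of a fixed segment are considered. *)
Lemma deepv_image (s : R) : 0 < s -> exists2 s', 0 < s' & forall x v v', deepv s x v -> enorm v <= s' ->
  v' = local_expr F x v -> deepv s' (F x) v'.
Proof using A_lower CA b0 cA cF nlF uA.
have locals := I.
move=> s0; have bp := b0; have [B B0 hB] := bounded_mx_torus cA.
have bs : 0 < b * s / 4 by rewrite divr_gt0 ?mulr_gt0.
have b2 : 0 < b / 2 by qlra.
have [r1 r10 h1] := nlF bs; have [r2 r20 h2] := uniform_continuous_mx cA bs.
have [r3 r30 h3] := nlF b2.
have [s2 [s20 s2s s2r]] : exists s2 : R, [/\ 0 < s2, s2 <= s & s2 <= r2].
  by exists (Num.min s r2); rewrite lt_min s0 !ge_min !lexx orbT.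
have [s' [s'0 s'r s'2 s'B]] : exists s' : R, [/\ 0 < s', s' <= r1, s' <= b / 2 * s2 & s' * (B + b * s) <= b * s / 4].
  have pB : 0 < B + b * s by rewrite addr_gt0// mulr_gt0.
  exists (Num.min r1 (Num.min (b / 2 * s2) (b * s / 4 / (B + b * s)))); split.
  - by rewrite !lt_min r10 mulr_gt0// divr_gt0.
  - by rewrite ge_min lexx.
  - by rewrite !ge_min lexx orbT.
  - by rewrite -ler_pdivlMr// !ge_min lexx !orbT.
exists s' => // x v v' dv vs v'E y' w' xy' wv'.
have [y xy yE] : exists2 y, tdist x y < s2 & F y = y'.
  apply: (@covering R n F A (b / 2) b r3 s2) => //; first by apply/andP; split; qlra.
  by apply: lt_le_trans xy' _; qlra.
rewrite -yE -(mulmxKV (uA y) w'); apply/CA/dv; first exact: lt_le_trans s2s.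
set w := w' *m invmx (A y).
have wE : w *m A y = w' by rewrite mulmxKV.
have k1 : enorm (v' - v *m A x) <= b * s / 4 * enorm v by rewrite v'E; apply: h1; exact: le_trans s'r.
have k2 : enorm (v *m (A x - A y)) <= b * s / 4 * enorm v.
  apply: le_trans (enorm_mulmx _ _) _; rewrite ler_wpM2r ?enorm_ge0//.
  by apply/ltW/h2/(lt_le_trans xy).
have k3 : enorm v' <= (B + b * s) * enorm v.
  have := enormD (v' - v *m A x) (v *m A x); rewrite subrK => k.
  have k4 : enorm (v *m A x) <= B * enorm v.
    by apply: le_trans (enorm_mulmx _ _) _; rewrite ler_wpM2r ?enorm_ge0.
  have p0 : 0 <= b * s * enorm v by rewrite mulr_ge0 ?enorm_ge0// mulr_ge0// ltW.
  qlra.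
have k5 : s' * enorm v' <= b * s / 4 * enorm v.
  apply: (@le_trans _ _ (s' * (B + b * s) * enorm v)); last by rewrite ler_wpM2r ?enorm_ge0.
  by rewrite -mulrA ler_pM2l.
rewrite -(ler_pM2l b0); apply: le_trans (A_lower y _) _.
have -> : (w - v) *m A y = (w' - v') + (v' - v *m A x) + v *m (A x - A y).
  by rewrite mulmxBl wE mulmxBr [_ + (v' - _)]addrA subrK addrA subrK.
have i1 := enormD (w' - v' + (v' - v *m A x)) (v *m (A x - A y)).
have i2 := enormD (w' - v') (v' - v *m A x).
have : 0 <= b * s * enorm v by rewrite mulr_ge0 ?enorm_ge0// mulr_ge0// ltW.
qlra.
Qed.

Lemma dtang_image (s : R) : 0 < s -> exists2 s', 0 < s' & forall P a e, continuous P ->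
  tang E C 4^-1 r0 P a e -> dtang s P a e -> dtang s' (F \o P) a e.
Proof using A_lower CA b0 cA cF nlF r00 tmF uA.
move=> s0; have [s1 s10 h1] := deepv_image s0.
have [s' [s'0 s's s'1 s'r]] : exists s' : R, [/\ 0 < s', s' <= s, s' <= s1 & s' <= r0].
  exists (Num.min s (Num.min s1 r0)); split.
  - by rewrite !lt_min s0 s10.
  - by rewrite ge_min lexx.
  - by rewrite !ge_min lexx orbT.
  - by rewrite !ge_min lexx !orbT.
exists s' => // P a e cP tg dt t t' at' tt' t'e sm.
have tm' : tame E C 4^-1 s' F by move=> x v tv vq; apply: tmF => //; exact: le_trans s'r.
have tg' : tang E C 4^-1 s' P a e.
  by move=> u u' h2 h3 h4 h5; apply: tg => // v hv; exact: le_trans (h5 v hv) s'r.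
have sm' := @tang_pullback _ _ _ _ _ _ _ _ a e t t' cP s'0 tm' tg' at' (ltW tt') t'e sm.
have [ne dv] := dt t t' at' tt' t'e (fun u hu => le_trans (sm' u hu) s's).
split.
  by have [] := @tang_image _ _ _ _ _ _ _ _ a e cP s'0 tm' tg' t t' at' tt' t'e sm.
apply: (deepv_mono s'1); apply: (h1 (P t) (tlog (P t' - P t))) => //.
- apply: le_trans s'1; rewrite -/(tnorm _) -tdistE tdistC; apply: sm'.
  by rewrite (ltW tt') lexx.
by rewrite /= tlog_diff_local.
Qed.

Lemma deep_direction_dtang s x u w : 0 < s -> s <= 2^-1 -> deep_direction C s x u -> w <= s / 2 ->
  dtang (s / 4) (fun t : R => x + tproj (t *: u)) 0 w.
Proof using CZ.
move=> s0 s1 [u1 hu] ws t t' t0 tt' t'w _.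
have E1 : x + tproj (t' *: u) - (x + tproj (t *: u)) = tproj ((t' - t) *: u).
  by rewrite opprD addrACA subrr add0r -tprojB scalerBl.
have tp : 0 < t' - t by lra.
have E2 : enorm ((t' - t) *: u) = t' - t by rewrite enormZ u1 mulr1 ger0_norm// ltW.
have sm : enorm ((t' - t) *: u) < 2^-1 by rewrite E2; lra.
rewrite E1 tlog_small//; split.
  move=> h; have : tlog (tproj ((t' - t) *: u)) = 0 by rewrite -E1 h subrr tlog0.
  rewrite tlog_small// => z; move: E2; rewrite z enorm0; lra.
move=> y z ty; rewrite E2 => zu.
have -> : z = (t' - t) *: ((t' - t)^-1 *: z) by rewrite scalerA mulfV ?gt_eqF// scale1r.
apply/CZ/hu.
  have := tdistD (x + tproj (t *: u)) x y; have := tdist_addr x (t *: u).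
  rewrite enormZ u1 mulr1 ger0_norm//; lra.
have -> : (t' - t)^-1 *: z - u = (t' - t)^-1 *: (z - (t' - t) *: u).
  by rewrite scalerBr scalerA mulVf ?gt_eqF// scale1r.
rewrite enormZ gtr0_norm ?invr_gt0// mulrC ler_pdivrMr//.
by apply: le_trans zu _; rewrite ler_pM2r//; lra.
Qed.

Lemma deep_segment_iter s x u w N : 0 < s -> s <= 2^-1 -> deep_direction C s x u -> w <= s / 2 ->
  exists2 s', 0 < s' & dtang s' (fun t : R => iter N F (x + tproj (t *: u))) 0 w.
Proof using A_lower CA CZ b0 cA cF nlF r00 tmF uA.
move=> s0 s1 du ws; elim: N => [|N [s2 s20 IH]].
  by exists (s / 4); [lra|exact: deep_direction_dtang].
have [s' s'0 h] := dtang_image s20; exists s' => //.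
have csg : continuous (fun t : R => x + tproj (t *: u)) by exact: line_continuous.
have p4 : (0 : R) < 4^-1 by rewrite invr_gt0.
have tsg : tang E C 4^-1 r0 (fun t : R => x + tproj (t *: u)) 0 w.
  have t1 : tang E C 4^-1 r0 (fun t : R => x + tproj (t *: u)) 0 (s / 2) by exact: deep_direction_tang.
  exact: tang_sub (lexx _) ws t1.
apply: (h (iter N F \o (fun t : R => x + tproj (t *: u)))) => //.
- exact: iter_curve_continuous.
- exact: tang_iter.
Qed.

End DeepChords.

(** * Chains of equidistant points on a curve *)

Section Chains.
Context {R : realType} {n : nat}.
Local Notation T := (torus R n).
Local Notation V := ('rV[R]_n).

Lemma steps_refine (P : R -> T) (r d : R) (j m : nat) (s e : R) : continuous P -> 0 < d -> j%:R * d <= r ->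
  steps P r m s e -> steps P d (m * j) s e.
Proof.
move=> cP d0 jr; elim: m s => [|m IH] s; first by [].
move=> [s' [t [ss' s't rt /IH st]]]; rewrite mulSn.
apply: (steps_mono ss'); have {rt} : j%:R * d <= tdist (P s') (P t) by exact: le_trans jr rt.
move: (m * j)%N st => k st; clear ss' IH jr; elim: j s' s't => [|j IHj] s' s't jr; first exact: steps_mono st.
have dd : d <= tdist (P s') (P t).
  apply: le_trans jr; rewrite -natr1 mulrDl mul1r lerDr mulr_ge0//; exact: ltW.
have [|t1 [/andP[s't1 t1t] t1d _]] := first_hit (@tdist_curve_continuous R n P (P s') cP) s't _ dd.
  by rewrite tdistxx ltW.
rewrite addSn /=; exists s', t1; split=> //; first by rewrite t1d.
apply: IHj => //; move: jr; rewrite -natr1 mulrDl mul1r -t1d => jr.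
by have := tdistD (P t1) (P s') (P t); lra.
Qed.

Lemma steps_chain (P : R -> T) (d : R) (m : nat) (s e : R) : continuous P -> 0 < d -> steps P (2 * d) m s e ->
  exists t : nat -> R, [/\ t 0%N = s, forall k, (k < m)%N -> t k < t k.+1,
    forall k, (k <= m)%N -> s <= t k <= e, forall k, (k < m)%N -> tdist (P (t k)) (P (t k.+1)) = d &
    forall k u, (k < m)%N -> t k <= u <= t k.+1 -> tdist (P (t k)) (P u) <= d].
Proof.
move=> cP d0; elim: m s => [|m IH] s /=.
  by move=> se; exists (fun=> s); split=> // k _; rewrite lexx.
move=> [s' [t [ss' s't rt st]]]; have te := steps_le st.
(* One of the ends of an arc of displacement [2 * d] is at distance at least [d] from the current
   point. *)
have [w [sw wt dw]] : exists w, [/\ s <= w, w <= t & d <= tdist (P s) (P w)].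
  have [h|h] := leP d (tdist (P s) (P s')); first by exists s'.
  exists t; split=> //; first exact: le_trans s't.
  have := tdistD (P s) (P s') (P t); rewrite (tdistC (P s') (P s)); lra.
have [|t1 [/andP[st1 t1w] t1d ht1]] := first_hit (@tdist_curve_continuous R n P (P s) cP) sw _ dw.
  by rewrite tdistxx ltW.
have st1' : s < t1.
  rewrite lt_def st1 andbT; apply/eqP => z; move: t1d; rewrite z tdistxx => h.
  by move: d0; rewrite -h ltxx.
have [f [f0 f1 f2 f3 f4]] := IH t1 (steps_mono (le_trans t1w wt) st).
exists (fun k => if k is k'.+1 then f k' else s); split=> //.
- by case=> [|k] km; rewrite ?f0//; exact: f1.
- case=> [|k] km; first by rewrite lexx (le_trans sw (le_trans wt te)).
  by have /andP[h1 h2] := f2 k km; rewrite (le_trans st1 h1).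
- by case=> [|k] km; rewrite ?f0//; exact: f3.
- by case=> [|k] u km; rewrite ?f0//; [exact: ht1|exact: f4].
Qed.

End Chains.

(** * Inscribed polygons *)

Section InscribedPolygons.
Context {R : realType} {n : nat} (C : torus R n -> set 'rV[R]_n) (s : R) (lf : torus R n -> 'rV[R]_n).
Local Notation T := (torus R n).
Local Notation V := ('rV[R]_n).
Hypotheses (s0 : 0 < s) (CZ : forall x a u, C x u -> C x (a *: u))
  (hl : forall x, half_functional C s x (lf x)).

Definition coherent (x : T) (u v : V) := 0 < edot u (lf x) * edot v (lf x).

Lemma tnorm_chord (x y : T) : enorm (tlog (y - x)) = tdist x y.
Proof. by rewrite -/(tnorm _) -tdistE tdistC. Qed.

(** Consecutive edges lie in the same half cone because the functional vanishes on no short chord: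
    its sign is constant along the chords from the first of three vertices, then along those to the
    last. *)
Lemma inscribed_polygon (P : R -> T) (a e r L sg rho : R) m : continuous P -> 0 < sg -> dtang C sg P a e ->
  0 < r -> steps P r m a e -> (0 < m)%N -> L <= m%:R * r -> 0 < rho ->
  exists (K : nat) (d : R) (p : nat -> V), [/\ (3 <= K)%N, 0 < d, d <= rho, L <= 4 * (K%:R * d) &
    [/\ forall k, (k < K)%N -> enorm (p k.+1 - p k) = d /\ deepv C sg (tproj (p k)) (p k.+1 - p k),
     forall k, (k.+1 < K)%N -> coherent (tproj (p k)) (p k.+1 - p k) (p k.+2 - p k.+1) &
     forall k, (k <= K)%N -> exists2 t, a <= t <= e & tproj (p k) = P t]].
Proof using CZ hl s0.
have locals := I.
move=> cP sg0 dt rp st m0 Lr rho0; have sp := s0.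
have [d [d0 drho dr dsg [ds d16]]] : exists d : R, [/\ 0 < d, d <= rho, 8 * d <= r, 4 * d <= sg & 4 * d < s /\ 16 * d < 1].
  pose M := Num.min rho (Num.min r (Num.min sg (Num.min s 1))).
  have M0 : 0 < M by rewrite !lt_min rho0 rp sg0 s0 ltr01.
  have h1 : M <= rho by rewrite ge_min lexx.
  have h2 : M <= r by rewrite !ge_min lexx orbT.
  have h3 : M <= sg by rewrite !ge_min lexx !orbT.
  have h4 : M <= s by rewrite !ge_min lexx !orbT.
  have h5 : M <= 1 by rewrite !ge_min lexx !orbT.
  by move: M M0 h1 h2 h3 h4 h5 => M *; exists (M / 17); split; try split; qlra.
have d20 : 0 < 2 * d by qlra.
have rd0 : 0 <= r / (2 * d) by rewrite divr_ge0 ?ltW.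
(* A step of size [r] is cut into [j] steps of size [2 * d], each giving one edge of length [d];
   with [j >= 3], rounding leaves [r <= 4 * (j%:R * d)]. *)
have := truncn_itv rd0; set j := Num.truncn _ => /andP[j1 j2].
have jr : j%:R * (2 * d) <= r by rewrite -ler_pdivlMr.
have j2' : r < (j%:R + 1) * (2 * d) by rewrite -ltr_pdivrMr// natr1.
have j3 : (3 <= j)%N.
  rewrite leqNgt; apply/negP => h; have : j%:R <= 2 :> R by rewrite (ler_nat R j 2); move: h; clear; lia.
  by nra.
have stm := steps_refine cP d20 jr st.
have [t [t0 tinc tae td tdu]] := steps_chain cP d0 stm.
set K := (m * j)%N in stm tinc tae td tdu.
pose p := fix p k : V := if k is k'.+1 then p k' + tlog (P (t k'.+1) - P (t k')) else tlog (P (t 0%N)).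
have pP k : tproj (p k) = P (t k).
  elim: k => [|k IH]; first by rewrite /= tlogK.
  by rewrite /= tprojD IH tlogK addrC subrK.
have wE k : p k.+1 - p k = tlog (P (t k.+1) - P (t k)) by rewrite /= addrAC subrr add0r.
have st1 k : (k < K)%N -> a <= t k /\ t k.+1 <= e.
  by move=> kK; have /andP[h1 _] := tae k (ltnW kK); have /andP[_ h2] := tae k.+1 kK.
exists K, d, p; split=> //.
- by apply: leq_trans j3 _; rewrite leq_pmull.
- apply: le_trans Lr _; rewrite /K natrM.
  have : r <= 4 * (j%:R * d).
    have : 3 <= j%:R :> R by rewrite (ler_nat R 3).
    nra.
  move=> h; have : m%:R * r <= m%:R * (4 * (j%:R * d)) by rewrite ler_wpM2l.
  by move=> h'; apply: le_trans h' _; rewrite le_eqVlt; apply/orP; left; apply/eqP; ring.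
split.
- move=> k kK; have [h1 h2] := st1 k kK.
  rewrite wE pP tnorm_chord td//; split=> //.
  have dsg' : d <= sg by qlra.
  by have [_] := dt (t k) (t k.+1) h1 (tinc k kK) h2 (fun u hu => le_trans (tdu k u kK hu) dsg').
- move=> k kK; rewrite /coherent !wE pP.
  have kK' := ltnW kK; have [h1 h2] := st1 k kK'; have [h3 h4] := st1 k.+1 kK.
  have i1 := tinc k kK'; have i2 := tinc k.+1 kK.
  set l := lf _.
  have far u : t k <= u -> u <= t k.+2 -> tdist (P (t k)) (P u) <= 2 * d.
    move=> u1 u2; have [u3|u3] := leP u (t k.+1).
      by have := tdu k u kK'; rewrite u1 u3 => /(_ isT); qlra.
    have := tdu k.+1 u kK; rewrite (ltW u3) u2 => /(_ isT).
    have := td k kK'; have := tdistD (P (t k.+1)) (P (t k)) (P u); qlra.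
  have nz u u' : t k <= u -> u < u' -> u' <= t k.+2 -> edot (tlog (P u' - P u)) l != 0.
    move=> u1 uu' u2.
    have sm v : u <= v <= u' -> tdist (P u) (P v) <= sg.
      move=> /andP[v1 v2]; have f1 := far u u1 (le_trans (ltW uu') u2).
      have f2 := far v (le_trans u1 v1) (le_trans v2 u2).
      have := tdistD (P (t k)) (P u) (P v); rewrite (tdistC (P u) (P (t k))); qlra.
    have [ne dv] := dt u u' (le_trans h1 u1) uu' (le_trans u2 h4) sm.
    have Cv : C (P u) (tlog (P u' - P u)) by apply: dv; rewrite ?tdistxx ?subrr ?enorm0 ?mulr_ge0 ?enorm_ge0// ltW.
    have [_ hk _] := hl (P (t k)).
    have nr : tdist (P (t k)) (P u) < s by have := far u u1 (le_trans (ltW uu') u2); qlra.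
    apply/eqP => z; have := hk _ _ nr Cv; rewrite -/l z normr0 pmulr_rle0// tnorm_chord => h.
    by apply: ne; apply: tdist_eq0; apply/eqP; rewrite eq_le h tdist_ge0.
  have s1 : 0 < edot (tlog (P (t k.+1) - P (t k))) l * edot (tlog (P (t k.+2) - P (t k))) l.
    apply: chord_sign => //; first exact: ltW.
      by move=> u /andP[u1 u2]; apply: le_lt_trans (far u (le_trans (ltW i1) u1) u2) _; qlra.
    by move=> u /andP[u1 u2]; apply: nz => //; exact: lt_le_trans u1.
  have far2 u : t k <= u -> u <= t k.+2 -> tdist (P (t k.+2)) (P u) <= 4 * d.
    move=> u1 u2; have := far u u1 u2; have := far (t k.+2) (ltW (lt_trans i1 i2)) (lexx _).
    have := tdistD (P (t k)) (P (t k.+2)) (P u); rewrite (tdistC (P (t k.+2)) (P (t k))); qlra.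
  have tN u : t k <= u -> u <= t k.+2 -> tlog (P u - P (t k.+2)) = - tlog (P (t k.+2) - P u).
    move=> u1 u2; rewrite -tlogN ?opprB// -tdistE; have := far2 u u1 u2; qlra.
  have s2 : 0 < edot (tlog (P (t k) - P (t k.+2))) l * edot (tlog (P (t k.+1) - P (t k.+2))) l.
    apply: chord_sign => //; first exact: ltW.
      move=> u /andP[u1 u2]; apply: le_lt_trans (far2 u u1 (le_trans u2 (ltW i2))) _; qlra.
    move=> u /andP[u1 u2]; rewrite tN ?(le_trans u2 (ltW i2))// edotNl oppr_eq0.
    by apply: nz => //; exact: le_lt_trans i2.
  rewrite !tN ?lexx ?(ltW i1) ?(ltW i2) ?(ltW (lt_trans i1 i2))// !edotNl mulrNN in s2.
  by move: s1 s2; clear; nra.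
- by move=> k kK; exists (t k); [exact: tae|exact: pP].
Qed.

(** The edges of [Q] are perturbations of vectors [W k] well inside the cones; both the cone
    condition and the coherence of signs survive when the error is small against [sg], [s] and the
    shortest edge. *)
Lemma near_cone_polygon (d sg mu : R) K (x : nat -> T) (W Q : nat -> V) (dl : R) : 0 < d -> 0 < dl -> dl <= d ->
  9 * d < sg -> 9 * d < s -> 0 <= mu -> mu * d <= sg * dl -> mu * d <= s * dl / 2 -> mu * d <= dl / 4 ->
  (forall k, (k < K)%N -> [/\ dl <= enorm (W k) <= d, deepv C sg (x k) (W k), tdist (x k) (tproj (Q k)) <= d &
     enorm (Q k.+1 - Q k - W k) <= mu * d]) ->
  (forall k, (k.+1 < K)%N -> coherent (x k) (W k) (W k.+1) /\ tdist (x k) (x k.+1) <= 4 * d) ->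
  cone_polygon C lf (dl / 2) (4 / 3 * d) K Q.
Proof using CZ hl s0.
have locals := I.
move=> d0 dl0 dld dsg ds mu0 mu1 mu2 mu3 hW hc; have sp := s0.
have Cw k y : (k < K)%N -> tdist (tproj (Q k)) y < 8 * d -> C y (Q k.+1 - Q k).
  move=> kK yk; have [/andP[w1 w2] dv xk wk] := hW k kK.
  apply: dv; first by have := tdistD (tproj (Q k)) (x k) y; qlra.
  apply: le_trans wk (le_trans mu1 _); rewrite ler_pM2l//; qlra.
have CW k y : (k < K)%N -> tdist (x k) y < sg -> C y (W k).
  move=> kK yk; have [/andP[w1 w2] dv xk wk] := hW k kK.
  by apply: dv => //; rewrite subrr enorm0 mulr_ge0 ?enorm_ge0//; qlra.
split=> [k kK|k kK].
  have [/andP[w1 w2] dv xk wk] := hW k kK; split; last by move=> y hy; apply: Cw => //; qlra.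
  have := enorm_lower (W k) (Q k.+1 - Q k - W k); rewrite subrKC => l1.
  have := enormD (W k) (Q k.+1 - Q k - W k); rewrite subrKC => l2.
  apply/andP; split; qlra.
have kK' := ltnW kK; have [co xx] := hc k kK.
have [/andP[w1 w2] dv xk wk] := hW k kK'; have [/andP[w1' w2'] dv' xk' wk'] := hW k.+1 kK.
have near : tdist (x k) (tproj (Q k)) < s by qlra.
have [lb lk _] := hl (x k).
have xs : tdist (x k) (x k) < s by rewrite tdistxx.
have lo v w : C (x k) v -> dl <= enorm v -> enorm (w - v) <= mu * d ->
    `|edot w (lf (x k)) - edot v (lf (x k))| < `|edot v (lf (x k))|.
  move=> Cv dv1 wv; rewrite -edotBl; apply: le_lt_trans (lb _) _; apply: le_lt_trans wv _.
  apply: le_lt_trans mu2 _; apply: lt_le_trans (lk _ _ xs Cv).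
  have : s * dl <= s * enorm v by rewrite ler_pM2l.
  have : 0 < s * dl by rewrite mulr_gt0.
  qlra.
have sx : tdist (x k) (x k) < sg by rewrite tdistxx; qlra.
have sx' : tdist (x k.+1) (x k) < sg by rewrite tdistC; qlra.
have a1 := lo _ _ (CW k (x k) kK' sx) w1 wk.
have a2 := lo _ _ (CW k.+1 (x k) kK sx') w1' wk'.
have pos2 : 0 < edot (Q k.+1 - Q k) (lf (x k)) * edot (Q k.+2 - Q k.+1) (lf (x k)).
  move: a1 a2 co; rewrite /coherent.
  move: (edot (Q k.+1 - Q k) _) (edot (W k) _) (edot (Q k.+2 - Q k.+1) _) (edot (W k.+1) _) => p p' q q'.
  case: (ltrgt0P p') => hp; last by rewrite hp mul0r ltxx.
    rewrite pmulr_rgt0// => h1 h2 h3; rewrite (gtr0_norm h3) in h2.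
    by move: h1 h2; rewrite !ltr_norml => /andP[? ?] /andP[? ?]; rewrite mulr_gt0//; qlra.
  rewrite nmulr_rgt0// => h1 h2 h3; rewrite (ltr0_norm h3) in h2.
  by move: h1 h2; rewrite !ltr_norml => /andP[? ?] /andP[? ?]; rewrite nmulr_rgt0//; qlra.
apply: (half_transfer s0 CZ hl near _ _ _ pos2); first by rewrite tdistxx.
  by apply: Cw => //; rewrite tdistxx; qlra.
have [_ dq _ wq] := hW k.+1 kK; apply: dq.
  by have := tdistD (x k) (x k.+1) (tproj (Q k)); rewrite (tdistC (x k.+1) (x k)); qlra.
apply: le_trans wq (le_trans mu1 _); rewrite ler_pM2l//; qlra.
Qed.

End InscribedPolygons.

(** * General position in dimension at least 3 *)

Section Avoidance.
Context {R : realType} {n : nat}.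
Local Notation V := ('rV[R]_n).

(** One hyperplane at a time: a small move leaves it, within a ball that already avoids the
    others. *)
Lemma avoid_hyperplanes (hs : seq (V * R)) (p : V) (z : R) : 0 < z -> all (fun h => h.1 != 0) hs ->
  exists q e, [/\ 0 < e, enorm (q - p) + e <= z &
    forall q', enorm (q' - q) <= e -> all (fun h => edot q' h.1 != h.2) hs].
Proof.
move=> z0; elim: hs => [|[l r] hs IH] /=.
  by move=> _; exists p, z; rewrite subrr enorm0 add0r.
move=> /andP[l0 /IH[q [e [e0 qe hq]]]].
have lp := enorm_gt0 l0.
have step q1 e1 : 0 < e1 -> enorm (q1 - q) + e1 <= e -> e1 * enorm l < `|edot q1 l - r| ->
    exists q e, [/\ 0 < e, enorm (q - p) + e <= z &
    forall q', enorm (q' - q) <= e -> (edot q' l != r) && all (fun h => edot q' h.1 != h.2) hs].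
  move=> e10 qe1 far; exists q1, e1; split=> //.
    by have := enormD (q1 - q) (q - p); rewrite addrA subrK; lra.
  move=> q' hq'; apply/andP; split.
    apply/eqP => E; move: far; rewrite -E -edotBl => /lt_le_trans/(_ (edot_le _ _)).
    by rewrite ltr_pM2r// enorm_distC ltNge hq'.
  by apply: hq; have := enormD (q' - q1) (q1 - q); rewrite addrA subrK; lra.
have [E|ne] := eqVneq (edot q l) r.
  pose t := e / 2 / enorm l; have t0 : 0 < t by rewrite !divr_gt0.
  apply: (step (q + t *: l) (e / 4)); first by lra.
    rewrite addrAC subrr add0r enormZ gtr0_norm// /t divfK ?gt_eqF//; lra.
  have tl : 0 < t * enorm l ^+ 2 by apply: mulr_gt0 t0 (exprn_gt0 2 lp).
  rewrite edotDl edotZl E addrAC subrr add0r edotvv gtr0_norm//.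
  have far : e / 4 < t * enorm l by rewrite /t divfK ?gt_eqF//; lra.
  by rewrite expr2 mulrA ltr_pM2r.
have d0 : 0 < `|edot q l - r| by rewrite normr_gt0 subr_eq0.
have h : 0 < `|edot q l - r| / 2 / enorm l by rewrite !divr_gt0.
apply: (step q (Num.min e (`|edot q l - r| / 2 / enorm l))).
- by rewrite lt_min e0.
- by rewrite subrr enorm0 add0r ge_min lexx.
apply: (@le_lt_trans _ _ (`|edot q l - r| / 2)); last by lra.
by rewrite -ler_pdivlMr// ge_min lexx orbT.
Qed.

Lemma plane_functional (a b : V) : (2 < n)%N -> exists l : V, [/\ l != 0, edot a l = 0 & edot b l = 0].
Proof.
move=> n3; pose M := col_mx a b.
have [j hj] : exists j, col j (cokermx M) != 0.
  apply: contrapT => /forallNP h.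
  have z : cokermx M = 0.
    apply/matrixP => i j; have /negP := h j; rewrite negbK => /eqP/matrixP/(_ i 0).
    by rewrite !mxE.
  have := mxrank_coker M; rewrite z mxrank0 => /esym/eqP; rewrite subn_eq0 => h'.
  by have := leq_trans h' (rank_leq_row M); move: n3; clear; lia.
exists (col j (cokermx M))^T; split.
- apply: contra_neq hj => z; by rewrite -[LHS]trmxK z trmx0.
- have := mulmx_coker M; rewrite mul_col_mx => /(congr1 usubmx); rewrite col_mxKu => h.
  have := congr1 (fun A : 'M[R]_(1, n) => A 0 j) (etrans h (linear0 usubmx)).
  rewrite !mxE => <-; by apply: eq_bigr => i _; rewrite !mxE.
- have := mulmx_coker M; rewrite mul_col_mx => /(congr1 dsubmx); rewrite col_mxKd => h.
  have := congr1 (fun A : 'M[R]_(1, n) => A 0 j) (etrans h (linear0 dsubmx)).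
  rewrite !mxE => <-; by apply: eq_bigr => i _; rewrite !mxE.
Qed.

Lemma avoid_planes (ps : seq (V * V * V)) (p : V) (z : R) : (2 < n)%N -> 0 < z ->
  exists2 q, enorm (q - p) <= z & forall c a b, (c, a, b) \in ps -> forall al be : R, q <> c + al *: a + be *: b.
Proof.
move=> n3 z0.
have [hs h0 hp] : exists2 hs : seq (V * R), all (fun h => h.1 != 0) hs &
    forall q, all (fun h => edot q h.1 != h.2) hs ->
      forall c a b, (c, a, b) \in ps -> forall al be : R, q <> c + al *: a + be *: b.
  elim: ps => [|[[c a] b] ps [hs h0 hp]]; first by exists [::].
  have [l [l0 la lb]] := plane_functional a b n3.
  exists ((l, edot c l) :: hs); first by rewrite /= l0.
  move=> q /= /andP[q0 qhs] c' a' b'; rewrite inE => /predU1P[[-> -> ->]|]; last exact: hp.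
  move=> al be E; move/eqP: q0; apply.
  by rewrite E !edotDl !edotZl la lb !mulr0 !addr0.
have [q [e [e0 qe hq]]] := avoid_hyperplanes p z0 h0.
exists q; first by lra.
by apply/hp/hq; rewrite subrr enorm0 ltW.
Qed.

(** The polygon being bounded, only these integer translations can make its edges meet on the
    torus. *)
Definition box (B : nat) : seq V :=
  [seq \row_i ((f i : nat)%:R - B%:R) | f : {ffun 'I_n -> 'I_(B + B).+1}].

Lemma mem_box B (m : V) : (forall i, m 0 i \is a Num.int) -> (forall i, `|m 0 i| <= B%:R) -> m \in box B.
Proof.
move=> mi mB; apply/mapP.
exists [ffun i => inord (Num.truncn (m 0 i + B%:R))]; first by rewrite mem_enum.
apply/rowP => i; rewrite mxE ffunE.
have h := mB i; rewrite ler_norml in h; move/andP: h => [h1 h2].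
have p0 : 0 <= m 0 i + B%:R by lra.
have N : m 0 i + B%:R \is a Num.nat by rewrite natrEint p0 andbT rpredD// rpred_nat.
rewrite inordK ?(truncnK N) ?addrK// ltnS -(ler_nat R) (truncnK N) natrD; lra.
Qed.

(** Each new vertex [Q l.+1] is placed off the planes through [Q l] and the integer translates of
    the earlier edges, so that the new edge can meet those only at its origin. The origin itself was
    placed off the planes of its own stage. *)
Lemma generic_polygon (p : nat -> V) (K : nat) (z : R) : (2 < n)%N -> 0 < z ->
  exists Q, (forall k, enorm (Q k - p k) <= z) /\ forall k l (th th' : R),
    (k.+1 < l)%N -> (l < K)%N -> 0 <= th <= 1 -> 0 <= th' <= 1 ->
    tproj (Q k + th *: (Q k.+1 - Q k)) <> tproj (Q l + th' *: (Q l.+1 - Q l)).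
Proof.
move=> n3 z0.
have [B hB] : exists B : nat, forall k, (k <= K)%N -> 2 * (enorm (p k) + z) <= B%:R.
  elim: K => [|K [B hB]].
    exists (Num.bound `|2 * (enorm (p 0%N) + z)|) => k; rewrite leqn0 => /eqP ->.
    exact: le_trans (ler_norm _) (ltW (archi_boundP (normr_ge0 _))).
  exists (maxn B (Num.bound `|2 * (enorm (p K.+1) + z)|)) => k.
  rewrite leq_eqVlt natr_max le_max => /predU1P[->|kK]; last by rewrite hB.
  by apply/orP; right; apply: le_trans (ler_norm _) (ltW (archi_boundP (normr_ge0 _))).
pose G Q L := forall l k m, (k < l)%N -> (l < L)%N -> m \in box B -> forall al be : R,
  Q l.+1 <> Q l + al *: (Q k + m - Q l) + be *: (Q k.+1 + m - Q l).
have [Q [Qp QG]] : exists Q, (forall k, enorm (Q k - p k) <= z) /\ G Q K.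
  elim: {hB} K => [|L [Q [Qp QG]]].
    by exists p; split=> // k; rewrite subrr enorm0 ltW.
  pose ps := [seq (Q L, Q km.1 + km.2 - Q L, Q km.1.+1 + km.2 - Q L) |
     km <- [seq (k, m) | k <- iota 0 L, m <- box B]].
  have [q qp hq] := avoid_planes ps (p L.+1) n3 z0.
  exists (fun k => if k == L.+1 then q else Q k); split.
    by move=> k; case: eqP => [->//|_]; exact: Qp.
  move=> l k m kl; rewrite ltnS => lL mB al be.
  have e1 : (l == L.+1) = false by apply/negbTE; move: lL; clear; lia.
  have e2 : (k == L.+1) = false by apply/negbTE; move: kl lL; clear; lia.
  have e3 : (k.+1 == L.+1) = false by apply/negbTE; move: kl lL; clear; lia.
  rewrite e1 e2 e3; case: eqP => [[E]|ne].
    rewrite E; apply: hq; apply/mapP; exists (k, m) => //=.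
    apply/allpairsP; exists (k, m); split=> //=; rewrite mem_iota /= add0n; move: kl; rewrite E; lia.
  by apply: QG => //; move: lL ne; clear; lia.
exists Q; split=> // k l th th' kl lK /andP[t0 t1] /andP[t0' t1'] E.
have Qn j : (j <= K)%N -> 2 * enorm (Q j) <= B%:R.
  by move=> jK; have := hB j jK; have := enormD (Q j - p j) (p j); rewrite subrK; have := Qp j; lra.
pose m := Q l + th' *: (Q l.+1 - Q l) - (Q k + th *: (Q k.+1 - Q k)).
have bnd j (t : R) : (j < K)%N -> 0 <= t -> t <= 1 -> 2 * enorm (Q j + t *: (Q j.+1 - Q j)) <= B%:R.
  move=> jK h0 h1; have -> : Q j + t *: (Q j.+1 - Q j) = (1 - t) *: Q j + t *: Q j.+1.
    by apply/rowP => i; rewrite !mxE; ring.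
  have := enormD ((1 - t) *: Q j) (t *: Q j.+1); rewrite !enormZ !ger0_norm//; last lra.
  have := Qn j (ltnW jK); have := Qn j.+1 jK => a1 a2.
  have : (1 - t) * (2 * enorm (Q j)) <= (1 - t) * B%:R by rewrite ler_wpM2l//; lra.
  have : t * (2 * enorm (Q j.+1)) <= t * B%:R by rewrite ler_wpM2l.
  lra.
have mB : m \in box B.
  apply: mem_box => i; first exact: ((tprojP _ _).1 (esym E)).
  apply: le_trans (coord_le_enorm _ _) _; apply: le_trans (enormB _ _) _.
  have := bnd l th' lK t0' t1'; have := bnd k th (ltn_trans (ltnW kl) lK) t0 t1; lra.
have mE : Q l + th' *: (Q l.+1 - Q l) = Q k + m + th *: (Q k.+1 - Q k).
  by apply/rowP => i; rewrite /m !mxE; ring.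
(* For [th' = 0] the common point is the vertex [Q l], excluded when it was placed. *)
have [z'|th'0] := eqVneq th' 0.
  case: l kl lK {E mB bnd} @m mE mB => // l kl lK m mE mB.
  rewrite z' scale0r addr0 in mE.
  apply: (QG l k m kl (ltnW lK) mB (1 - th) th); rewrite mE.
  by apply/rowP => i; rewrite !mxE; ring.
have th'p : 0 < th' by rewrite lt_def th'0.
apply: (QG l k m (ltnW kl) lK mB ((1 - th) / th') (th / th')).
have -> : Q l.+1 = Q l + th'^-1 *: (th' *: (Q l.+1 - Q l)).
  by rewrite scalerA mulVf// scale1r subrKC.
have -> : th' *: (Q l.+1 - Q l) = Q k + m + th *: (Q k.+1 - Q k) - Q l by rewrite -mE addrAC subrr add0r.
clearbody m; apply/rowP => i; rewrite !mxE; field; exact: th'0.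
Qed.

End Avoidance.

(** * Injectivity of polygons *)

Section PolygonInjectivity.
Context {R : realType} {n : nat} (C : torus R n -> set 'rV[R]_n) (s : R) (lf : torus R n -> 'rV[R]_n).
Local Notation T := (torus R n).
Local Notation V := ('rV[R]_n).
Hypotheses (s0 : 0 < s) (CZ : forall x a u, C x u -> C x (a *: u))
  (hl : forall x, half_functional C s x (lf x)).
Variables (dl d : R) (K : nat) (Q : nat -> V).
Hypotheses (dl0 : 0 < dl) (d0 : 0 < d) (ds : 6 * d <= s) (d1 : 24 * d <= 1) (K3 : (2 < K)%N)
  (cQ : cone_polygon C lf dl d K Q).
Local Notation w k := (Q k.+1 - Q k).
Local Notation S := (pl K Q).

(** On adjacent edges a chord is a nonzero combination of vectors of one half cone, hence nonzero,
    and it is too short to be an integer vector. *)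
Lemma polygon_injective : (forall k l (th th' : R),
    (k.+1 < l)%N -> (l < K)%N -> 0 <= th <= 1 -> 0 <= th' <= 1 ->
    tproj (Q k + th *: w k) <> tproj (Q l + th' *: w l)) ->
  forall t t' : R, 0 <= t <= K%:R -> 0 <= t' <= K%:R -> tproj (S t) = tproj (S t') -> t = t'.
Proof using CZ K3 cQ d0 d1 dl0 ds hl s0.
have locals := I.
move=> NA; have dp := d0; have d1' := d1; have dlp := dl0; have sp := s0; have ds' := ds.
have K0 : (0 < K)%N by exact: ltn_trans K3.
have nz (u v : V) : tproj u = tproj v -> 0 < enorm (v - u) -> enorm (v - u) < 2^-1 -> False.
  move=> E p h; have := tnorm_projE h; rewrite tprojB E subrr tnorm0 => z.
  by move: p; rewrite -z ltxx.
suff inj t t' : 0 <= t -> t < t' -> t' <= K%:R -> tproj (S t) = tproj (S t') -> False.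
  move=> t t' /andP[k1 k2] /andP[k3 k4] E; have [tt'|tt'|//] := ltgtP t t'.
    by have := inj t t' k1 tt' k4 E.
  by have := inj t' t k3 tt' k2 (esym E).
move=> t0 tt' t'K E.
have [near|far] := leP (t' - t) 1.
  have [_ lo up] := polygon_chord s0 CZ hl dl0 d0 ds K3 cQ t0 tt' t'K near.
  apply: (nz _ _ E).
    by apply: lt_le_trans lo; rewrite mulr_gt0 ?mulr_gt0// subr_gt0.
  apply: le_lt_trans up _; apply: (@le_lt_trans _ _ d); last by qlra.
  by rewrite ler_piMr// ltW.
have [k [th [kK th0 th1 tE]]] := edge_split K0 t0 (le_trans (ltW tt') t'K).
have [l [th' [lK th'0 th'1 t'E]]] := edge_split K0 (le_trans t0 (ltW tt')) t'K.
have th01 : 0 <= th <= 1 by rewrite th0.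
have th'01 : 0 <= th' <= 1 by rewrite th'0.
rewrite tE t'E !plE// in E.
have [kl|lk] := ltnP k.+1 l; first exact: (NA k l th th' kl lK th01 th'01 E).
have kl : (k < l)%N.
  rewrite ltnNge; apply/negP => lk'; have : l%:R <= k%:R :> R by rewrite ler_nat.
  by qlra.
have {lk kl} lk : l = k.+1 by apply/eqP; rewrite eqn_leq lk kl.
rewrite lk in lK E t'E.
have [hw hc] := cQ; have [/andP[w1 w2] Cw] := hw k kK; have [/andP[w1' w2'] Cw'] := hw k.+1 lK.
have xx : tdist (tproj (Q k)) (tproj (Q k)) < s by rewrite tdistxx.
have near' : tdist (tproj (Q k)) (tproj (Q k.+1)) <= d.
  by apply: le_trans (tdist_proj _ _) _; rewrite enorm_distC.
have Ck : C (tproj (Q k)) (w k) by apply: Cw; rewrite tdistxx; qlra.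
have Ck' : C (tproj (Q k)) (w k.+1) by apply: Cw'; rewrite tdistC; qlra.
have a0 : 0 <= 1 - th by qlra.
have lo := half_lower hl xx Ck Ck' (ltW (hc k lK)) a0 th'0.
have [lb _ _] := hl (tproj (Q k)).
have dE : Q k.+1 + th' *: w k.+1 - (Q k + th *: w k) = (1 - th) *: w k + th' *: w k.+1.
  by apply/rowP => i; rewrite !mxE; ring.
rewrite -natr1 in t'E.
apply: (nz _ _ E); rewrite dE.
  apply: lt_le_trans (lb _); apply: lt_le_trans lo; rewrite mulr_gt0//.
  have [z|z] := eqVneq th' 0; last by rewrite ltr_wpDl ?mulr_ge0 ?enorm_ge0// mulr_gt0 ?lt_def ?z//; qlra.
  by rewrite z mul0r addr0 mulr_gt0//; qlra.
apply: le_lt_trans (enormD _ _) _; rewrite !enormZ !ger0_norm//.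
have : (1 - th) * enorm (w k) <= 1 * d by apply: ler_pM; rewrite ?enorm_ge0//; qlra.
have : th' * enorm (w k.+1) <= 1 * d by apply: ler_pM; rewrite ?enorm_ge0.
qlra.
Qed.

End PolygonInjectivity.

(** * Long discs near polygons *)

Section LongDiscs.
Context {R : realType} {n : nat} (C : torus R n -> set 'rV[R]_n) (s : R) (lf : torus R n -> 'rV[R]_n).
Local Notation T := (torus R n).
Local Notation V := ('rV[R]_n).
Hypotheses (s0 : 0 < s) (CZ : forall x a u, C x u -> C x (a *: u))
  (hl : forall x, half_functional C s x (lf x)).

Definition deep_polygon (sg d : R) K (p : nat -> V) :=
  (forall k, (k < K)%N -> enorm (p k.+1 - p k) = d /\ deepv C sg (tproj (p k)) (p k.+1 - p k)) /\
  (forall k, (k.+1 < K)%N -> coherent lf (tproj (p k)) (p k.+1 - p k) (p k.+2 - p k.+1)).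

Definition nonadjacent_disjoint K (Q : nat -> V) := forall k l (th th' : R),
  (k.+1 < l)%N -> (l < K)%N -> 0 <= th <= 1 -> 0 <= th' <= 1 ->
  tproj (Q k + th *: (Q k.+1 - Q k)) <> tproj (Q l + th' *: (Q l.+1 - Q l)).

Definition long_disc_near (A : set T) (rho D : R) := exists h : 'rV[R]_1 -> V, [/\ embedded_disc h,
  tangent_disc h C, forall p, unit_disc p -> exists2 x, A x & tdist (tproj (h p)) x < rho &
  (D%:E < internal_diameter h)%E].

Lemma cone_polygon_disc (dl d : R) K Q rho D : 0 < dl -> 0 < d -> 6 * d <= s -> 24 * d <= 1 -> (2 < K)%N ->
  cone_polygon C lf dl d K Q -> nonadjacent_disjoint K Q -> 0 < rho -> D < (K%:R - 2) * (s * dl) ->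
  long_disc_near [set tproj (pl K Q t) | t in [set t | 0 <= t <= K%:R]] rho D.
Proof using CZ hl s0.
move=> dl0 d0 ds d1 K3 cQ na rho0 DK.
have inj := polygon_injective s0 CZ hl dl0 d0 ds d1 K3 cQ na.
have [h [eh th hn hD]] := polygon_disc s0 CZ hl dl0 d0 ds d1 K3 cQ inj rho0.
exists h; split=> //.
- by move=> p /hn[t t01 ht]; exists (tproj (pl K Q t)) => //; exists t.
- by apply: lt_le_trans hD; rewrite lte_fin.
Qed.

(** The room inside the cones absorbs a displacement [z] of the vertices: generic when the dimension
    is at least 3, zero when the polygon is already injective. The factor 6 comes from
    [K%:R / 6 <= (K%:R - 2) / 2]. *)
Lemma deep_polygon_disc (sg d : R) K p Q rho D z : 0 < sg -> 0 < d -> 9 * d < sg -> 9 * d < s -> 32 * d <= 1 ->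
  (2 < K)%N -> deep_polygon sg d K p -> 0 <= z -> 2 * z <= sg * d -> 4 * z <= s * d -> 8 * z <= d -> z < rho ->
  (forall k, (k <= K)%N -> enorm (Q k - p k) <= z) -> nonadjacent_disjoint K Q -> 0 < rho ->
  6 * D < K%:R * d * s ->
  long_disc_near [set tproj (pl K p t) | t in [set t | 0 <= t <= K%:R]] (2 * rho) D.
Proof using CZ hl s0.
have locals := I.
move=> sg0 d0 dsg ds d1 K3 [hp hc] z0 zsg zs zd zrho Qp na rho0 DK; have sp := s0.
have cQ : cone_polygon C lf (d / 2) (4 / 3 * d) K Q.
  apply: (@near_cone_polygon _ _ C s lf s0 CZ hl d sg (2 * z / d) K (fun k => tproj (p k)) (fun k => p k.+1 - p k) Q d) => //.
  - by rewrite divr_ge0 ?mulr_ge0// ltW.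
  - by rewrite divfK ?gt_eqF//.
  - by rewrite divfK ?gt_eqF//; qlra.
  - by rewrite divfK ?gt_eqF//; qlra.
  - move=> k kK; have [-> dv] := hp k kK; rewrite lexx; split=> //.
      apply: le_trans (tdist_proj _ _) _; rewrite enorm_distC; have := Qp k (ltnW kK); qlra.
    rewrite divfK ?gt_eqF//.
    have -> : Q k.+1 - Q k - (p k.+1 - p k) = (Q k.+1 - p k.+1) - (Q k - p k).
      by apply/rowP => i; rewrite !mxE; ring.
    by have := enormB (Q k.+1 - p k.+1) (Q k - p k); have := Qp k (ltnW kK); have := Qp k.+1 kK; qlra.
  - move=> k kK; split; first exact: hc.
    apply: le_trans (tdist_proj _ _) _; rewrite enorm_distC; have [-> _] := hp k (ltnW kK); qlra.
have K3' : 3 <= K%:R :> R by rewrite (ler_nat R 3).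
have DK' : D < (K%:R - 2) * (s * (d / 2)).
  have : K%:R * d * s / 6 <= (K%:R - 2) * (s * (d / 2)).
    rewrite (_ : (K%:R - 2) * (s * (d / 2)) = (K%:R - 2) / 2 * (d * s)); last by field.
    rewrite (_ : K%:R * d * s / 6 = K%:R / 6 * (d * s)); last by field.
    have k6 : K%:R / 6 <= (K%:R - 2) / 2 :> R by qlra.
    by apply: ler_wpM2r k6; exact: mulr_ge0 (ltW d0) (ltW sp).
  qlra.
have dl0 : 0 < d / 2 by qlra.
have d40 : 0 < 4 / 3 * d by qlra.
have ds4 : 6 * (4 / 3 * d) <= s by qlra.
have d14 : 24 * (4 / 3 * d) <= 1 by qlra.
have [h [eh th hn hD]] := cone_polygon_disc dl0 d40 ds4 d14 K3 cQ na rho0 DK'.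
exists h; split=> // q /hn[_ [t /andP[t0 tK] <-] ht]; exists (tproj (pl K p t)); first by exists t; rewrite //= t0.
have : tdist (tproj (pl K Q t)) (tproj (pl K p t)) <= z.
  have [k [tt [kK tt0 tt1 ->]]] := edge_split (ltn_trans (isT : (0 < 2)%N) K3) t0 tK.
  rewrite !plE//; apply: le_trans (tdist_proj _ _) _.
  have -> : Q k + tt *: (Q k.+1 - Q k) - (p k + tt *: (p k.+1 - p k)) =
      (1 - tt) *: (Q k - p k) + tt *: (Q k.+1 - p k.+1) by apply/rowP => i; rewrite !mxE; ring.
  apply: le_trans (enormD _ _) _; rewrite !enormZ !ger0_norm//; last qlra.
  have : (1 - tt) * enorm (Q k - p k) <= (1 - tt) * z by rewrite ler_wpM2l ?Qp// ?subr_ge0// ltnW.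
  have : tt * enorm (Q k.+1 - p k.+1) <= tt * z by rewrite ler_wpM2l ?Qp.
  qlra.
have := tdistD (tproj (pl K Q t)) (tproj (h q)) (tproj (pl K p t)); qlra.
Qed.

Lemma long_disc_generic (sg d : R) K p rho D : (2 < n)%N -> 0 < sg -> 0 < d -> 9 * d < sg -> 9 * d < s ->
  32 * d <= 1 -> (2 < K)%N -> deep_polygon sg d K p -> 0 < rho -> 6 * D < K%:R * d * s ->
  long_disc_near [set tproj (pl K p t) | t in [set t | 0 <= t <= K%:R]] (2 * rho) D.
Proof using CZ hl s0.
move=> n3 sg0 d0 dsg ds d1 K3 dp rho0 DK; have sp := s0.
have [z [z0 z1 z2 z3 z4]] : exists z : R, [/\ 0 < z, 2 * z <= sg * d, 4 * z <= s * d, 8 * z <= d & z < rho].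
  have h1 : 0 < sg * d by rewrite mulr_gt0.
  have h2 : 0 < s * d by rewrite mulr_gt0.
  pose M := Num.min (sg * d) (Num.min (s * d) (Num.min d rho)).
  have M0 : 0 < M by rewrite !lt_min h1 h2 d0.
  have i1 : M <= sg * d by rewrite ge_min lexx.
  have i2 : M <= s * d by rewrite !ge_min lexx orbT.
  have i3 : M <= d by rewrite !ge_min lexx !orbT.
  have i4 : M <= rho by rewrite !ge_min lexx !orbT.
  by move: M M0 i1 i2 i3 i4 => M *; exists (M / 8); split; lra.
have [Q [Qp na]] := generic_polygon p K n3 z0.
exact: (deep_polygon_disc sg0 d0 dsg ds d1 K3 dp (ltW z0) z1 z2 z3 z4 (fun k _ => Qp k) na rho0 DK).
Qed.

Lemma long_disc_injective (sg d : R) K p rho D : 0 < sg -> 0 < d -> 9 * d < sg -> 9 * d < s ->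
  32 * d <= 1 -> (2 < K)%N -> deep_polygon sg d K p -> nonadjacent_disjoint K p -> 0 < rho -> 6 * D < K%:R * d * s ->
  long_disc_near [set tproj (pl K p t) | t in [set t | 0 <= t <= K%:R]] (2 * rho) D.
Proof using CZ hl s0.
move=> sg0 d0 dsg ds d1 K3 dp na rho0 DK; have sp := s0.
apply: (deep_polygon_disc (Q := p) (z := 0) sg0 d0 dsg ds d1 K3 dp (lexx _)) => //.
- by rewrite mulr0 mulr_ge0 ?ltW.
- by rewrite mulr0 mulr_ge0 ?ltW.
- by rewrite mulr0 ltW.
- by move=> k _; rewrite subrr enorm0.
Qed.

End LongDiscs.

(** * Gaps between disjoint segments *)

Section SegmentGaps.
Context {R : realType} {n : nat}.
Local Notation V := ('rV[R]_n).

Lemma segments_gap (a b u v : V) : (forall th th' : R, 0 <= th <= 1 -> 0 <= th' <= 1 ->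
  tproj (a + th *: u) <> tproj (b + th' *: v)) ->
  exists2 e : R, 0 < e & forall th th' : R, 0 <= th <= 1 -> 0 <= th' <= 1 ->
    e <= tdist (tproj (a + th *: u)) (tproj (b + th' *: v)).
Proof.
have locals := I.
move=> ne; pose D := (`[0, 1]%classic `*` `[0, 1]%classic) : set (R * R).
have cD : compact D by apply: compact_setX; exact: segment_compact.
have D0 : D !=set0 by exists (0, 0); split; rewrite /= in_itv /= lexx ler01.
pose G (z : R * R) := tdist (tproj (a + z.1 *: u)) (tproj (b + z.2 *: v)).
have lip (p q : V) (y t : R) : tdist (tproj (p + y *: q)) (tproj (p + t *: q)) <= `|y - t| * enorm q.
  apply: le_trans (tdist_proj _ _) _; rewrite -enormZ.
  by rewrite (_ : p + y *: q - (p + t *: q) = (y - t) *: q)//; apply/rowP => i; rewrite !mxE; ring.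
have cG : continuous G.
  move=> z; apply/cvgrPdist_le => e e0.
  have e2 (q : V) : 0 < e / 2 / (1 + enorm q) by rewrite divr_gt0//; [qlra|have := enorm_ge0 q; qlra].
  near=> y.
  have h1 : `|z.1 - y.1| <= e / 2 / (1 + enorm u).
    near: y; have : (fun y : R * R => y.1) @ z --> z.1 by exact: cvg_fst.
    by move/cvgrPdist_le; apply; exact: e2.
  have h2 : `|z.2 - y.2| <= e / 2 / (1 + enorm v).
    near: y; have : (fun y : R * R => y.2) @ z --> z.2 by exact: cvg_snd.
    by move/cvgrPdist_le; apply; exact: e2.
  have aux (q : V) (r : R) : 0 <= r -> r <= e / 2 / (1 + enorm q) -> r * enorm q <= e / 2.
    have q0 := enorm_ge0 q; rewrite ler_pdivlMr; last qlra.
    by move=> r0 h; move: (enorm q) q0 h => x; clear -r0; nra.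
  have l1 := le_trans (lip a u z.1 y.1) (aux _ _ (normr_ge0 _) h1).
  have l2 := le_trans (lip b v z.2 y.2) (aux _ _ (normr_ge0 _) h2).
  rewrite /G; move: l1 l2.
  set p1 := tproj _; set q1 := tproj _; set p2 := tproj _; set q2 := tproj _ => l1 l2.
  have i1 := tdist_chain p1 q1 q2 p2; have i2 := tdist_chain q1 p1 p2 q2.
  rewrite (tdistC q1 p1) (tdistC q2 q1) (tdistC q2 p2) in i1; rewrite (tdistC p2 p1) in i2.
  rewrite ler_norml; qlra.
have [z zD zmin] := compact_EVT_min D0 cD (continuous_subspaceT cG).
move: zD; rewrite inE => -[/= z1 z2]; rewrite !in_itv /= in z1 z2.
exists (G z).
  rewrite lt_def tdist_ge0 andbT; apply/eqP => E0.
  by apply: (ne _ _ z1 z2); exact: tdist_eq0.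
by move=> th th' h h'; apply: (zmin (th, th')); rewrite inE; split; rewrite /= in_itv.
Unshelve. all: by end_near.
Qed.

Lemma tproj_cancel (p q x y : V) : tproj p = tproj q -> tproj (p + x) = tproj (q + y) ->
  enorm x < 4^-1 -> enorm y < 4^-1 -> x = y.
Proof.
rewrite !tprojD => -> /addrI E hx hy.
have h : enorm (x - y) < 2^-1 by have := enormB x y; lra.
have := tlog_small h; rewrite tprojB E subrr tlog0 => e0.
by apply/eqP; rewrite -subr_eq0 -e0.
Qed.

Lemma far_apart (a b z : torus R n) (e e' : R) : tdist a z <= e -> tdist b z <= e -> 2 * e < e' -> e' <= tdist a b -> False.
Proof. by have := tdistD z a b; rewrite (tdistC z b); lra. Qed.

Lemma common_lower_bound (P : nat -> R -> Prop) J : (forall i e e', e' <= e -> P i e -> P i e') ->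
  (forall i, (i < J)%N -> exists2 e, 0 < e & P i e) -> exists2 e, 0 < e & forall i, (i < J)%N -> P i e.
Proof.
move=> mono; elim: J => [|J IH] h; first by exists 1.
have [e e0 he] := IH (fun i iJ => h i (ltnW iJ)); have [e' e'0 he'] := h J (ltnSn J).
exists (Num.min e e'); first by rewrite lt_min e0.
move=> i; rewrite ltnS leq_eqVlt => /orP[/eqP->|iJ].
  by apply: mono he'; rewrite ge_min lexx orbT.
by apply: mono (he i iJ); rewrite ge_min lexx.
Qed.

End SegmentGaps.

(** * Spirals around closed walks in dimension 2 *)

Section PlanarWalks.
Context {R : realType}.
Local Notation V := ('rV[R]_2).

(** The area form. With the quarter turn [perp], a functional positive on an edge becomes a normal
    to the left of it ([om_perp]). *)
Definition om (a b : V) : R := a 0 0 * b 0 1 - a 0 1 * b 0 0.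
Definition perp (l : V) : V := \row_(j < 2) (if j == 0 then - l 0 1 else l 0 0).

Lemma rV2P (a b : V) : a 0 0 = b 0 0 -> a 0 1 = b 0 1 -> a = b.
Proof. by move=> h0 h1; apply/rowP; case=> -[|[|//]] hi; [rewrite (_ : Ordinal hi = 0)|rewrite (_ : Ordinal hi = 1)]; rewrite ?h0 ?h1//; apply/val_inj. Qed.

Lemma om_perp a l : om a (perp l) = edot a l.
Proof. by rewrite /om /edot !mxE /= big_ord_recl big_ord1 /= (_ : lift ord0 ord0 = 1 :> 'I_2) ?opprK ?mulrN ?opprK//; apply/val_inj. Qed.

Lemma omC a b : om a b = - om b a. Proof. by rewrite /om; ring. Qed.
Lemma omvv a : om a a = 0. Proof. by rewrite /om; ring. Qed.
Lemma omDl a b c : om (a + b) c = om a c + om b c. Proof. by rewrite /om !mxE; ring. Qed.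
Lemma omDr a b c : om c (a + b) = om c a + om c b. Proof. by rewrite /om !mxE; ring. Qed.
Lemma omZl t a c : om (t *: a) c = t * om a c. Proof. by rewrite /om !mxE; ring. Qed.
Lemma omZr t a c : om c (t *: a) = t * om c a. Proof. by rewrite /om !mxE; ring. Qed.
Lemma omNl a c : om (- a) c = - om a c. Proof. by rewrite /om !mxE; ring. Qed.
Lemma omNr a c : om c (- a) = - om c a. Proof. by rewrite /om !mxE; ring. Qed.
Definition omlin := (omDl, omDr, omZl, omZr, omNl, omNr, omvv).

Lemma enorm_perp l : enorm (perp l) = enorm l.
Proof.
rewrite /enorm; congr Num.sqrt; rewrite !big_ord_recl !big_ord0 !mxE /= (_ : lift ord0 ord0 = 1 :> 'I_2); last exact/val_inj.
by rewrite sqrrN; ring.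
Qed.

Lemma om_le a b : `|om a b| <= enorm a * enorm b.
Proof.
have -> : b = perp (- perp b) by apply: rV2P; rewrite !mxE /=; ring.
by rewrite om_perp; apply: le_trans (edot_le _ _) _; rewrite !enormN !enorm_perp enormN enorm_perp.
Qed.

(** Two edges ending and starting over one vertex, pushed along [N] by different amounts. Pairing
    with [N] cancels the push and leaves two terms of the same sign. *)
Lemma head_tail_apart (P N u v : V) (h g a b : R) : 0 < om u N -> 0 < om v N -> 0 <= a -> 0 <= b -> h != g ->
  P + h *: N - a *: u = P + g *: N + b *: v -> False.
Proof.
move=> uN vN a0 b0 hg E.
have E' : (h - g) *: N = a *: u + b *: v.
  have /rowP e := E; apply/rowP => i; have := e i; rewrite !mxE; lra.
have : om ((h - g) *: N) N = om (a *: u + b *: v) N by rewrite E'.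
rewrite !omlin mulr0 => z.
have za : a = 0 by move: (om u N) (om v N) uN vN z => p q p0 q0; clear -a0 b0 p0 q0; nra.
have zb : b = 0 by move: (om u N) (om v N) uN vN z => p q p0 q0; clear -a0 b0 p0 q0; nra.
move: E'; rewrite za zb !scale0r addr0 => /eqP; rewrite scaler_eq0 subr_eq0 (negPf hg) /= => /eqP N0.
by move: uN; rewrite N0 /om !mxE !mulr0 subrr ltxx.
Qed.

(** Two copies of one edge, the second pushed further at both ends. Pairing with the direction of
    the first leaves terms of one sign, not all zero. *)
Lemma strips_apart (P N N' W : V) (h h' g g' th th' : R) :
  0 < om (W + h' *: N' - h *: N) N -> 0 < om (W + h' *: N' - h *: N) N' -> h < g -> h' < g' -> 0 <= th' <= 1 ->
  P + h *: N + th *: (W + h' *: N' - h *: N) = P + g *: N + th' *: (W + g' *: N' - g *: N) -> False.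
Proof.
move EU : (W + h' *: N' - h *: N) => U UN UN' hg hg' /andP[t0 t1] E.
have E' : th *: U = ((1 - th') * (g - h)) *: N + th' *: U + (th' * (g' - h')) *: N'.
  rewrite -EU; rewrite -EU in E; have /rowP e := E; apply/rowP => i; have := e i; rewrite !mxE; clear; nra.
have := congr1 (om U) E'; rewrite !omlin !mulr0 addr0 => z.
have p1 : 0 < g - h by lra.
have p2 : 0 < g' - h' by lra.
have q1 : 0 < (g - h) * om U N by rewrite mulr_gt0.
have q2 : 0 < (g' - h') * om U N' by rewrite mulr_gt0.
move: z; rewrite -!mulrA; move: ((g - h) * om U N) ((g' - h') * om U N') q1 q2 => p q p0 q0.
clear -t0 t1 p0 q0; nra.
Qed.

(** The edges [u] and [v] leave and reach one vertex in opposite passages, each pushed to its own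
    left; pairing with [v] makes all terms nonpositive. *)
Lemma branches_apart (P N u v : V) (h g a b : R) : 0 < om u v -> om v N < 0 -> 0 < h + g -> 0 <= a -> 0 <= b ->
  P + h *: N + a *: u = P - g *: N - b *: v -> False.
Proof.
move=> uv vN hg a0 b0 E.
have E' : (h + g) *: N + a *: u + b *: v = 0.
  have /rowP e := E; apply/rowP => i; have := e i; rewrite !mxE; lra.
have := congr1 (om v) E'; rewrite !omlin mulr0 addr0 (omC v u) (_ : om v 0 = 0); last by rewrite /om !mxE; ring.
move: (om u v) (om v N) uv vN => p q p0 q0; clear -hg a0 p0 q0; nra.
Qed.

Lemma periodic_modn A (g : nat -> A) J k : (forall k, g (k + J)%N = g k) -> g k = g (k %% J)%N.
Proof.
move=> hg; rewrite {1}(divn_eq k J) addnC; elim: (k %/ J)%N => [|m IH]; first by rewrite mul0n addn0.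
by rewrite mulSn addnCA addnC hg.
Qed.

(* Ways in which the directed segments [i] and [j] of a closed walk may meet without crossing, both being pushed to
   their left: never, along the same segment reversed, head to head, tail to tail, or where the walk [j] arrives at the
   tail of [i] from the left of [i]. *)
Definition walk_pair (nu : R) (c n : nat -> V) (i j : nat) := let W k := c k.+1 - c k in
  [\/ forall th th' : R, 0 <= th <= 1 -> 0 <= th' <= 1 -> nu <= tdist (tproj (c i + th *: W i)) (tproj (c j + th' *: W j)),
      [/\ tproj (c j) = tproj (c i + W i), W j = - W i, n j = - n i.+1 & n j.+1 = - n i],
      tproj (c i + W i) = tproj (c j + W j) /\ n i.+1 = - n j.+1 |
      tproj (c i) = tproj (c j) /\ n i = - n j \/
      [/\ tproj (c i) = tproj (c j + W j), n i = - n j.+1 & nu <= om (W i) (W j)]].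

Section Spiral.
Variables (c n : nat -> V) (J : nat) (nu d mu eps : R) (Tn : nat).
Local Notation W k := (c k.+1 - c k).
Hypotheses (J0 : (0 < J)%N) (cJ : forall k, tproj (c (k + J)%N) = tproj (c k)) (WJ : forall k, W (k + J)%N = W k)
  (nJ : forall k, n (k + J)%N = n k) (Wd : forall k, enorm (W k) <= d) (n1 : forall k, enorm (n k) <= 1)
  (Wn : forall k, mu <= om (W k) (n k) /\ mu <= om (W k) (n k.+1))
  (pairs : forall i j, (i < J)%N -> (j < J)%N -> i != j -> (i.+1 %% J)%N != j -> (j.+1 %% J)%N != i ->
    walk_pair nu c n i j \/ walk_pair nu c n j i)
  (eps0 : 0 < eps) (d10 : 16 * d <= 1).

(** Pushing along the left normal by an amount that grows with [k] separates the successive windings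
    around the closed walk. *)
Definition spiral k : V := c k + (eps * k.+1%:R) *: n k.
Local Notation U k := (spiral k.+1 - spiral k).

Lemma spiral_edge k : U k = W k + (eps * k.+2%:R) *: n k.+1 - (eps * k.+1%:R) *: n k.
Proof. by rewrite /spiral; apply/rowP => i; rewrite !mxE; ring. Qed.

Hypotheses (emu : 2 * (eps * Tn.+1%:R) < mu) (e16 : 32 * (eps * Tn.+1%:R) <= 1)
  (enu : 2 * (eps * Tn.+1%:R) < nu) (ednu : 8 * (eps * Tn.+1%:R) < nu).

Lemma spiral_close k : (k <= Tn)%N -> enorm (spiral k - c k) <= eps * Tn.+1%:R.
Proof using eps0 n1.
move=> kT; rewrite /spiral addrC addrA addNr add0r enormZ ger0_norm; last by rewrite mulr_ge0 ?ltW.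
apply: (@le_trans _ _ (eps * k.+1%:R * 1)); first by rewrite ler_wpM2l// mulr_ge0// ltW.
by rewrite mulr1 ler_pM2l// ler_nat ltnS.
Qed.

Lemma spiral_edge_close k : (k < Tn)%N -> enorm (U k - W k) <= 2 * (eps * Tn.+1%:R).
Proof using eps0 n1.
move=> kT; have h1 := spiral_close kT; have h2 := spiral_close (ltnW kT).
have -> : U k - W k = (spiral k.+1 - c k.+1) - (spiral k - c k) by apply/rowP => i; rewrite !mxE; ring.
by have := enormB (spiral k.+1 - c k.+1) (spiral k - c k); lra.
Qed.

Lemma spiral_pos k : (k < Tn)%N -> 0 < om (U k) (n k) /\ 0 < om (U k) (n k.+1).
Proof using Wn emu eps0 n1.
move=> kT; have [m1 m2] := Wn k; have em := emu; have h := spiral_edge_close kT.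
have aux j : `|om (U k - W k) (n j)| <= 2 * (eps * Tn.+1%:R).
  apply: le_trans (om_le _ _) _; apply: le_trans h.
  by rewrite -[leRHS]mulr1 ler_wpM2l ?enorm_ge0.
have := aux k; have := aux k.+1; rewrite !omDl !omNl !ler_norml => /andP[a1 a2] /andP[b1 b2].
by split; lra.
Qed.

Lemma spiral_om k l : (k < Tn)%N -> (l < Tn)%N -> nu <= om (W k) (W l) -> 0 < om (U k) (U l).
Proof using Wd d10 e16 ednu eps0 n1.
have locals := I.
move=> kT lT h; have hk := spiral_edge_close kT; have hl := spiral_edge_close lT.
have E : om (U k) (U l) = om (W k) (W l) + om (U k - W k) (W l) + om (W k) (U l - W l) + om (U k - W k) (U l - W l).
  by rewrite !(omDl, omDr, omNl, omNr); ring.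
have a1 := om_le (U k - W k) (W l); have a2 := om_le (W k) (U l - W l); have a3 := om_le (U k - W k) (U l - W l).
have Dk := Wd k; have Dl := Wd l; have d16 := d10; have ee := e16; have en := ednu.
rewrite E; move: a1 a2 a3; rewrite !ler_norml => /andP[a1 _] /andP[a2 _] /andP[a3 _].
move: hk hl a1 a2 a3 Dk Dl ee en h; have := enorm_ge0 (W k); have := enorm_ge0 (W l).
have := enorm_ge0 (U k - W k); have := enorm_ge0 (U l - W l).
move: (enorm (U k - W k)) (enorm (U l - W l)) (enorm (W k)) (enorm (W l)) (eps * Tn.+1%:R) => x y p q e.
move: (om (W k) (W l)) (om (U k - W k) (W l)) (om (W k) (U l - W l)) (om (U k - W k) (U l - W l)) => A B D E'.
clear -d16 => *.
have t1 : x * q <= 2 * e * 1 by apply: ler_pM => //; qlra.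
have t2 : p * y <= 1 * (2 * e) by apply: ler_pM => //; qlra.
have t3 : x * y <= 2 * e * 1 by apply: ler_pM => //; qlra.
qlra.
Qed.

(** Case analysis on indices modulo [J]: the same edge in two windings, consecutive edges in
    different windings, or one of the configurations of [walk_pair]. Displacements are below 1/4, so
    that equalities on the torus lift to the plane ([tproj_cancel]). *)
Lemma spiral_nonadjacent k l (th th' : R) : (k.+1 < l)%N -> (l < Tn)%N -> 0 <= th <= 1 -> 0 <= th' <= 1 ->
  tproj (spiral k + th *: U k) <> tproj (spiral l + th' *: U l).
Proof using All.
have locals := I.
move=> kl lT t01 t01' E; have ep := eps0; have kT : (k < Tn)%N by exact: ltn_trans (ltnW kl) lT.
have [/andP[t0 t1] /andP[t0' t1']] := (t01, t01').
have d16 := d10; have en := enu; have ee := e16.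
have h0 m : 0 <= eps * m%:R by rewrite mulr_ge0// ltW.
have small m : (m < Tn)%N -> enorm (U m) < 6^-1.
  move=> mT; have := spiral_edge_close mT; have := Wd m; have := enormD (W m) (U m - W m); rewrite subrKC; qlra.
have smallZ m (t : R) : (m < Tn)%N -> 0 <= t <= 1 -> enorm (t *: U m) < 6^-1.
  move=> mT /andP[p0 p1]; rewrite enormZ ger0_norm//; apply: le_lt_trans (small _ mT).
  by rewrite -[leRHS]mul1r ler_wpM2r ?enorm_ge0.
have smalln m m' : (m <= Tn.+1)%N -> enorm ((eps * m%:R) *: n m') <= 16^-1.
  move=> mT; rewrite enormZ ger0_norm//; apply: (@le_trans _ _ (eps * Tn.+1%:R * 1)); last qlra.
  by rewrite ler_pM ?enorm_ge0// ler_pM2l// ler_nat.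
have sm2 m m' i (t : R) : (m <= Tn.+1)%N -> (i < Tn)%N -> 0 <= t <= 1 ->
   enorm ((eps * m%:R) *: n m' + t *: U i) < 4^-1.
  move=> mT iT t2; have := smalln m m' mT; have := smallZ i t iT t2; have := enormD ((eps * m%:R) *: n m') (t *: U i).
  qlra.
have tail m (t : R) : spiral m + t *: U m = c m + ((eps * m.+1%:R) *: n m + t *: U m) by rewrite addrA.
have head m (t : R) : spiral m + t *: U m = (c m + W m) + ((eps * m.+2%:R) *: n m.+1 + (t - 1) *: U m).
  by rewrite spiral_edge /spiral; apply/rowP => i; rewrite !mxE; ring.
have sm3 m m' i (t : R) : (m <= Tn.+1)%N -> (i < Tn)%N -> 0 <= t <= 1 ->
   enorm ((eps * m%:R) *: n m' + (t - 1) *: U i) < 4^-1.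
  move=> mT iT t2; have t3 : 0 <= 1 - t <= 1 by case/andP: t2 => *; apply/andP; split; qlra.
  have := smalln m m' mT; have := smallZ i _ iT t3.
  have := enormD ((eps * m%:R) *: n m') ((t - 1) *: U i); rewrite -(enormN ((t - 1) *: _)) -scaleNr opprB; qlra.
have cE m : tproj (c m) = tproj (c (m %% J)%N) := periodic_modn m (g := fun m => tproj (c m)) cJ.
have WE m : W m = W (m %% J)%N := periodic_modn m (g := fun m => W m) WJ.
have nE m : n m = n (m %% J)%N := periodic_modn m (g := n) nJ.
have nE' m : n m.+1 = n (m %% J).+1%N := periodic_modn m (g := fun m => n m.+1) (fun k => nJ k.+1).
have hE m : tproj (c m + W m) = tproj (c (m %% J)%N + W (m %% J)%N) by rewrite [LHS]tprojD [RHS]tprojD -cE -WE.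
have hS m : tproj (c m + W m) = tproj (c m.+1) by rewrite subrKC.
have [pk pk'] := spiral_pos kT; have [plo pl'] := spiral_pos lT.
have neq a b : (a < b)%N -> eps * a%:R < eps * b%:R by move=> ab; rewrite ltr_pM2l// ltr_nat.
have [same|ne] := eqVneq (k %% J)%N (l %% J)%N.
  have cc : tproj (c k) = tproj (c l) by rewrite cE same -cE.
  have nn : n k = n l by rewrite nE same -nE.
  have nn' : n k.+1 = n l.+1 by rewrite nE' same -nE'.
  have ww : W k = W l by rewrite WE same -WE.
  rewrite !tail in E; have := tproj_cancel cc E (sm2 _ _ _ _ (leqW kT) kT t01) (sm2 _ _ _ _ (leqW lT) lT t01').
  move=> E1; have kl' := ltnW kl; rewrite spiral_edge in pk pk'.
  apply: (@strips_apart (0 : V) (n k) (n k.+1) (W k) (eps * k.+1%:R) (eps * k.+2%:R) (eps * l.+1%:R) (eps * l.+2%:R) th th') => //.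
  - exact: neq.
  - exact: neq.
  - by rewrite !add0r -spiral_edge E1 nn nn' ww -spiral_edge.
have [con|nc1] := eqVneq (k.+1 %% J)%N (l %% J)%N.
  have cc : tproj (c k + W k) = tproj (c l) by rewrite hS cE con -cE.
  have nn : n k.+1 = n l by rewrite nE con -nE.
  rewrite head tail in E; have := tproj_cancel cc E (sm3 k.+2 _ _ _ kT kT t01) (sm2 _ _ _ _ (leqW lT) lT t01').
  rewrite -nn => E1; apply: (@head_tail_apart 0 (n k.+1) (U k) (U l) (eps * k.+2%:R) (eps * l.+1%:R) (1 - th) th') => //.
  - by rewrite nn.
  - qlra.
  - by rewrite lt_eqF// neq.
  - by rewrite !add0r -scaleNr opprB.
have [con|nc2] := eqVneq (l.+1 %% J)%N (k %% J)%N.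
  have cc : tproj (c l + W l) = tproj (c k) by rewrite hS cE con -cE.
  have nn : n l.+1 = n k by rewrite nE con -nE.
  rewrite (tail k) (head l) in E; have := tproj_cancel cc (esym E) (sm3 l.+2 _ _ _ lT lT t01') (sm2 _ _ _ _ (leqW kT) kT t01).
  rewrite -nn => E1; apply: (@head_tail_apart 0 (n l.+1) (U l) (U k) (eps * l.+2%:R) (eps * k.+1%:R) (1 - th') th) => //.
  - by rewrite nn.
  - qlra.
  - by rewrite gt_eqF// neq//; move: kl; clear; lia.
  - by rewrite !add0r -scaleNr opprB.
have pair_apart i j (t t' : R) : (i < Tn)%N -> (j < Tn)%N -> 0 <= t <= 1 -> 0 <= t' <= 1 ->
    tproj (spiral i + t *: U i) = tproj (spiral j + t' *: U j) -> walk_pair nu c n (i %% J)%N (j %% J)%N -> False.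
  move=> {E}iT jT t2 t2' E; have [/andP[u0 u1] /andP[u0' u1']] := (t2, t2').
  have [pi pi'] := spiral_pos iT; have [pj pj'] := spiral_pos jT.
  rewrite /walk_pair -!hE -!nE -!nE' -!WE -!cE; case.
  - move=> /(_ t t' t2 t2'); rewrite !(tprojD (c _)) -!cE -!tprojD.
    have k1 : tdist (tproj (c i + t *: W i)) (tproj (spiral i + t *: U i)) <= eps * Tn.+1%:R.
      apply: le_trans (tdist_proj _ _) _; rewrite enorm_distC.
      have -> : spiral i + t *: U i - (c i + t *: W i) = (1 - t) *: (spiral i - c i) + t *: (spiral i.+1 - c i.+1).
        by apply/rowP => o'; rewrite !mxE; ring.
      apply: le_trans (enormD _ _) _; rewrite !enormZ !ger0_norm//; last qlra.
      have t3 : 0 <= 1 - t by qlra.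
      have := ler_wpM2l t3 (spiral_close (ltnW iT)); have := ler_wpM2l u0 (spiral_close iT); qlra.
    have k2 : tdist (tproj (c j + t' *: W j)) (tproj (spiral j + t' *: U j)) <= eps * Tn.+1%:R.
      apply: le_trans (tdist_proj _ _) _; rewrite enorm_distC.
      have -> : spiral j + t' *: U j - (c j + t' *: W j) = (1 - t') *: (spiral j - c j) + t' *: (spiral j.+1 - c j.+1).
        by apply/rowP => o'; rewrite !mxE; ring.
      apply: le_trans (enormD _ _) _; rewrite !enormZ !ger0_norm//; last qlra.
      have t3 : 0 <= 1 - t' by qlra.
      have := ler_wpM2l t3 (spiral_close (ltnW jT)); have := ler_wpM2l u0' (spiral_close jT); qlra.
    rewrite -E in k2; move: k1 k2 (enu); clear.
    move: (tproj (c i + _)) (tproj (c j + _)) (tproj (spiral i + _)) => a b z k1 k2 k3 k4.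
    exact: far_apart k1 k2 k3 k4.
  (* The same segment run backwards is pushed to its other side, that is by negative multiples of
     the same normals. *)
  - move=> -[cc ww nj nj']; rewrite head tail in E.
    have E1 := tproj_cancel (esym cc) E (sm3 i.+2 _ _ _ iT iT t2) (sm2 _ _ _ _ (leqW jT) jT t2').
    have EU : - U j = W i + (- (eps * j.+1%:R)) *: n i.+1 - (- (eps * j.+2%:R)) *: n i.
      by rewrite spiral_edge nj nj' ww; apply/rowP => o'; rewrite !mxE; ring.
    apply: (@strips_apart (0 : V) (n i) (n i.+1) (W i) (- (eps * j.+2%:R)) (- (eps * j.+1%:R))
      (eps * i.+1%:R) (eps * i.+2%:R) (1 - t') t) => //.
    + by rewrite -EU omNl -omNr -nj'.
    + by rewrite -EU omNl -omNr -nj.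
    + by rewrite (@lt_trans _ _ 0)// ?oppr_lt0 mulr_gt0.
    + by rewrite (@lt_trans _ _ 0)// ?oppr_lt0 mulr_gt0.
    rewrite -EU -spiral_edge !add0r; move: E1 EU; rewrite nj.
    have := spiral_edge i; move: (U i) (U j) => ui uj Ei E1 EU.
    apply/rowP => o'; move: Ei E1 EU => /rowP/(_ o') a1 /rowP/(_ o') a2 /rowP/(_ o') a3.
    move: a1 a2 a3; rewrite !mxE; qlra.
  - move=> -[cc nn]; rewrite !head in E.
    have E1 := tproj_cancel cc E (sm3 i.+2 _ _ _ iT iT t2) (sm3 j.+2 _ _ _ jT jT t2').
    apply: (@head_tail_apart 0 (n i.+1) (U i) (- U j) (eps * i.+2%:R) (- (eps * j.+2%:R)) (1 - t) (1 - t')) => //.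
    + by rewrite nn omNl omNr opprK.
    + qlra.
    + qlra.
    + by rewrite gt_eqF// (@lt_trans _ _ 0)// ?oppr_lt0 mulr_gt0.
    by rewrite !add0r -scaleNr opprB E1 nn scaleNr !scalerN opprK -scaleNr opprB.
  - case=> [[cc nn]|[]].
      rewrite !tail in E.
      have E1 := tproj_cancel cc E (sm2 _ _ _ _ (leqW iT) iT t2) (sm2 _ _ _ _ (leqW jT) jT t2').
      apply: (@head_tail_apart 0 (n i) (- U j) (U i) (- (eps * j.+1%:R)) (eps * i.+1%:R) t' t) => //.
      + by rewrite nn omNl omNr opprK.
      + by rewrite lt_eqF// (@lt_trans _ _ 0)// ?oppr_lt0 mulr_gt0.
      by rewrite !add0r E1 nn scaleNr !scalerN !opprK.
    move=> cc nn /(spiral_om iT jT) ww; rewrite tail head in E.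
    have E1 := tproj_cancel cc E (sm2 _ _ _ _ (leqW iT) iT t2) (sm3 j.+2 _ _ _ jT jT t2').
    apply: (@branches_apart 0 (n i) (U i) (U j) (eps * i.+1%:R) (eps * j.+2%:R) t (1 - t')) => //.
    + by rewrite nn omNr oppr_lt0.
    + by rewrite addr_gt0// mulr_gt0.
    + qlra.
    by rewrite add0r E1 sub0r nn scalerN opprK -scaleNr opprB.
have kJ : (k %% J < J)%N by rewrite ltn_mod.
have lJ : (l %% J < J)%N by rewrite ltn_mod.
have mS m : ((m %% J).+1 %% J = m.+1 %% J)%N by rewrite -addn1 modnDml addn1.
have nc1' : ((k %% J).+1 %% J)%N != (l %% J)%N by rewrite mS.
have nc2' : ((l %% J).+1 %% J)%N != (k %% J)%N by rewrite mS.
case: (pairs kJ lJ ne nc1' nc2').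
  exact: pair_apart kT lT t01 t01' E.
exact: pair_apart lT kT t01' t01 (esym E).
Qed.

End Spiral.
End PlanarWalks.

(** * Long discs winding around a walk *)

Section WalkDiscs.
Context {R : realType} (C : torus R 2 -> set 'rV[R]_2) (s : R) (lf : torus R 2 -> 'rV[R]_2).
Local Notation T := (torus R 2).
Local Notation V := ('rV[R]_2).
Hypotheses (s0 : 0 < s) (CZ : forall x a u, C x u -> C x (a *: u))
  (hl : forall x, half_functional C s x (lf x)).

Lemma deepv_mem sg x y v : deepv C sg x v -> 0 < sg -> tdist x y < sg -> C y v.
Proof. by move=> h sg0 xy; apply: h => //; rewrite subrr enorm0 mulr_ge0 ?enorm_ge0// ltW. Qed.

Lemma small_min (a1 a2 a3 a4 a5 a6 : R) : 0 < a1 -> 0 < a2 -> 0 < a3 -> 0 < a4 -> 0 < a5 -> 0 < a6 ->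
  exists2 z : R, 0 < z & [/\ 32 * z < a1, 32 * z < a2, 32 * z < a3, 32 * z < a4 & 32 * z < a5 /\ 32 * z < a6].
Proof.
move=> *; pose M := Num.min a1 (Num.min a2 (Num.min a3 (Num.min a4 (Num.min a5 a6)))).
have M0 : 0 < M by rewrite !lt_min; do !(apply/andP; split).
have i1 : M <= a1 by rewrite ge_min lexx.
have i2 : M <= a2 by rewrite !ge_min lexx !orbT.
have i3 : M <= a3 by rewrite !ge_min lexx !orbT.
have i4 : M <= a4 by rewrite !ge_min lexx !orbT.
have i5 : M <= a5 by rewrite !ge_min lexx !orbT.
have i6 : M <= a6 by rewrite !ge_min lexx !orbT.
by move: M M0 i1 i2 i3 i4 i5 i6 => M *; exists (M / 33); [lra|split; try split; lra].
Qed.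

Definition walk_points (c : nat -> V) : set T :=
  [set x | exists k th, 0 <= th <= 1 /\ x = tproj (c k + th *: (c k.+1 - c k))].

(** The walk is periodic, so the spiral can be followed for as many edges as [D] requires; its edges
    have length at least [dl / 2] while the total push remains [z]. *)
Lemma walk_long_disc (c L : nat -> V) J sg d D rho nu : (0 < J)%N -> 0 < sg -> 0 < d -> 9 * d < sg -> 9 * d < s ->
  32 * d <= 1 -> 0 < nu ->
  (forall k, tproj (c (k + J)%N) = tproj (c k)) -> (forall k, c (k + J).+1 - c (k + J)%N = c k.+1 - c k) ->
  (forall k, L (k + J)%N = L k) -> (forall k, enorm (c k.+1 - c k) <= d) ->
  (forall k, deepv C sg (tproj (c k)) (c k.+1 - c k)) ->
  (forall k, L k = lf (tproj (c k)) \/ L k = - lf (tproj (c k))) ->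
  (forall k, 0 < edot (c k.+1 - c k) (L k) /\ 0 < edot (c k.+1 - c k) (L k.+1)) ->
  (forall k, coherent lf (tproj (c k)) (c k.+1 - c k) (c k.+2 - c k.+1)) ->
  (forall i j, (i < J)%N -> (j < J)%N -> i != j -> (i.+1 %% J)%N != j -> (j.+1 %% J)%N != i ->
    walk_pair nu c (fun k => perp (L k)) i j \/ walk_pair nu c (fun k => perp (L k)) j i) ->
  0 < rho -> long_disc_near C (walk_points c) rho D.
Proof using CZ hl s0.
have locals := I.
move=> J0 sg0 d0 dsg ds d1 nu0 cJ WJ LJ Wd dv Ll WL co pairs rho0; have sp := s0.
have E1 k : enorm (L k) <= 1.
  have h : enorm (lf (tproj (c k))) <= 1.
    have [h _ _] := hl (tproj (c k)); have := h (lf (tproj (c k))).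
    rewrite edotvv ger0_norm ?sqr_ge0// expr2.
    have := enorm_ge0 (lf (tproj (c k))); move: (enorm _) => x; nra.
  by case: (Ll k) => ->; rewrite ?enormN.
have Wne k : 0 < enorm (c k.+1 - c k).
  rewrite enorm_gt0//; apply/eqP => e; have [] := WL k; rewrite e.
  by rewrite -(scale0r (0 : V)) edotZl mul0r ltxx.
have [dl dl0 hdl] : exists2 dl : R, 0 < dl & forall k, dl <= enorm (c k.+1 - c k).
  have [] := @common_lower_bound R (fun k e => e <= enorm (c k.+1 - c k)) J.
  - by move=> i e e' ee h; exact: le_trans ee h.
  - by move=> i _; exists (enorm (c i.+1 - c i)).
  move=> e e0 he; exists e => // k.
  by rewrite (periodic_modn k (g := fun k => c k.+1 - c k) WJ); apply: he; rewrite ltn_mod.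
have dld : dl <= d by exact: le_trans (hdl 0%N) (Wd 0%N).
have mu0 : 0 < s * dl by rewrite mulr_gt0.
have sgdl0 : 0 < sg * dl by rewrite mulr_gt0.
have Wn k : s * dl <= edot (c k.+1 - c k) (L k) /\ s * dl <= edot (c k.+1 - c k) (L k.+1).
  have [p1 p2] := WL k.
  have aux j : tdist (tproj (c k)) (tproj (c j)) < sg -> s * dl <= `|edot (c k.+1 - c k) (L j)|.
    move=> jk; have [_ h _] := hl (tproj (c j)).
    have Ce : `|edot (c k.+1 - c k) (L j)| = `|edot (c k.+1 - c k) (lf (tproj (c j)))|.
      by case: (Ll j) => ->; rewrite ?edotNr ?normrN.
    rewrite Ce; apply: le_trans (h (tproj (c j)) (c k.+1 - c k) _ _); first by rewrite ler_pM2l.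
      by rewrite tdistxx.
    exact: deepv_mem (dv k) sg0 jk.
  split; [rewrite -(gtr0_norm p1)|rewrite -(gtr0_norm p2)]; apply: aux; first by rewrite tdistxx.
  apply: le_lt_trans (tdist_proj _ _) _; rewrite enorm_distC; have := Wd k; qlra.
have [Tn [T2 DT]] : exists Tn, (2 < Tn)%N /\ D < (Tn%:R - 2) * (s * (dl / 2)).
  have h : 0 < s * (dl / 2) by rewrite mulr_gt0//; qlra.
  have [m hm] : exists m : nat, D / (s * (dl / 2)) <= m%:R.
    exists (Num.truncn `|D / (s * (dl / 2))|).+1; apply: le_trans (ler_norm _) _; apply: ltW.
    by have := truncn_itv (normr_ge0 (D / (s * (dl / 2)))) => /andP[].
  exists m.+3; split=> //.
  by rewrite -ltr_pdivrMr// (_ : m.+3%:R - 2 = m%:R + 1 :> R); [apply: le_lt_trans hm _; rewrite ltrDl|rewrite -addn3 natrD; ring].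
have [z z0 [z1 z2 z3 z4 [z5 z6]]] := small_min (ltr01 : 0 < 1 :> R) nu0 mu0 sgdl0 dl0 rho0.
(* The increment of the push is fixed after the number [Tn] of edges. *)
have [eps [eps0 epsz]] : exists eps : R, 0 < eps /\ eps * Tn.+1%:R = z.
  by exists (z / Tn.+1%:R); rewrite divr_gt0 ?ltr0n// divfK// pnatr_eq0.
have WJ' k : c (k + J).+1 - c (k + J)%N = c k.+1 - c k := WJ k.
have nJ k : perp (L (k + J)%N) = perp (L k) by rewrite LJ.
have n1 k : enorm (perp (L k)) <= 1 by rewrite enorm_perp.
have Wn' k : s * dl <= om (c k.+1 - c k) (perp (L k)) /\ s * dl <= om (c k.+1 - c k) (perp (L k.+1)).
  by rewrite !om_perp.
have d16 : 16 * d <= 1 by qlra.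
have c1 : 2 * (eps * Tn.+1%:R) < s * dl by qlra.
have c2 : 32 * (eps * Tn.+1%:R) <= 1 by qlra.
have c3 : 2 * (eps * Tn.+1%:R) < nu by qlra.
have c4 : 8 * (eps * Tn.+1%:R) < nu by qlra.
have na := @spiral_nonadjacent R c (fun k => perp (L k)) J nu d (s * dl) eps Tn J0 cJ WJ nJ Wd n1 Wn' pairs eps0 d16 c1 c2 c3 c4.
have close := @spiral_close R c (fun k => perp (L k)) eps Tn n1 eps0.
have eclose := @spiral_edge_close R c (fun k => perp (L k)) eps Tn n1 eps0.
move: na close eclose; set Q := spiral _ _ _ => na close eclose.
have cQ : cone_polygon C lf (dl / 2) (4 / 3 * d) Tn Q.
  apply: (@near_cone_polygon _ _ C s lf s0 CZ hl d sg (2 * z / d) Tn (fun k => tproj (c k)) (fun k => c k.+1 - c k) Q dl) => //.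
  - by rewrite divr_ge0 ?mulr_ge0// ltW.
  - by rewrite divfK ?gt_eqF//; qlra.
  - by rewrite divfK ?gt_eqF//; qlra.
  - by rewrite divfK ?gt_eqF//; qlra.
  - move=> k kK; rewrite hdl Wd; split=> //.
      apply: le_trans (tdist_proj _ _) _; rewrite enorm_distC; have := close k (ltnW kK); qlra.
    by rewrite divfK ?gt_eqF//; have := eclose k kK; qlra.
  - move=> k kK; split=> //.
    apply: le_trans (tdist_proj _ _) _; rewrite enorm_distC; have := Wd k; qlra.
have dl2 : 0 < dl / 2 by qlra.
have d40 : 0 < 4 / 3 * d by qlra.
have ds4 : 6 * (4 / 3 * d) <= s by qlra.
have d14 : 24 * (4 / 3 * d) <= 1 by qlra.
have rho2 : 0 < rho / 2 by qlra.
have [h [eh th hn hD]] := cone_polygon_disc s0 CZ hl dl2 d40 ds4 d14 T2 cQ na rho2 DT.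
exists h; split=> // q /hn[_ [t /andP[t0 tK] <-] ht].
have [k [tt [kK tt0 tt1 Et]]] := edge_split (ltn_trans (isT : (0 < 2)%N) T2) t0 tK.
exists (tproj (c k + tt *: (c k.+1 - c k))); first by exists k, tt; rewrite tt0.
have : tdist (tproj (pl Tn Q t)) (tproj (c k + tt *: (c k.+1 - c k))) <= z.
  rewrite Et !plE//; apply: le_trans (tdist_proj _ _) _.
  have -> : Q k + tt *: (Q k.+1 - Q k) - (c k + tt *: (c k.+1 - c k)) =
      (1 - tt) *: (Q k - c k) + tt *: (Q k.+1 - c k.+1) by apply/rowP => i; rewrite !mxE; ring.
  apply: le_trans (enormD _ _) _; rewrite !enormZ !ger0_norm//; last qlra.
  have t3 : 0 <= 1 - tt by qlra.
  have := ler_wpM2l t3 (close k (ltnW kK)); have := ler_wpM2l tt0 (close k.+1 kK); rewrite epsz; qlra.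
have := tdistD (tproj (pl Tn Q t)) (tproj (h q)) (tproj (c k + tt *: (c k.+1 - c k))); qlra.
Qed.

End WalkDiscs.

(** * Walks on train tracks *)

Section GluedWalks.
Context {R : realType} (C : torus R 2 -> set 'rV[R]_2) (s : R) (lf : torus R 2 -> 'rV[R]_2).
Local Notation T := (torus R 2).
Local Notation V := ('rV[R]_2).
Hypotheses (s0 : 0 < s) (CZ : forall x a u, C x u -> C x (a *: u))
  (hl : forall x, half_functional C s x (lf x)).

Lemma deepvN sg x v : deepv C sg x v -> deepv C sg x (- v).
Proof using CZ.
move=> h y w xy wv; have -> : w = -1 *: (- w) by rewrite scaleN1r opprK.
by apply: CZ; apply: h => //; rewrite -opprD enormN -(enormN v) -[w + v](congr1 (fun u => w + u) (opprK v)).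
Qed.

Lemma walk_pair_mono nu nu' c n i j : nu' <= nu -> @walk_pair R nu c n i j -> walk_pair nu' c n i j.
Proof.
move=> le; case.
- by move=> h; apply: Or41 => th th' t t'; apply: le_trans le _; exact: h.
- by move=> h; apply: Or42.
- by move=> h; apply: Or43.
- case=> [h|[h1 h2 h3]]; first by apply: Or44; left.
  by apply: Or44; right; split=> //; exact: le_trans h3.
Qed.

Definition src (e : nat * bool) := if e.2 then e.1 else e.1.+1.
Definition tgt (e : nat * bool) := if e.2 then e.1.+1 else e.1.

(* A train track: a chain of segments [P m, P m.+1], whose vertices, together with a direction of passage (true when it
   is the direction of increasing indices), are identified by [gl].  A walk [w] on it, given by directed segments, may
   be pushed to its left when it passes every vertex at most once in each direction. *)
Variables (M J : nat) (P Lv : nat -> V) (gl : nat * bool -> nat * bool) (w : nat -> nat * bool) (sg d : R).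
Local Notation B m := (P m.+1 - P m).
Definition signed (A : zmodType) (e : bool) (v : A) := if e then v else - v.
Definition walk_edge k := signed (w k).2 (B (w k).1).
Hypotheses (J0 : (0 < J)%N) (sg0 : 0 < sg) (d0 : 0 < d) (dsg : 9 * d < sg) (ds : 9 * d < s) (d1 : 32 * d <= 1)
  (edge : forall m, (m < M)%N -> [/\ enorm (B m) <= d, deepv C sg (tproj (P m)) (B m),
     deepv C sg (tproj (P m.+1)) (B m), 0 < edot (B m) (Lv m) & 0 < edot (B m) (Lv m.+1)])
  (Lvlf : forall m, (m <= M)%N -> Lv m = lf (tproj (P m)) \/ Lv m = - lf (tproj (P m)))
  (glP : forall p e, (p <= M)%N -> tproj (P (gl (p, e)).1) = tproj (P p) /\
     signed (gl (p, e)).2 (Lv (gl (p, e)).1) = signed e (Lv p))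
  (contact : forall m m' (th th' : R), (m < M)%N -> (m' < M)%N -> m != m' -> 0 <= th <= 1 -> 0 <= th' <= 1 ->
     tproj (P m + th *: B m) = tproj (P m' + th' *: B m') ->
     exists p p', [/\ p \in [:: m; m.+1], p' \in [:: m'; m'.+1] & forall e e', (gl (p, e)).1 = (gl (p', e')).1])
  (wM : forall k, ((w k).1 < M)%N) (wJ : forall k, w (k + J)%N = w k)
  (wnext : forall k, gl (tgt (w k), (w k).2) = gl (src (w k.+1), (w k.+1).2))
  (winj : forall i j, (i < J)%N -> (j < J)%N -> gl (src (w i), (w i).2) = gl (src (w j), (w j).2) -> i = j)
  (wbranch : forall i j, (i < J)%N -> (j < J)%N -> (w i).1 != (w j).1 ->
     (gl (src (w i), (w i).2)).1 = (gl (tgt (w j), (w j).2)).1 ->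
     gl (src (w i), (w i).2) <> gl (tgt (w j), (w j).2) -> 0 < om (walk_edge i) (walk_edge j)).

(** The walk unfolded in the plane by adding its edges; its vertices project to those of the track
    ([walk_vertexE]). *)
Definition walk_vertex k := P (src (w 0%N)) + \sum_(j < k) walk_edge j.
Definition walk_normal k := signed (w k).2 (Lv (src (w k))).

Lemma walk_edgeE k : walk_vertex k.+1 - walk_vertex k = walk_edge k.
Proof. by rewrite /walk_vertex big_ord_recr /= addrA [LHS]addrC addKr. Qed.

Lemma walk_edge_tgt k : P (src (w k)) + walk_edge k = P (tgt (w k)).
Proof. by rewrite /src /tgt /walk_edge /signed; case: (w k).2; [rewrite addrC subrK|rewrite opprB addrC subrK]. Qed.

Lemma src_le k : (src (w k) <= M)%N.
Proof using wM. by rewrite /src; have := wM k; case: (w k).2 => // /ltnW. Qed.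

Lemma tgt_le k : (tgt (w k) <= M)%N.
Proof using wM. by rewrite /tgt; have := wM k; case: (w k).2 => // /ltnW. Qed.

Lemma walk_vertexE k : tproj (walk_vertex k) = tproj (P (src (w k))).
Proof using glP wM wnext.
elim: k => [|k IH]; first by rewrite /walk_vertex big_ord0 addr0.
have -> : walk_vertex k.+1 = walk_vertex k + walk_edge k by rewrite -walk_edgeE addrC subrK.
rewrite tprojD IH -tprojD walk_edge_tgt.
have [<- _] := glP (w k).2 (tgt_le k); have [<- _] := glP (w k.+1).2 (src_le k.+1).
by rewrite wnext.
Qed.

Lemma walk_normal_tgt k : walk_normal k.+1 = signed (w k).2 (Lv (tgt (w k))).
Proof using glP wM wnext.
rewrite /walk_normal; have [_ <-] := glP (w k).2 (tgt_le k); have [_ <-] := glP (w k.+1).2 (src_le k.+1).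
by rewrite wnext.
Qed.

Lemma signedN (A : zmodType) e e' (v : A) : e != e' -> signed e v = - signed e' v.
Proof. by case: e; case: e' => //= _; rewrite /signed ?opprK. Qed.

Lemma walk_normal_pos k : 0 < edot (walk_edge k) (walk_normal k) /\ 0 < edot (walk_edge k) (walk_normal k.+1).
Proof using edge glP wM wnext.
rewrite walk_normal_tgt /walk_edge /walk_normal /src /tgt /signed; have [_ _ _ h h'] := edge (wM k).
by case: (w k).2; rewrite ?edotNl ?edotNr ?opprK.
Qed.

Lemma walk_edge_le k : enorm (walk_edge k) <= d.
Proof using edge wM. by have [h _ _ _ _] := edge (wM k); rewrite /walk_edge /signed; case: (w k).2; rewrite ?enormN. Qed.

Lemma walk_deep k : deepv C sg (tproj (walk_vertex k)) (walk_edge k).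
Proof using CZ edge glP wM wnext.
rewrite walk_vertexE /walk_edge /src /signed; have [_ h h' _ _] := edge (wM k).
by case: (w k).2 => //; exact: deepvN.
Qed.

Lemma walk_normalE k : walk_normal k = lf (tproj (walk_vertex k)) \/ walk_normal k = - lf (tproj (walk_vertex k)).
Proof using Lvlf glP wM wnext.
rewrite walk_vertexE /walk_normal; have := Lvlf (src_le k); rewrite /signed.
by case: (w k).2 => // -[] ->; [right|left; rewrite opprK].
Qed.

Lemma walk_coherent k : coherent lf (tproj (walk_vertex k)) (walk_edge k) (walk_edge k.+1).
Proof using All.
have sp := s0; have ds' := ds; have dsg' := dsg; have dp := d0.
have near : tdist (tproj (walk_vertex k)) (tproj (walk_vertex k.+1)) <= d.
  apply: le_trans (tdist_proj _ _) _; rewrite enorm_distC walk_edgeE; exact: walk_edge_le.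
have sgp := sg0.
apply: (half_transfer s0 CZ hl (x := tproj (walk_vertex k.+1)) (y := tproj (walk_vertex k.+1))).
- by rewrite tdistxx.
- lra.
- by refine (deepv_mem (@walk_deep k) sg0 _); lra.
- by refine (deepv_mem (@walk_deep k.+1) sg0 _); rewrite tdistxx.
have [_ h] := walk_normal_pos k; have [h' _] := walk_normal_pos k.+1.
by case: (walk_normalE k.+1) h h' => ->; rewrite ?edotNr ?oppr_gt0 => h h'; [exact: mulr_gt0|rewrite nmulr_rgt0].
Qed.

(** Two edges on the same segment run in opposite directions, since no state recurs within a period.
    Otherwise they meet only at a glued vertex, where by the same reason the two passages are
    opposite. The cases are whether each edge starts or ends there. *)
Lemma glued_pairs i j : (i < J)%N -> (j < J)%N -> i != j -> (i.+1 %% J)%N != j -> (j.+1 %% J)%N != i ->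
  exists2 nu : R, 0 < nu & walk_pair nu walk_vertex (fun k => perp (walk_normal k)) i j \/
    walk_pair nu walk_vertex (fun k => perp (walk_normal k)) j i.
Proof using All.
move=> iJ jJ ij ij1 ji1.
have perpN (l : V) : perp (- l) = - perp l by apply: rV2P; rewrite !mxE.
have state k : gl (src (w k), (w k).2) = gl (src (w (k %% J)%N), (w (k %% J)%N).2).
  exact: (periodic_modn k (g := fun k => gl (src (w k), (w k).2)) (fun k => congr1 (fun e => gl (src e, e.2)) (wJ k))).
(* A vertex visited twice in a period is passed once in each direction, so its two normals are
   opposite. *)
have nopp k l : k != l %[mod J] -> (gl (src (w k), (w k).2)).1 = (gl (src (w l), (w l).2)).1 ->
    walk_normal k = - walk_normal l.
  move=> kl e1.
  have ne : gl (src (w k), (w k).2) <> gl (src (w l), (w l).2).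
    by rewrite state (state l) => /winj e; move: kl; rewrite e ?ltn_mod ?eqxx.
  have ne2 : (gl (src (w k), (w k).2)).2 != (gl (src (w l), (w l).2)).2.
    by apply/eqP => e2; apply: ne; move: e1 e2; case: (gl _) => ? ?; case: (gl _) => ? ? /= -> ->.
  rewrite /walk_normal; have [_ <-] := glP (w k).2 (src_le k); have [_ <-] := glP (w l).2 (src_le l).
  by rewrite e1; exact: signedN.
have [na|] := pselect (forall th th' : R, 0 <= th <= 1 -> 0 <= th' <= 1 ->
    tproj (walk_vertex i + th *: walk_edge i) <> tproj (walk_vertex j + th' *: walk_edge j)).
  have [e e0 he] := segments_gap na; exists e => //; left; apply: Or41; by rewrite !walk_edgeE.
move=> nna; have [th [th' [t t' E]]] : exists th th' : R, [/\ 0 <= th <= 1, 0 <= th' <= 1 &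
    tproj (walk_vertex i + th *: walk_edge i) = tproj (walk_vertex j + th' *: walk_edge j)].
  by apply: contrapT => h; apply: nna => th th' t t' E; apply: h; exists th, th'.
have modi : (i %% J)%N = i by rewrite modn_small.
have modj : (j %% J)%N = j by rewrite modn_small.
have ijm : i != j %[mod J] by rewrite modi modj.
have [me|mne] := eqVneq (w i).1 (w j).1.
  have oo : (w j).2 != (w i).2.
    apply/eqP => oo; move: ij; rewrite (_ : i = j) ?eqxx//; apply: winj => //.
    by move: me oo; case: (w i) => ? ?; case: (w j) => ? ? /= -> ->.
  have st : src (w j) = tgt (w i) by rewrite /src /tgt me; move: oo; case: (w j).2; case: (w i).2.
  have ts : tgt (w j) = src (w i) by rewrite /src /tgt me; move: oo; case: (w j).2; case: (w i).2.
  exists 1 => //; left; apply: Or42; rewrite !walk_edgeE -!perpN.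
  rewrite [in X in [/\ _, _, _ & X]]walk_normal_tgt (walk_normal_tgt i) /walk_normal st ts; split.
  - by rewrite walk_vertexE tprojD walk_vertexE -tprojD walk_edge_tgt st.
  - by rewrite /walk_edge me; exact: signedN.
  - by rewrite (signedN _ oo).
  - by rewrite (signedN _ oo).
have on k (th0 : R) : tproj (walk_vertex k + th0 *: walk_edge k) =
    tproj (P (w k).1 + (if (w k).2 then th0 else 1 - th0) *: B (w k).1).
  rewrite tprojD walk_vertexE -tprojD /src /walk_edge /signed; case: (w k).2 => //; congr tproj.
  by apply/rowP => o'; rewrite !mxE; ring.
have flip (th0 : R) (e : bool) : 0 <= th0 <= 1 -> 0 <= (if e then th0 else 1 - th0) <= 1.
  by case: e => // /andP[? ?]; apply/andP; split; lra.
rewrite !on in E; have [p [p' [pi pj g]]] := contact (wM i) (wM j) mne (flip _ _ t) (flip _ _ t') E.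
have ends k q : q \in [:: (w k).1; (w k).1.+1] -> q = src (w k) \/ q = tgt (w k).
  rewrite !inE /src /tgt; case: (w k).2 => /orP[] /eqP ->; by [left|right].
have proj k : tproj (P (gl (src (w k), (w k).2)).1) = tproj (P (src (w k))) by have [] := glP (w k).2 (src_le k).
have projt k : tproj (P (gl (tgt (w k), (w k).2)).1) = tproj (P (tgt (w k))) by have [] := glP (w k).2 (tgt_le k).
have head k : tproj (walk_vertex k + walk_edge k) = tproj (P (tgt (w k))).
  by rewrite tprojD walk_vertexE -tprojD walk_edge_tgt.
have gE k : (gl (tgt (w k), (w k).2)).1 = (gl (src (w k.+1), (w k.+1).2)).1 by rewrite wnext.
have branch k l : (k < J)%N -> (l < J)%N -> (w k).1 != (w l).1 -> (l.+1 %% J)%N != k -> src (w k) = p \/ src (w k) = p' -> 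
    (gl (src (w k), (w k).2)).1 = (gl (tgt (w l), (w l).2)).1 ->
    exists2 nu : R, 0 < nu & walk_pair nu walk_vertex (fun k => perp (walk_normal k)) k l.
  move=> kJ lJ kl lk _ e.
  have lk' : k != l.+1 %[mod J] by rewrite (modn_small kJ) eq_sym.
  exists (om (walk_edge k) (walk_edge l)).
    apply: wbranch => //; rewrite wnext state (state l.+1) => /winj; rewrite !ltn_mod => /(_ J0 J0) e'.
    by move: lk'; rewrite e' eqxx.
  apply: Or44; right; rewrite !walk_edgeE; split=> //.
    by rewrite walk_vertexE head -proj -projt e.
  by rewrite -perpN; congr perp; apply: nopp => //; rewrite e gE.
have [pE|pE] := ends _ _ pi; have [pE'|pE'] := ends _ _ pj; have := g (w i).2 (w j).2; rewrite {1}pE {1}pE' => e.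
- exists 1 => //; left; apply: Or44; left; split; first by rewrite !walk_vertexE -!proj e.
  by rewrite -perpN; congr perp; exact: nopp.
- have [nu nu0 h] := branch _ _ iJ jJ mne ji1 (or_introl (esym pE)) e; exists nu => //; by left.
- have mne' : (w j).1 != (w i).1 by rewrite eq_sym.
  have [nu nu0 h] := branch _ _ jJ iJ mne' ij1 (or_intror (esym pE')) (esym e); exists nu => //; by right.
- exists 1 => //; left; apply: Or43; rewrite !walk_edgeE; split; first by rewrite !head -!projt e.
  rewrite -perpN; congr perp; apply: nopp; last by rewrite -!gE.
  by rewrite -(addn1 i) -(addn1 j) eqn_modDr.
Qed.

Lemma glued_long_disc D rho : 0 < rho -> long_disc_near C (walk_points walk_vertex) rho D.
Proof using All.
move=> rho0.
have [nu nu0 hnu] : exists2 nu : R, 0 < nu & forall i, (i < J)%N -> forall j, (j < J)%N -> i != j ->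
    (i.+1 %% J)%N != j -> (j.+1 %% J)%N != i ->
    walk_pair nu walk_vertex (fun k => perp (walk_normal k)) i j \/
    walk_pair nu walk_vertex (fun k => perp (walk_normal k)) j i.
  apply: common_lower_bound => [i e e' ee h j jJ h1 h2 h3|i iJ].
    by case: (h j jJ h1 h2 h3) => hh; [left|right]; exact: walk_pair_mono hh.
  apply: (@common_lower_bound R (fun j e => i != j -> (i.+1 %% J)%N != j -> (j.+1 %% J)%N != i ->
    walk_pair e walk_vertex (fun k => perp (walk_normal k)) i j \/
    walk_pair e walk_vertex (fun k => perp (walk_normal k)) j i)) => [j e e' ee h h1 h2 h3|j jJ].
    by case: (h h1 h2 h3) => hh; [left|right]; exact: walk_pair_mono hh.
  have [[ij [ij1 ji1]]|h] := pselect (i != j /\ (i.+1 %% J)%N != j /\ (j.+1 %% J)%N != i).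
    by have [nu nu0 h] := glued_pairs iJ jJ ij ij1 ji1; exists nu.
  by exists 1 => // h1 h2 h3; exfalso; apply: h.
apply: (@walk_long_disc R C s lf s0 CZ hl walk_vertex walk_normal J sg d D rho nu) => //.
- by move=> k; rewrite !walk_vertexE wJ.
- by move=> k; rewrite !walk_edgeE /walk_edge wJ.
- by move=> k; rewrite /walk_normal wJ.
- by move=> k; rewrite walk_edgeE; exact: walk_edge_le.
- by move=> k; rewrite walk_edgeE; exact: walk_deep.
- exact: walk_normalE.
- by move=> k; rewrite !walk_edgeE; exact: walk_normal_pos.
- by move=> k; rewrite !walk_edgeE; exact: walk_coherent.
- by move=> i j iJ jJ; exact: hnu.
Qed.

Lemma walk_points_chain x : walk_points walk_vertex x ->
  exists m th, [/\ (m < M)%N, 0 <= th <= 1 & x = tproj (P m + th *: B m)].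
Proof using glP wM wnext.
move=> [k [th [/andP[t0 t1] ->]]]; rewrite walk_edgeE; exists (w k).1, (if (w k).2 then th else 1 - th); split=> //.
  by case: (w k).2; apply/andP; split; lra.
rewrite tprojD walk_vertexE -tprojD /src /walk_edge /signed; case: (w k).2 => //; congr tproj.
by apply/rowP => o'; rewrite !mxE; ring.
Qed.

End GluedWalks.

(** * Combinatorics of the two train tracks *)

Section TrainTracks.

(** The chain meets itself in the opposite direction at both ends: its first vertex is glued to [Y],
    its last to [X], and the flag is reversed. *)
Definition glue_ends (Y X M : nat) (e : nat * bool) : nat * bool :=
  if e.1 == 0%N then (Y, ~~ e.2) else if e.1 == M then (X, ~~ e.2) else e.

Local Ltac split_if_with tac := repeat (match goal with |- context [if ?b then _ else _] =>
  lazymatch b with context [if _ then _ else _] => fail | _ => destruct b eqn:? end end; rewrite /=; tac).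
Local Ltac split_if := split_if_with idtac.
Local Ltac split_nat := split_if_with ltac:(try (exfalso; lia)).
Local Ltac solve_nat := first [done | exfalso; lia | by congr (_, _); lia | lia].

Local Ltac branch_nat := first [exfalso; lia | left; split; congr (_, _); lia | right; split; congr (_, _); lia].

(** For [X < Y]: from 0 up to [X], which is also [M] in the other direction, then from [M] down to
    [Y], which is also 0. The segments between [X] and [Y] are left out. *)
Definition theta_walk (Y X M k : nat) : nat * bool :=
  if (k < X)%N then (k, true) else ((M - (k - X).+1)%N, false).

(** For [Y <= X]: along the bar from [Y] to [X], around the loop between [X] and [M], back along the
    bar, and around the loop between 0 and [Y]. The flags [s2] and [s1] choose the direction of each
    loop. *)
Definition barbell_walk (s1 s2 : bool) (Y X M k : nat) : nat * bool :=
  if (k < X - Y)%N then ((Y + k)%N, true)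
  else if (k < M - Y)%N then (if s2 then ((Y + k)%N, true) else ((M - (k - (X - Y)).+1)%N, false))
  else if (k < M + X - Y.*2)%N then ((X - (k - (M - Y)).+1)%N, false)
  else if s1 then ((k - (M + X - Y.*2))%N, true) else ((Y - (k - (M + X - Y.*2)).+1)%N, false).

Definition succ_mod (J k : nat) := if k.+1 == J then 0%N else k.+1.

Section Theta.
Variables (Y X M : nat).
Hypotheses (X0 : (0 < X)%N) (XY : (X < Y)%N) (YM : (Y < M)%N).
Let J := (X + (M - Y))%N.
Let w := theta_walk Y X M.
Let gl := glue_ends Y X M.

Lemma theta_lt k : (k < J)%N -> ((w k).1 < M)%N.
Proof using X0 XY YM. by move: X0 XY YM; rewrite /J /w /theta_walk => x0 xy ym kJ; split_nat; solve_nat. Qed.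

Lemma theta_next k : (k < J)%N -> gl (tgt (w k), (w k).2) = gl (src (w (succ_mod J k)), (w (succ_mod J k)).2).
Proof using X0 XY YM.
by move: X0 XY YM; rewrite /gl /glue_ends /src /tgt /w /succ_mod /theta_walk /J => x0 xy ym kJ; split_nat; solve_nat.
Qed.

Lemma theta_inj i j : (i < J)%N -> (j < J)%N -> gl (src (w i), (w i).2) = gl (src (w j), (w j).2) -> i = j.
Proof using X0 XY YM.
by move: X0 XY YM; rewrite /gl /glue_ends /src /tgt /w /theta_walk /J => x0 xy ym iJ jJ; split_nat; first [done | by move/pair_equal_spec => -[? ?]; first [discriminate | lia]].
Qed.

Lemma theta_branch i j : (i < J)%N -> (j < J)%N -> (w i).1 != (w j).1 ->
  (gl (src (w i), (w i).2)).1 = (gl (tgt (w j), (w j).2)).1 -> gl (src (w i), (w i).2) <> gl (tgt (w j), (w j).2) -> False.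
Proof using X0 XY YM.
move: X0 XY YM; rewrite /gl /glue_ends /src /tgt /w /theta_walk /J => x0 xy ym iJ jJ; split_nat => /= /eqP h1 h2 h3; apply: h3; solve_nat.
Qed.

End Theta.

Section Barbell.
Variables (s1 s2 : bool) (Y X M : nat).
Hypotheses (Y0 : (0 < Y)%N) (YX : (Y <= X)%N) (XM : (X < M)%N).
Let J := (M + X - Y)%N.
Let w := barbell_walk s1 s2 Y X M.
Let gl := glue_ends Y X M.

Lemma barbell_lt k : (k < J)%N -> ((w k).1 < M)%N.
Proof using Y0 YX XM. by move: Y0 YX XM; rewrite /J /w /barbell_walk => y0 yx xm kJ; case: s1; case: s2; split_nat; solve_nat. Qed.

(* The state in which the walk leaves its [k]-th vertex. *)
Let state k : nat * bool :=
  if (k < X - Y)%N then ((Y + k)%N, true)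
  else if (k < M - Y)%N then (if s2 || (k == X - Y)%N then ((Y + k)%N, true) else ((M - (k - (X - Y)))%N, false))
  else if (k < M + X - Y.*2)%N then ((X - (k - (M - Y)))%N, false)
  else if (k == M + X - Y.*2)%N then (Y, false) 
  else if s1 then ((k - (M + X - Y.*2))%N, true) else ((Y - (k - (M + X - Y.*2)))%N, false).

Lemma barbell_state k : (k < J)%N -> gl (src (w k), (w k).2) = state k.
Proof using Y0 YX XM.
by rewrite /gl /glue_ends /src /w /barbell_walk /state /J => kJ; case: s1; case: s2; split_nat; solve_nat.
Qed.

Lemma barbell_next k : (k < J)%N -> gl (tgt (w k), (w k).2) = gl (src (w (succ_mod J k)), (w (succ_mod J k)).2).
Proof using Y0 YX XM.
move=> kJ; have sJ : (succ_mod J k < J)%N by move: Y0 YX XM kJ; rewrite /succ_mod /J => y0 yx xm kJ; case: eqP => ?; lia.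
rewrite [RHS]barbell_state//; move: Y0 YX XM kJ {sJ}.
rewrite /gl /glue_ends /tgt /w /succ_mod /barbell_walk /state /J; case: s1; case: s2; clear => y0 yx xm kJ.
- by split_nat; solve_nat.
- by split_nat; solve_nat.
- by split_nat; solve_nat.
- by split_nat; solve_nat.
Qed.

Lemma barbell_inj i j : (i < J)%N -> (j < J)%N -> gl (src (w i), (w i).2) = gl (src (w j), (w j).2) -> i = j.
Proof using Y0 YX XM.
move=> iJ jJ; rewrite !barbell_state// /state; move: Y0 YX XM iJ jJ; rewrite /J; case: s1; case: s2; clear => /= y0 yx xm iJ jJ;
  split_nat; first [done | by move/pair_equal_spec => -[? ?]; first [discriminate | lia]].
Qed.

(** Away from the ends of the bar a vertex belongs to at most two segments. At each end of it, the
    pair of edges for which a sign is required consists of the first and the last edge of the loop,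
    in an order fixed by [s1] or [s2]. *)
Lemma barbell_branch i j : (i < J)%N -> (j < J)%N -> (w i).1 != (w j).1 ->
  (gl (src (w i), (w i).2)).1 = (gl (tgt (w j), (w j).2)).1 -> gl (src (w i), (w i).2) <> gl (tgt (w j), (w j).2) ->
  (if s1 then w i = (0%N, true) /\ w j = (Y.-1, true) else w i = (Y.-1, false) /\ w j = (0%N, false)) \/
  (if s2 then w i = (X, true) /\ w j = (M.-1, true) else w i = (M.-1, false) /\ w j = (X, false)).
Proof using Y0 YX XM.
move: Y0 YX XM => y0 yx xm iJ jJ; have sJ : (succ_mod J j < J)%N by move: jJ; rewrite /succ_mod /J; case: eqP => ?; lia.
rewrite barbell_next// !barbell_state// => h1 h2 h3.
have h4 : (state i).2 (+) (state (succ_mod J j)).2.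
  apply: contra_notT h3; rewrite [state i]surjective_pairing [state (succ_mod J j)]surjective_pairing h2.
  by case: (state i).2; case: (state _).2.
move: h2 h4 h1 iJ jJ {h3 sJ}; rewrite /state /succ_mod /J /w; case: s1; case: s2; move: y0 yx xm; clear => y0 yx xm.
1-4: by move=> h2 h4 h1 iJ jJ; move: h2 h4; split_if; first [by move=> _ | by move=> h2 _; exfalso; lia
  | move=> h2 _; move: h1; rewrite /barbell_walk; split_nat => /eqP h1; branch_nat].
Qed.

End Barbell.
End TrainTracks.

(** * Self-intersections of a polygon *)

Section PolygonHits.
Context {R : realType} {n : nat} (C : torus R n -> set 'rV[R]_n) (s : R) (lf : torus R n -> 'rV[R]_n).
Local Notation T := (torus R n).
Local Notation V := ('rV[R]_n).
Hypotheses (s0 : 0 < s) (CZ : forall x a u, C x u -> C x (a *: u))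
  (hl : forall x, half_functional C s x (lf x)).
Variables (sg d : R) (K : nat) (p : nat -> V).
Hypotheses (sg0 : 0 < sg) (d0 : 0 < d) (dsg : 18 * d < sg) (ds : 9 * d < s) (d1 : 32 * d <= 1) (K3 : (2 < K)%N)
  (dp : deep_polygon C lf sg d K p).
Local Notation w k := (p k.+1 - p k).
Local Notation g t := (tproj (pl K p t)).

Lemma deepv_near x y v : deepv C sg x v -> tdist x y < sg / 2 -> deepv C (sg / 2) y v.
Proof using sg0.
move=> h xy z u yz uv; have sgp := sg0; apply: h; first by have := tdistD y x z; lra.
by apply: le_trans uv _; rewrite ler_wpM2r ?enorm_ge0//; lra.
Qed.

Lemma deepvZ r x v a : 0 <= r -> deepv C r x v -> deepv C r x (a *: v).
Proof using CZ.
move=> r0 h y u xy; have [->|a0] := eqVneq a 0.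
  rewrite scale0r subr0 enorm0 mulr0 => u0; have -> : u = 0 *: v.
    by rewrite scale0r; apply: enorm_eq0; apply/eqP; rewrite eq_le u0 enorm_ge0.
  by apply: CZ; apply: h => //; rewrite subrr enorm0 mulr_ge0 ?enorm_ge0.
move=> ua; have -> : u = a *: (a^-1 *: u) by rewrite scalerA divff// scale1r.
apply: CZ; apply: h => //; rewrite -[v in _ - v]scale1r -(mulVf a0) -scalerA -scalerBr enormZ normfV.
by rewrite ler_pdivrMl ?normr_gt0// mulrCA -enormZ.
Qed.

Lemma deep_cone_polygon : cone_polygon C lf (d / 2) (4 / 3 * d) K p.
Proof using All.
have dq := d0; have sp := s0; have dsg' := dsg; have ds' := ds; have sgp := sg0; have [hp hc] := dp.
apply: (@near_cone_polygon _ _ C s lf s0 CZ hl d sg 0 K (fun k => tproj (p k)) (fun k => p k.+1 - p k) p d) => //.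
- lra.
- by rewrite mul0r mulr_ge0// ltW.
- by rewrite mul0r !mulr_ge0// ?invr_ge0// ltW.
- by rewrite mul0r; lra.
- move=> k kK; have [-> dv] := hp k kK; rewrite lexx; split=> //; first by rewrite tdistxx; lra.
  by rewrite subrr enorm0 mul0r.
- move=> k kK; split; first exact: hc.
  apply: le_trans (tdist_proj _ _) _; rewrite enorm_distC; have [-> _] := hp k (ltnW kK); lra.
Qed.

Lemma polygon_local_chord (t t' : R) : 0 <= t -> t < t' -> t' <= K%:R -> t' - t <= 1 ->
  0 < enorm (pl K p t' - pl K p t) /\ enorm (pl K p t' - pl K p t) < 4^-1.
Proof using All.
move=> t0 tt' t'K h; have dq := d0; have sp := s0; have ds' := ds; have d1' := d1.
have dl0 : 0 < d / 2 by lra.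
have d40 : 0 < 4 / 3 * d by lra.
have ds4 : 6 * (4 / 3 * d) <= s by lra.
have d14 : 24 * (4 / 3 * d) <= 1 by lra.
have [_ h1 h2] := polygon_chord s0 CZ hl dl0 d40 ds4 K3 deep_cone_polygon t0 tt' t'K h.
split.
  by apply: lt_le_trans h1; rewrite !mulr_gt0// subr_gt0.
apply: le_lt_trans h2 _; apply: (@le_lt_trans _ _ (4 / 3 * d)); last lra.
by rewrite -[leRHS]mulr1 ler_wpM2l// ltW.
Qed.

Lemma polygon_local_inj (t t' : R) : 0 <= t -> t < t' -> t' <= K%:R -> t' - t <= 1 -> g t <> g t'.
Proof using All.
move=> t0 tt' t'K h E; have [h1 h2] := polygon_local_chord t0 tt' t'K h.
have := @tproj_cancel R n 0 0 (pl K p t') (pl K p t) erefl.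
have h3 : enorm (pl K p t' - pl K p t) < 2^-1 by lra.
have := tlog_small h3; rewrite tprojB E subrr tlog0 => e; move: h1; rewrite -e enorm0 ltxx//.
Qed.

(* The functional of the cone at [g t], with the sign which makes it positive on the direction of travel. *)
Definition dir_functional (t : R) : V :=
  if pselect (exists k, [/\ (k < K)%N, k%:R <= t <= k.+1%:R & 0 < edot (w k) (lf (g t))]) then lf (g t) else - lf (g t).

Lemma dir_functionalE t : dir_functional t = lf (g t) \/ dir_functional t = - lf (g t).
Proof. by rewrite /dir_functional; case: pselect => h; [left|right]. Qed.

Lemma edge_near k (t : R) : (k < K)%N -> k%:R <= t <= k.+1%:R -> tdist (tproj (p k)) (g t) <= d /\
  tdist (tproj (p k.+1)) (g t) <= d.
Proof using dp.
move=> kK /andP[k0 k1]; have [hp _] := dp; have [wd _] := hp k kK.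
have t0 : 0 <= t - k%:R by lra.
have t1 : t - k%:R <= 1 by move: k1; rewrite -natr1; lra.
have -> : t = k%:R + (t - k%:R) by rewrite addrC subrK.
rewrite plE// !(tdistC (tproj (p _))); move: (t - k%:R) t0 t1 => th t0 t1; split; apply: le_trans (tdist_proj _ _) _.
  rewrite addrAC subrr add0r enormZ ger0_norm// wd; have := enorm_ge0 (w k); rewrite wd => dd.
  by rewrite -[leRHS]mul1r ler_wpM2r.
have -> : p k + th *: w k - p k.+1 = (th - 1) *: w k by apply/rowP => i; rewrite !mxE; ring.
rewrite enormZ ler0_norm; last lra.
by have := enorm_ge0 (w k); rewrite wd => dd; rewrite -[leRHS]mul1r ler_wpM2r//; lra.
Qed.

Lemma edge_mem k y : (k < K)%N -> tdist (tproj (p k)) y < sg -> C y (w k).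
Proof using dp sg0.
move=> kK ky; have [hp _] := dp; have [_ h] := hp k kK.
by apply: h => //; rewrite subrr enorm0 mulr_ge0 ?enorm_ge0// ltW.
Qed.

Lemma adjacent_coherent k (t : R) : (k.+1 < K)%N -> k%:R <= t <= k.+2%:R ->
  0 < edot (w k) (lf (g t)) * edot (w k.+1) (lf (g t)).
Proof using All.
move=> kK /andP[t0 t2]; have [_ hc] := dp; have := hc k kK; rewrite /coherent => co.
have dq := d0; have sp := s0; have ds' := ds; have dsg' := dsg.
have [hp _] := dp; have [wd _] := hp k (ltnW kK).
have kk : tdist (tproj (p k)) (tproj (p k.+1)) <= d.
  by apply: le_trans (tdist_proj _ _) _; rewrite enorm_distC wd.
have near : tdist (tproj (p k.+1)) (g t) <= d.
  have [tk|tk] := leP t k.+1%:R.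
    by have [] := @edge_near k t (ltnW kK); rewrite ?t0 ?tk.
  by have [] := @edge_near k.+1 t kK; rewrite ?t2 ?(ltW tk).
apply: (half_transfer s0 CZ hl (x := tproj (p k)) (y := tproj (p k.+1)) (u := w k) (v := w k.+1)) => //.
- lra.
- by rewrite tdistC; lra.
- by apply: edge_mem; rewrite ?(ltnW kK)//; lra.
- by apply: edge_mem; rewrite ?tdistxx.
Qed.

(** At a vertex two edges contain the parameter; coherence makes them agree on the sign. *)
Lemma edge_dir k (t : R) : (k < K)%N -> k%:R <= t <= k.+1%:R -> 0 < edot (w k) (dir_functional t).
Proof using All.
move=> kK kt; have dq := d0; have sp := s0; have ds' := ds; have dsg' := dsg.
have nz : edot (w k) (lf (g t)) != 0.
  have [_ h _] := hl (g t); have [e1 _] := edge_near kK kt.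
  have Cg : C (g t) (w k) by apply: edge_mem => //; lra.
  have [hp _] := dp; have [wd _] := hp k kK.
  have := h (g t) (w k) _ Cg; rewrite tdistxx wd => /(_ sp) h'.
  by rewrite -normr_gt0; apply: lt_le_trans h'; rewrite mulr_gt0.
rewrite /dir_functional; case: pselect => [[j [jK jt jp]]|h] /=; last first.
  rewrite edotNr oppr_gt0 lt_neqAle nz /= leNgt; apply/negP => kp; apply: h; by exists k.
have [jk|kj|jk] := ltngtP j k; last by rewrite -jk.
  have E : k = j.+1.
    move: kt jt => /andP[a _] /andP[_ b]; have := le_trans a b; rewrite ler_nat; move: jk; clear; lia.
  have := @adjacent_coherent j t; rewrite -E => /(_ kK); rewrite E in jt *.
  have -> : j%:R <= t <= j.+2%:R.
    case/andP: jt => a b; rewrite a; apply: le_trans b _; by rewrite ler_nat.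
  by move=> /(_ isT); rewrite pmulr_rgt0.
have E : j = k.+1.
  move: kt jt => /andP[_ a] /andP[b _]; have := le_trans b a; rewrite ler_nat; move: kj; clear; lia.
have := @adjacent_coherent k t; rewrite -E => /(_ jK).
have -> : k%:R <= t <= j.+1%:R.
  case/andP: kt => a b; rewrite a; apply: le_trans b _; by rewrite ler_nat E.
by rewrite E in jp *; move=> /(_ isT); rewrite pmulr_lgt0.
Qed.

Lemma adjacent_dir k (t : R) : k%:R <= t <= k.+2%:R -> t <= K%:R -> (k < K)%N ->
  0 < edot (w k) (dir_functional t) /\ ((k.+1 < K)%N -> 0 < edot (w k.+1) (dir_functional t)).
Proof using All.
move=> /andP[t0 t2] tK kK.
have [kK'|kK'] := ltnP k.+1 K; last first.
  have tk : t <= k.+1%:R by apply: le_trans tK _; rewrite ler_nat.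
  by split=> //; apply: edge_dir; rewrite ?t0.
have := @adjacent_coherent k t kK'; rewrite t0 t2 => /(_ isT) co.
have co' : 0 < edot (w k) (dir_functional t) * edot (w k.+1) (dir_functional t).
  by case: (dir_functionalE t) => ->; rewrite // !edotNr mulrNN.
have [tk|tk] := leP t k.+1%:R.
  have h : 0 < edot (w k) (dir_functional t) by apply: edge_dir; rewrite ?t0.
  by split=> // _; rewrite -(pmulr_rgt0 _ h).
have h : 0 < edot (w k.+1) (dir_functional t) by apply: edge_dir; rewrite ?(ltW tk).
by split=> //; rewrite -(pmulr_lgt0 _ h).
Qed.

Lemma chord_dir (t t' : R) : 0 <= t -> t < t' -> t' <= K%:R -> t' - t <= 1 ->
  0 < edot (pl K p t' - pl K p t) (dir_functional t) /\ 0 < edot (pl K p t' - pl K p t) (dir_functional t').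
Proof using All.
move=> t0 tt' t'K h.
have [k [a [b [th [kK /andP[th0 th1] tE [a0 b0 ab bk] ->]]]]] := pl_chord p (ltn_trans (isT : (0 < 2)%N) K3) t0 tt' t'K h.
have pos (u : R) : k%:R <= u <= k.+2%:R -> u <= K%:R -> 0 < edot (a *: w k + b *: w k.+1) (dir_functional u).
  move=> ku uK; have [h1 h2] := adjacent_dir ku uK kK; rewrite edotDl !edotZl.
  case: bk => [bz|/h2 h2'].
    by rewrite bz mul0r addr0 mulr_gt0//; lra.
  have [bz|bp] := eqVneq b 0; first by rewrite bz mul0r addr0 mulr_gt0//; lra.
  apply: ltr_wpDl; first by rewrite mulr_ge0// ltW.
  by rewrite mulr_gt0// lt_def bp.
have k2 : k.+2%:R = k%:R + 2 :> R by rewrite -addn2 natrD.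
by split; apply: pos; rewrite ?k2 //; [apply/andP; split; lra|lra|apply/andP; split; lra].
Qed.

(** A common point would have the same displacement to [g x] along both arcs, yet this displacement
    is positive for two opposite functionals. *)
Lemma opposite_passages_apart (x b t t' : R) : 0 <= t -> x - 1 <= t -> t < x -> x <= K%:R -> 0 <= b - 1 -> b - 1 <= t' -> t' <= b -> b <= K%:R ->
  g x = g b -> dir_functional x = - dir_functional b -> g t <> g t'.
Proof using All.
have locals := I.
move=> t0 xt tx xK b1 bt tb bK xb op E.
have tx1 : x - t <= 1 by qlra.
have [c1 c2] := polygon_local_chord t0 tx xK tx1.
have [_ e1] := chord_dir t0 tx xK tx1.
have t'0 : 0 <= t' by qlra.
have [tb'|/eqP] := eqVneq t' b.
  move: c1; rewrite tb' -xb in E; have h : enorm (pl K p x - pl K p t) < 2^-1 by qlra.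
  by have := tlog_small h; rewrite tprojB E subrr tlog0 => <-; rewrite enorm0 ltxx.
move=> tb'; have {}tb' : t' < b by rewrite lt_neqAle tb andbT; apply/eqP.
have tb1 : b - t' <= 1 by qlra.
have [c1' c2'] := polygon_local_chord t'0 tb' bK tb1.
have [_ e2] := chord_dir t'0 tb' bK tb1.
have E1 : - (pl K p x - pl K p t) = - (pl K p b - pl K p t').
  apply: (tproj_cancel xb); rewrite ?enormN//; by rewrite !opprB !subrKC.
by move: e1; rewrite (oppr_inj E1) op edotNr; qlra.
Qed.

(** The coincidences in a closed set of pairs form a compact set, so the extreme parameters are
    attained. *)
Lemma extremal_hits (al be : R) (Q : set (R * R)) : closed Q -> 
  (exists t t', [/\ al <= t <= be, al <= t' <= be, Q (t, t') & g t = g t']) ->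
  (exists t t', [/\ al <= t <= be, al <= t' <= be, Q (t, t'), g t = g t' &
     forall u u', al <= u <= be -> al <= u' <= be -> Q (u, u') -> g u = g u' -> t' <= u']) /\
  (exists t t', [/\ al <= t <= be, al <= t' <= be, Q (t, t'), g t = g t' &
     forall u u', al <= u <= be -> al <= u' <= be -> Q (u, u') -> g u = g u' -> u <= t]).
Proof.
have locals := I.
move=> cQ [h0 [h0' [hh hh' hQ hE]]].
pose G (z : R * R) := tdist (g z.1) (g z.2).
have cG : continuous G.
  move=> z; apply/cvgrPdist_le => e e0.
  have e2 : 0 < e / 2 by qlra.
  have near1 (pr : R * R -> R) : continuous pr -> \forall y \near z, enorm (pl K p (pr z) - pl K p (pr y)) < e / 2.
    move=> cpr; have [r r0 hr] := @enorm_cvg0 R n (e / 2) e2.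
    have c : {for z, continuous (pl K p \o pr)}.
      by apply: continuous_comp; [exact: cpr|exact: pl_continuous].
    move/cvgrPdist_lt: c => /(_ r r0); apply: filterS => u; exact: hr.
  near=> y.
  have h1 : enorm (pl K p z.1 - pl K p y.1) < e / 2.
    by near: y; apply: (near1 fst) => u; exact: cvg_fst.
  have h2 : enorm (pl K p z.2 - pl K p y.2) < e / 2.
    by near: y; apply: (near1 snd) => u; exact: cvg_snd.
  exact: tdist_lip (le_lt_trans (tdist_proj _ _) h1) (le_lt_trans (tdist_proj _ _) h2).
pose D := ((`[al, be]%classic `*` `[al, be]%classic) `&` (Q `&` G @^-1` [set 0])) : set (R * R).
have cD : compact D.
  apply: compact_closedI; first by apply: compact_setX; exact: segment_compact.
  apply: closedI => //; apply: closed_comp; last exact: closed_eq.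
  by move=> z _; exact: cG.
have inD u u' : al <= u <= be -> al <= u' <= be -> Q (u, u') -> g u = g u' -> D (u, u').
  by move=> a a' q e; split; [split; rewrite /= in_itv|split=> //; rewrite /= /G e tdistxx].
have Din z : D z -> [/\ al <= z.1 <= be, al <= z.2 <= be, Q z & g z.1 = g z.2].
  by move=> [[]]; rewrite /= !in_itv /= => a a' [q /tdist_eq0].
have D0 : D !=set0 by exists (h0, h0'); exact: inD.
split.
  have c2 : continuous (fun z : R * R => z.2) by move=> z; exact: cvg_snd.
  have [z] := compact_EVT_min D0 cD (continuous_subspaceT c2); rewrite inE => /Din[a a' q e] zm.
  exists z.1, z.2; split=> //; first by case: (z) q.
  by move=> u u' b b' q' e'; apply: (zm (u, u')); rewrite inE; exact: inD.
have c1 : continuous (fun z : R * R => - z.1) by move=> z; apply: cvgN; exact: cvg_fst.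
have [z] := compact_EVT_min D0 cD (continuous_subspaceT c1); rewrite inE => /Din[a a' q e] zm.
exists z.1, z.2; split=> //; first by case: (z) q.
move=> u u' b b' q' e'; rewrite -lerN2; apply: (zm (u, u')); rewrite inE; exact: inD.
Unshelve. all: by end_near.
Qed.

Lemma closed_gap : closed [set z : R * R | z.1 + 1 <= z.2].
Proof.
have -> : [set z : R * R | z.1 + 1 <= z.2] = (fun z : R * R => z.2 - z.1) @^-1` [set r | 1 <= r].
  by apply/seteqP; split => z /=; lra.
apply: closed_comp; last exact: closed_ge.
by move=> z _; apply: cvgB; [exact: cvg_snd|exact: cvg_fst].
Qed.

(** By local injectivity, coincident parameters are at least 1 apart; this closed condition replaces
    [t < t'] and yields an earliest return. *)
Lemma first_return (al be : R) : 0 <= al -> al <= be -> be <= K%:R ->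
  (forall t t', al <= t -> t < t' -> t' <= be -> g t <> g t') \/
  exists x b, [/\ al <= x, x + 1 <= b, b <= be, g x = g b & forall t t', al <= t -> t < t' -> t' < b -> g t <> g t'].
Proof using All.
move=> al0 alb beK.
have gap t t' : al <= t -> t < t' -> t' <= be -> g t = g t' -> t + 1 <= t'.
  move=> h1 h2 h3 e; rewrite leNgt; apply/negP => h4; apply: (@polygon_local_inj t t') => //; lra.
have [h|h] := pselect (exists t t', [/\ al <= t <= be, al <= t' <= be, [set z : R * R | z.1 + 1 <= z.2] (t, t') & g t = g t']); last first.
  left=> t t' h1 h2 h3 e; apply: h; exists t, t'; split=> //; last exact: gap.
    by apply/andP; split; lra.
  by apply/andP; split; lra.
have [[x [b [/andP[x0 x1] /andP[b0 b1] /= xb e hmin]]] _] := extremal_hits closed_gap h.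
right; exists x, b; split=> // t t' t0 tt' t'b e'.
have := hmin t t'; rewrite t0 (_ : t <= be) /=; last lra.
rewrite (_ : al <= t' <= be); last by apply/andP; split; lra.
move=> /(_ isT isT _ e')/wrap[|h']; first by apply: gap => //; lra.
lra.
Qed.

(** Coincidences with parameters below [b] do not form a closed set. Allowing [b] is harmless, since
    a coincidence with [b] is one with [x], provided that those tending to the pair of [x] and [b]
    are excluded; [opposite_passages_apart] does so, whence the closed condition [Q]. *)
Lemma last_backward_return (al mid x b : R) : 0 <= al -> al <= mid -> mid <= x -> x + 1 <= b -> b <= K%:R -> g x = g b ->
  dir_functional x = - dir_functional b -> (forall t t', mid <= t -> t < t' -> t' < b -> g t <> g t') ->
  (forall t t', al <= t -> t < t' -> t' < b -> g t <> g t') \/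
  exists a y, [/\ al <= a, a < mid, a < y, y < b & g a = g y /\ forall t t', a < t -> t < t' -> t' < b -> g t <> g t'].
Proof using All.
have locals := I.
move=> al0 am mx xb bK gxb op inj.
have gap t t' : al <= t -> t < t' -> t' <= b -> g t = g t' -> t + 1 <= t'.
  move=> h1 h2 h3 e; rewrite leNgt; apply/negP => h4; apply: (@polygon_local_inj t t') => //; qlra.
pose Q := [set z : R * R | z.1 + 1 <= z.2] `&` ([set z | z.1 <= mid] `&` ([set z | z.1 <= x - 1] `|` [set z | z.2 <= b - 1])).
have cQ : closed Q.
  have c1 (c : R) : closed [set z : R * R | z.1 <= c].
    have -> : [set z : R * R | z.1 <= c] = (fun z : R * R => z.1) @^-1` [set r | r <= c] by [].
    by apply: closed_comp; [move=> z _; exact: cvg_fst|exact: closed_le].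
  have c2 (c : R) : closed [set z : R * R | z.2 <= c].
    have -> : [set z : R * R | z.2 <= c] = (fun z : R * R => z.2) @^-1` [set r | r <= c] by [].
    by apply: closed_comp; [move=> z _; exact: cvg_snd|exact: closed_le].
  by apply: closedI; [exact: closed_gap|apply: closedI => //; apply: closedU].
have inQ t t' : al <= t -> t < mid -> t < t' -> t' <= b -> g t = g t' -> Q (t, t').
  move=> h1 h2 h3 h4 e; have g1 := gap t t' h1 h3 h4 e; do 2!split=> //=; first qlra.
  have [tb|tb] := leP t' (b - 1); [by right|left].
  rewrite leNgt; apply/negP => h5; apply: (@opposite_passages_apart x b t t') => //; qlra.
have before t t' : al <= t -> t < t' -> t' < b -> g t = g t' -> t < mid.
  by move=> h1 h2 h3 e; rewrite ltNge; apply/negP => h4; exact: (inj t t').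
have [h|h] := pselect (exists t t', [/\ al <= t <= b, al <= t' <= b, Q (t, t') & g t = g t']); last first.
  left=> t t' h1 h2 h3 e; apply: h; have h4 := before _ _ h1 h2 h3 e.
  exists t, t'; split=> //; try (by apply/andP; split; qlra).
  by apply: inQ => //; qlra.
have [_ [a [y [/andP[a0 a1] /andP[y0 y1] Qay e hmax]]]] := extremal_hits cQ h; right.
have [/= ay [/= amid xy]] := Qay.
have am' : a < mid.
  rewrite lt_neqAle amid andbT; apply/eqP => am'.
  have [yb|yb] := ltP y b; first by apply: (inj a y) => //; qlra.
  have yb' : y = b by qlra.
  case: xy => /= xy; last qlra.
  by apply: (inj a x); rewrite ?e ?yb' ?gxb//; qlra.
(* If the second parameter is [b], it is replaced by [x]. *)
have [y' [y'a y'b e']] : exists y', [/\ a < y', y' < b & g a = g y'].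
  have [yb|yb] := ltP y b; first by exists y; split=> //; qlra.
  have yb' : y = b by qlra.
  by exists x; rewrite e yb' gxb; split=> //; qlra.
exists a, y'; split=> //; split=> // t t' h1 h2 h3 e2.
have t0 : al <= t by qlra.
have h4 := before t t' t0 h2 h3 e2.
have := hmax t t'; rewrite (_ : al <= t <= b); last by apply/andP; split; qlra.
rewrite (_ : al <= t' <= b); last by apply/andP; split; qlra.
move=> /(_ isT isT _ e2)/wrap[|h5]; first by apply: inQ => //; qlra.
qlra.
Qed.

End PolygonHits.

(** * Subdivisions of a parameter interval *)

Section Grids.
Context {R : realType}.

Lemma convex_itv (x y h : R) : x < y -> 0 <= h -> h <= 1 -> x <= x + h * (y - x) <= y.
Proof. by move=> *; apply/andP; split; nra. Qed.

Lemma sorted_grid (l : seq R) (a b : R) : a < b -> a \in l -> b \in l -> (forall z, z \in l -> a <= z <= b) ->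
  exists M (tau : nat -> R), [/\ (0 < M)%N, tau 0%N = a, tau M = b, forall m, (m < M)%N -> tau m < tau m.+1 &
    (forall z, z \in l -> exists2 m, (m <= M)%N & tau m = z) /\
    forall m z, (m < M)%N -> z \in l -> z <= tau m \/ tau m.+1 <= z].
Proof.
move=> ab al bl lab; pose L := sort <=%R (undup l).
have mL z : (z \in L) = (z \in l) by rewrite mem_sort mem_undup.
have sL : sorted <%R L by rewrite sort_lt_sorted undup_uniq.
have mono i j : (i < j)%N -> (j < size L)%N -> nth b L i < nth b L j.
  move=> ij jL; have tr : transitive (<%R : rel R) by move=> x y z; exact: lt_trans.
  by apply: (sorted_ltn_nth tr b sL) => //; rewrite inE// (ltn_trans ij).
have aL : a \in L by rewrite mL.
have bL : b \in L by rewrite mL.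
have sz : (0 < size L)%N by rewrite -has_predT; apply/hasP; exists a.
have mem i : (i < size L)%N -> a <= nth b L i <= b by move=> iL; apply: lab; rewrite -mL mem_nth.
have idx z : z \in l -> exists2 m, (m <= (size L).-1)%N & nth b L m = z.
  rewrite -mL => zL; exists (index z L); last exact: nth_index.
  by rewrite -ltnS prednK// index_mem.
have t0 : nth b L 0 = a.
  have [[|m] mM ma] := idx a al => //.
  have mL' : (m.+1 < size L)%N by rewrite -(prednK sz) ltnS.
  have := mono 0%N m.+1 isT mL'; rewrite ma; have /andP[h _] := mem 0%N sz; lra.
have tM : nth b L (size L).-1 = b.
  have [m mM mb] := idx b bl.
  move: mM; rewrite leq_eqVlt => /orP[/eqP <-//|mM].
  have mL' : ((size L).-1 < size L)%N by rewrite prednK.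
  have := mono _ _ mM mL'; rewrite mb; have /andP[_ h] := mem _ mL'; lra.
exists (size L).-1, (nth b L); split=> //.
- by rewrite lt0n; apply/eqP => e; have := t0; rewrite -e tM => ba; move: ab; rewrite ba ltxx.
- by move=> m mM; apply: mono => //; rewrite -(prednK sz) ltnS.
split=> // m z mM /idx[k kM <-].
have kL : (k < size L)%N by rewrite -(prednK sz) ltnS.
have mL' : (m.+1 < size L)%N by rewrite -(prednK sz) ltnS.
have [km|mk] := leqP k m.
  by left; move: km; rewrite leq_eqVlt => /orP[/eqP->//|km]; apply/ltW/mono => //; rewrite (ltn_trans _ mL').
by right; move: mk; rewrite leq_eqVlt => /orP[/eqP->//|mk]; exact/ltW/mono.
Qed.

(** The prescribed parameters are sorted together with the integers, at which the edges change. *)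
Lemma edge_grid (K : nat) (al be : R) (xs : seq R) : 0 <= al -> al < be -> be <= K%:R -> 
  (forall z, z \in xs -> al <= z <= be) ->
  exists M (tau : nat -> R), [/\ (0 < M)%N, tau 0%N = al, tau M = be, forall m, (m < M)%N -> tau m < tau m.+1 &
    (forall z, z \in xs -> exists2 m, (m <= M)%N & tau m = z) /\
    forall m, (m < M)%N -> exists k, [/\ (k < K)%N, k%:R <= tau m & tau m.+1 <= k.+1%:R]].
Proof.
move=> al0 ab bK xsab.
pose l := al :: be :: xs ++ [seq z <- [seq k%:R | k <- iota 0 K] | al <= z <= be].
have [|||M [tau [M0 t0 tM mono [mem cut]]]] := @sorted_grid l al be ab.
- by rewrite inE eqxx.
- by rewrite !inE eqxx orbT.
- move=> z; rewrite !inE mem_cat => /orP[/eqP->|/orP[/eqP->|/orP[/xsab//|]]]; rewrite ?lexx ?(ltW ab)//.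
  by rewrite mem_filter => /andP[].
exists M, tau; split=> //; split=> [z zx|m mM].
  by apply: mem; rewrite !inE mem_cat zx !orbT.
have mo i j : (i <= j)%N -> (j <= M)%N -> tau i <= tau j.
  elim: j => [|j IH]; first by rewrite leqn0 => /eqP->.
  rewrite leq_eqVlt => /orP[/eqP->//|ij] jM; apply: le_trans (IH ij (ltnW jM)) (ltW (mono _ jM)).
have tm0 : al <= tau m by rewrite -t0; apply: mo => //; exact: ltnW.
have tmb : tau m < be by apply: lt_le_trans (mono m mM) _; rewrite -tM; exact: mo.
have t00 : 0 <= tau m by lra.
have /andP[k1 k2] := truncn_itv t00; set k := Num.truncn _ in k1 k2.
have kK : (k < K)%N by rewrite -(ltr_nat R); lra.
exists k; split=> //.
have [kb|kb] := leP k.+1%:R be; last by apply: le_trans (ltW kb); rewrite -tM; exact: mo.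
have [kK'|kK'] := ltnP k.+1 K; last first.
  have E : k.+1 = K by apply/eqP; rewrite eqn_leq kK kK'.
  by apply: (@le_trans _ _ be); [rewrite -tM; exact: mo|rewrite E].
have kl : k.+1%:R \in l.
  rewrite !inE mem_cat mem_filter kb andbT (_ : al <= k.+1%:R) /=; last lra.
  by rewrite (map_f (fun k => k%:R : R)) ?orbT// mem_iota.
by case: (cut m _ mM kl) => // h; move: (le_lt_trans h k2); rewrite ltxx.
Qed.

Lemma edot2 (u v : 'rV[R]_2) : edot u v = u 0 0 * v 0 0 + u 0 1 * v 0 1.
Proof. by rewrite -om_perp /om !mxE /=; ring. Qed.

Lemma opposite_parallel (u v l : 'rV[R]_2) : om u v = 0 -> 0 < edot u l -> edot v l < 0 -> exists2 a : R, 0 < a & u = - (a *: v).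
Proof.
move=> uv ul vl; exists (- (edot u l / edot v l)); first by rewrite oppr_gt0 pmulr_rlt0// invr_lt0.
have vn : edot v l != 0 by rewrite lt_eqF.
rewrite scaleNr opprK; suff E : edot v l *: u = edot u l *: v by rewrite mulrC -scalerA -E scalerA mulVf// scale1r.
by move: uv; rewrite /om !edot2 => uv; apply: rV2P; rewrite !mxE;
  [have : l 0 1 * (u 0 0 * v 0 1 - u 0 1 * v 0 0) = 0 by rewrite uv mulr0|
   have : l 0 0 * (u 0 0 * v 0 1 - u 0 1 * v 0 0) = 0 by rewrite uv mulr0]; lra.
Qed.

End Grids.

(** * Long discs near polygons of the 2-torus *)

Section PlanePolygons.
Context {R : realType} (C : torus R 2 -> set 'rV[R]_2) (s : R) (lf : torus R 2 -> 'rV[R]_2).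
Local Notation T := (torus R 2).
Local Notation V := ('rV[R]_2).
Hypotheses (s0 : 0 < s) (CZ : forall x a u, C x u -> C x (a *: u))
  (hl : forall x, half_functional C s x (lf x)).
Variables (sg d : R) (K : nat) (p : nat -> V).
Hypotheses (sg0 : 0 < sg) (d0 : 0 < d) (dsg : 18 * d < sg) (ds : 9 * d < s) (d1 : 32 * d <= 1) (K3 : (2 < K)%N)
  (dp : deep_polygon C lf sg d K p).
Local Notation w k := (p k.+1 - p k).
Local Notation g t := (tproj (pl K p t)).
Local Notation dir := (dir_functional lf K p).

Section Chains.
Variables (M : nat) (tau : nat -> R).
Hypotheses (M0 : (0 < M)%N) (t00 : 0 <= tau 0%N) (tMK : tau M <= K%:R) (mono1 : forall m, (m < M)%N -> tau m < tau m.+1)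
  (inedge : forall m, (m < M)%N -> exists k, [/\ (k < K)%N, k%:R <= tau m & tau m.+1 <= k.+1%:R]).
Let P m := pl K p (tau m).
Local Notation B m := (P m.+1 - P m).
Definition param m (th : R) := tau m + th * (tau m.+1 - tau m).

Lemma tau_lt i j : (i < j)%N -> (j <= M)%N -> tau i < tau j.
Proof using mono1.
elim: j => // j IH; rewrite ltnS leq_eqVlt => /orP[/eqP->|ij] jM; first exact: mono1.
exact: lt_trans (IH ij (ltnW jM)) (mono1 jM).
Qed.

Lemma tau_le i j : (i <= j)%N -> (j <= M)%N -> tau i <= tau j.
Proof using mono1. by rewrite leq_eqVlt => /orP[/eqP->//|ij] jM; apply/ltW/tau_lt. Qed.

Lemma chain_point m th : (m < M)%N -> 0 <= th <= 1 -> P m + th *: B m = pl K p (param m th).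
Proof using inedge mono1.
move=> mM /andP[h0 h1]; have [k [kK k1 k2]] := inedge mM; have mm := mono1 mM; rewrite -natr1 in k2.
have aff t : k%:R <= t -> t <= k%:R + 1 -> pl K p t = p k + (t - k%:R) *: w k.
  by move=> a b; have := @plE R 2 K p k (t - k%:R) kK; rewrite (addrC k%:R) subrK; apply; lra.
have q : tau m <= param m th <= tau m.+1.
  exact: convex_itv.
case/andP: q => q1 q2.
have u1 : tau m <= k%:R + 1 by lra.
have u2 : k%:R <= tau m.+1 by lra.
have u3 : k%:R <= param m th by lra.
have u4 : param m th <= k%:R + 1 by lra.
rewrite /P (aff _ k1 u1) (aff _ u2 k2) (aff _ u3 u4).
by rewrite /param; apply/rowP => i; rewrite !mxE; ring.
Qed.

Lemma chain_edge m : (m < M)%N -> [/\ enorm (B m) <= d, deepv C (sg / 2) (tproj (P m)) (B m),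
  deepv C (sg / 2) (tproj (P m.+1)) (B m), 0 < edot (B m) (dir (tau m)) & 0 < edot (B m) (dir (tau m.+1))].
Proof using All.
move=> mM; have [k [kK k1 k2]] := inedge mM; have mm := mono1 mM; have [hp _] := dp; have [wd wdv] := hp k kK.
have k2' := k2; rewrite -natr1 in k2'.
have aff t : k%:R <= t -> t <= k%:R + 1 -> pl K p t = p k + (t - k%:R) *: w k.
  by move=> a b; have := @plE R 2 K p k (t - k%:R) kK; rewrite (addrC k%:R) subrK; apply; lra.
have BE : B m = (tau m.+1 - tau m) *: w k.
  have u1 : tau m <= k%:R + 1 by lra.
  have u2 : k%:R <= tau m.+1 by lra.
  by rewrite /P (aff _ k1 u1) (aff _ u2 k2'); apply/rowP => i; rewrite !mxE; ring.
have D0 : 0 < tau m.+1 - tau m by lra.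
have D1 : tau m.+1 - tau m <= 1 by lra.
have sgp := sg0; have dq := d0; have dsg' := dsg.
have i1 : k%:R <= tau m <= k.+1%:R by rewrite k1 -natr1; lra.
have i2 : k%:R <= tau m.+1 <= k.+1%:R by rewrite k2 andbT; lra.
have [n1 _] := edge_near dp kK i1; have [n2 _] := edge_near dp kK i2.
have sg2 : 0 <= sg / 2 by lra.
have e1 := edge_dir s0 CZ hl sg0 d0 dsg ds d1 K3 dp kK i1.
have e2 := edge_dir s0 CZ hl sg0 d0 dsg ds d1 K3 dp kK i2.
rewrite BE; split.
- by rewrite enormZ gtr0_norm// wd -[leRHS]mul1r ler_wpM2r// ltW.
- by apply: deepvZ => //; apply: (deepv_near sg0 wdv); lra.
- by apply: deepvZ => //; apply: (deepv_near sg0 wdv); lra.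
- by rewrite edotZl mulr_gt0.
- by rewrite edotZl mulr_gt0.
Qed.

Lemma chain_dir m : (m <= M)%N -> dir (tau m) = lf (tproj (P m)) \/ dir (tau m) = - lf (tproj (P m)).
Proof. by move=> _; exact: dir_functionalE. Qed.

Lemma param_itv m th : (m < M)%N -> 0 <= th <= 1 -> tau m <= param m th <= tau m.+1.
Proof using mono1.
move=> mM /andP[h0 h1]; have mm := mono1 mM.
exact: convex_itv.
Qed.

Lemma vertex_of i m : (i <= M)%N -> (m < M)%N -> tau m <= tau i <= tau m.+1 -> i \in [:: m; m.+1].
Proof using mono1.
move=> iM mM /andP[h1 h2]; rewrite !inE; have [//|n1] := eqVneq i m; have [//|n2] := eqVneq i m.+1; exfalso.
have [im|im] : (i < m)%N \/ (m.+1 < i)%N by move: n1 n2; clear; lia.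
  by have := tau_lt im (ltnW mM); lra.
by have := tau_lt im iM; lra.
Qed.

Lemma same_param_vertex m m' th th' : (m < M)%N -> (m' < M)%N -> m != m' -> 0 <= th <= 1 -> 0 <= th' <= 1 ->
  param m th = param m' th' -> exists q, q \in [:: m; m.+1] /\ q \in [:: m'; m'.+1].
Proof using mono1.
wlog mm' : m m' th th' / (m < m')%N.
  move=> H mM m'M ne t t' e; move: (ne); rewrite neq_ltn => /orP[h|h]; first exact: (H m m' th th').
  have ne' : m' != m by rewrite eq_sym.
  by have [q [q1 q2]] := H m' m th' th h m'M mM ne' t' t (esym e); exists q.
move=> mM m'M _ t t' e; have /andP[a1 a2] := param_itv mM t; have /andP[b1 b2] := param_itv m'M t'.
have [mq|mq|E] := ltngtP m.+1 m'; [|by move: mm' mq; clear; lia|].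
  by have := tau_lt mq (ltnW m'M); move: a2 b1; rewrite e => u v; lra.
by exists m'; rewrite !inE eqxx -E eqxx orbT.
Qed.

Lemma param_bounds m th : (m < M)%N -> 0 <= th <= 1 -> tau 0%N <= param m th <= tau M.
Proof using mono1.
move=> mM t; have /andP[a1 a2] := param_itv mM t; apply/andP; split.
  by apply: le_trans a1; apply: tau_le => //; exact: ltnW.
by apply: le_trans a2 _; exact: tau_le.
Qed.

(** [glued_long_disc] for a subdivided polygon, with the walk extended periodically. Coincidences
    need only be examined for increasing parameters, since those at equal parameters are common
    vertices. *)
Lemma chain_long_disc (gl : nat * bool -> nat * bool) (wk : nat -> nat * bool) J D rho :
  (0 < J)%N ->
  (forall q e, (q <= M)%N -> g (tau (gl (q, e)).1) = g (tau q) /\ signed (gl (q, e)).2 (dir (tau (gl (q, e)).1)) = signed e (dir (tau q))) ->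
  (forall q e e', (gl (q, e)).1 = (gl (q, e')).1) ->
  (forall m m' th th', (m < M)%N -> (m' < M)%N -> 0 <= th <= 1 -> 0 <= th' <= 1 -> param m th < param m' th' ->
     g (param m th) = g (param m' th') ->
     exists q q', [/\ q \in [:: m; m.+1], q' \in [:: m'; m'.+1] & forall e e', (gl (q, e)).1 = (gl (q', e')).1]) ->
  (forall k, (k < J)%N -> ((wk k).1 < M)%N) ->
  (forall k, (k < J)%N -> gl (tgt (wk k), (wk k).2) = gl (src (wk (succ_mod J k)), (wk (succ_mod J k)).2)) ->
  (forall i j, (i < J)%N -> (j < J)%N -> gl (src (wk i), (wk i).2) = gl (src (wk j), (wk j).2) -> i = j) ->
  (forall i j, (i < J)%N -> (j < J)%N -> (wk i).1 != (wk j).1 ->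
     (gl (src (wk i), (wk i).2)).1 = (gl (tgt (wk j), (wk j).2)).1 ->
     gl (src (wk i), (wk i).2) <> gl (tgt (wk j), (wk j).2) ->
     0 < om (signed (wk i).2 (B (wk i).1)) (signed (wk j).2 (B (wk j).1))) ->
  0 < rho -> long_disc_near C [set g t | t in [set t | 0 <= t <= K%:R]] rho D.
Proof using All.
move=> J0 glP gl1 hit wM wn wi wb rho0; pose w' k := wk (k %% J)%N.
have kJ k : (k %% J < J)%N by rewrite ltn_mod.
have sgp := sg0; have dsg' := dsg; have dq := d0.
have sg2 : 0 < sg / 2 by lra.
have dsg2 : 9 * d < sg / 2 by lra.
have contact m m' (th th' : R) : (m < M)%N -> (m' < M)%N -> m != m' -> 0 <= th <= 1 -> 0 <= th' <= 1 ->
     tproj (P m + th *: B m) = tproj (P m' + th' *: B m') ->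
     exists q q', [/\ q \in [:: m; m.+1], q' \in [:: m'; m'.+1] & forall e e', (gl (q, e)).1 = (gl (q', e')).1].
  move=> mM m'M mm' t t'; rewrite !chain_point// => E.
  have [lt|lt|e] := ltgtP (param m th) (param m' th').
  - exact: (hit m m' th th').
  - have [q [q' [h1 h2 h3]]] := hit m' m th' th m'M mM t' t lt (esym E).
    by exists q', q; split=> // e e'; rewrite -(h3 e' e).
  - have [q [h1 h2]] := same_param_vertex mM m'M mm' t t' e.
    by exists q, q; split.
have w'M k : ((w' k).1 < M)%N by exact: wM.
have w'J k : w' (k + J)%N = w' k by rewrite /w' modnDr.
have sm k : (k.+1 %% J)%N = succ_mod J (k %% J)%N.
  rewrite /succ_mod; have -> : (k.+1 %% J)%N = ((k %% J).+1 %% J)%N by rewrite -addn1 -modnDml addn1.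
  by case: eqP => [->|ne]; [rewrite modnn|rewrite modn_small// ltn_neqAle; apply/andP; split; [exact/eqP|exact: kJ]].
have w'n k : gl (tgt (w' k), (w' k).2) = gl (src (w' k.+1), (w' k.+1).2) by rewrite /w' sm; exact: wn.
have w'E k : (k < J)%N -> w' k = wk k by move=> h; rewrite /w' modn_small.
have w'i i j : (i < J)%N -> (j < J)%N -> gl (src (w' i), (w' i).2) = gl (src (w' j), (w' j).2) -> i = j.
  by move=> iJ jJ; rewrite !w'E//; exact: wi.
have w'b i j : (i < J)%N -> (j < J)%N -> (w' i).1 != (w' j).1 ->
     (gl (src (w' i), (w' i).2)).1 = (gl (tgt (w' j), (w' j).2)).1 ->
     gl (src (w' i), (w' i).2) <> gl (tgt (w' j), (w' j).2) -> 0 < om (walk_edge P w' i) (walk_edge P w' j).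
  by move=> iJ jJ; rewrite /walk_edge !w'E//; exact: wb.
have [h [eh th hn hD]] := @glued_long_disc R C s lf s0 CZ hl M J P (fun m => dir (tau m)) gl w' (sg / 2) d J0 sg2 d0 dsg2 ds d1
  chain_edge chain_dir glP contact w'M w'J w'n w'i w'b D rho rho0.
exists h; split=> // q /hn[x wx xq]; exists x => //.
have [m [t [mM t01 ->]]] := @walk_points_chain R M P (fun m => dir (tau m)) gl w' glP w'M w'n x wx.
have /andP[b1 b2] := param_bounds mM t01.
exists (param m t); last by rewrite chain_point.
by rewrite /=; move: t00 tMK => u0 uM; apply/andP; split; [exact: le_trans b1|exact: le_trans b2 uM].
Qed.

End Chains.

(** The two ends agree in position and direction, so gluing them makes a closed walk which runs
    forward and passes each vertex once. *)
Lemma closed_loop_disc (al be D rho : R) : 0 <= al -> al < be -> be <= K%:R -> g al = g be -> dir al = dir be ->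
  (forall t t', al <= t -> t < t' -> t' < be -> g t <> g t') -> 0 < rho ->
  long_disc_near C [set g t | t in [set t | 0 <= t <= K%:R]] rho D.
Proof using All.
move=> al0 ab bK gab dab inj rho0.
have nox z : z \in ([::] : seq R) -> al <= z <= be by rewrite in_nil.
have [M [tau [M0 t0 tM mono [_ ined]]]] := edge_grid al0 ab bK nox.
have t00 : 0 <= tau 0%N by rewrite t0.
have tMK : tau M <= K%:R by rewrite tM.
pose gl (e : nat * bool) := if e.1 == M then (0%N, e.2) else e.
have Mn0 : (0%N == M) = false by move: M0; rewrite lt0n eq_sym => /negPf.
apply: (@chain_long_disc M tau M0 t00 tMK mono ined gl (fun k => (k, true)) M D rho) => //.
- by move=> q e qM; rewrite /gl /=; case: eqP => [->|//] /=; rewrite t0 tM gab dab.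
- by move=> q e e'; rewrite /gl /=; case: eqP.
- move=> m m' th th' mM m'M t t' lt E.
  have /andP[b1 b2] := param_bounds mono mM t; have /andP[b1' b2'] := param_bounds mono m'M t'.
  rewrite t0 in b1 b1'; rewrite tM in b2 b2'.
  have [lb|lb] := ltP (param tau m' th') be; first by case: (inj _ _ b1 lt lb).
  have Eb : param tau m' th' = be by apply/eqP; rewrite eq_le b2'.
  have Ea : param tau m th = al.
    apply/eqP; rewrite eq_le b1 andbT leNgt; apply/negP => h; apply: (inj _ _ (lexx al) h); first by lra.
    by rewrite E Eb.
  exists 0%N, M; split.
  + by apply: (vertex_of mono) => //; rewrite t0 -Ea; exact: (param_itv mono mM t).
  + by apply: (vertex_of mono) => //; rewrite tM -Eb; exact: (param_itv mono m'M t').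
  + by move=> e e'; rewrite /gl /= Mn0 eqxx.
- move=> k kM; rewrite /gl /src /tgt /succ_mod /=; have [E|ne] := eqVneq k.+1 M; rewrite /= ?Mn0 ?(negPf ne)//.
- move=> i j iM jM; rewrite /gl /src /= !ltn_eqF//; by case.
- move=> i j iM jM; rewrite /gl /src /tgt /= (ltn_eqF iM) => ne e ne'; exfalso; apply: ne'; move: e.
  by case: eqP => _ /= ->.
Qed.

(** The subdivision contains [x] and [y], and the only coincidences are those of [a] with [y] and of
    [x] with [b]. The order of [x] and [y] decides between a simple closed walk and a barbell. *)
Lemma opposite_loop_disc (a b x y D rho : R) : 0 <= a -> a < x -> x < b -> a < y -> y < b -> b <= K%:R -> g a = g y -> g x = g b ->
  dir a = - dir y -> dir x = - dir b -> (forall t t', a < t -> t < t' -> t' < b -> g t <> g t') -> 0 < rho ->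
  long_disc_near C [set g t | t in [set t | 0 <= t <= K%:R]] rho D.
Proof using All.
have locals := I.
move=> a0 ax xb ay yb bK gay gxb day dxb inj rho0.
have ab : a < b by qlra.
have inab z : z \in [:: x; y] -> a <= z <= b.
  by rewrite !inE => /orP[] /eqP ->; apply/andP; split; qlra.
have [M [tau [M0 t0 tM mono [mem ined]]]] := edge_grid a0 ab bK inab.
have t00 : 0 <= tau 0%N by rewrite t0.
have tMK : tau M <= K%:R by rewrite tM.
have [X XM tX] := mem x (mem_head _ _).
have [Y YM tY] := mem y (mem_last x [:: y]).
have lt_tau i j : (i <= M)%N -> (j <= M)%N -> tau i < tau j -> (i < j)%N.
  move=> iM jM; rewrite ltnNge; case: (leqP j i) => // ji; have := tau_le mono ji iM; qlra.
have X0 : (0 < X)%N by apply: lt_tau; rewrite ?t0 ?tX.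
have Y0 : (0 < Y)%N by apply: lt_tau; rewrite ?t0 ?tY.
have XM' : (X < M)%N by apply: lt_tau; rewrite ?tM ?tX.
have YM' : (Y < M)%N by apply: lt_tau; rewrite ?tM ?tY.
pose gl := glue_ends Y X M.
have Mn0 : (0%N == M) = false by rewrite ltn_eqF.
have nM i : (i < M)%N -> (i == M) = false by move=> h; rewrite ltn_eqF.
have n0 i : (0 < i)%N -> (i == 0%N) = false by move=> h; rewrite gtn_eqF.
have glY e : gl (Y, e) = (Y, e) by rewrite /gl /glue_ends /= n0// nM.
have glX e : gl (X, e) = (X, e) by rewrite /gl /glue_ends /= n0// nM.
have gl0 e : gl (0%N, e) = (Y, ~~ e) by [].
have glM e : gl (M, e) = (X, ~~ e) by rewrite /gl /glue_ends /= n0// eqxx.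
have sN e (v : V) : signed (~~ e) (- v) = signed e v by case: e; rewrite /signed ?opprK.
have glP q e : (q <= M)%N -> g (tau (gl (q, e)).1) = g (tau q) /\
    signed (gl (q, e)).2 (dir (tau (gl (q, e)).1)) = signed e (dir (tau q)).
  move=> qM; have [->|q0] := eqVneq q 0%N; first by rewrite gl0 /= t0 tY gay day -(sN e) opprK.
  have [->|qn] := eqVneq q M; first by rewrite glM /= tM tX gxb dxb sN.
  by rewrite /gl /glue_ends /= (negPf q0) (negPf qn).
have gl1 q e e' : (gl (q, e)).1 = (gl (q, e')).1.
  by rewrite /gl /glue_ends /=; case: eqP => //; case: eqP.
have hit m m' th th' : (m < M)%N -> (m' < M)%N -> 0 <= th <= 1 -> 0 <= th' <= 1 -> param tau m th < param tau m' th' ->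
     g (param tau m th) = g (param tau m' th') ->
     exists q q', [/\ q \in [:: m; m.+1], q' \in [:: m'; m'.+1] & forall e e', (gl (q, e)).1 = (gl (q', e')).1].
  move=> mM m'M t t' lt E.
  have /andP[b1 b2] := param_bounds mono mM t; have /andP[b1' b2'] := param_bounds mono m'M t'.
  have at_ i k h : (k < M)%N -> 0 <= h <= 1 -> (i <= M)%N -> param tau k h = tau i -> i \in [:: k; k.+1].
    by move=> kM h01 iM e; apply: (vertex_of mono) => //; rewrite -e; exact: (param_itv mono kM h01).
  rewrite t0 in b1 b1'; rewrite tM in b2 b2'.
  have [la|la] := ltP a (param tau m th); have [lb|lb] := ltP (param tau m' th') b.
  - by case: (inj _ _ la lt lb).
  - have Eb : param tau m' th' = b by apply/eqP; rewrite eq_le b2'.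
    have Ex : param tau m th = x.
      have [h|h|//] := ltgtP (param tau m th) x.
        by case: (inj _ _ la h xb); rewrite E Eb gxb.
      by case: (inj _ _ ax h (lt_le_trans lt b2')); rewrite E Eb gxb.
    exists X, M; split; [by apply: at_ t _ _; rewrite ?tX|by apply: at_ t' _ _; rewrite ?tM|].
    by move=> e e'; rewrite glX glM.
  - have Ea : param tau m th = a by apply/eqP; rewrite eq_le b1 la.
    have Ey : param tau m' th' = y.
      have [h|h|//] := ltgtP (param tau m' th') y.
        by case: (inj _ _ (le_lt_trans b1 lt) h yb); rewrite -E Ea gay.
      by case: (inj _ _ ay h lb); rewrite -E Ea gay.
    exists 0%N, Y; split; [by apply: at_ t _ _; rewrite ?t0|by apply: at_ t' _ _; rewrite ?tY|].
    by move=> e e'; rewrite glY gl0.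
  (* When [a] meets [b], all four points coincide, and injectivity inside forces [x = y]. *)
  - have Ea : param tau m th = a by apply/eqP; rewrite eq_le b1 la.
    have Eb : param tau m' th' = b by apply/eqP; rewrite eq_le b2'.
    have gxy : g x = g y by rewrite -gay gxb -Ea -Eb.
    have Exy : x = y.
      have [h|h|//] := ltgtP x y; first by case: (inj _ _ ax h yb).
      by case: (inj _ _ ay h xb).
    have EXY : X = Y.
      have [h|h|//] := ltngtP X Y; first by have := tau_lt mono h YM; rewrite tX tY Exy ltxx.
      by have := tau_lt mono h XM; rewrite tX tY Exy ltxx.
    exists 0%N, M; split; [by apply: at_ t _ _; rewrite ?t0|by apply: at_ t' _ _; rewrite ?tM|].
    by move=> e e'; rewrite gl0 glM EXY.
pose P m := pl K p (tau m).
have edge := chain_edge M0 t00 tMK mono ined.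
(* Two germs leaving an opposite passage are not parallel, since they would overlap. *)
have transverse m m' u v : (m < m')%N -> (m' < M)%N -> tau m = u -> tau m'.+1 = v -> a <= u -> v <= b -> 
    g u = g v -> dir u = - dir v -> om (P m.+1 - P m) (P m'.+1 - P m') <> 0.
  move=> mm' m'M mu mv au vb guv duv om0.
  have mM : (m < M)%N by exact: ltn_trans mm' m'M.
  have [_ _ _ e1 _] := edge m mM; have [_ _ _ _ e2] := edge m' m'M.
  have e1' : 0 < edot (P m.+1 - P m) (- dir v) by rewrite -duv -mu.
  have e2' : edot (P m'.+1 - P m') (- dir v) < 0 by rewrite edotNr oppr_lt0 -mv.
  have [k k0 Ek] := opposite_parallel om0 e1' e2'.
  have k1 : 0 < 1 + k by qlra.
  have [th th0 [th1 th2]] : exists2 th : R, 0 < th & 2 * th <= 1 /\ 2 * (th * k) <= 1.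
    exists (2^-1 / (1 + k)); first by rewrite divr_gt0.
    split; rewrite ?mulrA mulfV ?pnatr_eq0// mul1r; first by rewrite invf_le1//; qlra.
    by rewrite mulrC ler_pdivrMr//; qlra.
  have tk0 : 0 < th * k by rewrite mulr_gt0.
  have E : P m + th *: (P m.+1 - P m) = P m' + (1 - th * k) *: (P m'.+1 - P m') + (P m - P m'.+1).
    rewrite Ek; apply/rowP => i; rewrite !mxE; ring.
  have tt : 0 <= th <= 1 by apply/andP; split; qlra.
  have tt' : 0 <= 1 - th * k <= 1 by apply/andP; split; qlra.
  have p1 := chain_point mono ined mM tt; have p2 := chain_point mono ined m'M tt'.
  have mt := mono m mM; have mt' := mono m' m'M.
  have mid : tau m.+1 <= tau m' by exact: (tau_le mono mm' (ltnW m'M)).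
  have q1 : tau m < param tau m th by rewrite /param ltrDl mulr_gt0// subr_gt0.
  have q2 : param tau m th < tau m.+1 by rewrite /param; nra.
  have q3 : tau m' < param tau m' (1 - th * k) by rewrite /param ltrDl mulr_gt0 ?subr_gt0//; qlra.
  have q4 : param tau m' (1 - th * k) < tau m'.+1 by rewrite /param; nra.
  have r1 : a < param tau m th by apply: le_lt_trans q1; rewrite mu.
  have r3 : param tau m' (1 - th * k) < b by apply: lt_le_trans q4 _; rewrite mv.
  apply: (inj _ _ r1 (lt_trans q2 (le_lt_trans mid q3)) r3).
  rewrite -p1 -p2; move: E; rewrite /P => ->; rewrite tprojD; apply/eqP; rewrite -subr_eq0 addrC addKr tprojB subr_eq0.
  by rewrite mu mv guv.
have [XY|YX] := ltnP X Y.
  apply: (@chain_long_disc M tau M0 t00 tMK mono ined gl (theta_walk Y X M) (X + (M - Y))%N D rho) => //.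
  - by rewrite addn_gt0 X0.
  - by move=> k kJ; exact: theta_lt.
  - by move=> k kJ; exact: theta_next.
  - by move=> i j; exact: theta_inj.
  - by move=> i j iJ jJ h1 h2 h3; exfalso; exact: (theta_branch X0 XY YM' iJ jJ h1 h2 h3).
(* Reversing a loop exchanges its two edges at the end of the bar, hence changes the sign of [om];
   the directions are chosen to make it positive. *)
pose s1 := 0 < om (P 1%N - P 0%N) (P Y.-1.+1 - P Y.-1).
pose s2 := 0 < om (P X.+1 - P X) (P M.-1.+1 - P M.-1).
have YX' : (Y <= X)%N := YX.
apply: (@chain_long_disc M tau M0 t00 tMK mono ined gl (barbell_walk s1 s2 Y X M) (M + X - Y)%N D rho) => //.
- by move: YX XM' Y0; clear; lia.
- by move=> k kJ; exact: barbell_lt.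
- by move=> k kJ; exact: barbell_next.
- by move=> i j; exact: barbell_inj.
move=> i j iJ jJ h1 h2 h3; have := @barbell_branch s1 s2 Y X M Y0 YX XM' i j iJ jJ h1 h2 h3.
move: (barbell_walk s1 s2 Y X M i) (barbell_walk s1 s2 Y X M j) h1 {h2 h3} => ei ej h1; case.
  have tr : (0 < Y.-1)%N -> om (P 1%N - P 0%N) (P Y.-1.+1 - P Y.-1) <> 0.
    move=> Y1; have Y1M : (Y.-1 < M)%N by exact: leq_ltn_trans (leq_pred _) YM'.
    by apply: (transverse 0%N Y.-1 a y) => //; rewrite ?prednK//; exact: ltW.
  case: ifP => [p1 [wi wj]|/negbT p1 [wi wj]].
    by rewrite wi wj.
  rewrite wi wj /signed /= omNl omNr opprK omC oppr_gt0 lt_neqAle leNgt p1 andbT; apply/eqP; apply: tr.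
  by move: h1; rewrite wi wj /=; case: (Y.-1).
have tr : (X < M.-1)%N -> om (P X.+1 - P X) (P M.-1.+1 - P M.-1) <> 0.
  have M1 : (M.-1 < M)%N by rewrite prednK.
  by move=> X1; apply: (transverse X M.-1 x b) => //; rewrite ?prednK//; exact: ltW.
case: ifP => [p1 [wi wj]|/negbT p1 [wi wj]].
  by rewrite wi wj.
rewrite wi wj /signed /= omNl omNr opprK omC oppr_gt0 lt_neqAle leNgt p1 andbT; apply/eqP; apply: tr.
move: h1; rewrite wi wj /= => h1; move: XM' h1; clear; lia.
Qed.

(* Either an arc of half the length is injective, or a first return in the same direction closes a loop around which one
   can spiral, or two returns in opposite directions form a barbell or a loop. *)
Lemma long_disc_plane (H : nat) (D rho : R) : K = (H + H)%N -> (2 < H)%N -> 6 * D < H%:R * d * s -> 0 < rho ->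
  long_disc_near C [set g t | t in [set t | 0 <= t <= K%:R]] (2 * rho) D.
Proof using All.
move=> KH H3 DH rho0; have sgp := sg0; have dq := d0; have dsg' := dsg.
have rho20 : 0 < 2 * rho by lra.
have dsg9 : 9 * d < sg by lra.
have HK : H%:R <= K%:R :> R by rewrite ler_nat KH leq_addr.
have KHH : K%:R = H%:R + H%:R :> R by rewrite KH natrD.
have H0 : 0 <= H%:R :> R by [].
(* An injective stretch of [H] edges is itself a polygon whose nonadjacent edges are disjoint. *)
have arc (k0 : nat) : (k0 + H <= K)%N -> (forall t t', k0%:R <= t -> t < t' -> t' <= (k0 + H)%:R -> g t <> g t') ->
    long_disc_near C [set g t | t in [set t | 0 <= t <= K%:R]] (2 * rho) D.
  move=> kH inj; pose q k := p (k0 + k)%N.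
  have [hp hc] := dp.
  have dq' : deep_polygon C lf sg d H q.
    split=> [k kK|k kK]; rewrite /q !addnS.
      by apply: hp; apply: leq_trans kH; rewrite -addnS leq_add2l.
    by apply: hc; apply: leq_trans kH; rewrite -!addnS leq_add2l.
  have onq k (th : R) : (k < H)%N -> 0 <= th <= 1 -> q k + th *: (q k.+1 - q k) = pl K p ((k0 + k)%:R + th).
    move=> kK /andP[h0 h1]; rewrite plE// /q ?addnS//.
    by apply: leq_trans kH; rewrite -addnS leq_add2l.
  have na : nonadjacent_disjoint H q.
    move=> k l th th' kl lH t t'; have kH' : (k < H)%N by exact: ltn_trans (ltnW kl) lH.
    rewrite !onq//; case/andP: t => h0 h1; case/andP: t' => h0' h1'.
    have k2 : (k0 + k).+2%:R <= (k0 + l)%:R :> R by rewrite ler_nat -!addnS leq_add2l.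
    have k2' : (k0 + k).+2%:R = (k0 + k)%:R + 2 :> R by rewrite -addn2 natrD.
    have l2 : (k0 + l).+1%:R <= (k0 + H)%:R :> R by rewrite ler_nat -addnS leq_add2l.
    have l2' : (k0 + l).+1%:R = (k0 + l)%:R + 1 :> R by rewrite natr1.
    have kk : k0%:R <= (k0 + k)%:R :> R by rewrite ler_nat leq_addr.
    by apply: inj; lra.
  have [h [eh th hn hD]] := long_disc_injective s0 CZ hl sg0 d0 dsg9 ds d1 H3 dq' na rho0 DH.
  exists h; split=> // z /hn[_ [t /andP[t0 tH] <-] hz].
  have [k [tt [kH' tt0 tt1 Et]]] := edge_split (ltn_trans (isT : (0 < 2)%N) H3) t0 tH.
  exists (tproj (pl H q t)) => //; rewrite Et plE// onq ?tt0//.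
  exists ((k0 + k)%:R + tt) => //=.
  have l2 : (k0 + k).+1%:R <= K%:R :> R by rewrite ler_nat; apply: leq_trans kH; rewrite -addnS leq_add2l.
  have l2' : (k0 + k).+1%:R = (k0 + k)%:R + 1 :> R by rewrite natr1.
  have l3 : 0 <= (k0 + k)%:R :> R by [].
  by apply/andP; split; lra.
have HKn : (H + H <= K)%N by rewrite KH.
(* The first return is sought in the second half, which leaves the first half for the backward
   search. *)
have [inj|[x [b [Hx xb bK gxb inj]]]] := first_return s0 CZ hl sg0 d0 dsg ds d1 K3 dp H0 HK (lexx K%:R).
  by apply: (arc H) => //; rewrite -KH.
have dirs u v : g u = g v -> dir u = dir v \/ dir u = - dir v.
  by move=> e; have [->|->] := dir_functionalE lf K p u; have [->|->] := dir_functionalE lf K p v;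
     rewrite e ?opprK; [left|right|right|left].
have xb' : x < b by lra.
have x0 : 0 <= x by lra.
have [dxb|dxb] := dirs _ _ gxb.
  apply: (@closed_loop_disc x b) => // t t' h1; apply: inj; lra.
have [inj'|[a [y [a0 aH ay yb [gay inj']]]]] := last_backward_return s0 CZ hl sg0 d0 dsg ds d1 K3 dp (lexx 0) H0 Hx xb bK gxb dxb inj.
  apply: (arc 0%N); first by rewrite add0n KH leq_addr.
  by move=> t t' h1 h2 h3; rewrite add0n in h3; apply: inj' => //; lra.
have [day|day] := dirs _ _ gay.
  apply: (@closed_loop_disc a y) => //; first lra.
  move=> t t' h1 h2 h3; have [h4|h4] := ltP a t; first by apply: inj' => //; lra.
  have {h4}-> : t = a by lra.
  by rewrite gay => e; apply: (inj' t' y); rewrite ?e//; lra.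
by apply: (@opposite_loop_disc a b x y) => //; lra.
Qed.

End PlanePolygons.

Lemma half_split K : exists H, (H + H <= K)%N /\ (K <= H + H + 1)%N.
Proof. by exists K./2; lia. Qed.

Lemma deep_polygon_long_disc {R : realType} {n : nat} (C : torus R n -> set 'rV[R]_n) (s : R) (lf : torus R n -> 'rV[R]_n)
    (sg d : R) (H : nat) (p : nat -> 'rV[R]_n) (D rho : R) :
  (1 < n)%N -> 0 < s -> (forall x a u, C x u -> C x (a *: u)) -> (forall x, half_functional C s x (lf x)) ->
  0 < sg -> 0 < d -> 18 * d < sg -> 9 * d < s -> 32 * d <= 1 -> (2 < H)%N -> deep_polygon C lf sg d (H + H) p ->
  0 < rho -> 6 * D < H%:R * d * s ->
  long_disc_near C [set tproj (pl (H + H) p t) | t in [set t | 0 <= t <= (H + H)%:R]] (2 * rho) D.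
Proof.
rewrite leq_eqVlt => /orP[/eqP n2|n3] s0 CZ hl sg0 d0 dsg ds d1 H3 dp rho0 DH.
  subst n; apply: (long_disc_plane s0 CZ hl sg0 d0 dsg ds d1 _ dp (H := H)) => //.
  by apply: leq_trans H3 (leq_addr _ _).
apply: (long_disc_generic s0 CZ hl n3 sg0 d0 _ ds d1 _ dp rho0); first lra.
  by apply: leq_trans H3 (leq_addr _ _).
rewrite natrD; have : 0 < H%:R * d * s by rewrite !mulr_gt0// ltr0n (ltn_trans _ H3).
lra.
Qed.

(** * Long images of segments pass near good points *)

Section Hits.
Context {R : realType} {n : nat} (F : torus R n -> torus R n)
  (A E : torus R n -> 'M[R]_n) (C : torus R n -> set 'rV[R]_n) (b r0 : R).
Local Notation T := (torus R n).
Local Notation V := ('rV[R]_n).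
Hypotheses (cF : continuous F) (cA : continuous A)
  (CZ : forall x a u, C x u -> C x (a *: u))
  (CA : forall x u, C x u -> C (F x) (u *m A x))
  (b0 : 0 < b) (A_lower : forall x (v : V), b * enorm v <= enorm (v *m A x))
  (uA : forall x, A x \in unitmx)
  (nlF : forall eta : R, 0 < eta -> exists2 r, 0 < r & near_lin A eta r F)
  (r00 : 0 < r0) (tmF : tame E C 4^-1 r0 F).
Variables (s1 : R) (lf : T -> V).
Hypotheses (s10 : 0 < s1) (hl : forall x, half_functional C s1 x (lf x)) (n1 : (1 < n)%N).

(** A polygon inscribed in the image of the segment, with an even number of edges, is bent into an
    embedded disc of internal diameter above [D]. The disc contains a point of [G], which is then
    near the polygon and hence near the curve. *)
Lemma long_discs_hit (D : R) (G : set T) :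
  (forall h : 'rV[R]_1 -> V, embedded_disc h -> tangent_disc h C -> (D%:E < internal_diameter h)%E ->
     exists2 y, disc h y & G y) ->
  exists L : R, forall s x u w N m r rho, 0 < s -> s <= 2^-1 -> deep_direction C s x u -> 0 < w <= s / 2 ->
     0 < r -> steps (fun t : R => iter N F (x + tproj (t *: u))) r m 0 w -> L <= m%:R * r -> 0 < rho ->
     exists t y, [/\ 0 <= t <= w, G y & tdist (iter N F (x + tproj (t *: u))) y < rho].
Proof using All.
have locals := I.
move=> hG; have sp := s10.
have DD : 0 <= `|D| / s1 by rewrite divr_ge0 ?normr_ge0 ?ltW.
(* The inscribed polygon loses the factor 4; halving it and the condition [6 * D < H%:R * d * s1]
   account for 12; the summand 2 covers an odd edge and forces at least 32 edges. *)
exists (4 * (2 + 12 * (`|D| / s1))) => s x u w N m r rho s0 s2 du /andP[w0 ws] rp st Lm rho0.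
have [sg sg0 dt] := deep_segment_iter cF cA CZ CA b0 A_lower uA nlF r00 tmF N s0 s2 du ws.
set P := (fun t : R => iter N F (x + tproj (t *: u))) in st dt *.
have cP : continuous P.
  have cN := @iter_continuous R n F N cF.
  by move=> t; apply: (@continuous_comp _ _ _ (fun t : R => x + tproj (t *: u)) (iter N F)); [exact: line_continuous|exact: cN].
have m0 : (0 < m)%N.
  by rewrite lt0n; apply/eqP => m0; move: Lm; rewrite m0 mul0r; qlra.
have [z z0 [z1 z2 z3 z4 [z5 z6]]] := small_min rho0 sg0 s10 (ltr01 : 0 < 1 :> R) (ltr01 : 0 < 1 :> R) (ltr01 : 0 < 1 :> R).
have [K [d [p [K3 d0 dz LK [hp hc onP]]]]] := inscribed_polygon s10 CZ hl cP sg0 dt rp st m0 Lm z0.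
have [H KH] := half_split K.
have Kd : 2 + 12 * (`|D| / s1) <= K%:R * d by qlra.
have K64 : 32 <= K%:R :> R.
  rewrite leNgt; apply/negP => h; have : K%:R * d <= 32 * d by rewrite ler_wpM2r// ltW.
  qlra.
have [KH1 KH2] := KH.
have H3 : (2 < H)%N.
  have : (32 <= K)%N by rewrite -(ler_nat R).
  by move: KH2; clear; lia.
have HdE : (K%:R - 1) * d <= 2 * (H%:R * d).
  have : K%:R <= (H + H + 1)%:R :> R by rewrite ler_nat.
  rewrite !natrD.
  move=> h; have h' : K%:R - 1 <= 2 * H%:R :> R by qlra.
  by rewrite mulrA; exact: (ler_wpM2r (ltW d0) h').
have DH : 6 * D < H%:R * d * s1.
  rewrite -ltr_pdivrMr// -mulrA; have : D / s1 <= `|D| / s1 by rewrite ler_pM2r ?invr_gt0// ler_norm.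
  qlra.
have dpH : deep_polygon C lf sg d (H + H) p.
  by split=> k kH; [apply: hp; exact: leq_trans KH1|apply: hc; exact: leq_trans KH1].
have i1 : 18 * d < sg by qlra.
have i2 : 9 * d < s1 by qlra.
have i3 : 32 * d <= 1 by qlra.
have [h [eh th hn hD]] := deep_polygon_long_disc n1 s10 CZ hl sg0 d0 i1 i2 i3 H3 dpH z0 DH.
have [_ [q uq <-] Gy] := hG h eh th hD.
have [_ [t /andP[t0 tH] <-] ht] := hn q uq.
have HH0 : (0 < H + H)%N by rewrite addn_gt0 (ltn_trans _ H3).
have [k [tt [kH tt0 tt1 Et]]] := edge_split HH0 t0 tH.
have kK : (k < K)%N by exact: leq_trans KH1.
have [v v01 vP] := onP k (ltnW kK).
exists v, (tproj (h q)); split=> //.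
have near : tdist (tproj (p k)) (tproj (pl (H + H) p t)) <= d.
  rewrite Et plE// tdistC; apply: le_trans (tdist_proj _ _) _; rewrite addrAC subrr add0r enormZ ger0_norm//.
  by have [-> _] := hp k kK; rewrite -[leRHS]mul1r ler_wpM2r// ltW.
rewrite -/(P v) -vP; have := tdistD (tproj (pl (H + H) p t)) (tproj (p k)) (tproj (h q)).
rewrite (tdistC (tproj (pl (H + H) p t)) (tproj (h q))); qlra.
Qed.

End Hits.

(** The first coordinate subspace lies in the interior of the standard cone, so its image in one
    frame also lies in the cones of nearby frames. A flat disc in that subspace is then tangent to
    the cones at all of its points. *)
Lemma cone_contains_subspace_near {R : realType} {n d : nat} (C : torus R n -> set 'rV[R]_n) x0 :
  continuous_cone_field d C -> (d <= n)%N ->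
  exists2 B : 'M[R]_(d, n), row_free B & exists2 r : R, 0 < r & forall y w, tdist x0 y < r -> C y (w *m B).
Proof.
move=> hC dn; have [A /torus_nbhs_nearP[r0 r00 hA]] := hC x0.
have [cA uA _] := hA x0 ltac:(by rewrite tdistxx).
exists (pid_mx d *m A x0); first by rewrite /row_free mxrankMfree ?row_free_unit// rank_pid_mx.
pose N := mxbnd (invmx (A x0)) + 1.
have N0 : 0 < N by rewrite ltr_wpDl ?mxbnd_ge0.
have b0 : 0 < N^-1 / 4 by rewrite divr_gt0 ?invr_gt0.
have nn1 : (0 : R) < n%:R * n%:R + 1 by rewrite ltr_wpDl ?mulr_ge0.
have zn0 : 0 < N^-1 / 4 / (n%:R * n%:R + 1) by rewrite divr_gt0.
have [r1 r10 h1] := (torus_continuous_normP _ _).1 cA _ zn0.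
exists (Num.min r0 r1) => [|y w]; first by rewrite lt_min r00.
rewrite lt_min => /andP[yr0 yr1]; have [_ uy ->] := hA y yr0.
have Az : mxbnd (A x0 - A y) <= N^-1 / 4.
  move: yr1 => /h1; rewrite ltr_pdivlMr// mulrC mulrDl mul1r => h2.
  by rewrite ltW//; apply: le_lt_trans h2; rewrite lerDl.
pose z := w *m pid_mx d : 'rV[R]_n; pose t := z *m A x0 *m invmx (A y).
have tE : t *m A y = z *m A x0 by rewrite mulmxKV.
exists t; last by rewrite tE mulmxA.
have lowx (v : 'rV[R]_n) : N^-1 * enorm v <= enorm (v *m A x0).
  rewrite mulrC ler_pdivrMr// mulrC; apply: le_trans (unitmx_lower v uA) _.
  by rewrite ler_wpM2r ?enorm_ge0// lerDl.
have dz : enorm (t - z) <= 2^-1 * enorm z.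
  have k1 := lowx (t - z).
  have k2 : enorm ((t - z) *m (A x0 - A y)) <= N^-1 / 4 * enorm (t - z).
    by apply: le_trans (enorm_mulmx _ _) _; rewrite ler_wpM2r ?enorm_ge0.
  have k3 : enorm (z *m (A x0 - A y)) <= N^-1 / 4 * enorm z.
    by apply: le_trans (enorm_mulmx _ _) _; rewrite ler_wpM2r ?enorm_ge0.
  have E : (t - z) *m A x0 = (t - z) *m (A x0 - A y) + z *m (A x0 - A y).
    by rewrite !mulmxBl !mulmxBr tE; apply/rowP => i; rewrite !mxE; ring.
  have k4 := enormD ((t - z) *m (A x0 - A y)) (z *m (A x0 - A y)); rewrite -E in k4.
  have Np : 0 < N^-1 by rewrite invr_gt0.
  have zp : 0 <= N^-1 * enorm z by rewrite mulr_ge0 ?enorm_ge0// ltW.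
  rewrite -(ler_pM2l Np); lra.
have hz : hi_part d z = 0.
  apply/rowP => i; rewrite !mxE; case: ltnP => // di.
  rewrite big1// => j _; rewrite mxE.
  by case: eqP => [->|_]; rewrite ?(ltnNge i d) ?di /= mulr0.
have lz : lo_part d z = z.
  apply/rowP => i; rewrite !mxE; case: ltnP => // di.
  rewrite big1// => j _; rewrite mxE.
  by case: eqP => [->|_]; rewrite ?(ltnNge i d) ?di /= mulr0.
apply/std_coneE; rewrite -(subrKC z t) hi_partD lo_partD hz lz add0r.
have := enorm_hi d (t - z); have := enorm_lo d (t - z); have := enorm_lower z (lo_part d (t - z)).
lra.
Qed.

(** * Passing to a power of the map *)

Section Powers.
Context {R : realType} {n : nat} (f : torus R n -> torus R n)
  (A E : torus R n -> 'M[R]_n) (C : torus R n -> set 'rV[R]_n) (lam : R).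
Local Notation T := (torus R n).
Local Notation V := ('rV[R]_n).

Lemma cocyc_iter j k x : cocyc (iter j f) (cocyc f A j) k x = cocyc f A (k * j) x.
Proof. by elim: k => [//|k IH] /=; rewrite IH mulSn addnC cocycD iter_iter. Qed.

Lemma cocyc_unit j x : (forall x, A x \in unitmx) -> cocyc f A j x \in unitmx.
Proof. by move=> uA; elim: j => [|k IH] /=; [exact: unitmx1|rewrite unitmx_mul IH uA]. Qed.

Lemma iter_iter_fun (g : T -> T) k j : iter k (iter j g) = iter (k * j) g.
Proof. by apply/funext => x; exact: iter_iter. Qed.

Lemma cocyc_expand l0 k0 y j k (e : V) : 1 < l0 ->
  (forall x (e : V), (e <= E x)%MS -> (e *m A x <= E (f x))%MS) ->
  good_point f A E l0 k0 y -> (k0 <= k)%N -> (e <= E (iter k f y))%MS ->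
  l0 ^+ j * enorm e <= enorm (e *m cocyc f A j (iter k f y)).
Proof.
move=> l01 EA gy kk eE; elim: j => [|j IH]; first by rewrite expr0 mul1r mulmx1.
have l00 : 0 <= l0 by lra.
rewrite exprS -mulrA /= mulmxA; apply: le_trans (ler_wpM2l l00 IH) _.
rewrite -iterD; apply: gy; first exact: leq_trans (leq_addl _ _).
by rewrite iterD; exact: (cocyc_center EA).
Qed.

Lemma good_point_iter l0 k0 y j : (0 < j)%N -> 1 < l0 ->
  (forall x (e : V), (e <= E x)%MS -> (e *m A x <= E (f x))%MS) ->
  good_point f A E l0 k0 y -> good_point (iter j f) (cocyc f A j) E l0 k0 y.
Proof.
move=> j0 l01 EA gy k kk e; rewrite iter_iter => eE.
have kj : (k0 <= k * j)%N by apply: leq_trans kk (leq_pmulr _ j0).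
apply: le_trans (cocyc_expand j l01 EA gy kj eE); rewrite ler_wpM2r ?enorm_ge0//.
by rewrite ler_eXnr//; exact: ltW.
Qed.

(** By induction: the one-step inequality at the [j]-th image is multiplied with the previous one,
    then divided by the length of the [j]-th image of [u], which vanishes only if [u] does. *)
Lemma cocyc_dominated (lam0 : 0 < lam) j x (u e : V) :
  (forall x u, C x u -> C (f x) (u *m A x)) ->
  (forall x u, C x u -> enorm u <= lam * enorm (u *m A x)) ->
  (forall x (e : V), (e <= E x)%MS -> (e *m A x <= E (f x))%MS) ->
  (forall x u (e : V), C x u -> (e <= E x)%MS ->
     enorm (e *m A x) * enorm u <= lam * (enorm e * enorm (u *m A x))) ->
  C x u -> (e <= E x)%MS ->
  enorm (e *m cocyc f A j x) * enorm u <= lam ^+ j * (enorm e * enorm (u *m cocyc f A j x)).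
Proof.
move=> CA Ce EA dom Cu eE; elim: j => [|j IH]; first by rewrite !mulmx1 expr0 mul1r.
have Cj k : C (iter k f x) (u *m cocyc f A k x) by elim: k => [|k IHk] /=; rewrite ?mulmx1// mulmxA; exact: CA.
have le k : enorm u <= lam ^+ k * enorm (u *m cocyc f A k x).
  elim: k => [|k IHk]; first by rewrite expr0 mul1r mulmx1.
  apply: le_trans IHk _; rewrite exprSr -mulrA ler_wpM2l ?exprn_ge0 ?(ltW lam0)//= mulmxA; exact: Ce.
have Ej := cocyc_center EA j eE.
have h := dom _ _ _ (Cj j) Ej; rewrite /= !mulmxA.
have [uj0|ujn] := eqVneq (enorm (u *m cocyc f A j x)) 0.
  have u0 : enorm u = 0 by apply/eqP; rewrite eq_le enorm_ge0 andbT; have := le j; rewrite uj0 mulr0.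
  by rewrite u0 mulr0 !mulr_ge0 ?exprn_ge0 ?enorm_ge0 ?(ltW lam0).
have uj : 0 < enorm (u *m cocyc f A j x) by rewrite lt_def ujn enorm_ge0.
rewrite -(ler_pM2r uj); set a := enorm (_ *m A _) in h *; set b := enorm (_ *m A _) in h *.
move: h IH uj; set c := enorm (u *m _); set e1 := enorm (e *m _) => h IH uj.
have u0 : 0 <= enorm u := enorm_ge0 u.
have k1 := ler_wpM2r u0 h.
have b0 : 0 <= lam * b by rewrite mulr_ge0 ?enorm_ge0 ?ltW.
have k2 := ler_wpM2l b0 IH.
apply: (@le_trans _ _ (lam * (e1 * b) * enorm u)); first by rewrite mulrAC.
rewrite (_ : lam * (e1 * b) * enorm u = lam * b * (e1 * enorm u)); last by ring.
apply: le_trans k2 _; rewrite exprS le_eqVlt; apply/orP; left; apply/eqP; ring.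
Qed.

End Powers.

(** * Robust density of preorbits *)

Section Robustness.
Context {R : realType} {n : nat} (f : torus R n -> torus R n) (c : nat)
  (Ec : torus R n -> 'M[R]_n) (Cu : torus R n -> set 'rV[R]_n).
Local Notation T := (torus R n).
Local Notation V := ('rV[R]_n).
Hypotheses (f_C1 : C1_map f) (f_diffeo : local_diffeo f) (f_ph : partially_hyperbolic f c Ec Cu)
  (f_dense : forall x, dense (preorbit f x)).
Local Notation Df := (tderiv f).

Lemma ph_dimensions : (0 < c < n)%N. Proof. by case: f_ph. Qed.
Lemma ph_subbundle : continuous_subbundle c Ec. Proof. by case: f_ph => _ []. Qed.
Lemma ph_cone_field : continuous_cone_field (n - c) Cu. Proof. by case: f_ph => _ _ [[]]. Qed.

Lemma ph_cone x u : Cu x u -> Cu (f x) (u *m Df x).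
Proof. by have [_ _ [[_ h] _] _] := f_ph; move=> Cux; apply: h; exists u. Qed.

Lemma ph_center x (e : V) : (e <= Ec x)%MS -> (e *m Df x <= Ec (f x))%MS.
Proof.
have [_ [_ inv] _ _] := f_ph; move=> eE; have /eqmxP <- := inv x; exact: submxMr.
Qed.

Lemma ph_decomposition x (v : V) : exists u e : V, [/\ Cu x u, (e <= Ec x)%MS & v = u + e].
Proof.
have /andP[c0 cn] := ph_dimensions.
have [W rW CW] := cone_contains_subspace x ph_cone_field (leq_subr c n).
have cd : (c + (n - c) = n)%N by rewrite subnKC// ltnW.
have tr u : Cu x u -> (u <= Ec x)%MS -> u = 0 := @cone_center_trivial _ _ _ _ _ _ f_C1 f_diffeo f_ph f_dense x u.
have [w [e [wW eE ->]]] := cone_complement ph_subbundle cd tr rW CW v.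
by exists w, e; split=> //; exact: CW.
Qed.

Lemma C1_close_refl (e : R) : 0 < e -> C1_close e f f.
Proof. by move=> e0 x; rewrite tdistxx subrr normr0. Qed.

Lemma iter_near_lin j eta : 0 < eta -> exists2 r : R, 0 < r & capprox (iter j f) (cocyc f Df j) eta r (iter j f).
Proof.
move=> eta0; have [r r0 [e e0 h]] := iter_capprox j (C1_continuous f_C1) (C1_tderiv_continuous f_C1) (C1_capprox f_C1) eta0.
by exists r => //; apply: h => //; exact: C1_close_refl.
Qed.

Section OneDimensional.
Hypothesis d1 : (n - c = 1)%N.

(** The estimates on curves require the rate [8^-1]; they are applied to a power [F] of [f] with
    [lam ^+ j <= 8^-1], perturbed into the same power of [g]. The blocks of [F] of length [N] are
    blocks of [f] of length [N * j]. *)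
Lemma robust_density_line (D l0 : R) (k0 : nat) : 1 < l0 ->
  (forall h : 'rV[R]_1 -> V, embedded_disc h -> tangent_disc h Cu -> (D%:E < internal_diameter h)%E ->
     exists2 y, disc h y & good_point f Df Ec l0 k0 y) ->
  evC1 f (fun g => forall x, dense (preorbit g x)).
Proof.
move=> l01 hG; have /andP[c0 cn] := ph_dimensions.
have n1 : (1 < n)%N by exact: leq_ltn_trans c0 cn.
have cf := C1_continuous f_C1; have cD := C1_tderiv_continuous f_C1.
have uD x := tderiv_unit f_C1 f_diffeo x.
have [b /andP[b0 b1] hb] := unit_cocycle_lower cD uD.
have [lam /andP[lam0 lam1] rates] := ph_rates f_C1 f_diffeo f_ph.
have hC : continuous_cone_field 1 Cu by rewrite -d1; exact: ph_cone_field.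
have CZ := std_cone_field_scale hC.
have tr0 x u : Cu x u -> (u <= Ec x)%MS -> u = 0 := @cone_center_trivial _ _ _ _ _ _ f_C1 f_diffeo f_ph f_dense x u.
have [kap kap0 tr] := cone_transversal ph_subbundle hC tr0.
have [s1 s10 /choice[lf hl]] := cone_functional (ltn_trans (isT : (0 < 1)%N) n1) hC.
have Ce x u : Cu x u -> enorm u <= lam * enorm (u *m Df x) by move=> /ph_cone/rates[].
have dom x u (e : V) : Cu x u -> (e <= Ec x)%MS -> enorm (e *m Df x) * enorm u <= lam * (enorm e * enorm (u *m Df x)).
  by move=> /ph_cone/rates[_]; apply.
have [j0 hj] := @expr_unbounded R lam^-1 8 ltac:(by rewrite invf_gt1).
pose j := j0.+1; have lj : lam ^+ j <= 8^-1.
  have := hj j (leqnSn _); rewrite exprVn -[8 in X in X -> _]invrK lef_pV2 ?posrE ?exprn_gt0 ?invr_gt0//.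
pose F := iter j f; pose A := cocyc f Df j.
have cF : continuous F by exact: iter_continuous.
have cA : continuous A by exact: cocyc_continuous.
have b01 : 0 < b <= 1 by rewrite b0.
have A_lower x (v : V) : b ^+ j * enorm v <= enorm (v *m A x) by apply: cocyc_lower.
have bj0 : 0 < b ^+ j by rewrite exprn_gt0.
have bj1 : b ^+ j <= 1 by rewrite exprn_ile1// ltW.
have uA x : A x \in unitmx by exact: cocyc_unit.
have lam01 : 0 < lam < 1 by rewrite lam0.
have CA x u : Cu x u -> Cu (F x) (u *m A x) by move=> h; have [] := cocyc_cone lam01 ph_cone Ce j h.
have C_exp x u : Cu x u -> enorm u <= lam ^+ j * enorm (u *m A x).
  by move=> h; have [] := cocyc_cone lam01 ph_cone Ce j h.
have EA x (e : V) : (e <= Ec x)%MS -> (e *m A x <= Ec (F x))%MS by exact: (cocyc_center ph_center).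
have CE_dom x u (e : V) : Cu x u -> (e <= Ec x)%MS ->
    enorm (e *m A x) * enorm u <= lam ^+ j * (enorm e * enorm (u *m A x)).
  by apply: cocyc_dominated => //; [exact: ph_cone|exact: ph_center].
have lj0 : 0 < lam ^+ j by rewrite exprn_gt0.
have dec1 x (u v : V) : Cu x u -> u != 0 -> exists (s : R) (e : V), (e <= Ec x)%MS /\ v = s *: u + e.
  move=> Cux u0; have rW : \rank <<u>>%MS = 1%N by rewrite genmxE rank_rV u0.
  have CW (w : V) : (w <= <<u>>)%MS -> Cu x w by rewrite genmxE => /sub_rVP[a ->]; exact: CZ.
  have cd : (c + 1 = n)%N by rewrite -d1 subnKC// ltnW.
  have [w [e [+ eE ->]]] := cone_complement ph_subbundle cd (@tr0 x) rW CW v.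
  by rewrite genmxE => /sub_rVP[a ->]; exists a, e.
have C_nontrivial x : exists2 u, Cu x u & u != 0.
  have [W rW CW] := cone_contains_subspace x hC (ltnW n1).
  have : W != 0 by rewrite -mxrank_eq0 rW.
  by case/rowV0Pn => v vW v0; exists v => //; exact: CW.
have contC := cone_field_continuous hC; have contE := subbundle_continuous ph_subbundle; have deep := cone_field_deep hC.
have nlF eta : 0 < eta -> exists2 r : R, 0 < r & near_lin A eta r F.
  by move=> eta0; have [r r0 [_ h]] := iter_near_lin j eta0; exists r.
have p4 : (0 : R) < 4^-1 by rewrite invr_gt0.
have [eta eta0 htame] := near_lin_tame lj0 lj CZ CA C_exp EA CE_dom kap0 tr dec1 contC contE bj0 A_lower p4 (lexx _).
have [r0 r00 capF] := iter_near_lin j eta0.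
have tmF := htame r0 F capF.
pose ev (P : (T -> T) -> Prop) := evC1 f (fun g => P (iter j g)).
have ev_and P Q : ev P -> ev Q -> ev (fun g => P g /\ Q g) by exact: evC1_and.
have ev_imp (P Q : (T -> T) -> Prop) : (forall g, P g -> Q g) -> ev P -> ev Q.
  by move=> PQ; apply: evC1_imp => g; exact: PQ.
have ev_iter k eta' : 0 < eta' -> exists2 r : R, 0 < r &
    ev (fun g => capprox (iter k F) (cocyc F A k) eta' r (iter k g)).
  move=> e0; have [r rr h] := iter_capprox (k * j) cf cD (C1_capprox f_C1) e0; exists r => //.
  apply: evC1_imp h => g; rewrite iter_iter_fun /F iter_iter_fun.
  by have -> : cocyc (iter j f) A k = cocyc f Df (k * j) by apply/funext => x; exact: cocyc_iter.
have goodF (h : 'rV[R]_1 -> V) : embedded_disc h -> tangent_disc h Cu -> (D%:E < internal_diameter h)%E ->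
    exists2 y, disc h y & good_point F A Ec l0 k0 y.
  by move=> h1 h2 h3; have [y hy gy] := hG h h1 h2 h3; exists y => //; apply: good_point_iter => //; exact: ph_center.
have hit := long_discs_hit cF cA CZ CA bj0 A_lower uA nlF r00 tmF s10 hl n1 goodF.
have [N evN] := curve_blocks cF cA lj0 lj CZ CA C_exp EA CE_dom kap0 tr dec1 C_nontrivial contC contE deep bj0 bj1
  A_lower nlF ev_and ev_imp ev_iter l01 hit.
apply: (growth_dense cf cD uD (C1_capprox f_C1) (N := N * j) f_dense _ evN) => g /= hg x0 s sp.
have [N0 hN0] := hg x0 s sp; exists (N0 * j)%N => J; have [u [xu hu]] := hN0 J; exists u; split=> // i iJ v.
by have := hu i iJ v; rewrite /F /A cocyc_iter !iter_iter_fun mulnA.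
Qed.

End OneDimensional.

(** Spiral strips inside any ball, flat in a subspace common to the nearby cones, provide good
    points arbitrarily near every [z]. Thus one [N] is expanding at all points, and [growth_dense]
    applies with any starting point. *)
Lemma robust_density_plane (D l0 : R) (k0 : nat) : (1 < n - c)%N -> 1 < l0 ->
  (forall h : 'rV[R]_(n - c) -> V, embedded_disc h -> tangent_disc h Cu -> (D%:E < internal_diameter h)%E ->
     exists2 y, disc h y & good_point f Df Ec l0 k0 y) ->
  evC1 f (fun g => forall x, dense (preorbit g x)).
Proof.
move=> d2 l01 hG; have /andP[c0 cn] := ph_dimensions.
have cf := C1_continuous f_C1; have cD := C1_tderiv_continuous f_C1.
have uD x := tderiv_unit f_C1 f_diffeo x.
have [b b01 hb] := unit_cocycle_lower cD uD.
have [lam lam01 rates] := ph_rates f_C1 f_diffeo f_ph.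
have hC := ph_cone_field.
have tr0 x u : Cu x u -> (u <= Ec x)%MS -> u = 0 := @cone_center_trivial _ _ _ _ _ _ f_C1 f_diffeo f_ph f_dense x u.
have [kap kap0 tr] := cone_transversal ph_subbundle hC tr0.
have Ce x u : Cu x u -> enorm u <= lam * enorm (u *m Df x) by move=> /ph_cone/rates[].
have [r2 r20 hr2] := block_expansion k0 cD lam01 ph_cone Ce ph_center kap0 tr ph_decomposition
  (subbundle_continuous ph_subbundle) b01 hb l01.
(* With [M = 0], closeness to the good orbit is available during the whole block. *)
have [N [_ _ hN]] := hr2 0%N 0%N.
have [rho rho0 hrho] := iter_uniform cf N r20.
have expd z : expanding_at f Df N z.
  have [B Bf [r rp CB]] := cone_contains_subspace_near z hC (leq_subr c n).
  have rr : 0 < Num.min r rho / 2 by rewrite divr_gt0// lt_min rp.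
  have [h [eh hz hB hD]] := flat_disc_of_large_diameter (tlog z) D d2 Bf rr.
  have near p : unit_disc p -> tdist z (tproj (h p)) < Num.min r rho.
    move=> /hz hp; rewrite tdistC -{1}(tlogK z); apply: le_lt_trans (tdist_proj _ _) _.
    by apply: le_lt_trans hp _; rewrite ltr_pdivrMr// ltr_pMr ?ltr1n// lt_min rp.
  have th : tangent_disc h Cu.
    move=> p up w; have [w' ->] := hB p w; apply: CB.
    by have := near p up; rewrite lt_min => /andP[].
  have [_ [p up <-] gy] := hG h eh th hD.
  apply: (hN z (tproj (h p)) gy) => k kN; apply: hrho; first by rewrite subn0 in kN.
  by have := near p up; rewrite lt_min => /andP[].
apply: (growth_dense cf cD uD (C1_capprox f_C1) (N := N) (H := fun _ => True) f_dense).
  move=> g _ x0 s sp; exists 0%N => J; exists x0; split; first by rewrite tdistxx.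
  by move=> i _; exact: expd.
by exists 1.
Qed.

End Robustness.

Theorem theorem1 (R : realType) (n : nat) (f : torus R n -> torus R n)
    (c : nat) (Ec : torus R n -> 'M[R]_n) (Cu : torus R n -> set 'rV[R]_n)
    (f_C1 : C1_map f) (f_diffeo : local_diffeo f)
    (f_ph : partially_hyperbolic f c Ec Cu)
    (f_dense : forall x, dense (preorbit f x))
    (f_exp : exists (delta0 lambda0 : R) (k0 : nat), 0 < delta0 /\ 1 < lambda0 /\
       forall (x : torus R n) (h : 'rV[R]_(n - c) -> 'rV[R]_n),
         embedded_disc h -> disc h x -> tangent_disc h Cu ->
         (delta0%:E < internal_diameter h)%E ->
         exists y, disc h y /\
           forall i k : nat, (0 < i)%N -> (k0 < k)%N ->
             lambda0 ^+ i <
               conorm_on (Ec (iter k f y)) (tderiv (iter i f) (iter k f y))) :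
  exists eps : R, 0 < eps /\
    forall g : torus R n -> torus R n, C1_map g -> C1_close eps f g ->
      forall x, dense (preorbit g x).
Proof.
have [D [l0 [k0 [D0 [l01 hexp]]]]] := f_exp.
have hG (h : 'rV[R]_(n - c) -> 'rV[R]_n) : embedded_disc h -> tangent_disc h Cu -> (D%:E < internal_diameter h)%E ->
    exists2 y, disc h y & good_point f (tderiv f) Ec l0 k0.+1 y.
  (* The disc is regarded as passing through the image of 0. *)
  move=> eh th hD; have h0 : disc h (tproj (h 0)) by exists 0 => //; rewrite /unit_disc /= enorm0.
  have [y [yh gy]] := hexp _ h eh h0 th hD; exists y => // k kk e eE.
  (* With [i = 1] the hypothesis bounds each single step; the strict inequality [k0 < k] is why the
     good time is [k0.+1]. *)
  have := gy 1%N k isT kk; rewrite expr1.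
  by move=> /(conorm_on_lb (tderiv_unit f_C1 f_diffeo _) (lt_trans ltr01 l01)); apply.
have [e e0 he] : evC1 f (fun g => forall x, dense (preorbit g x)).
  have /andP[c0 cn] := ph_dimensions f_ph.
  have : (0 < n - c)%N by rewrite subn_gt0.
  rewrite leq_eqVlt => /orP[/eqP d1|d2]; last exact: robust_density_plane d2 l01 hG.
  apply: (robust_density_line f_C1 f_diffeo f_ph f_dense (esym d1) (D := D) (k0 := k0.+1) l01).
  by move: hG; rewrite -d1.
by exists e; split=> // g Cg cg; exact: he.
Qed.
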